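(* Let $g\in L^2(\mathbb{R}^d)$ and $\alpha,\beta>0$. Then the following are equivalent: (i) $\mathcal{G}(g,\alpha,\beta)$ is a frame for $L^2(\mathbb{R}^d)$. (ii) $\mathcal{G}(g,\alpha,\beta)$ is a Bessel sequence and there exists $\gamma\in L^2(\mathbb{R}^d)$ such that $\mathcal{G}(\gamma,\alpha,\beta)$ is a Bessel sequence satisfying $$\sum_{j\in\mathbb{Z}^d}\gamma(x+\alpha j)\,\overline{g}\big(x+\alpha j-\tfrac{k}{\beta}\big)=\beta^d\delta_{k,0}\qquad\text{for all }k\in\mathbb{Z}^d\text{ and a.e. }x\in\mathbb{R}^d.$$ (iii) $\mathcal{G}(g,\frac1\beta,\frac1\alpha)$ is a Riesz sequence in $L^2(\mathbb{R}^d)$. (iv) There exist constants $A,B>0$ such that for almost all $x\in\mathbb{R}^d$ and all $c\in\ell^2(\mathbb{Z}^d)$ $$A\|c\|_{\ell^2}^2\le\sum_{j\in\mathbb{Z}^d}\Big|\sum_{k\in\mathbb{Z}^d}c_k\,\overline{g}\big(x+\alpha j-\tfrac{k}{\beta}\big)\Big|^2\le B\|c\|_{\ell^2}^2 .$$ (v) There exist constants $A,B>0$ such that the spectrum of almost every Ron-Shen matrix is contained in $[A,B]$, i.e. $\sigma(R(x))\subseteq[A,B]$ for a.e. $x\in\mathbb{R}^d$. (vi) The pre-Gramians $P(x)$ are uniformly bounded on $\ell^2(\mathbb{Z}^d)$ (for a.e. $x$) and have uniformly bounded left-inverses; that is, there exist a constant $C$ and operators $\Gamma(x):\ell^2(\mathbb{Z}^d)\to\ell^2(\mathbb{Z}^d)$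 such that $\Gamma(x)P(x)=I_{\ell^2(\mathbb{Z}^d)}$ and $\|\Gamma(x)\|\le C$ for a.e. $x\in\mathbb{R}^d$.
   Context: For $z=(x,\xi)\in\mathbb{R}^{2d}$ the time-frequency shift is $\pi(z)f(t)=e^{2\pi i\xi\cdot t}f(t-x)$. For $a,b>0$, $\mathcal{G}(g,a,b)=\{\pi(\lambda)g:\lambda\in a\mathbb{Z}^d\times b\mathbb{Z}^d\}$, indexed by $\Lambda=a\mathbb{Z}^d\times b\mathbb{Z}^d$. It is a frame for $L^2(\mathbb{R}^d)$ if there are $A,B>0$ with $A\|f\|^2\le\sum_{\lambda\in\Lambda}|\langle f,\pi(\lambda)g\rangle|^2\le B\|f\|^2$ for all $f\in L^2(\mathbb{R}^d)$; a Bessel sequence if the upper inequality holds for some $B>0$; a Riesz sequence if there are $A,B>0$ with $A\|c\|_{\ell^2}^2\le\|\sum_{\lambda\in\Lambda}c_\lambda\pi(\lambda)g\|_{L^2}^2\le B\|c\|_{\ell^2}^2$ for all $c\in\ell^2(\Lambda)$. The pre-Gramian matrix $P(x)$ (for given $g,\alpha,\beta$) has entries $P(x)_{j,k}=\overline{g}(x+\alpha j-\frac{k}{\beta})$, $j,k\in\mathbb{Z}^d$. The Ron-Shen matrix is $R(x)=P(x)^*P(x)$, with entries $R(x)_{k,l}=\sum_{j\in\mathbb{Z}^d}g(x+\alpha j-\frac{k}{\beta})\,\overline{g}(x+\alpha j-\frac{l}{\beta})$, $k,l\in\mathbb{Z}^d$. Both are regarded as operators on $\ell^2(\mathbb{Z}^d)$;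 condition (v) includes that $R(x)$ is a bounded operator for a.e. $x$. *)

(* Defs.v *)
From HB Require Import structures.
From mathcomp Require Import all_boot all_order all_algebra finmap.
From mathcomp Require Import complex.
From mathcomp Require Import all_classical all_reals all_analysis.
From mathcomp.analysis.showcase Require summability.

Set Implicit Arguments.
Unset Strict Implicit.
Unset Printing Implicit Defensive.

Import Order.TTheory GRing.Theory Num.Theory.
Import numFieldNormedType.Exports.
Import complex.ComplexField.Normc.

Local Open Scope classical_set_scope.
Local Open Scope ring_scope.

Notation Rd R d := (d.-tuple (measurableTypeR R)).
Notation Zd d := {ffun 'I_d -> int}.

(* Lebesgue measure on R^d, by recursion on d: R^d.+1 carries the image of the
   product of the one-dimensional measure and the measure of R^d. *)
Section LebesgueMeasure.
Context (R : realType) (d : nat).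
Variable m : {sigma_finite_measure set (Rd R d) -> \bar R}.

Let cons2 (p : measurableTypeR R * Rd R d) : Rd R d.+1 := cons_tuple p.1 p.2.

Let measurable_cons2 : measurable_fun setT cons2.
Proof. by apply: measurable_cons. Qed.

Definition lebesgue_cons : set (Rd R d.+1) -> \bar R :=
  pushforward (@lebesgue_measure R \x m)%E cons2.

Let lebesgue_cons0 : lebesgue_cons set0 = 0%E.
Proof. by rewrite /lebesgue_cons /pushforward preimage_set0 measure0. Qed.

Let lebesgue_cons_ge0 A : (0 <= lebesgue_cons A)%E.
Proof. exact: measure_ge0. Qed.

Let lebesgue_cons_sigma_additive : semi_sigma_additive lebesgue_cons.
Proof.
pose M := @pushforward _ _ _ _ _ (@lebesgue_measure R \x m)%E cons2.
exact: (@measure_semi_sigma_additive _ _ _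
  (@measure_function_pushforward__canonical__measure_function_Measure _ _ _ _ _ _ _ measurable_cons2)).
Qed.

HB.instance Definition _ := isMeasure.Build _ _ _ lebesgue_cons
  lebesgue_cons0 lebesgue_cons_ge0 lebesgue_cons_sigma_additive.

Let lebesgue_cons_sigma_finite : sigma_finite setT lebesgue_cons.
Proof.
have /sigma_finiteP[F [TF ndF Foo]] := sigma_finiteT (@lebesgue_measure R).
have /sigma_finiteP[G [TG ndG Goo]] := sigma_finiteT m.
pose uncons (x : Rd R d.+1) := (thead x, [tuple of behead x]).
exists (fun n => uncons @^-1` (F n `*` G n)).
  apply/esym/seteqP; split => // x _.
  have [n _ Fx] : (\bigcup_k F k) (thead x) by rewrite -TF.
  have [k _ Gx] : (\bigcup_k G k) [tuple of behead x] by rewrite -TG.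
  exists (maxn n k) => //; split => /=.
    by move: Fx; apply: subsetPset; exact/ndF/leq_maxl.
  by move: Gx; apply: subsetPset; exact/ndG/leq_maxr.
move=> k; have [mF Foo1] := Foo k; have [mG Goo1] := Goo k; split.
  rewrite -[X in measurable X]setTI.
  apply: measurable_fun_pair => //; last exact: measurableX.
    exact: measurable_tnth.
  exact: measurable_behead.
rewrite /lebesgue_cons /pushforward.
set A := (X in (_ \x _)%E X); rewrite (_ : A = F k `*` G k).
  by rewrite product_measure1E// lte_mul_pinfty// ge0_fin_numE.
rewrite /A; apply/seteqP; split => -[x t] /=; rewrite theadE;
by rewrite (_ : [tuple of _] = t)//; apply/val_inj.
Qed.

HB.instance Definition _ := Measure_isSigmaFinite.Build _ _ _ lebesgue_cons
  lebesgue_cons_sigma_finite.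

End LebesgueMeasure.

Fixpoint lebesgue (R : realType) d :
    {sigma_finite_measure set (Rd R d) -> \bar R} :=
  if d is d'.+1 then lebesgue_cons (lebesgue R d') else \d_ [tuple].

Lemma lebesgue_box (R : realType) d (A : 'I_d -> set (measurableTypeR R)) :
  (forall i, measurable (A i)) ->
  lebesgue R d [set x | forall i, A i (tnth x i)] =
  (\prod_(i < d) lebesgue_measure (A i))%E.
Proof.
elim: d A => [|d IH] A mA.
  by rewrite big_ord0 /= diracE mem_set// => -[].
rewrite big_ord_recl -IH //= /lebesgue_cons /pushforward.
rewrite -product_measure1E//; last first.
  rewrite (_ : mkset _ =
      \bigcap_i ((fun x : Rd R d => tnth x i) @^-1` A (lift ord0 i))).
    apply: fin_bigcap_measurable => [|i _]; first exact: finite_finset.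
    by rewrite -[X in measurable X]setTI; exact: measurable_tnth.
  by apply/seteqP; split => x /= h; [move=> i _|move=> i]; exact: h.
congr product_measure1; apply/seteqP; split => -[x t] /=.
  move=> h; split; first by have := h ord0; rewrite tnth0.
  by move=> i; have := h (lift ord0 i); rewrite tnthS.
move=> [A0 At] i; case: (unliftP ord0 i) => [j|] ->; first by rewrite tnthS.
by rewrite tnth0.
Qed.

(* Families are summed unconditionally, along the finite subsets of the index
   set; R[i]^o is R[i] with the topology of its norm. *)
Section ComplexSums.
Context (R : realType) (I : choiceType).
Implicit Types u c : I -> R[i].

Definition has_csum u (s : R[i]) : Prop :=
  summability.partial_sum u @ summability.totally --> (s : R[i]^o).

Definition csummable u : Prop := exists s, has_csum u s.

(* Unspecified when u is not summable. *)
Definition csum u : R[i] := summability.sum (u : I -> R[i]^o).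

Definition sqnorm_l2 c : \bar R := \esum_(i in setT) (normc (c i) ^+ 2)%:E.

Definition l2 : set (I -> R[i]) := [set c | (sqnorm_l2 c < +oo)%E].

End ComplexSums.

(* Operators on l2(I) are represented by maps on all families, of which only
   the values on l2 are constrained. *)
Section Operators.
Context (R : realType) (I : choiceType).
Implicit Types (T S : (I -> R[i]) -> (I -> R[i])) (M : I -> I -> R[i]).

(* T is a linear operator from l2 to l2 with norm at most C. *)
Definition bounded_op (C : R) T : Prop :=
  [/\ 0 <= C,
      forall (a : R[i]) (c c' : I -> R[i]), l2 c -> l2 c' ->
        T (fun i => a * c i + c' i) = (fun i => a * T c i + T c' i)
    & forall c : I -> R[i], l2 c ->
        (sqnorm_l2 (T c) <= (C ^+ 2)%:E * sqnorm_l2 c)%E].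

Definition resolvent_set T : set R[i] := [set z | exists S,
  (exists C : R, bounded_op C S) /\
  forall c : I -> R[i], l2 c ->
    S (fun i => T c i - z * c i) = c /\
    (fun i => T (S c) i - z * S c i) = c].

Definition spectrum T : set R[i] := ~` resolvent_set T.

Definition mx_op M (c : I -> R[i]) : I -> R[i] :=
  fun j => csum (fun k => M j k * c k).

(* The series defining the action of M converge on l2, and M acts on l2 with
   norm at most C. *)
Definition bounded_mx (C : R) M : Prop :=
  (forall c : I -> R[i], l2 c ->
     forall j, csummable (fun k => M j k * c k)) /\
  bounded_op C (mx_op M).

End Operators.

(* L^2(R^d); its elements are represented by Borel functions. *)
Section L2space.
Context (R : realType) (d : nat).
Implicit Types f h : Rd R d -> R[i].

Definition sqnorm_L2 f : \bar R :=
  (\int[lebesgue R d]_x (normc (f x) ^+ 2)%:E)%E.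

Definition L2 : set (Rd R d -> R[i]) := [set f |
  [/\ measurable_fun setT (fun x => complex.Re (f x)),
      measurable_fun setT (fun x => complex.Im (f x))
    & (sqnorm_L2 f < +oo)%E]].

Definition inner f h : R[i] :=
  ((\int[lebesgue R d]_x complex.Re (f x * conjc (h x)))%R
     +i* (\int[lebesgue R d]_x complex.Im (f x * conjc (h x)))%R)%C.

(* F is the (unconditional) sum of the family v in L^2. *)
Definition has_L2sum (I : choiceType) (v : I -> Rd R d -> R[i])
    (F : Rd R d -> R[i]) : Prop :=
  (fun J : {fset I} => sqnorm_L2
     (fun x => F x - summability.partial_sum (fun i => v i x) J))
    @ summability.totally --> 0%E.

Definition is_bessel (I : choiceType) (v : I -> Rd R d -> R[i]) : Prop :=
  exists B : R, 0 < B /\ forall f, L2 f ->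
    (\esum_(i in setT) (normc (inner f (v i)) ^+ 2)%:E
       <= B%:E * sqnorm_L2 f)%E.

Definition is_frame (I : choiceType) (v : I -> Rd R d -> R[i]) : Prop :=
  exists A B : R, [/\ 0 < A, 0 < B & forall f, L2 f ->
    (A%:E * sqnorm_L2 f
       <= \esum_(i in setT) (normc (inner f (v i)) ^+ 2)%:E
       <= B%:E * sqnorm_L2 f)%E].

Definition is_riesz_seq (I : choiceType) (v : I -> Rd R d -> R[i]) : Prop :=
  exists A B : R, [/\ 0 < A, 0 < B & forall c : I -> R[i], l2 c ->
    exists F, [/\ L2 F, has_L2sum (fun i x => c i * v i x) F
      & (A%:E * sqnorm_l2 c <= sqnorm_L2 F <= B%:E * sqnorm_l2 c)%E]].

End L2space.

Section Gabor.
Context (R : realType) (d : nat).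
Implicit Types (g : Rd R d -> R[i]) (x xi t : Rd R d) (a b alpha beta : R).

Definition tf_shift x xi g : Rd R d -> R[i] := fun t =>
  let theta := 2 * pi * \sum_(i < d) tnth xi i * tnth t i in
  (cos theta +i* sin theta)%C * g [tuple tnth t i - tnth x i | i < d].

(* The lattice aZ^d x bZ^d is parametrized by Z^d x Z^d. *)
Definition gabor g a b : Zd d * Zd d -> Rd R d -> R[i] := fun lam =>
  tf_shift [tuple a * (lam.1 i)%:~R | i < d]
           [tuple b * (lam.2 i)%:~R | i < d] g.

Definition shift_pt alpha beta x (j k : Zd d) : Rd R d :=
  [tuple tnth x i + alpha * (j i)%:~R - (k i)%:~R / beta | i < d].

Definition pre_gramian g alpha beta x : Zd d -> Zd d -> R[i] := fun j k =>
  conjc (g (shift_pt alpha beta x j k)).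

(* For g in L^2 these series converge absolutely for almost every x. *)
Definition ron_shen g alpha beta x : Zd d -> Zd d -> R[i] := fun k l =>
  csum (fun j => g (shift_pt alpha beta x j k)
                 * conjc (g (shift_pt alpha beta x j l))).

End Gabor.

(* Main.v *)
Require Import Defs.
From HB Require Import structures.
From mathcomp Require Import all_boot all_order all_algebra finmap.
From mathcomp Require Import complex ring lra.
From mathcomp Require Import all_classical all_reals all_analysis.
From mathcomp Require Import measurable_realfun.
From mathcomp.analysis.showcase Require summability.

Set Implicit Arguments.
Unset Strict Implicit.
Unset Printing Implicit Defensive.

Import Order.TTheory GRing.Theory Num.Theory.
Import numFieldNormedType.Exports.
Import complex.ComplexField.Normc.

Local Open Scope classical_set_scope.
Local Open Scope ring_scope.

(** All six conditions are equivalent to the existence of A, B > 0 such that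
    A |c|^2 <= sum_j |sum_k P(x)_jk c_k|^2 <= B |c|^2 for a.e. x and all finitely
    supported c.

    Fourier series in the modulation variable turn sum |<f, pi(lambda) g>|^2 into
    beta^-d times the integral over [0, 1/beta)^d of sum_j |sum_k P(x)_jk f(x - k/beta)|^2,
    and the squared norm of a combination of the adjoint system G(g, 1/beta, 1/alpha)
    into the integral over [0, alpha)^d of sum_j |sum_k P(x)_jk conj(m_k(x))|^2, where the
    m_k are trigonometric polynomials.  Testing the first identity on functions with
    f(x - k/beta) = c_k 1_E(x), and the second one on m_k = conj(c_k) p with p close to 1_E,
    localizes the frame and the Riesz inequalities to almost every x.

    For fixed x the condition says that the form of the Gram matrix R(x) = P(x)^* P(x)
    lies between A and B, which gives the spectral condition and the left inverse
    R(x)^-1 P(x)^*.  The dual window is gamma(x) = beta^d conj((P(x) R(x)^-1 e_0)_0); it is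
    measurable because R(x)^-1 e_0 is a limit of Richardson iterates. *)

(** * Complex square-integrable functions *)

(** Finite support keeps every sum over k finite: no convergence of rows is assumed, boundedness of
    P(x) on l2 comes out as a consequence, and finite sets with rational coefficients are countable
    in number, so that one null set of x serves all c. The bounds do not change when x moves by
    alpha Z^d or (1/beta) Z^d, since this only renumbers rows or columns of P(x). So it suffices to
    prove them on a cube, whose side is the period of the modulations: 1/beta for the frame, alpha
    for the adjoint system.

    The spaces l2 and L2 are treated at once, as L2 of an arbitrary measure. The operator theory
    rests on coercivity: inverses come from an explicit iteration, whose approximants can be
    followed as x varies. The remaining obstacle is that the dual window is a single function, while
    the inverses are chosen separately at each x; uniqueness of the solution of R(x) u = e_m makes
    the choices agree along an orbit of the lattices. *)

Section Complex.
Context {R : realType}.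
Implicit Types (x y z : R[i]) (a t : R).

(** The squared modulus as a polynomial in the components, free of the square root in [normc]:
    identities fall to [ring], and measurability is inherited from sums and products. *)
Definition sqn z : R := complex.Re z ^+ 2 + complex.Im z ^+ 2.

Lemma normc_sqn z : normc z ^+ 2 = sqn z.
Proof. by case: z => a b; rewrite /normc sqr_sqrtr// addr_ge0// sqr_ge0. Qed.

Lemma cplxP x y :
  complex.Re x = complex.Re y -> complex.Im x = complex.Im y -> x = y.
Proof. by case: x => a b; case: y => c d /= -> ->. Qed.

Lemma ReD x y : complex.Re (x + y) = complex.Re x + complex.Re y.
Proof. by case: x => a b; case: y. Qed.
Lemma ImD x y : complex.Im (x + y) = complex.Im x + complex.Im y.
Proof. by case: x => a b; case: y. Qed.
Lemma ReN x : complex.Re (- x) = - complex.Re x.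
Proof. by case: x. Qed.
Lemma ImN x : complex.Im (- x) = - complex.Im x.
Proof. by case: x. Qed.
Lemma ReM x y : complex.Re (x * y) =
  complex.Re x * complex.Re y - complex.Im x * complex.Im y.
Proof. by case: x => a b; case: y. Qed.
Lemma ImM x y : complex.Im (x * y) =
  complex.Re x * complex.Im y + complex.Im x * complex.Re y.
Proof. by case: x => a b; case: y. Qed.
Lemma ReJ x : complex.Re (conjc x) = complex.Re x.
Proof. by case: x. Qed.
Lemma ImJ x : complex.Im (conjc x) = - complex.Im x.
Proof. by case: x. Qed.
Lemma Re1 : complex.Re (1 : R[i]) = 1. Proof. by []. Qed.
Lemma Im1 : complex.Im (1 : R[i]) = 0. Proof. by []. Qed.
Lemma Re0 : complex.Re (0 : R[i]) = 0. Proof. by []. Qed.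
Lemma Im0 : complex.Im (0 : R[i]) = 0. Proof. by []. Qed.
Lemma ReR a : complex.Re (a%:C)%C = a. Proof. by []. Qed.
Lemma ImR a : complex.Im (a%:C)%C = 0. Proof. by []. Qed.

Definition cplxE :=
  (ReD, ImD, ReN, ImN, ReM, ImM, ReJ, ImJ, Re1, Im1, Re0, Im0).

Lemma Re_sum (I : Type) (s : seq I) (P : pred I) (f : I -> R[i]) :
  complex.Re (\sum_(i <- s | P i) f i) = \sum_(i <- s | P i) complex.Re (f i).
Proof. exact: (big_morph _ ReD Re0). Qed.
Lemma Im_sum (I : Type) (s : seq I) (P : pred I) (f : I -> R[i]) :
  complex.Im (\sum_(i <- s | P i) f i) = \sum_(i <- s | P i) complex.Im (f i).
Proof. exact: (big_morph _ ImD Im0). Qed.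
Lemma conjcD x y : conjc (x + y) = conjc x + conjc y.
Proof. by apply: cplxP; rewrite !cplxE// opprD. Qed.
Lemma conjcM x y : conjc (x * y) = conjc x * conjc y.
Proof. by apply: cplxP; rewrite !cplxE; ring. Qed.
Lemma conjcN x : conjc (- x) = - conjc x.
Proof. by apply: cplxP; rewrite !cplxE. Qed.
Lemma conjc_sum (I : Type) (s : seq I) (P : pred I) (f : I -> R[i]) :
  conjc (\sum_(i <- s | P i) f i) = \sum_(i <- s | P i) conjc (f i).
Proof. exact: (big_morph _ conjcD (@conjc0 R)). Qed.

Lemma sqn_ge0 z : 0 <= sqn z.
Proof. by rewrite addr_ge0// sqr_ge0. Qed.
Lemma sqn0 : sqn 0 = 0. Proof. by rewrite /sqn !cplxE expr0n addr0. Qed.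
Lemma sqn1 : sqn 1 = 1. Proof. by rewrite /sqn !cplxE expr0n expr1n addr0. Qed.
Lemma sqnM x y : sqn (x * y) = sqn x * sqn y.
Proof. by rewrite /sqn !cplxE; ring. Qed.
Lemma sqnJ x : sqn (conjc x) = sqn x.
Proof. by rewrite /sqn !cplxE sqrrN. Qed.
Lemma sqnN x : sqn (- x) = sqn x.
Proof. by rewrite /sqn !cplxE !sqrrN. Qed.
Lemma sqnR a : sqn (a%:C)%C = a ^+ 2.
Proof. by rewrite /sqn ReR ImR expr0n addr0. Qed.
Lemma sqn_eq0 x : sqn x = 0 -> x = 0.
Proof.
move=> /eqP; rewrite paddr_eq0 ?sqr_ge0// !sqrf_eq0 => /andP[/eqP a /eqP b].
exact: cplxP.
Qed.
Lemma sqnD2 x y : sqn (x + y) <= 2 * sqn x + 2 * sqn y.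
Proof.
rewrite /sqn !cplxE -subr_ge0.
set a := complex.Re x; set b := complex.Im x; set c := complex.Re y.
set e := complex.Im y.
rewrite (_ : _ - _ = (a - c) ^+ 2 + (b - e) ^+ 2); last by ring.
by rewrite addr_ge0// sqr_ge0.
Qed.
Lemma mulcJ x : x * conjc x = ((sqn x)%:C)%C.
Proof. by apply: cplxP; rewrite !cplxE /sqn ?ReR ?ImR; ring. Qed.
(** A factor 1/2 is given away: together with [Im_le_sqn] the bound serves only as an integrable
    majorant of products of square-integrable functions. *)
Lemma Re_le_sqn x y : `|complex.Re (x * conjc y)| <= sqn x + sqn y.
Proof.
rewrite !cplxE /sqn; set a := complex.Re x; set b := complex.Im x.
set c := complex.Re y; set e := complex.Im y; rewrite ler_norml.
have := sqr_ge0 (a - c); have := sqr_ge0 (a + c).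
have := sqr_ge0 (b - e); have := sqr_ge0 (b + e).
have := sqr_ge0 a; have := sqr_ge0 b; have := sqr_ge0 c; have := sqr_ge0 e.
by move=> *; apply/andP; split; nra.
Qed.
Lemma Im_le_sqn x y : `|complex.Im (x * conjc y)| <= sqn x + sqn y.
Proof.
rewrite !cplxE /sqn; set a := complex.Re x; set b := complex.Im x.
set c := complex.Re y; set e := complex.Im y; rewrite ler_norml.
have := sqr_ge0 (a - e); have := sqr_ge0 (a + e).
have := sqr_ge0 (b - c); have := sqr_ge0 (b + c).
have := sqr_ge0 a; have := sqr_ge0 b; have := sqr_ge0 c; have := sqr_ge0 e.
by move=> *; apply/andP; split; nra.
Qed.

(* Cauchy-Schwarz in the form of a discriminant. *)
Lemma quadratic_ge0 (a b q : R) : 0 <= a -> 0 <= b -> 0 <= q ->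
  (forall t, 0 <= a - 2 * t * q + t ^+ 2 * q * b) -> q <= a * b.
Proof.
move=> a0 b0 q0 h.
have [->|qn0] := eqVneq q 0; first by rewrite mulr_ge0.
have q1 : 0 < q by rewrite lt_neqAle eq_sym qn0.
have [b1|bn0] := eqVneq b 0.
  (* For b = 0 the expression is affine in t, and at this t it equals -a - 2 < 0, which is
     absurd. *)
  have := h ((a + 1) / q).
  rewrite b1 mulr0 addr0 (_ : 2 * _ * q = 2 * (a + 1)); last by field.
  lra.
have b1 : 0 < b by rewrite lt_neqAle eq_sym bn0.
(* For b > 0 the minimum over t is attained at 1/b. *)
have := h (b^-1).
rewrite (_ : _ - _ + _ = a - q / b); last by field.
by rewrite subr_ge0 ler_pdivrMr.
Qed.

End Complex.

Section CMeas.
Context d (T : measurableType d) (R : realType).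
Implicit Types f g h : T -> R[i].

Definition cmeas f :=
  measurable_fun setT (fun x => complex.Re (f x)) /\
  measurable_fun setT (fun x => complex.Im (f x)).

Lemma cmeas_cst (z : R[i]) : cmeas (fun=> z).
Proof. by split; exact: measurable_cst. Qed.

Lemma cmeasD f g : cmeas f -> cmeas g -> cmeas (fun x => f x + g x).
Proof.
by move=> [f1 f2] [g1 g2]; split; under eq_fun do rewrite !cplxE;
  exact: measurable_funD.
Qed.

Lemma cmeasN f : cmeas f -> cmeas (fun x => - f x).
Proof.
by move=> [f1 f2]; split; under eq_fun do rewrite !cplxE; exact: measurable_funN.
Qed.

Lemma cmeasB f g : cmeas f -> cmeas g -> cmeas (fun x => f x - g x).
Proof. by move=> mf mg; apply: cmeasD => //; exact: cmeasN. Qed.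

Lemma cmeasM f g : cmeas f -> cmeas g -> cmeas (fun x => f x * g x).
Proof.
move=> [f1 f2] [g1 g2]; split; under eq_fun do rewrite !cplxE.
  by apply: measurable_funB; exact: measurable_funM.
by apply: measurable_funD; exact: measurable_funM.
Qed.

Lemma cmeasJ f : cmeas f -> cmeas (fun x => conjc (f x)).
Proof.
move=> [f1 f2]; split; under eq_fun do rewrite !cplxE; first exact: f1.
exact: measurable_funN.
Qed.

Lemma cmeasR (f : T -> R) : measurable_fun setT f -> cmeas (fun x => ((f x)%:C)%C).
Proof. by move=> mf; split => //=; exact: measurable_cst. Qed.

Lemma cmeas_sum (I : Type) (s : seq I) (F : I -> T -> R[i]) :
  (forall i, cmeas (F i)) -> cmeas (fun x => \sum_(i <- s) F i x).
Proof.
move=> mF; split.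
  by under eq_fun do rewrite Re_sum; apply: measurable_sum => i; have [] := mF i.
by under eq_fun do rewrite Im_sum; apply: measurable_sum => i; have [] := mF i.
Qed.

Lemma measurable_sqn f : cmeas f -> measurable_fun setT (fun x => sqn (f x)).
Proof. by move=> [f1 f2]; apply: measurable_funD; exact: measurable_funX. Qed.

Lemma cmeas_comp d' (T' : measurableType d') (phi : T' -> T) f :
  measurable_fun setT phi -> cmeas f ->
  measurable_fun setT (fun x => complex.Re (f (phi x))) /\
  measurable_fun setT (fun x => complex.Im (f (phi x))).
Proof.
by move=> mphi [f1 f2]; split; [exact: (measurableT_comp f1)|
  exact: (measurableT_comp f2)].
Qed.

End CMeas.

(** * Square-integrable functions over an arbitrary measure *)

Section L2gen.
Context d (T : measurableType d) (R : realType).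
Variable mu : {measure set T -> \bar R}.
Implicit Types f g h : T -> R[i].

(** The measure is left arbitrary in order to serve R^d, the line and, through counting measure, l2.
    Functions are not identified when they agree almost everywhere, so [N2] vanishes on more than 0.
    Since [fine] sends +oo to 0, [N2 f] says something about f only under [LL f]. *)
Definition n2 f : \bar R := (\int[mu]_x (sqn (f x))%:E)%E.
Definition N2 f : R := fine (n2 f).
Definition LL f := cmeas f /\ (n2 f < +oo)%E.
Definition cint f : R[i] :=
  ((\int[mu]_x complex.Re (f x))%R +i* (\int[mu]_x complex.Im (f x))%R)%C.
Definition cintb f := mu.-integrable setT (EFin \o (fun x => complex.Re (f x)))
  /\ mu.-integrable setT (EFin \o (fun x => complex.Im (f x))).
Definition ip f h : R[i] := cint (fun x => f x * conjc (h x)).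

Lemma Re_cint f : complex.Re (cint f) = \int[mu]_x complex.Re (f x).
Proof. by []. Qed.
Lemma Im_cint f : complex.Im (cint f) = \int[mu]_x complex.Im (f x).
Proof. by []. Qed.

Let esqn_ge0 f x : (0 <= (sqn (f x))%:E)%E.
Proof. by rewrite lee_fin sqn_ge0. Qed.

Let esqn_meas f : cmeas f -> measurable_fun setT (fun x => (sqn (f x))%:E).
Proof. by move=> mf; apply/measurable_EFinP; exact: measurable_sqn. Qed.

Lemma n2_ge0 f : (0 <= n2 f)%E.
Proof. exact: integral_ge0. Qed.

Lemma N2_ge0 f : 0 <= N2 f.
Proof. by rewrite fine_ge0// n2_ge0. Qed.

Lemma LL_fin f : LL f -> n2 f = (N2 f)%:E.
Proof. by case=> _ f2; rewrite fineK// ge0_fin_numE// n2_ge0. Qed.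

Lemma LL_meas f : LL f -> cmeas f. Proof. by case. Qed.

Lemma n2_le f g : cmeas g -> (forall x, sqn (f x) <= sqn (g x)) ->
  cmeas f -> (n2 f <= n2 g)%E.
Proof.
move=> mg fg mf; apply: ge0_le_integral => //; try exact: esqn_meas.
by move=> x _; rewrite lee_fin.
Qed.

Lemma LL_le f g : cmeas f -> (forall x, sqn (f x) <= sqn (g x)) -> LL g -> LL f.
Proof. by move=> mf fg [mg gy]; split => //; apply: le_lt_trans gy; exact: n2_le. Qed.

Lemma n2Z (a : R[i]) f : cmeas f -> n2 (fun x => a * f x) = ((sqn a)%:E * n2 f)%E.
Proof.
move=> mf; rewrite /n2; under eq_integral do rewrite sqnM EFinM.
by rewrite ge0_integralZl_EFin// ?sqn_ge0//; exact: esqn_meas.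
Qed.

Lemma LL_Z (a : R[i]) f : LL f -> LL (fun x => a * f x).
Proof.
move=> [mf fy]; split; first by apply: cmeasM => //; exact: cmeas_cst.
rewrite n2Z//; have := LL_fin (conj mf fy) => ->; exact: ltry.
Qed.

Lemma N2Z (a : R[i]) f : LL f -> N2 (fun x => a * f x) = sqn a * N2 f.
Proof. by move=> Lf; rewrite /N2 n2Z ?LL_fin//; exact: LL_meas. Qed.

Lemma LL_D f g : LL f -> LL g -> LL (fun x => f x + g x).
Proof.
move=> Lf Lg; have [mf fy] := Lf; have [mg gy] := Lg.
split; first exact: cmeasD.
apply: (@le_lt_trans _ _ (2%:E * n2 f + 2%:E * n2 g)%E); last first.
  by rewrite !LL_fin//= -!EFinM -EFinD ltry.
rewrite -!ge0_integralZl_EFin//; try exact: esqn_meas.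
rewrite -ge0_integralD//; last 4 first.
- by move=> x _; rewrite mule_ge0.
- by apply: measurable_funeM; exact: esqn_meas.
- by move=> x _; rewrite mule_ge0.
- by apply: measurable_funeM; exact: esqn_meas.
apply: ge0_le_integral => //.
- by move=> x _; rewrite lee_fin sqn_ge0.
- exact/esqn_meas/cmeasD.
- by apply: emeasurable_funD; apply: measurable_funeM; exact: esqn_meas.
by move=> x _; rewrite -!EFinM -EFinD lee_fin sqnD2.
Qed.

Lemma LL0 : LL (fun=> 0).
Proof.
split; first exact: cmeas_cst.
by rewrite /n2 sqn0 integral0 ltry.
Qed.

Lemma LL_N f : LL f -> LL (fun x => - f x).
Proof.
move=> Lf; apply: (LL_le _ _ Lf); first by apply: cmeasN; exact: LL_meas.
by move=> x; rewrite sqnN.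
Qed.

Lemma LL_B f g : LL f -> LL g -> LL (fun x => f x - g x).
Proof. by move=> Lf Lg; apply: LL_D => //; exact: LL_N. Qed.

Lemma LL_J f : LL f -> LL (fun x => conjc (f x)).
Proof.
move=> Lf; apply: (LL_le _ _ Lf); first by apply: cmeasJ; exact: LL_meas.
by move=> x; rewrite sqnJ.
Qed.

Lemma LL_sum (I : Type) (s : seq I) (F : I -> T -> R[i]) :
  (forall i, LL (F i)) -> LL (fun x => \sum_(i <- s) F i x).
Proof.
move=> LF; elim: s => [|i s ih].
  by under eq_fun do rewrite big_nil; exact: LL0.
by under eq_fun do rewrite big_cons; exact: LL_D.
Qed.

Lemma LL_bM (phi f : T -> R[i]) (M : R) : cmeas phi ->
  (forall x, sqn (phi x) <= M) -> LL f -> LL (fun x => phi x * f x).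
Proof.
move=> mp pM Lf; have mf := LL_meas Lf.
apply: (@LL_le _ (fun x => ((Num.sqrt M)%:C)%C * f x)); first exact: cmeasM.
  move=> x; rewrite !sqnM sqnR ler_wpM2r ?sqn_ge0// sqr_sqrtr//.
  exact: le_trans (sqn_ge0 _) (pM x).
exact: LL_Z.
Qed.

Lemma cintb_bound f (H : T -> R) : cmeas f -> mu.-integrable setT (EFin \o H) ->
  (forall x, `|complex.Re (f x)| <= H x) ->
  (forall x, `|complex.Im (f x)| <= H x) -> cintb f.
Proof.
move=> [f1 f2] iH h1 h2; split; apply: (le_integrable _ _ _ iH) => //.
- exact/measurable_EFinP.
- by move=> x _ /=; rewrite lee_fin (le_trans (h1 x))// ler_norm.
- exact/measurable_EFinP.
- by move=> x _ /=; rewrite lee_fin (le_trans (h2 x))// ler_norm.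
Qed.

Lemma integrable_sqn f : LL f -> mu.-integrable setT (EFin \o (fun x => sqn (f x))).
Proof.
move=> [mf fy]; apply/integrableP; split; first exact: esqn_meas.
by under eq_integral do rewrite /= ger0_norm ?sqn_ge0//.
Qed.

Lemma cintb_LL f g : LL f -> LL g -> cintb (fun x => f x * conjc (g x)).
Proof.
move=> Lf Lg; apply: (@cintb_bound _ (fun x => sqn (f x) + sqn (g x))).
- by apply: cmeasM; [exact: LL_meas|apply: cmeasJ; exact: LL_meas].
- rewrite (_ : EFin \o _ = (EFin \o (fun x => sqn (f x))) \+
    (EFin \o (fun x => sqn (g x))))%E; last by apply/funext.
  by apply: integrableD => //; exact: integrable_sqn.
- by move=> x; exact: Re_le_sqn.
- by move=> x; exact: Im_le_sqn.
Qed.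

Lemma eq_cint f g : f =1 g -> cint f = cint g.
Proof. by move=> fg; have -> : f = g by exact/funext. Qed.

Lemma cintbD f g : cintb f -> cintb g -> cintb (fun x => f x + g x).
Proof.
move=> [f1 f2] [g1 g2]; split.
  rewrite (_ : EFin \o _ = (EFin \o (fun x => complex.Re (f x))) \+
    (EFin \o (fun x => complex.Re (g x))))%E; first exact: integrableD.
  by apply/funext => x /=; rewrite cplxE.
rewrite (_ : EFin \o _ = (EFin \o (fun x => complex.Im (f x))) \+
    (EFin \o (fun x => complex.Im (g x))))%E; first exact: integrableD.
by apply/funext => x /=; rewrite cplxE.
Qed.

Lemma cintD f g : cintb f -> cintb g ->
  cint (fun x => f x + g x) = cint f + cint g.
Proof.
move=> [f1 f2] [g1 g2]; apply: cplxP.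
  rewrite ReD !Re_cint -RintegralD//.
  by apply: eq_Rintegral => x _; rewrite ReD.
rewrite ImD !Im_cint -RintegralD//.
by apply: eq_Rintegral => x _; rewrite ImD.
Qed.

Lemma integrableZlr (c : R) (f : T -> R) : mu.-integrable setT (EFin \o f) ->
  mu.-integrable setT (EFin \o (fun x => c * f x)).
Proof. by move=> h; have := integrableZl measurableT c h. Qed.

Lemma integrableBr (f g : T -> R) : mu.-integrable setT (EFin \o f) ->
  mu.-integrable setT (EFin \o g) ->
  mu.-integrable setT (EFin \o (fun x => f x - g x)).
Proof. by move=> h k; have := integrableB measurableT h k. Qed.

Lemma integrableDr (f g : T -> R) : mu.-integrable setT (EFin \o f) ->
  mu.-integrable setT (EFin \o g) ->
  mu.-integrable setT (EFin \o (fun x => f x + g x)).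
Proof. by move=> h k; have := integrableD measurableT h k. Qed.

Lemma cintbZ (a : R[i]) f : cintb f -> cintb (fun x => a * f x).
Proof.
move=> [f1 f2]; split; under eq_fun do rewrite cplxE.
  by apply: integrableBr; exact: integrableZlr.
by apply: integrableDr; exact: integrableZlr.
Qed.

Lemma cintZ (a : R[i]) f : cintb f -> cint (fun x => a * f x) = a * cint f.
Proof.
move=> [f1 f2]; apply: cplxP.
  rewrite ReM !Re_cint Im_cint -!RintegralZl// -RintegralB//; try exact: integrableZlr.
  by apply: eq_Rintegral => x _; rewrite ReM.
rewrite ImM !Im_cint Re_cint -!RintegralZl// -RintegralD//; try exact: integrableZlr.
by apply: eq_Rintegral => x _; rewrite ImM.
Qed.

Lemma cintJ f : cintb f -> cint (fun x => conjc (f x)) = conjc (cint f).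
Proof.
move=> [f1 f2]; apply: cplxP.
  by rewrite ReJ !Re_cint; apply: eq_Rintegral => x _; rewrite ReJ.
rewrite ImJ !Im_cint -mulN1r -RintegralZl//.
by apply: eq_Rintegral => x _; rewrite ImJ mulN1r.
Qed.

Lemma cintb_sum (I : Type) (s : seq I) (F : I -> T -> R[i]) :
  (forall i, cintb (F i)) -> cintb (fun x => \sum_(i <- s) F i x).
Proof.
move=> LF; elim: s => [|i s ih].
  by under eq_fun do rewrite big_nil; split; exact: integrable0.
by under eq_fun do rewrite big_cons; exact: cintbD.
Qed.

Lemma cint0 : cint (fun=> 0) = 0.
Proof.
by apply: cplxP; rewrite ?Re_cint ?Im_cint /Rintegral integral0_eq.
Qed.

Lemma cint_sum (I : Type) (s : seq I) (F : I -> T -> R[i]) :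
  (forall i, cintb (F i)) ->
  cint (fun x => \sum_(i <- s) F i x) = \sum_(i <- s) cint (F i).
Proof.
move=> LF; elim: s => [|i s ih].
  by rewrite big_nil -[RHS]cint0; apply: eq_cint => x; rewrite big_nil.
rewrite big_cons -ih -cintD//; last exact: cintb_sum.
by apply: eq_cint => x; rewrite big_cons.
Qed.

Lemma ipDl f g h : LL f -> LL g -> LL h ->
  ip (fun x => f x + g x) h = ip f h + ip g h.
Proof.
move=> Lf Lg Lh; rewrite /ip -cintD; try exact: cintb_LL.
by apply: eq_cint => x; rewrite mulrDl.
Qed.

Lemma ipZl (a : R[i]) f h : LL f -> LL h -> ip (fun x => a * f x) h = a * ip f h.
Proof.
move=> Lf Lh; rewrite /ip -cintZ; try exact: cintb_LL.
by apply: eq_cint => x; rewrite mulrA.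
Qed.

Lemma ipJ f h : LL f -> LL h -> ip h f = conjc (ip f h).
Proof.
move=> Lf Lh; rewrite /ip -cintJ; last exact: cintb_LL.
by apply: eq_cint => x; rewrite conjcM conjcK mulrC.
Qed.

Lemma ipNl f h : LL f -> LL h -> ip (fun x => - f x) h = - ip f h.
Proof.
move=> Lf Lh; rewrite -mulN1r -ipZl//; congr ip.
by apply/funext => x; rewrite mulN1r.
Qed.

Lemma ipBl f g h : LL f -> LL g -> LL h ->
  ip (fun x => f x - g x) h = ip f h - ip g h.
Proof. by move=> Lf Lg Lh; rewrite ipDl// ?ipNl//; exact: LL_N. Qed.

Lemma ipDr f g h : LL f -> LL g -> LL h ->
  ip h (fun x => f x + g x) = ip h f + ip h g.
Proof.
move=> Lf Lg Lh; rewrite ipJ//; last exact: LL_D.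
by rewrite ipDl// conjcD -!ipJ.
Qed.

Lemma ipZr (a : R[i]) f h : LL f -> LL h -> ip h (fun x => a * f x) = conjc a * ip h f.
Proof.
move=> Lf Lh; rewrite ipJ//; last exact: LL_Z.
by rewrite ipZl// conjcM -!ipJ.
Qed.

Lemma ipBr f g h : LL f -> LL g -> LL h ->
  ip h (fun x => f x - g x) = ip h f - ip h g.
Proof.
move=> Lf Lg Lh; rewrite ipJ//; last exact: LL_B.
by rewrite ipBl// conjcD conjcN -!ipJ.
Qed.

Lemma ip_suml (I : Type) (s : seq I) (F : I -> T -> R[i]) h :
  (forall i, LL (F i)) -> LL h ->
  ip (fun x => \sum_(i <- s) F i x) h = \sum_(i <- s) ip (F i) h.
Proof.
move=> LF Lh; rewrite /ip -cint_sum; last by move=> i; exact: cintb_LL.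
by apply: eq_cint => x; rewrite mulr_suml.
Qed.

Lemma ip_sumr (I : Type) (s : seq I) (F : I -> T -> R[i]) h :
  (forall i, LL (F i)) -> LL h ->
  ip h (fun x => \sum_(i <- s) F i x) = \sum_(i <- s) ip h (F i).
Proof.
move=> LF Lh; rewrite ipJ//; last exact: LL_sum.
by rewrite ip_suml// conjc_sum; apply: eq_bigr => i _; rewrite -ipJ.
Qed.

Lemma ipff f : ip f f = ((N2 f)%:C)%C.
Proof.
apply: cplxP.
  rewrite /ip Re_cint -[RHS]/(N2 f) /Rintegral; congr fine; apply: eq_integral => x _.
  by rewrite mulcJ.
rewrite /ip Im_cint -[RHS]/(0 : R) /Rintegral integral0_eq// => x _; by rewrite mulcJ.
Qed.

Lemma N2DE f g : LL f -> LL g ->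
  N2 (fun x => f x + g x) = N2 f + 2 * complex.Re (ip f g) + N2 g.
Proof.
move=> Lf Lg; have := ipff (fun x => f x + g x) => /(congr1 (@complex.Re R)).
rewrite [RHS]/= => <-.
have LD : LL (fun x => f x + g x) by exact: LL_D.
by rewrite ipDl// !ipDr// (ipJ Lf Lg) !ipff; move: (ip f g) => p; rewrite !cplxE !ReR; ring.
Qed.

Lemma N2N f : N2 (fun x => - f x) = N2 f.
Proof. by rewrite /N2 /n2; under eq_integral do rewrite sqnN. Qed.

Lemma N2BC f g : N2 (fun x => f x - g x) = N2 (fun x => g x - f x).
Proof. by rewrite -N2N; congr N2; apply/funext => x; rewrite opprB. Qed.

Lemma N2BE f g : LL f -> LL g ->
  N2 (fun x => f x - g x) = N2 f - 2 * complex.Re (ip f g) + N2 g.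
Proof.
move=> Lf Lg; rewrite N2DE//; last exact: LL_N.
rewrite N2N (ipJ (LL_N Lg) Lf) ipNl// (ipJ Lf Lg).
by move: (ip f g) => p; rewrite !cplxE; ring.
Qed.

(** Positivity of the squared norm of f - t <f,g> g, for real t, is a quadratic inequality with
    constant term [N2 f] and leading coefficient |<f,g>|^2 [N2 g]. Keeping t free instead of
    dividing by [N2 g] covers a g of norm 0. *)
Lemma CS f g : LL f -> LL g -> sqn (ip f g) <= N2 f * N2 g.
Proof.
move=> Lf Lg; apply: quadratic_ge0; try exact: N2_ge0; first exact: sqn_ge0.
move=> t; have := N2_ge0 (fun x => f x - (((t%:C)%C * ip f g) * g x)).
rewrite N2BE//; last exact: LL_Z.
rewrite ipZr// N2Z// conjcM -mulrA [_ * ip f g]mulrC mulcJ sqnM sqnR.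
move: (ip f g) => p; rewrite conjc_real ReM !ReR !ImR.
by rewrite mulr0 subr0 mulrA.
Qed.

Definition Nm f : R := Num.sqrt (N2 f).

Lemma Nm_ge0 f : 0 <= Nm f. Proof. exact: sqrtr_ge0. Qed.

Lemma Nm2 f : Nm f ^+ 2 = N2 f.
Proof. by rewrite sqr_sqrtr// N2_ge0. Qed.

Lemma Re_ip_le f g : LL f -> LL g -> `|complex.Re (ip f g)| <= Nm f * Nm g.
Proof.
move=> Lf Lg; rewrite -(@ler_pXn2r _ 2)// ?nnegrE ?mulr_ge0 ?Nm_ge0//.
rewrite exprMn !Nm2; apply: le_trans (CS Lf Lg).
by rewrite real_normK ?num_real// /sqn lerDl sqr_ge0.
Qed.

Lemma Nm_triangle f g : LL f -> LL g -> Nm (fun x => f x + g x) <= Nm f + Nm g.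
Proof.
move=> Lf Lg; rewrite -(@ler_pXn2r _ 2)// ?nnegrE ?addr_ge0 ?Nm_ge0//.
rewrite Nm2 N2DE// sqrrD !Nm2 lerD2r lerD2l mulr2n mulrDl !mul1r.
by rewrite lerD// (le_trans (ler_norm _) (Re_ip_le Lf Lg)).
Qed.

Lemma NmBC f g : Nm (fun x => f x - g x) = Nm (fun x => g x - f x).
Proof. by rewrite /Nm N2BC. Qed.

Lemma Nm_le_D f g : LL f -> LL g -> Nm f <= Nm g + Nm (fun x => f x - g x).
Proof.
move=> Lf Lg; have := Nm_triangle Lg (LL_B Lf Lg).
by under eq_fun do rewrite addrC subrK.
Qed.

Lemma Nm_dist f g h : LL f -> LL g -> LL h ->
  Nm (fun x => f x - h x) <= Nm (fun x => f x - g x) + Nm (fun x => g x - h x).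
Proof.
move=> Lf Lg Lh; have := Nm_triangle (LL_B Lf Lg) (LL_B Lg Lh).
by under eq_fun do rewrite addrA subrK.
Qed.

Lemma NmZ (a : R[i]) f : LL f -> Nm (fun x => a * f x) = Num.sqrt (sqn a) * Nm f.
Proof. by move=> Lf; rewrite /Nm N2Z// sqrtrM// sqn_ge0. Qed.

End L2gen.

(** * Completeness of L2 *)

Section Completeness.
Context d (T : measurableType d) (R : realType).
Variable mu : {measure set T -> \bar R}.
Implicit Types f g h : T -> R[i].

Lemma limn_einf_le (u : (\bar R)^nat) (B : \bar R) :
  (exists N, forall n, (N <= n)%N -> (u n <= B)%E) -> (limn_einf u <= B)%E.
Proof.
move=> [N uB]; rewrite limn_einf_lim; apply: lime_le.
  exact: is_cvg_einfs.
exists N => // n /= Nn; apply: le_trans (uB n Nn).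
by apply: ereal_inf_lbound; exists n => //=; exact: leqnn.
Qed.

Lemma fatou_le (u : nat -> T -> \bar R) (v : T -> \bar R) (B : \bar R) :
  (forall n, measurable_fun setT (u n)) -> (forall n x, (0 <= u n x)%E) ->
  (forall x, u ^~ x @ \oo --> v x) ->
  (exists N, forall n, (N <= n)%N -> (\int[mu]_x u n x <= B)%E) ->
  (\int[mu]_x v x <= B)%E.
Proof.
move=> mu0 u0 uv uB.
rewrite (_ : v = (fun x => limn_einf (u ^~ x))); last first.
  by apply/funext => x; rewrite (cvg_limn_einf_sup (uv x)).
apply: le_trans (limn_einf_le uB).
by apply: fatou => //.
Qed.

Lemma cvg_geom_cauchy (u : R^nat) (C : R) :
  (forall k, `|u k.+1 - u k| <= C * (1 / 2) ^+ k) -> cvgn u.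
Proof.
move=> h.
rewrite (_ : u = fun n => u 0%N + series (telescope u) n); last first.
  by apply/funext => n; exact: eq_sum_telescope.
apply: is_cvgD; first exact: is_cvg_cst.
apply: normed_cvg.
apply: (series_le_cvg (v_ := geometric C (1 / 2))).
- by move=> n /=; exact: normr_ge0.
- by move=> n /=; apply: le_trans (h n); exact: normr_ge0.
- by move=> n; exact: h.
- apply: is_cvg_geometric_series; rewrite ger0_norm//; lra.
Qed.

Lemma sqn_cvg (u : nat -> R[i]) (z w : R[i]) :
  (fun n => complex.Re (u n)) @ \oo --> complex.Re z ->
  (fun n => complex.Im (u n)) @ \oo --> complex.Im z ->
  (fun n => (sqn (u n - w))%:E) @ \oo --> (sqn (z - w))%:E.
Proof.
move=> h1 h2; apply: cvg_EFin; first exact: nearW.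
rewrite /= /comp /sqn.
apply: cvgD; under eq_fun do rewrite expr2; rewrite expr2; apply: cvgM;
  rewrite ?cplxE; under eq_fun do rewrite ?cplxE; apply: cvgB => //; exact: cvg_cst.
Qed.

(** The sum of the 4^n w_n has integral at most the sum of the 4^-n, hence is finite off a null set,
    and there it bounds each of its terms. The weights trade the decay 16^-n of the integrals for a
    pointwise decay 4^-n. *)
Lemma n2_series_ae (w : nat -> T -> R) :
  (forall n, measurable_fun setT (w n)) -> (forall n x, 0 <= w n x) ->
  (forall n, (\int[mu]_x (w n x)%:E <= ((1 / 16) ^+ n)%:E)%E) ->
  exists D : set T, [/\ measurable D, mu (~` D) = 0%E
   & forall x, D x -> exists C, forall n, w n x <= C * (1 / 4) ^+ n].
Proof.
move=> mw w0 wB.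
pose H x := (\sum_(n <oo) (4 ^+ n * w n x)%:E)%E.
have mt n : measurable_fun setT (fun x => (4 ^+ n * w n x)%:E).
  by apply/measurable_EFinP; apply: measurable_funM => //; exact: measurable_cst.
have t0 n x : (0 <= (4 ^+ n * w n x)%:E)%E.
  by rewrite lee_fin mulr_ge0// exprn_ge0.
have mH : measurable_fun setT H.
  by apply: ge0_emeasurable_sum => // n x _ _.
have H0 x : (0 <= H x)%E by apply: nneseries_ge0 => n _ _.
have iH : (\int[mu]_x H x < +oo)%E.
  rewrite integral_nneseries//.
  apply: (@le_lt_trans _ _ (\sum_(n <oo) ((1 / 4) ^+ n)%:E)%E).
    apply: lee_nneseries => [n _ _|n _].
      by apply: integral_ge0 => x _.
    under eq_integral do rewrite EFinM.
    rewrite ge0_integralZl_EFin//; last 2 first.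
    - by move=> x _; rewrite lee_fin.
    - exact/measurable_EFinP.
    apply: (@le_trans _ _ ((4 ^+ n)%:E * ((1 / 16) ^+ n)%:E)%E).
      by rewrite lee_wpmul2l// lee_fin exprn_ge0.
    rewrite -EFinM -exprMn lee_fin le_eqVlt; apply/orP; left; apply/eqP.
    by congr (_ ^+ _); field.
  have -> : (fun n => \sum_(0 <= k < n) ((1 / 4 : R) ^+ k)%:E)%E =
      EFin \o series (geometric (1 : R) (1 / 4)).
    by apply/funext => n; rewrite /= /series /= sumEFin; congr EFin;
       apply: eq_bigr => i _; rewrite [RHS]mul1r.
  have c : (series (geometric (1 : R) (1 / 4))) @ \oo --> (1 / (1 - 1 / 4) : R).
    by apply: cvg_geometric_series; rewrite ger0_norm//; lra.
  have /cvg_lim -> // : (EFin \o series (geometric (1 : R) (1 / 4))) @ \oo -->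
     (1 / (1 - 1 / 4) : R)%:E.
    by apply: cvg_EFin => //; exact: nearW.
  exact: ltry.
have iHH : mu.-integrable setT H.
  apply/integrableP; split=> //.
  by under eq_integral do rewrite gee0_abs//.
exists [set x | H x \is a fin_num]; split.
- by have := emeasurable_fin_num measurableT mH; rewrite setTI.
- have := integrable_ae measurableT iHH.
  move=> [N [mN N0 sub]]; apply/eqP; rewrite eq_le measure_ge0 andbT -N0.
  apply: le_measure; rewrite ?inE//.
    apply: measurableC.
    by have := emeasurable_fin_num measurableT mH; rewrite setTI.
  by move=> x nf; apply: sub => /= h; apply: nf; exact: h.
move=> x /= Hx; exists (fine (H x)) => n.
have : ((4 ^+ n * w n x)%:E <= H x)%E.
  have := @nneseries_lim_ge _ (fun k => (4 ^+ k * w k x)%:E) xpredT 0 n.+1.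
  move=> /(_ (fun k _ _ => t0 k x)); apply: le_trans.
  by rewrite big_nat_recr//= leeDr// sume_ge0.
rewrite -[X in (_ <= X)%E](fineK Hx) lee_fin => h.
rewrite expr_div_n expr1n mul1r ler_pdivlMr ?exprn_gt0//.
by rewrite mulrC.
Qed.

(** The Riesz-Fischer argument: the squared increments decay like 4^-n almost everywhere, so the
    sequence converges there, and Fatou's lemma carries the Cauchy estimate to the limit. *)
Lemma LL_complete_fast (f : nat -> T -> R[i]) : (forall n, LL mu (f n)) ->
  (forall n m, (n <= m)%N -> N2 mu (fun x => f m x - f n x) <= (1 / 16) ^+ n) ->
  exists F, LL mu F /\ forall n, N2 mu (fun x => F x - f n x) <= (1 / 16) ^+ n.
Proof.
move=> Lf fC.
have [D [mD D0 DP]] : exists D : set T, [/\ measurable D, mu (~` D) = 0%E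
   & forall x, D x -> exists C, forall n, sqn (f n.+1 x - f n x) <= C * (1 / 4) ^+ n].
  apply: n2_series_ae.
  - by move=> n; apply/measurable_sqn/cmeasB; exact: LL_meas.
  - by move=> n x; exact: sqn_ge0.
  - move=> n; rewrite -/(n2 mu (fun x => f n.+1 x - f n x)) LL_fin; last exact: LL_B.
    by rewrite lee_fin; exact: fC.
(* Setting the functions to 0 off D makes them converge everywhere, so that the limit is Borel
   measurable. *)
pose e n x : R[i] := (((\1_D x : R)%:C)%C * f n x).
have me n : cmeas (e n).
  by apply: cmeasM; [apply: cmeasR; exact: measurable_indic|exact: LL_meas].
have eD n x : D x -> e n x = f n x.
  by move=> Dx; rewrite /e indicE mem_set// mul1r.
have enD n x : ~ D x -> e n x = 0.
  by move=> Dx; rewrite /e indicE memNset// mul0r.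
have small x : exists C, forall n, sqn (e n.+1 x - e n x) <= (C * (1 / 2) ^+ n) ^+ 2.
  have [Dx|nDx] := pselect (D x); last first.
    by exists 0 => n; rewrite !enD// subrr sqn0 mul0r expr0n.
  (* 1 + C stands in for the square root of C: its square dominates C, and the square of (1/2)^n is
     (1/4)^n. *)
  have [C hC] := DP x Dx; exists (1 + C) => n; rewrite !eD//.
  have C0 : 0 <= C.
    by have := hC 0%N; rewrite expr0 mulr1; apply: le_trans; exact: sqn_ge0.
  apply: le_trans (hC n) _.
  rewrite (_ : (_ * _) ^+ 2 = (1 + C) ^+ 2 * (1 / 4) ^+ n); last first.
    by rewrite [LHS]exprMn -exprM mulnC exprM; congr (_ * _ ^+ _); field.
  rewrite ler_wpM2r ?exprn_ge0//; nra.
have cR x : cvgn (fun n => complex.Re (e n x)).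
  have [C hC] := small x; apply: (@cvg_geom_cauchy _ `|C|) => k.
  rewrite -(@ler_pXn2r _ 2)// ?nnegrE ?mulr_ge0 ?exprn_ge0//.
  rewrite real_normK ?num_real// (le_trans _ (le_trans (hC k) _))//.
    by rewrite -ReN -ReD lerDl sqr_ge0.
  by rewrite !exprMn real_normK ?num_real.
have cI x : cvgn (fun n => complex.Im (e n x)).
  have [C hC] := small x; apply: (@cvg_geom_cauchy _ `|C|) => k.
  rewrite -(@ler_pXn2r _ 2)// ?nnegrE ?mulr_ge0 ?exprn_ge0//.
  rewrite real_normK ?num_real// (le_trans _ (le_trans (hC k) _))//.
    by rewrite -ImN -ImD lerDr sqr_ge0.
  by rewrite !exprMn real_normK ?num_real.
pose F x : R[i] := (limn (fun n => complex.Re (e n x)) +i*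
                    limn (fun n => complex.Im (e n x)))%C.
have mF : cmeas F.
  by split; [apply: (measurable_fun_cvg (h := fun n x => complex.Re (e n x)))|
    apply: (measurable_fun_cvg (h := fun n x => complex.Im (e n x)))] => // n;
    have [] := me n.
have ae_e n (G : T -> R[i]) : cmeas G ->
   n2 mu (fun x => G x - f n x) = n2 mu (fun x => G x - e n x).
  move=> mG; apply: ge0_ae_eq_integral => //.
  - by apply/measurable_EFinP/measurable_sqn/cmeasB => //; exact: LL_meas.
  - by apply/measurable_EFinP/measurable_sqn/cmeasB.
  - by move=> x _; rewrite lee_fin sqn_ge0.
  - by move=> x _; rewrite lee_fin sqn_ge0.
  exists (~` D); split => //; first exact: measurableC.
  by move=> x /= h Dx; apply: h => _; rewrite eD.
have ae_e2 n m : n2 mu (fun x => f m x - f n x) = n2 mu (fun x => e m x - e n x).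
  rewrite ae_e; last exact: LL_meas.
  rewrite /n2; under eq_integral do rewrite -sqnN opprB.
  rewrite -/(n2 mu (fun x => e n x - f m x)) ae_e//.
  by rewrite /n2; under eq_integral do rewrite -sqnN opprB.
have bF n : (n2 mu (fun x => F x - f n x)%R <= ((1 / 16) ^+ n)%:E)%E.
  rewrite ae_e//.
  apply: (@fatou_le (fun m x => (sqn (e m x - e n x))%:E)).
  - by move=> m; apply/measurable_EFinP/measurable_sqn/cmeasB.
  - by move=> m x; rewrite lee_fin sqn_ge0.
  - by move=> x; apply: sqn_cvg; [exact: cR|exact: cI].
  - exists n => m nm; rewrite -/(n2 mu (fun x => e m x - e n x)) -ae_e2.
    by rewrite LL_fin ?lee_fin ?fC//; exact: LL_B.
have LF n : LL mu (fun x => F x - f n x).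
  split; last exact: le_lt_trans (bF n) (ltry _).
  by apply: cmeasB => //; exact: LL_meas.
exists F; split; last by move=> n; rewrite -lee_fin -LL_fin.
rewrite (_ : F = fun x => (F x - f 0%N x) + f 0%N x); first exact: LL_D.
by apply/funext => x; rewrite subrK.
Qed.

Lemma LL_complete (f : nat -> T -> R[i]) : (forall n, LL mu (f n)) ->
  (forall e : R, 0 < e -> exists N, forall n m, (N <= n)%N -> (N <= m)%N ->
     N2 mu (fun x => f m x - f n x) <= e) ->
  exists F, LL mu F /\ forall e : R, 0 < e -> exists N, forall n, (N <= n)%N ->
     Nm mu (fun x => F x - f n x) <= e.
Proof.
move=> Lf fC.
have /choice[N hN] : forall k : nat, exists N, forall n m, (N <= n)%N -> (N <= m)%N ->
     N2 mu (fun x => f m x - f n x) <= (1 / 16) ^+ k.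
  by move=> k; apply: fC; rewrite exprn_gt0.
(* Summing the ranks keeps [M k] above [N k] and makes it monotone in k. *)
pose M k := (\sum_(i < k.+1) N i)%N.
have NM k : (N k <= M k)%N by rewrite /M big_ord_recr leq_addl.
have MM k m : (k <= m)%N -> (M k <= M m)%N.
  elim: m => [|m ih]; first by rewrite leqn0 => /eqP ->.
  rewrite leq_eqVlt => /orP[/eqP -> //|]; rewrite ltnS => /ih h.
  by apply: leq_trans h _; rewrite {2}/M big_ord_recr leq_addr.
have [F [LF hF]] := @LL_complete_fast (fun k => f (M k)) (fun k => Lf (M k))
  (fun n m nm => hN n _ _ (NM n) (leq_trans (NM n) (MM _ _ nm))).
exists F; split=> // e e0.
have [k hk] : exists k : nat, (1 / 4 : R) ^+ k <= e / 2.
  have := @cvg_geometric R 1 (1 / 4).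
  rewrite ger0_norm; last by lra.
  move=> /(_ ltac:(lra))/cvgrPdist_le/(_ (e / 2)) [|k _ hk]; first lra.
  exists k; have := hk k (leqnn k); rewrite /= sub0r normrN [X in `|X|]mul1r.
  by apply: le_trans; exact: ler_norm.
exists (M k) => n Mn; have Lfn := Lf n.
apply: le_trans (Nm_dist LF (Lf (M k)) Lfn) _.
have q (x : R) : 0 <= x -> x <= (1 / 16) ^+ k -> Num.sqrt x <= e / 2.
  move=> x0 xk; rewrite -(@ler_pXn2r _ 2)// ?nnegrE ?sqrtr_ge0//; last lra.
  rewrite sqr_sqrtr//; apply: le_trans xk _.
  rewrite (_ : 1 / 16 = (1 / 4) ^+ 2 :> R); last by field.
  by rewrite exprAC ler_pXn2r// ?nnegrE ?exprn_ge0//; lra.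
rewrite (_ : e = e / 2 + e / 2); last by field.
apply: lerD; apply: q; rewrite ?N2_ge0//; apply: hN => //.
exact: leq_trans Mn.
Qed.

End Completeness.

(** * Unconditional sums *)

Section Esum.
Context {R : realType} {I : choiceType}.
Implicit Types (a : I -> \bar R).
Local Open Scope ereal_scope.

Lemma fsbig_fset a (B : {fset I}) : \sum_(x \in [set` B]) a x = \sum_(i <- B) a i.
Proof. by rewrite fsbig_finite//= set_fsetK. Qed.

Lemma fset_le_esum a (B : {fset I}) : (forall i, 0 <= a i) ->
  \sum_(i <- B) a i <= \esum_(i in setT) a i.
Proof.
move=> a0; rewrite -fsbig_fset; apply: ereal_sup_ubound.
by exists [set` B] => //; split.
Qed.

Lemma esum_le_fset a (M : \bar R) : (forall B : {fset I}, \sum_(i <- B) a i <= M) ->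
  \esum_(i in setT) a i <= M.
Proof.
move=> h; apply: ge_ereal_sup => _ [A [fA _] <-].
by rewrite fsbig_finite//=; exact: h.
Qed.

Lemma esum_gt_fset a (M : \bar R) : M < \esum_(i in setT) a i ->
  exists B : {fset I}, M < \sum_(i <- B) a i.
Proof.
move=> /ereal_sup_gt[_ [A [fA _] <-]]; rewrite fsbig_finite//= => h.
by exists (fset_set A).
Qed.

End Esum.

Section CountEsum.
Context {R : realType} {I : countType}.
Local Open Scope ereal_scope.

Definition enumf (a : I -> \bar R) (n : nat) : \bar R := oapp a 0 (pickle_inv n).

Lemma enumf_ge0 (a : I -> \bar R) n : (forall i, 0 <= a i) -> 0 <= enumf a n.
Proof. by move=> a0; rewrite /enumf; case: pickle_inv. Qed.

Lemma esum_nneseries (a : I -> \bar R) : (forall i, 0 <= a i) ->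
  \esum_(i in setT) a i = \sum_(n <oo) enumf a n.
Proof.
move=> a0; rewrite nneseries_esumT; last by move=> n; exact: enumf_ge0.
rewrite (esumID (range (@choice.pickle I))); last by move=> n _; exact: enumf_ge0.
rewrite [X in _ + X]esum1 ?adde0; last first.
  move=> n [_ nr]; rewrite /enumf; case E : (pickle_inv n) => [i|//].
  exfalso; apply: nr; exists i => //.
  by have := @pickle_invK I n; rewrite E.
rewrite setTI (@reindex_esum _ _ _ setT (range (@choice.pickle I)) (@choice.pickle I))//.
- by apply: eq_esum => i _; rewrite /enumf pickleK_inv.
- by split=> //; move=> i j _ _ /(pcan_inj (@pickleK I)).
Qed.

Context d (T : measurableType d) (mu : {measure set T -> \bar R}).

Lemma enumf_fun (f : I -> T -> \bar R) n :
  (fun x => enumf (f ^~ x) n) = (if pickle_inv n is Some i then f i else cst 0).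
Proof. by apply/funext => x; rewrite /enumf; case: pickle_inv. Qed.

Lemma emeasurable_esum (f : I -> T -> \bar R) :
  (forall i, measurable_fun setT (f i)) -> (forall i x, 0 <= f i x) ->
  measurable_fun setT (fun x => \esum_(i in setT) f i x).
Proof.
move=> mf f0; under eq_fun do rewrite esum_nneseries//.
apply: ge0_emeasurable_sum => [n x _ _|n _]; first exact: enumf_ge0.
by rewrite enumf_fun; case: pickle_inv => // ; exact: measurable_cst.
Qed.

Lemma integral_esum (f : I -> T -> \bar R) :
  (forall i, measurable_fun setT (f i)) -> (forall i x, 0 <= f i x) ->
  \int[mu]_x (\esum_(i in setT) f i x) = \esum_(i in setT) \int[mu]_x f i x.
Proof.
move=> mf f0; under eq_integral do rewrite esum_nneseries//.
rewrite integral_nneseries//; last 2 first.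
- by move=> n; rewrite enumf_fun; case: pickle_inv => //; exact: measurable_cst.
- by move=> n x _; exact: enumf_ge0.
rewrite esum_nneseries; last by move=> i; exact: integral_ge0.
apply: eq_eseriesr => n _; rewrite /enumf; case: pickle_inv => //=.
by rewrite integral0_eq.
Qed.

End CountEsum.

(* I with all its subsets as measurable sets; i0 makes it a pointed type. *)
Definition disc (I : choiceType) (i0 : I) : Type := I.

Section Disc.
Variables (I : choiceType) (i0 : I).
HB.instance Definition _ := Choice.on (disc i0).
HB.instance Definition _ := isPointed.Build (disc i0) i0.
Let disc_meas : set (set (disc i0)) := setT.
Let disc0 : disc_meas set0. Proof. by []. Qed.
Let discC A : disc_meas A -> disc_meas (~` A). Proof. by []. Qed.
Let discU (F : (set (disc i0))^nat) : (forall i, disc_meas (F i)) ->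
  disc_meas (\bigcup_i F i). Proof. by []. Qed.
HB.instance Definition _ := @isMeasurable.Build default_measure_display (disc i0)
  disc_meas disc0 discC discU.
End Disc.

(** With counting measure the integral is [esum] and l2(I) becomes a space [LL]; Cauchy-Schwarz, the
    triangle inequality and completeness are then those already proved. *)
Definition cnt (R : realType) (I : choiceType) (i0 : I) :
  {measure set (disc i0) -> \bar R} := @counting (disc i0) R.
Arguments cnt {R I} i0.

Section L2seq.
Context {R : realType} {I : countType} {i0 : I}.
Implicit Types (c f : I -> R[i]) (B : {fset I}).
Local Notation cnt := (@cnt R I i0).

Lemma disc_measurable_fun d (T : measurableType d) (f : disc i0 -> T) :
  measurable_fun setT f.
Proof. by []. Qed.

Lemma cmeas_disc (c : disc i0 -> R[i]) : cmeas c.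
Proof. by split; exact: disc_measurable_fun. Qed.

Lemma integral_cnt (a : disc i0 -> \bar R) : (forall i, (0 <= a i)%E) ->
  (\int[cnt]_i a i = \esum_(i in setT) a i)%E.
Proof.
move=> a0.
(* The function is the sum over j of a(j) times the indicator of {j}; sum and integral are then
   exchanged. *)
transitivity (\int[cnt]_i \esum_(j in [set: I]) (a j * (\1_[set j] i)%:E))%E.
  apply: eq_integral => i _.
  rewrite (esumID [set i : I]); last first.
    by move=> j _; rewrite mule_ge0//.
  rewrite setTI esum_set1; last by rewrite mule_ge0.
  rewrite indicE mem_set// mule1 esum1 ?adde0// => j [_ /= ji].
  by rewrite indicE memNset ?mule0//= => /esym.
rewrite integral_esum//; last by move=> j x; rewrite mule_ge0.
apply: eq_esum => j _.
rewrite ge0_integralZl//.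
rewrite integral_indic// setIT -[RHS]mule1; congr (_ * _)%E.
rewrite /= /counting asboolT; last exact: finite_set1.
by rewrite fset_set1 cardfs1.
Qed.

Lemma n2_l2 c : n2 cnt c = sqnorm_l2 c.
Proof.
rewrite /n2 integral_cnt; last by move=> i; rewrite lee_fin sqn_ge0.
by apply: eq_esum => i _; rewrite normc_sqn.
Qed.

Lemma l2_LL c : l2 c <-> LL cnt c.
Proof.
rewrite /l2 /= /LL n2_l2; split=> [h|[]//]; split => //; exact: cmeas_disc.
Qed.

Lemma n2_esum c : n2 cnt c = (\esum_(i in setT) (sqn (c i))%:E)%E.
Proof. by rewrite /n2 integral_cnt// => i; rewrite lee_fin sqn_ge0. Qed.

Lemma sum_sqn_le c B : LL cnt c -> \sum_(i <- B) sqn (c i) <= N2 cnt c.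
Proof.
move=> Lc; rewrite -lee_fin -LL_fin// n2_esum -sumEFin.
by apply: fset_le_esum => i; rewrite lee_fin sqn_ge0.
Qed.

Lemma LL_cnt_bound c (M : R) : (forall B, \sum_(i <- B) sqn (c i) <= M) ->
  LL cnt c /\ N2 cnt c <= M.
Proof.
move=> h.
have h2 : (n2 cnt c <= M%:E)%E.
  by rewrite n2_esum; apply: esum_le_fset => B; rewrite sumEFin lee_fin.
have Lc : LL cnt c by split; [exact: cmeas_disc|apply: le_lt_trans h2 (ltry _)].
by split; rewrite // -lee_fin -LL_fin.
Qed.

Lemma sqn_le_N2 c i : LL cnt c -> sqn (c i) <= N2 cnt c.
Proof.
by move=> Lc; have := sum_sqn_le [fset i]%fset Lc; rewrite big_seq_fset1.
Qed.

Lemma N2_eq0 c : LL cnt c -> N2 cnt c <= 0 -> c = fun=> 0.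
Proof.
move=> Lc h; apply/funext => i; apply: sqn_eq0; apply/eqP.
by rewrite eq_le sqn_ge0 andbT (le_trans (sqn_le_N2 i Lc)).
Qed.

Definition delta (i : I) : I -> R[i] := fun j => ((j == i)%:R)%C.
Definition trunc c B : I -> R[i] := fun j => if j \in B then c j else 0.

Lemma trunc_sum c B : trunc c B = fun j => \sum_(i <- B) c i * delta i j.
Proof.
apply/funext => j; rewrite /trunc; case: ifPn => jB.
  rewrite (big_fsetD1 j)//= /delta eqxx mulr1 big_seq big1 ?addr0// => i.
  by rewrite in_fsetD1 eq_sym => /andP[/negbTE -> _]; rewrite mulr0.
rewrite big_seq big1// => i iB; rewrite /delta; case: eqVneq => [ji|]; last first.
  by rewrite mulr0.
by move: jB; rewrite ji iB.
Qed.

Lemma N2_trunc c B : LL cnt (trunc c B) /\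
  N2 cnt (trunc c B) = \sum_(i <- B) sqn (c i).
Proof.
have le (B' : {fset I}) : \sum_(i <- B') sqn (trunc c B i) <= \sum_(i <- B) sqn (c i).
  rewrite (big_fsetID _ (mem B))/= [X in _ + X]big_seq [X in _ + X]big1; last first.
    by move=> i; rewrite !inE => /andP[_ /negbTE iB]; rewrite /trunc iB sqn0.
  rewrite addr0.
  have : ([fset x in B' | x \in B] `<=` B)%fset.
    by apply/fsubsetP => i; rewrite !inE => /andP[].
  move=> /fsetIidPr h.
  rewrite [leRHS](big_fsetID _ (mem [fset x in B' | x \in B]%fset))/=.
  rewrite (_ : [fset x in B | x \in [fset x in B' | x \in B]]%fset =
    [fset x in B' | x \in B]%fset); last first.
    by apply/fsetP => i; rewrite !inE; case: (i \in B); rewrite ?andbT ?andbF.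
  apply: (@le_trans _ _ (\sum_(i <- [fset x in B' | x \in B]%fset) sqn (c i))).
    rewrite big_seq [leRHS]big_seq; apply: ler_sum => i; rewrite !inE /trunc.
    by move=> /andP[_ ->].
  by rewrite lerDl sumr_ge0// => i _; exact: sqn_ge0.
have [LT h] := LL_cnt_bound le; split => //.
apply/eqP; rewrite eq_le h/=; apply: le_trans (sum_sqn_le B LT).
rewrite big_seq [leRHS]big_seq; apply: ler_sum => i iB.
by rewrite /trunc iB.
Qed.

Lemma LL_delta i : LL cnt (delta i).
Proof.
have [h _] := N2_trunc (fun=> 1) [fset i]%fset.
rewrite (_ : delta i = trunc (fun=> 1) [fset i]%fset)//.
by rewrite trunc_sum; apply/funext => j; rewrite big_seq_fset1 mul1r.
Qed.

Lemma N2_split c B : LL cnt c -> LL cnt (fun j => c j - trunc c B j) /\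
  N2 cnt (fun j => c j - trunc c B j) = N2 cnt c - \sum_(i <- B) sqn (c i).
Proof.
move=> Lc; have [LT hT] := N2_trunc c B; split; first exact: LL_B.
rewrite N2BE// hT.
suff -> : complex.Re (ip cnt c (trunc c B)) = \sum_(i <- B) sqn (c i) by ring.
rewrite -hT -[N2 _ _]/(complex.Re ((N2 cnt (trunc c B))%:C)%C) -ipff.
congr complex.Re; apply: eq_cint => j; rewrite /trunc.
by case: ifPn => // _; rewrite conjc0 !mulr0.
Qed.

Lemma trunc_approx c (e : R) : LL cnt c -> 0 < e -> exists A : {fset I},
  forall B, (A `<=` B)%fset -> N2 cnt (fun j => c j - trunc c B j) <= e.
Proof.
move=> Lc e0.
have : ((N2 cnt c - e)%:E < \esum_(i in setT) (sqn (c i))%:E)%E.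
  by rewrite -n2_esum LL_fin// lte_fin ltrBlDr ltrDl.
move=> /esum_gt_fset[A]; rewrite sumEFin lte_fin => hA.
exists A => B AB; have [_ ->] := N2_split B Lc.
suff : \sum_(i <- A) sqn (c i) <= \sum_(i <- B) sqn (c i) by lra.
rewrite [leRHS](big_fsetID _ (mem A))/=.
rewrite (_ : [fset x in B | x \in A]%fset = A); last first.
  apply/fsetP => i; rewrite !inE; case iA : (i \in A); rewrite ?andbF ?andbT//.
  by apply: (fsubsetP AB).
by rewrite lerDl sumr_ge0// => i _; exact: sqn_ge0.
Qed.

End L2seq.

Local Existing Instance summability.totally_filter.

Section Csum.
Context {R : realType} {I : choiceType}.
Implicit Types (u : I -> R[i]) (s : R[i]).

Lemma partial_sumE u (B : {fset I}) : summability.partial_sum u B = \sum_(i <- B) u i.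
Proof. by rewrite /summability.partial_sum big_seq_fsetE. Qed.

Lemma normcC (z : R[i]) : `|z| = ((normc z)%:C)%C.
Proof. by []. Qed.

Lemma normc_le_sqn (z : R[i]) (e : R) : 0 <= e -> (normc z <= e) = (sqn z <= e ^+ 2).
Proof.
move=> e0; rewrite -normc_sqn ler_pXn2r// nnegrE//.
by case: z => a b; rewrite /normc sqrtr_ge0.
Qed.

(** With this form, arguments about series become real inequalities between squared moduli. *)
Lemma has_csumP u s : has_csum u s <->
  (forall e, 0 < e -> exists A : {fset I}, forall B, (A `<=` B)%fset ->
    sqn (s - \sum_(i <- B) u i) <= e).
Proof.
split=> [h e e0|h].
  have /(@cvgrPdist_le _ (R[i]^o))/(_ (((Num.sqrt e)%:C)%C)) : summability.partial_sum u @ summability.totally --> (s : R[i]^o) by exact: h.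
  rewrite ltcR sqrtr_gt0 => /(_ e0)[A _ hA]; exists A => B AB.
  have := hA B AB; rewrite partial_sumE normcC lecR normc_le_sqn ?sqrtr_ge0//.
  by rewrite sqr_sqrtr// ltW.
apply/(@cvgrPdist_le _ (R[i]^o)) => e; case: e => e1 e2; rewrite ltcE/= => /andP[/eqP -> e0].
have [A hA] := h (e1 ^+ 2) (exprn_gt0 2 e0).
exists A => // B AB; rewrite partial_sumE normcC lecR normc_le_sqn ?(ltW e0)//.
exact: hA.
Qed.

Lemma has_csum_unique u s s' : has_csum u s -> has_csum u s' -> s = s'.
Proof.
move=> /has_csumP h /has_csumP h'; apply/eqP; rewrite -subr_eq0; apply/eqP.
apply: sqn_eq0; apply/eqP; rewrite eq_le sqn_ge0 andbT.
apply/ler_addgt0Pr => e e0; rewrite add0r.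
have e4 : 0 < e / 4 by lra.
have [A hA] := h _ e4; have [A' hA'] := h' _ e4.
pose B := (A `|` A')%fset.
have AB : (A `<=` B)%fset by exact: fsubsetUl.
have AB' : (A' `<=` B)%fset by exact: fsubsetUr.
have := sqnD2 (s - \sum_(i <- B) u i) (\sum_(i <- B) u i - s').
rewrite addrA subrK -(sqnN (\sum_(i <- B) u i - s')) opprB => /le_trans; apply.
have := hA _ AB; have := hA' _ AB'; lra.
Qed.

Lemma csum_eq u s : has_csum u s -> csum u = s.
Proof.
move=> h; rewrite /csum /summability.sum.
apply: (@cvg_lim (R[i]^o)) => //; exact: norm_hausdorff.
Qed.

Lemma has_csum_fin u (K : {fset I}) : (forall i, i \notin K -> u i = 0) ->
  has_csum u (\sum_(i <- K) u i).
Proof.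
move=> h; apply/has_csumP => e e0; exists K => B KB.
rewrite [X in _ - X](big_fsetID _ (mem K))/= [X in _ - (_ + X)]big_seq.
rewrite [X in _ - (_ + X)]big1; last first.
  by move=> i; rewrite !inE => /andP[_ /h].
rewrite (_ : [fset x in B | x \in K]%fset = K); last first.
  apply/fsetP => i; rewrite !inE; case iA : (i \in K); rewrite ?andbF ?andbT//.
  by apply: (fsubsetP KB).
by rewrite addr0 subrr sqn0 ltW.
Qed.

Lemma has_csum_eq u u' s : u =1 u' -> has_csum u s -> has_csum u' s.
Proof. by move=> /funext ->. Qed.

End Csum.

Section Continuity.
Context d (T : measurableType d) (R : realType).
Variable mu : {measure set T -> \bar R}.
Implicit Types f g h : T -> R[i].

Lemma sqn_ip_le f g : LL mu f -> LL mu g -> sqn (ip mu f g) <= (Nm mu f * Nm mu g) ^+ 2.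
Proof. by move=> Lf Lg; rewrite exprMn !Nm2; exact: CS. Qed.

Lemma sqn_ip_cont f v (e : R) : LL mu f -> LL mu v -> 0 < e ->
  exists2 d : R, 0 < d & forall h, LL mu h -> Nm mu (fun x => f x - h x) <= d ->
   `|sqn (ip mu f v) - sqn (ip mu h v)| <= e.
Proof.
move=> Lf Lv e0.
set F := Nm mu f; set N := Nm mu v.
have F0 : 0 <= F by exact: Nm_ge0.
have N0 : 0 <= N by exact: Nm_ge0.
(* For h at distance D <= 1 from f the two error terms 2 D N^2 F and D^2 N^2 are together at most D
   N^2 (2 F + 1); the last 1 keeps [M] positive. *)
pose M := (N ^+ 2 * (2 * F + 1) + 1).
have M0 : 0 < M by rewrite /M; nra.
exists (Num.min 1 (e / M)); first by rewrite lt_min ltr01 divr_gt0.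
move=> h Lh; rewrite le_min => /andP[D1 D2].
have Lfh := LL_B Lf Lh.
set D := Nm _ _ in D1 D2.
have D0 : 0 <= D by exact: Nm_ge0.
have -> : sqn (ip mu h v) = sqn (ip mu f v) -
   2 * complex.Re (ip mu (fun x => f x - h x) v * conjc (ip mu f v)) +
   sqn (ip mu (fun x => f x - h x) v).
  rewrite ipBl//; move: (ip mu f v) (ip mu h v) => a b.
  by rewrite /sqn !cplxE; ring.
set a := ip mu f v; set b := ip mu (fun x => f x - h x) v.
have hb : sqn b <= (D * N) ^+ 2 by exact: sqn_ip_le.
have ha : sqn a <= (F * N) ^+ 2 by exact: sqn_ip_le.
have hab : `|complex.Re (b * conjc a)| <= (D * N) * (F * N).
  rewrite -(@ler_pXn2r _ 2)// ?nnegrE ?mulr_ge0//.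
  rewrite real_normK ?num_real// [leRHS]exprMn.
  apply: (@le_trans _ _ (sqn b * sqn a)).
    by rewrite -(sqnJ a) -sqnM /sqn lerDl sqr_ge0.
  by apply: ler_pM => //; exact: sqn_ge0.
have : D * M <= e by rewrite -ler_pdivlMr.
have sb := sqn_ge0 b.
have DD : D ^+ 2 <= D by rewrite expr2 ler_piMl.
rewrite /M => DM.
rewrite (_ : _ - _ = 2 * complex.Re (b * conjc a) - sqn b); last by ring.
apply: (@le_trans _ _ (2 * ((D * N) * (F * N)) + (D * N) ^+ 2)).
  apply: le_trans (ler_normB _ _) _; rewrite normrM (ger0_norm sb) ger0_norm//.
  by apply: lerD => //; rewrite ler_pM2l.
apply: le_trans DM.
have N2 : 0 <= N ^+ 2 by exact: sqr_ge0.
have : D ^+ 2 * N ^+ 2 <= D * N ^+ 2 by rewrite ler_wpM2r.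
rewrite !exprMn; nra.
Qed.

Lemma sum_ip_cont (I : Type) (s : seq I) (v : I -> T -> R[i]) f (e : R) :
  LL mu f -> (forall i, LL mu (v i)) -> 0 < e ->
  exists2 d : R, 0 < d & forall h, LL mu h -> Nm mu (fun x => f x - h x) <= d ->
   `|\sum_(i <- s) sqn (ip mu f (v i)) - \sum_(i <- s) sqn (ip mu h (v i))| <= e.
Proof.
move=> Lf Lv; elim: s e => [|i s ih] e e0.
  by exists 1 => // h _ _; rewrite !big_nil subrr normr0 ltW.
have e2 : 0 < e / 2 by lra.
have [d1 d10 h1] := ih _ e2; have [d2 d20 h2] := sqn_ip_cont Lf (Lv i) e2.
exists (Num.min d1 d2); first by rewrite lt_min d10.
move=> h Lh; rewrite le_min => /andP[l1 l2]; rewrite !big_cons.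
rewrite opprD addrACA; apply: le_trans (ler_normD _ _) _.
have := h1 h Lh l1; have := h2 h Lh l2; lra.
Qed.

Lemma Nm_ipl (f g : T -> R[i]) : LL mu f -> LL mu g -> complex.Re (ip mu f g) <= Nm mu f * Nm mu g.
Proof. by move=> Lf Lg; apply: le_trans (ler_norm _) (Re_ip_le Lf Lg). Qed.

End Continuity.

(** * Operators on l2 *)

Lemma RC_sum (R : realType) (I : Type) (s : seq I) (f : I -> R) :
  ((\sum_(i <- s) f i)%:C)%C = \sum_(i <- s) ((f i)%:C)%C.
Proof. by apply: cplxP; rewrite ?Re_sum ?Im_sum//= big1. Qed.

Section L2ops.
Context {R : realType} {I : countType} {i0 : I}.
Implicit Types (c d u : I -> R[i]) (B K : {fset I}) (T S : (I -> R[i]) -> (I -> R[i])).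
Local Notation cnt := (@cnt R I i0).
Local Notation LLc := (@LL _ (disc i0) R cnt).
Local Notation N2c := (@N2 _ (disc i0) R cnt).
Local Notation Nmc := (@Nm _ (disc i0) R cnt).
Local Notation ipc := (@ip _ (disc i0) R cnt).

Lemma trunc_approxN c (e : R) : LLc c -> 0 < e -> exists A : {fset I},
  forall B, (A `<=` B)%fset -> Nmc (fun j => c j - trunc c B j) <= e.
Proof.
move=> Lc e0; have [A hA] := trunc_approx Lc (exprn_gt0 2 e0).
exists A => B AB; rewrite -(@ler_pXn2r _ 2)// ?nnegrE ?Nm_ge0 ?(ltW e0)// Nm2.
exact: hA.
Qed.

Lemma LL_trunc c B : LLc (trunc c B).
Proof. by have [] := @N2_trunc R I i0 c B. Qed.

(** On truncations linearity gives the finite sums, and the bound makes the values at the tails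
    small. Most series over I are evaluated in this way: inner products, adjoints and the action of
    Gram matrices reduce to a bounded functional and its values at the [delta i]. *)
Lemma functional_csum (phi : (I -> R[i]) -> R[i]) (C : R) c :
  (forall c c', LLc c -> LLc c' -> phi (fun i => c i + c' i) = phi c + phi c') ->
  (forall a c, LLc c -> phi (fun i => a * c i) = a * phi c) ->
  (forall c, LLc c -> sqn (phi c) <= C * N2c c) -> LLc c ->
  has_csum (fun i => c i * phi (delta i)) (phi c).
Proof.
move=> phiD phiZ phiB Lc.
have phi0 : phi (fun=> 0) = 0.
  rewrite -[RHS](mul0r (phi c)) -phiZ//; congr phi.
  by apply/funext => i; rewrite mul0r.
have phiN c1 c2 : LLc c1 -> LLc c2 -> phi (fun i => c1 i - c2 i) = phi c1 - phi c2.
  move=> L1 L2; rewrite phiD//; last exact: LL_N.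
  congr (_ + _); rewrite -mulN1r -phiZ//; congr phi.
  by apply/funext => i; rewrite mulN1r.
have phiT B : phi (trunc c B) = \sum_(i <- B) c i * phi (delta i).
  rewrite trunc_sum; elim: (B : seq I) => [|i s ih].
    by rewrite big_nil -[RHS]phi0; congr phi; apply/funext => i; rewrite big_nil.
  rewrite big_cons -ih -phiZ; last exact: LL_delta.
  rewrite -phiD; last 2 first.
  - by apply: LL_Z; exact: LL_delta.
  - by apply: LL_sum => j; apply: LL_Z; exact: LL_delta.
  by congr phi; apply/funext => j; rewrite big_cons.
apply/has_csumP => e e0.
have C1 : 0 < `|C| + 1 by rewrite ltr_wpDl.
have [A hA] := trunc_approx Lc (divr_gt0 e0 C1).
exists A => B AB; rewrite -phiT -phiN//; last exact: LL_trunc.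
have LB := LL_B Lc (LL_trunc c B).
apply: le_trans (phiB _ LB) _.
have := hA B AB; rewrite ler_pdivlMr// => h.
apply: le_trans h; rewrite mulrC ler_wpM2l ?N2_ge0//.
by apply: le_trans (ler_norm _) _; rewrite lerDl.
Qed.

Lemma ip_deltar c k : LLc c -> ipc c (delta k) = c k.
Proof.
move=> Lc.
have Ld : LLc (delta k) by exact: LL_delta.
have -> : ipc c (delta k) = ipc (fun i => c i * delta k i) (delta k).
  apply: eq_cint => i; rewrite -mulrA; congr (_ * _).
  by rewrite /delta; case: eqVneq; rewrite ?conjc1 ?conjc0 ?mul1r// mul0r.
have -> : (fun i => c i * delta k i) = (fun i => c k * delta k i).
  by apply/funext => i; rewrite /delta; case: eqVneq => [->//|]; rewrite !mulr0.
rewrite ipZl// ipff; suff -> : N2c (delta k) = 1 by rewrite mulr1.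
have [_] := @N2_trunc R I i0 (fun=> 1) [fset k]%fset.
rewrite trunc_sum; under eq_fun do rewrite big_seq_fset1 mul1r.
by move=> ->; rewrite big_seq_fset1 sqn1.
Qed.

Lemma ip_deltal c k : LLc c -> ipc (delta k) c = conjc (c k).
Proof. by move=> Lc; rewrite (ipJ Lc) ?ip_deltar//; exact: LL_delta. Qed.

Lemma ip_csum c d : LLc c -> LLc d -> has_csum (fun i => c i * conjc (d i)) (ipc c d).
Proof.
move=> Lc Ld.
have := @functional_csum (fun c => ipc c d) (N2c d) c.
move=> /(_ (fun c c' L L' => ipDl L L' Ld) (fun a c L => ipZl a L Ld)).
move=> /(_ (fun c L => ltac:(rewrite mulrC; exact: CS)) Lc).
by apply: has_csum_eq => i; rewrite ip_deltal.
Qed.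

Lemma bounded_opP (C : R) T : bounded_op C T -> forall c, LLc c ->
  LLc (T c) /\ N2c (T c) <= C ^+ 2 * N2c c.
Proof.
move=> [C0 _ bT] c Lc; have := bT c.
rewrite -!(@n2_l2 R I i0) => /(_ (iffRL (l2_LL c) Lc)).
rewrite (LL_fin Lc) -EFinM => h.
have LT : LLc (T c) by split; [exact: cmeas_disc|exact: le_lt_trans h (ltry _)].
by split => //; rewrite -lee_fin -LL_fin.
Qed.

Lemma bounded_opI (C : R) T : 0 <= C ->
  (forall (a : R[i]) c c', LLc c -> LLc c' ->
     T (fun i => a * c i + c' i) = (fun i => a * T c i + T c' i)) ->
  (forall c, LLc c -> LLc (T c) /\ N2c (T c) <= C ^+ 2 * N2c c) ->
  bounded_op C T.
Proof.
move=> C0 lT bT; split => //.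
  by move=> a c c' /(@l2_LL R I i0) Lc /(@l2_LL R I i0) Lc'; exact: lT.
move=> c /(@l2_LL R I i0) Lc; have [LT h] := bT _ Lc.
by rewrite -!(@n2_l2 R I i0) !LL_fin// -EFinM lee_fin.
Qed.

Section Op.
Variables (C : R) (T : (I -> R[i]) -> (I -> R[i])).
Hypothesis bT : bounded_op C T.

Lemma op_LL c : LLc c -> LLc (T c).
Proof. by move=> /(bounded_opP bT)[]. Qed.

Lemma op_N2 c : LLc c -> N2c (T c) <= C ^+ 2 * N2c c.
Proof. by move=> /(bounded_opP bT)[]. Qed.

Lemma op_C0 : 0 <= C. Proof. by case: bT. Qed.

Lemma op_Nm c : LLc c -> Nmc (T c) <= C * Nmc c.
Proof.
move=> Lc; rewrite -(@ler_pXn2r _ 2)// ?nnegrE ?mulr_ge0 ?Nm_ge0 ?op_C0//.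
by rewrite exprMn !Nm2; exact: op_N2.
Qed.

Lemma op_lin (a : R[i]) c c' : LLc c -> LLc c' ->
  T (fun i => a * c i + c' i) = (fun i => a * T c i + T c' i).
Proof.
move=> /(@l2_LL R I i0) Lc /(@l2_LL R I i0) Lc'.
by case: bT => _ h _; exact: h.
Qed.

Lemma op_D c c' : LLc c -> LLc c' ->
  T (fun i => c i + c' i) = (fun i => T c i + T c' i).
Proof.
move=> Lc Lc'; have := op_lin 1 Lc Lc'.
by under eq_fun do rewrite mul1r; under [X in _ = X -> _]eq_fun do rewrite mul1r.
Qed.

Lemma op_0 : T (fun=> 0) = fun=> 0.
Proof.
have := op_lin (-1) (@LL0 _ _ _ cnt) (@LL0 _ _ _ cnt).
by under eq_fun do rewrite mulr0 addr0; under [X in _ = X -> _]eq_fun do rewrite mulN1r addNr.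
Qed.

Lemma op_Z (a : R[i]) c : LLc c -> T (fun i => a * c i) = (fun i => a * T c i).
Proof.
move=> Lc; have := op_lin a Lc (@LL0 _ _ _ cnt); rewrite op_0.
by under eq_fun do rewrite addr0; under [X in _ = X -> _]eq_fun do rewrite addr0.
Qed.

Lemma op_B c c' : LLc c -> LLc c' ->
  T (fun i => c i - c' i) = (fun i => T c i - T c' i).
Proof.
move=> Lc Lc'; rewrite op_D//; last exact: LL_N.
apply/funext => i; congr (_ + _).
have := op_Z (-1) Lc'; under eq_fun do rewrite mulN1r.
by move=> ->; rewrite mulN1r.
Qed.

(** The k-th coordinate of the adjoint at d must be <d, T (delta k)>. Taking this as the definition
    replaces the representation theorem for functionals; what is left is to show that the
    coordinates are square-summable. *)
Definition adj d : I -> R[i] := fun k => ipc d (T (delta k)).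

(** A finite partial sum s of the squares equals <d, T u>, where u is the truncation of [adj d] and
    has squared norm s. Cauchy-Schwarz gives s^2 <= |d|^2 C^2 s, and s cancels. *)
Lemma adj_bound d : LLc d -> LLc (adj d) /\ N2c (adj d) <= C ^+ 2 * N2c d.
Proof.
move=> Ld; apply: LL_cnt_bound => B.
have Lt := LL_trunc (adj d) B.
have LTt := op_LL Lt.
have LTd k : LLc (T (delta k)) by apply: op_LL; exact: LL_delta.
set s := \sum_(i <- B) _.
have sE : (s%:C)%C = ipc d (T (trunc (adj d) B)).
  have h := @functional_csum (fun c => ipc (T c) d) (C ^+ 2 * N2c d) (trunc (adj d) B).
  have /h{}h : forall c c' : I -> R[i], LLc c -> LLc c' -> ipc (T (fun i => c i + c' i)) d = ipc (T c) d + ipc (T c') d.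
    by move=> c c' L L'; rewrite op_D// ipDl//; exact: op_LL.
  have /h{}h : forall (a : R[i]) (c : I -> R[i]), LLc c -> ipc (T (fun i => a * c i)) d = a * ipc (T c) d.
    by move=> a c L; rewrite op_Z// ipZl//; exact: op_LL.
  have /h/(_ Lt){}h : forall c : I -> R[i], LLc c -> sqn (ipc (T c) d) <= C ^+ 2 * N2c d * N2c c.
    move=> c L; apply: le_trans (CS (op_LL L) Ld) _.
    by rewrite mulrAC ler_wpM2r ?N2_ge0// op_N2.
  have /has_csum_unique : has_csum (fun i => trunc (adj d) B i * ipc (T (delta i)) d)
     (\sum_(i <- B) trunc (adj d) B i * ipc (T (delta i)) d).
    by apply: has_csum_fin => i; rewrite /trunc => /negbTE ->; rewrite mul0r.
  move=> /(_ _ h) e; rewrite (ipJ LTt Ld) -e conjc_sum /s.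
  rewrite RC_sum.
  rewrite big_seq [RHS]big_seq; apply: eq_bigr => i iB.
  rewrite /trunc iB (ipJ Ld (LTd i)) -/(adj d i) conjcM conjcK mulrC.
  by rewrite -mulcJ.
have s0 : 0 <= s by apply: sumr_ge0 => i _; exact: sqn_ge0.
have h1 : s ^+ 2 <= N2c d * (C ^+ 2 * s).
  rewrite -(@sqnR _ s) sE; apply: le_trans (CS Ld LTt) _.
  rewrite ler_wpM2l ?N2_ge0//; apply: le_trans (op_N2 Lt) _.
  by have [_ ->] := @N2_trunc R I i0 (adj d) B.
have [->|sn0] := eqVneq s 0; first by rewrite mulr_ge0 ?sqr_ge0 ?N2_ge0.
have sp : 0 < s by rewrite lt_neqAle eq_sym sn0.
by move: h1; rewrite expr2 mulrA ler_pM2r// mulrC.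
Qed.

(** Both sides are sums of the same series, with terms c_i <T (delta i), d>. *)
Lemma adj_ip c d : LLc c -> LLc d -> ipc (T c) d = ipc c (adj d).
Proof.
move=> Lc Ld; have [La _] := adj_bound Ld.
have h := @functional_csum (fun c => ipc (T c) d) (C ^+ 2 * N2c d) c.
have /h{}h : forall c c' : I -> R[i], LLc c -> LLc c' -> ipc (T (fun i => c i + c' i)) d = ipc (T c) d + ipc (T c') d.
  by move=> c1 c2 L L'; rewrite op_D// ipDl//; exact: op_LL.
have /h{}h : forall (a : R[i]) (c : I -> R[i]), LLc c -> ipc (T (fun i => a * c i)) d = a * ipc (T c) d.
  by move=> a c1 L; rewrite op_Z// ipZl//; exact: op_LL.
have /h/(_ Lc){}h : forall c : I -> R[i], LLc c -> sqn (ipc (T c) d) <= C ^+ 2 * N2c d * N2c c.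
  move=> c1 L; apply: le_trans (CS (op_LL L) Ld) _.
  by rewrite mulrAC ler_wpM2r ?N2_ge0// op_N2.
apply: has_csum_unique h _.
apply: has_csum_eq (ip_csum Lc La) => i; congr (_ * _).
by rewrite /adj -ipJ//; apply: op_LL; exact: LL_delta.
Qed.

Lemma adj_op : bounded_op C adj.
Proof.
apply: bounded_opI op_C0 _ adj_bound => a c c' Lc Lc'.
have LTd k : LLc (T (delta k)) by apply: op_LL; exact: LL_delta.
by apply/funext => k; rewrite /adj ipDl// ?ipZl//; exact: LL_Z.
Qed.

End Op.

(** * Inversion of coercive operators *)

Section LaxMilgram.
Variables (C a : R) (T : (I -> R[i]) -> (I -> R[i])).
Hypotheses (bT : bounded_op C T) (a0 : 0 < a).
Hypothesis coerc : forall c, LLc c -> a * N2c c <= complex.Re (ipc (T c) c).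

(* Fixed-point iteration for T u = c; the step a / C^2 makes 1 - (a / C^2) T a
   contraction when T >= a and |T| <= C. *)
Definition richardson c n : I -> R[i] :=
  iter n (fun u i => u i + ((a / C ^+ 2)%:C)%C * (c i - T u i)) (fun=> 0).

Let N2_delta : N2c (delta i0) = 1.
Proof.
have Ld : LLc (delta i0) by exact: LL_delta.
have := ip_deltar i0 Ld; rewrite ipff /delta eqxx => /(congr1 (@complex.Re R)).
by [].
Qed.

(** Tested on one unit vector. It yields C > 0, so that the step of the iteration makes sense, and
    it keeps the contraction factor [q] from being negative. *)
Lemma coercive_le : a <= C.
Proof.
have Ld : LLc (delta i0) by exact: LL_delta.
have := coerc Ld; have := Nm_ipl (op_LL bT Ld) Ld; have := op_Nm bT Ld.
rewrite /Nm N2_delta sqrtr1 !mulr1 => h1 h2 h3.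
exact: le_trans h3 (le_trans h2 h1).
Qed.

Let C0 : 0 < C. Proof. exact: lt_le_trans a0 coercive_le. Qed.
Let t := a / C ^+ 2.
Let q := 1 - (a / C) ^+ 2.
Let q0 : 0 <= q.
Proof.
rewrite subr_ge0 -(expr1n R 2) ler_pXn2r// ?nnegrE ?divr_ge0 ?(ltW a0) ?(ltW C0)//.
by rewrite ler_pdivrMr// mul1r coercive_le.
Qed.
Let q1 : q < 1.
Proof. by rewrite ltrBlDr ltrDl exprn_gt0// divr_gt0. Qed.
Let t0 : 0 < t. Proof. by rewrite divr_gt0// exprn_gt0. Qed.

Let G u : I -> R[i] := fun i => u i - (t%:C)%C * T u i.

Let LG u : LLc u -> LLc (G u).
Proof. by move=> Lu; apply: LL_B => //; apply: LL_Z; exact: (op_LL bT). Qed.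

Let GB u v : LLc u -> LLc v -> (fun i => G u i - G v i) = G (fun i => u i - v i).
Proof.
by move=> Lu Lv; apply/funext => i; rewrite /G (op_B bT)// mulrBr; ring.
Qed.

(** Expanding, |u - t T u|^2 <= (1 - 2 t a + t^2 C^2) |u|^2, and t = a / C^2 minimizes the factor,
    with value 1 - (a / C)^2. *)
Let GN u : LLc u -> N2c (G u) <= q * N2c u.
Proof.
move=> Lu; have LT := op_LL bT Lu.
rewrite /G N2BE//; last exact: LL_Z.
rewrite ipZr// conjc_real N2Z// sqnR ReM ReR ImR mul0r subr0 (ipJ LT Lu) ReJ.
have h1 := coerc Lu; have h2 := op_N2 bT Lu.
have e1 : t ^+ 2 * C ^+ 2 = a / C * (a / C).
  by rewrite /t; field; rewrite gt_eqF.
have e2 : t * a = a / C * (a / C) by rewrite /t; field; rewrite gt_eqF.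
rewrite /q expr2.
have h3 : t ^+ 2 * N2c (T u) <= a / C * (a / C) * N2c u.
  by rewrite -e1 -mulrA ler_wpM2l// sqr_ge0.
have h4 : a / C * (a / C) * N2c u <= t * complex.Re (ipc (T u) u).
  by rewrite -e2 -mulrA ler_wpM2l// ltW.
rewrite mulrBl mul1r; lra.
Qed.

Let richS c n : richardson c n.+1 = fun i => G (richardson c n) i + (t%:C)%C * c i.
Proof. by apply/funext => i; rewrite /G /richardson iterS -/t mulrBr; ring. Qed.

Lemma LL_richardson c n : LLc c -> LLc (richardson c n).
Proof.
move=> Lc; elim: n => [|n ih]; first exact: LL0.
by rewrite richS; apply: LL_D; [exact: LG|exact: LL_Z].
Qed.

(** The iterates n + k and n arise from the iterate k and from 0 by n applications of the same
    affine contraction. *)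
Let rich_cauchy c n k : LLc c ->
  N2c (fun i => richardson c (n + k) i - richardson c n i) <=
    q ^+ n * N2c (richardson c k).
Proof.
move=> Lc; elim: n => [|n ih].
  by rewrite add0n expr0 mul1r; under eq_fun do rewrite subr0.
have L1 := LL_richardson (n + k) Lc; have L2 := LL_richardson n Lc.
rewrite addSn !richS.
have -> : (fun i => G (richardson c (n + k)) i + (t%:C)%C * c i - (G (richardson c n) i + (t%:C)%C * c i)) =
  G (fun i => richardson c (n + k) i - richardson c n i).
  by rewrite -GB//; apply/funext => i; ring.
apply: le_trans (GN (LL_B L1 L2)) _.
by rewrite exprS -mulrA ler_wpM2l.
Qed.

Let rich_bounded c : LLc c -> exists M : R, forall k, N2c (richardson c k) <= M.
Proof.
move=> Lc; pose r := Num.sqrt q.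
have r0 : 0 <= r by exact: sqrtr_ge0.
have r1 : r < 1 by rewrite -sqrtr1 ltr_sqrt.
(* The solution of M = r M + t |c|, so that the bound reproduces itself. *)
pose M := t * Nmc c / (1 - r).
have M0 : 0 <= M.
  by rewrite /M divr_ge0 ?subr_ge0 ?(ltW r1)// mulr_ge0 ?Nm_ge0// ltW.
exists (M ^+ 2) => k; rewrite -Nm2 ler_pXn2r ?nnegrE ?Nm_ge0//.
elim: k => [|k ih].
  by rewrite /Nm /N2 /n2 integral0_eq ?sqrtr0// => x _; rewrite sqn0.
rewrite richS; have L1 := LL_richardson k Lc.
apply: le_trans (Nm_triangle (LG L1) (LL_Z _ Lc)) _.
rewrite NmZ// sqnR sqrtr_sqr ger0_norm ?(ltW t0)//.
have : Nmc (G (richardson c k)) <= r * Nmc (richardson c k).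
  by rewrite /Nm -sqrtrM// ler_sqrt ?mulr_ge0 ?N2_ge0// GN.
have : r * Nmc (richardson c k) <= r * M by rewrite ler_wpM2l.
have -> : t * Nmc c = M * (1 - r) by rewrite /M divfK// gt_eqF// subr_gt0.
lra.
Qed.

(** The convergence of the iterates is part of the conclusion because the measurability in x of the
    inverse Gram matrices is derived from it. *)
Lemma lax_milgram c : LLc c -> exists u, [/\ LLc u, T u = c &
  forall e : R, 0 < e -> exists N, forall n, (N <= n)%N ->
     Nmc (fun x => u x - richardson c n x) <= e].
Proof.
move=> Lc; have [M hM] := rich_bounded Lc.
have M0 : 0 <= M by apply: le_trans (hM 0%N); exact: N2_ge0.
have small (e : R) : 0 < e -> exists N, q ^+ N * M <= e.
  move=> e0.
  have : geometric M q @ \oo --> 0 by apply: cvg_geometric; rewrite ger0_norm.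
  move=> /cvgrPdist_le/(_ e e0)[N _ hN]; exists N.
  have := hN N (leqnn N); rewrite /= sub0r normrN mulrC.
  by apply: le_trans; exact: ler_norm.
have cau n k : (n <= k)%N -> N2c (fun i => richardson c k i - richardson c n i) <= q ^+ n * M.
  move=> nk; rewrite -(subnKC nk); apply: le_trans (rich_cauchy n (k - n) Lc) _.
  by rewrite ler_wpM2l// exprn_ge0.
have cau2 (e : R) : 0 < e -> exists N, forall n m, (N <= n)%N -> (N <= m)%N ->
     N2c (fun x => richardson c m x - richardson c n x) <= e.
  move=> e0; have [N hN] := small e e0; exists N => n m Nn Nm.
  have Q (x : nat) : (N <= x)%N -> q ^+ x * M <= e.
    by move=> Nx; apply: le_trans hN; rewrite ler_wpM2r// ler_wiXn2l// ltW.
  have [nm|mn] := leqP n m; first exact: le_trans (cau n m nm) (Q _ Nn).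
  by rewrite N2BC; exact: le_trans (cau m n (ltnW mn)) (Q _ Nm).
have [u [Lu hu]] := LL_complete (fun n => LL_richardson n Lc) cau2.
exists u; split => //.
have LTu := op_LL bT Lu.
suff h : (fun i => c i - T u i) = fun=> 0.
  by apply/funext => i; have /(congr1 (fun f => f i))/eqP := h;
     rewrite subr_eq0 => /eqP.
apply: (@N2_eq0 _ _ i0); first exact: LL_B.
rewrite -Nm2 (_ : Nmc _ = 0) ?expr0n//; apply/eqP; rewrite eq_le Nm_ge0 andbT.
rewrite -(@ler_pM2l _ t)// mulr0.
apply/ler_addgt0Pr => e e0; rewrite add0r.
have e4 : 0 < e / (4 * (1 + t * C)) by rewrite divr_gt0// mulr_gt0// addr_gt0// mulr_gt0.
have [N hN] := hu _ e4.
set v := richardson c N.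
have Lv : LLc v by exact: LL_richardson.
have LTv := op_LL bT Lv.
have Lv1 : LLc (richardson c N.+1) by exact: LL_richardson.
have h1 := hN N (leqnn N); have h2 := hN N.+1 (leqnSn N).
(* The residual of the limit u is written through the distances of u to two successive iterates;
   these are arbitrarily small, so it vanishes. *)
have E : (fun i => (t%:C)%C * (c i - T u i)) =
  (fun i => ((richardson c N.+1 i - u i) + (u i - v i)) - (t%:C)%C * T (fun i => u i - v i) i).
  rewrite (op_B bT)//; apply/funext => i; rewrite richS /G -/v; ring.
have -> : t * Nmc (fun i => c i - T u i) = Nmc (fun i => (t%:C)%C * (c i - T u i)).
  by rewrite NmZ ?sqnR ?sqrtr_sqr ?ger0_norm ?(ltW t0)//; exact: LL_B.
rewrite E.
have L1 : LLc (fun i => richardson c N.+1 i - u i) by exact: LL_B.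
have L2 : LLc (fun i => u i - v i) by exact: LL_B.
have L3 := op_LL bT L2.
have L4 : LLc (fun i => (t%:C)%C * T (fun i => u i - v i) i) by exact: LL_Z.
apply: le_trans (Nm_triangle (LL_D L1 L2) (LL_N L4)) _.
have h3 := Nm_triangle L1 L2.
have h4 : Nmc (fun i => - ((t%:C)%C * T (fun i => u i - v i) i)) <= t * (C * Nmc (fun i => u i - v i)).
  rewrite /Nm N2N -/(Nm _ _) NmZ ?sqnR ?sqrtr_sqr ?ger0_norm ?(ltW t0)//.
  by rewrite ler_pM2l// (op_Nm bT).
have h5 : Nmc (fun i => richardson c N.+1 i - u i) <= e / (4 * (1 + t * C)).
  by rewrite NmBC.
rewrite -/v in h1.
set x := e / _ in h1 h2 h5.
have h6 : t * (C * Nmc (fun i => u i - v i)) <= t * C * x.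
  by rewrite mulrA ler_pM2l// mulr_gt0.
have tC : 0 < t * C by rewrite mulr_gt0.
have xe : x * (4 * (1 + t * C)) = e by rewrite /x divfK// gt_eqF// mulr_gt0// addr_gt0.
have x0 : 0 < x by [].
nra.
Qed.

Lemma coercive_inj u v : LLc u -> LLc v -> T u = T v -> u = v.
Proof.
move=> Lu Lv E; have L := LL_B Lu Lv.
have := coerc L; rewrite (op_B bT)// E.
have -> : ipc (fun i => T v i - T v i) (fun i => u i - v i) = 0.
  by rewrite -[RHS](@cint0 _ _ _ cnt); apply: eq_cint => i; rewrite subrr mul0r.
rewrite -[complex.Re 0]/(0 : R) pmulr_rle0// => /(@N2_eq0 _ _ i0) h0.
apply/funext => i; have /(congr1 (fun f => f i))/eqP := h0 L.
by rewrite subr_eq0 => /eqP.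
Qed.

(** The norm bound comes from a |S c|^2 <= Re <c, S c> <= |c| |S c|. The solutions are collected by
    choice, and linearity follows from their uniqueness. *)
Lemma lax_inverse : exists S, bounded_op a^-1 S /\
  forall c, LLc c -> [/\ LLc (S c), S (T c) = c, T (S c) = c &
   forall e : R, 0 < e -> exists N, forall n, (N <= n)%N ->
     Nmc (fun x => S c x - richardson c n x) <= e].
Proof.
have /choice[S hS] : forall c, exists u, LLc c -> [/\ LLc u, T u = c &
  forall e : R, 0 < e -> exists N, forall n, (N <= n)%N ->
     Nmc (fun x => u x - richardson c n x) <= e].
  move=> c; have [Lc|nL] := pselect (LLc c); last by exists c.
  by have [u hu] := lax_milgram Lc; exists u.
exists S; split; last first.
  move=> c Lc; have [L1 L2 L3] := hS c Lc; split => //.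
  have [L4 L5 _] := hS _ (op_LL bT Lc).
  exact: coercive_inj.
apply: bounded_opI; first by rewrite invr_ge0 ltW.
  move=> z c c' Lc Lc'; have [L1 E1 _] := hS c Lc; have [L2 E2 _] := hS c' Lc'.
  have L : LLc (fun i => z * c i + c' i) by apply: LL_D => //; exact: LL_Z.
  have [L3 E3 _] := hS _ L; apply: coercive_inj => //.
    by apply: LL_D => //; exact: LL_Z.
  by rewrite E3 (op_lin bT)// E1 E2.
move=> c Lc; have [L1 E1 _] := hS c Lc; split => //.
have h1 := coerc L1; rewrite E1 in h1; have h2 := Nm_ipl Lc L1.
rewrite -!Nm2 -exprMn ler_pXn2r// ?nnegrE ?mulr_ge0 ?invr_ge0 ?Nm_ge0 ?(ltW a0)//.
rewrite mulrC ler_pdivlMr//.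
have := le_trans h1 h2; rewrite -Nm2 expr2 mulrA.
have := Nm_ge0 cnt (S c : disc i0 -> _); rewrite le_eqVlt => /orP[/eqP <- _|p].
  by rewrite mul0r Nm_ge0.
by rewrite ler_pM2r// mulrC.
Qed.

End LaxMilgram.

End L2ops.

(** * Spectra of self-adjoint operators *)

Section Spectrum.
Context {R : realType} {I : countType} {i0 : I}.
Implicit Types (c d u : I -> R[i]) (B K : {fset I}) (S T : (I -> R[i]) -> (I -> R[i])).
Local Notation cnt := (@cnt R I i0).
Local Notation LLc := (@LL _ (disc i0) R cnt).
Local Notation N2c := (@N2 _ (disc i0) R cnt).
Local Notation Nmc := (@Nm _ (disc i0) R cnt).
Local Notation ipc := (@ip _ (disc i0) R cnt).

Definition lbound T : set R :=
  [set m | forall c, LLc c -> m * N2c c <= complex.Re (ipc (T c) c)].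

(* The best lower bound s of a self-adjoint operator lies in its spectrum:
   T - s is a positive form, so by Cauchy-Schwarz N2 ((T - s) c) is controlled by
   the form, and a bounded inverse of T - s would allow a larger lower bound. *)
Lemma spectrum_lower (C A : R) T : bounded_op C T ->
  (forall c d, LLc c -> LLc d -> ipc (T c) d = ipc c (T d)) ->
  (forall t : R, t < A -> resolvent_set T (t%:C)%C) -> lbound T A.
Proof.
move=> bT sT res.
have Ld : LLc (delta i0) by exact: LL_delta.
have N1 : N2c (delta i0) = 1.
  have := ip_deltar i0 Ld; rewrite ipff /delta eqxx => /(congr1 (@complex.Re R)).
  by [].
have Nm1 : Nmc (delta i0) = 1 by rewrite /Nm N1 sqrtr1.
have reb c : LLc c -> `|complex.Re (ipc (T c) c)| <= C * N2c c.
  move=> Lc; apply: le_trans (Re_ip_le (op_LL bT Lc) Lc) _.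
  by rewrite -Nm2 expr2 mulrA ler_wpM2r ?Nm_ge0// (op_Nm bT).
have C0 : 0 <= C by exact: op_C0 bT.
have lb1 : lbound T (- C).
  by move=> c Lc; have := reb c Lc; rewrite ler_norml mulNr => /andP[].
have ub1 : ubound (lbound T) C.
  move=> m hm; have := hm _ Ld; have := reb _ Ld; rewrite N1 !mulr1 => h1 h2.
  exact: le_trans h2 (le_trans (ler_norm _) h1).
have hs : has_sup (lbound T) by split; [exists (- C)|exists C].
pose s := sup (lbound T).
have lbs : lbound T s.
  move=> c Lc; have [N0|N0] := eqVneq (N2c c) 0.
    by have := reb c Lc; rewrite N0 !mulr0 normr_le0 => /eqP ->.
  have Np : 0 < N2c c by rewrite lt_neqAle eq_sym N0 N2_ge0.
  rewrite -ler_pdivlMr//; apply: ge_sup; first by exists (- C).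
  by move=> m hm; rewrite ler_pdivlMr//; exact: hm.
have lble m m' : m <= m' -> lbound T m' -> lbound T m.
  by move=> mm h c Lc; apply: le_trans (h c Lc); rewrite ler_wpM2r// N2_ge0.
have [As|sA] := leP A s; first exact: lble lbs.
have [S [[D bS] hS]] := res _ sA.
pose Q c : I -> R[i] := fun i => T c i - (s%:C)%C * c i.
have LQ c : LLc c -> LLc (Q c).
  by move=> Lc; apply: LL_B; [exact: (op_LL bT)|exact: LL_Z].
pose K := C + `|s| + 1.
have K0 : 0 < K by rewrite /K ltr_wpDl// addr_ge0.
have ReQ c : LLc c -> complex.Re (ipc (Q c) c) = complex.Re (ipc (T c) c) - s * N2c c.
  move=> Lc; rewrite /Q ipBl//; last 2 first.
  - exact: (op_LL bT).
  - exact: LL_Z.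
  by rewrite ipZl// ipff ReD ReN ReM ReR ImR mul0r subr0.
have Q0 c : LLc c -> 0 <= complex.Re (ipc (Q c) c).
  by move=> Lc; rewrite ReQ// subr_ge0; exact: lbs.
have QK c : LLc c -> complex.Re (ipc (Q c) c) <= K * N2c c.
  move=> Lc; rewrite ReQ//; have := reb c Lc; rewrite ler_norml => /andP[_ h].
  have : - s * N2c c <= `|s| * N2c c.
    by rewrite ler_wpM2r ?N2_ge0// -normrN ler_norm.
  have := N2_ge0 cnt (c : disc i0 -> _); rewrite /K !mulrDl; lra.
have QB c d : LLc c -> LLc d -> Q (fun i => c i - d i) = fun i => Q c i - Q d i.
  by move=> Lc Lq; apply/funext => i; rewrite /Q (op_B bT Lc Lq); ring.
have sQ c d : LLc c -> LLc d -> ipc (Q c) d = ipc c (Q d).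
  move=> Lc Lq; have L1 := op_LL bT Lc; have L2 := op_LL bT Lq.
  rewrite /Q ipBl//; last exact: LL_Z.
  rewrite ipBr//; last exact: LL_Z.
  by rewrite ipZl// ipZr// sT// conjc_real.
(* Positivity of the form of Q at c - t Q c reads 0 <= p - 2 t n + t^2 q, with p and q the forms at
   c and at Q c and n = |Q c|^2. Since q <= K n, the choice t = 1/K leaves t n <= p. *)
have key c : LLc c -> N2c (Q c) <= K * complex.Re (ipc (Q c) c).
  move=> Lc; have L1 := LQ c Lc; have L2 := LQ _ L1.
  pose t := K^-1.
  have Lt : LLc (fun i => (t%:C)%C * Q c i) by exact: LL_Z.
  have QZ : Q (fun i => (t%:C)%C * Q c i) = fun i => (t%:C)%C * Q (Q c) i.
    by apply/funext => i; rewrite /Q (op_Z bT _ L1); ring.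
  have := Q0 _ (LL_B Lc Lt); rewrite QB// QZ.
  rewrite ipBl//; last 2 first.
  - exact: LL_Z.
  - exact: LL_B.
  rewrite !ipBr//; last exact: LL_Z.
  rewrite !ipZl// !ipZr// (sQ (Q c) c)// ipff conjc_real.
  have := QK _ L1.
  have e1 : K * t = 1 by rewrite /t divff// gt_eqF.
  have t0 : 0 < t by rewrite invr_gt0.
  move: (ipc (Q (Q c)) (Q c)) (ipc (Q c) c) (N2c (Q c)) => q' p' n.
  rewrite !cplxE !ReR ?ImR !(mulr0, mul0r, subr0, addr0).
  move: (complex.Re q') (complex.Re p') => q p h1 h2.
  have h3 : t * (t * q) <= t * n.
    rewrite ler_pM2l//; have : t * q <= t * (K * n) by rewrite ler_pM2l.
    by rewrite mulrA [t * K]mulrC e1 mul1r.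
  have : t * n <= p by lra.
  by move=> h4; have := ler_wpM2l (ltW K0) h4; rewrite mulrA e1 mul1r.
(* An inverse of T - s with bound D gives |c|^2 <= D^2 |Q c|^2 <= D^2 K Re <Q c, c>. The form of Q
   is then at least e |c|^2, against the maximality of s; |D| + 1 keeps the denominator positive. *)
pose e := (K * (`|D| + 1) ^+ 2)^-1.
have e0 : 0 < e by rewrite invr_gt0 mulr_gt0// exprn_gt0// ltr_wpDl.
suff : lbound T (s + e).
  move=> h; have := ub_le_sup (proj2 hs) h; rewrite -/s; lra.
move=> c Lc; rewrite mulrDl -lerBrDl -ReQ// /e mulrC ler_pdivrMr; last first.
  by rewrite mulr_gt0// exprn_gt0// ltr_wpDl.
have [SQ _] := hS c (iffRL (l2_LL c) Lc).
have : N2c c <= D ^+ 2 * N2c (Q c) by rewrite -{1}SQ (op_N2 bS)//; exact: LQ.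
have k1 := key c Lc.
have D1 : D ^+ 2 <= (`|D| + 1) ^+ 2.
  by rewrite -real_normK ?num_real// ler_pXn2r ?nnegrE ?addr_ge0// lerDl.
move=> k2; apply: le_trans k2 _.
apply: (@le_trans _ _ ((`|D| + 1) ^+ 2 * N2c (Q c))).
  by rewrite ler_wpM2r// N2_ge0.
rewrite mulrA [leRHS]mulrC ler_wpM2l ?sqr_ge0//.
by rewrite (le_trans k1)// mulrC.
Qed.

Lemma bounded_opN (C : R) T : bounded_op C T -> bounded_op C (fun c i => - T c i).
Proof.
move=> bT; apply: (@bounded_opI _ _ i0); first exact: op_C0 bT.
  by move=> a c c' Lc Lc'; rewrite (op_lin bT a Lc Lc'); apply/funext => i; ring.
move=> c Lc; rewrite N2N; split; first by apply: LL_N; exact: (op_LL bT).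
exact: (op_N2 bT).
Qed.

(** The upper bound is the lower bound for -T, whose resolvent set is the reflected one. *)
Lemma spectrum_bounds (C A B : R) T : bounded_op C T ->
  (forall c d, LLc c -> LLc d -> ipc (T c) d = ipc c (T d)) ->
  spectrum T `<=` [set (r%:C)%C | r in `[A, B]] ->
  forall c, LLc c -> A * N2c c <= complex.Re (ipc (T c) c) <= B * N2c c.
Proof.
move=> bT sT sp.
have res (t : R) : t \notin `[A, B] -> resolvent_set T (t%:C)%C.
  move=> tAB; apply: contrapT => /sp[r rAB [rt]].
  by move: tAB; rewrite -rt rAB.
have h1 : lbound T A.
  apply: (spectrum_lower bT sT) => t tA; apply: res.
  by rewrite in_itv/= negb_and -ltNge tA.
have h2 : lbound (fun c i => - T c i) (- B).
  apply: (spectrum_lower (bounded_opN bT)).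
    move=> c d Lc Lq; rewrite ipNl// ?sT//; last exact: (op_LL bT).
    rewrite [RHS](ipJ _ Lc); last by apply: LL_N; exact: (op_LL bT).
    rewrite ipNl//; last exact: (op_LL bT).
    by rewrite conjcN -(ipJ _ Lc)//; exact: (op_LL bT).
  move=> t tB; have [|S [[D bS] hS]] := res (- t).
    by rewrite in_itv/= negb_and -!ltNge orbC ltrNr tB.
  (* The inverse of -T - t is c -> S (-c), with S the inverse of T + t. *)
  exists (fun c => S (fun i => - c i)); split.
    exists D; apply: (@bounded_opI _ _ i0); first exact: op_C0 bS.
      move=> a c c' Lc Lc'.
      rewrite -(op_lin bS a (LL_N Lc) (LL_N Lc')).
      by congr S; apply/funext => i; ring.
    move=> c Lc; split; first by apply: (op_LL bS); exact: LL_N.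
    by apply: le_trans (op_N2 bS (LL_N Lc)) _; rewrite N2N.
  move=> c lc; have Lc : LLc c by exact/l2_LL.
  have [e1 _] := hS c lc.
  have [_ e2] := hS _ (iffRL (l2_LL _) (LL_N Lc)); split.
    rewrite -[RHS]e1; congr S; apply/funext => i.
    by rewrite (_ : ((- t)%:C)%C = - (t%:C)%C) ?rmorphN//; ring.
  apply/funext => i; have /(congr1 (fun f => f i)) := e2.
  rewrite (_ : ((- t)%:C)%C = - (t%:C)%C) ?rmorphN//.
  by move=> e3; rewrite -[RHS]opprK -e3; ring.
move=> c Lc; apply/andP; split; first exact: h1.
have := h2 c Lc; rewrite ipNl//; last exact: (op_LL bT).
by rewrite ReN mulNr lerN2.
Qed.

(** For z off the interval a complex factor w makes w (T - z) coercive: w = i y if z has imaginary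
    part y different from 0, and w = 1 or w = -1 if z is real and lies to the left or to the right
    of [A, B]. The inverse then comes from [lax_inverse]. *)
Lemma numrange_spectrum (C A B : R) T : bounded_op C T -> 
  (forall c, LLc c -> A * N2c c <= complex.Re (ipc (T c) c) <= B * N2c c) ->
  (forall c, LLc c -> complex.Im (ipc (T c) c) = 0) ->
  spectrum T `<=` [set (r%:C)%C | r in `[A, B]].
Proof.
move=> bT hT iT z; apply: contra_notP => nz.
have [w [a [a0 hw]]] : exists (w : R[i]) (a : R), 0 < a /\
    forall n p : R, 0 <= n -> A * n <= p <= B * n ->
     a * n <= complex.Re (w * ((p%:C)%C - z * (n%:C)%C)).
  case: z nz => x y nz.
  have [y0|y0] := eqVneq y 0; last first.
    exists (0 +i* y)%C, (y ^+ 2); split; first by rewrite exprn_even_gt0.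
    by move=> n p n0 _; rewrite /= le_eqVlt; apply/orP; left; apply/eqP; ring.
  have [xA|Ax] := ltP x A.
    exists 1, (A - x); split; first by rewrite subr_gt0.
    move=> n p n0 /andP[h1 h2]; rewrite mul1r ReD ReN ReM !ReR !ImR /= mulr0 subr0.
    by rewrite mulrBl lerD2r.
  have [Bx|xB] := ltP B x.
    exists (-1), (x - B); split; first by rewrite subr_gt0.
    move=> n p n0 /andP[h1 h2]; rewrite mulN1r ReN ReD ReN ReM !ReR !ImR /= mulr0 subr0.
    by rewrite mulrBl opprB lerD2l lerN2.
  by exfalso; apply: nz; exists x; rewrite /= ?in_itv/= ?Ax ?xB// y0.
pose T' c : I -> R[i] := fun i => w * (T c i - z * c i).
have LT' c : LLc c -> LLc (T' c).
  by move=> Lc; apply: LL_Z; apply: LL_B; [exact: (op_LL bT)|exact: LL_Z].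
(* A unit vector shows A <= B, so n = 1, p = A is admissible in [hw]; with w = 0 it would give a <=
   0. *)
have w0 : w != 0.
  apply/eqP => w0; have := hw 1 A ler01; rewrite w0 !mul0r !mulr1 lexx/=.
  have AB : A <= B.
    have Ld : LLc (delta i0) by exact: LL_delta.
    have := hT _ Ld; have := ip_deltar i0 Ld.
    rewrite ipff /delta eqxx => /(congr1 (@complex.Re R)) /= ->.
    by rewrite !mulr1 => /andP[]; exact: le_trans.
  by move=> /(_ AB); rewrite leNgt a0.
pose C' := Num.sqrt (sqn w) * (C + Num.sqrt (sqn z)).
have bT' : bounded_op C' T'.
  apply: (@bounded_opI _ _ i0).
  - by rewrite mulr_ge0 ?addr_ge0 ?sqrtr_ge0//; exact: op_C0 bT.
  - by move=> b c c' Lc Lc'; rewrite /T' (op_lin bT b Lc Lc'); apply/funext => i; ring.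
  move=> c Lc; split; first exact: LT'.
  have L1 := op_LL bT Lc; have L2 := LL_Z z Lc.
  rewrite -!Nm2 -exprMn ler_pXn2r ?nnegrE ?mulr_ge0 ?addr_ge0 ?Nm_ge0 ?sqrtr_ge0//; last exact: op_C0 bT.
  rewrite /T' NmZ; last exact: LL_B.
  rewrite -mulrA ler_wpM2l ?sqrtr_ge0//.
  apply: le_trans (Nm_triangle L1 (LL_N L2)) _.
  rewrite mulrDl; apply: lerD; first exact: (op_Nm bT).
  by rewrite {1}/Nm N2N -/(Nm _ _) NmZ.
have coT' c : LLc c -> a * N2c c <= complex.Re (ipc (T' c) c).
  move=> Lc; have L1 := op_LL bT Lc; have L2 := LL_Z z Lc.
  rewrite /T' ipZl//; last exact: LL_B.
  rewrite ipBl// ipZl// ipff.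
  have -> : ipc (T c) c = ((complex.Re (ipc (T c) c))%:C)%C.
    by apply: cplxP => //; rewrite iT.
  by apply: hw; [exact: N2_ge0|exact: hT].
have [S [bS hS]] := lax_inverse bT' a0 coT'.
exists (fun c => S (fun i => w * c i)); split.
  exists (a^-1 * Num.sqrt (sqn w)); apply: (@bounded_opI _ _ i0).
  - by rewrite mulr_ge0 ?invr_ge0 ?sqrtr_ge0// ltW.
  - move=> b c c' Lc Lc'; rewrite -(op_lin bS b (LL_Z w Lc) (LL_Z w Lc')).
    by congr S; apply/funext => i; ring.
  move=> c Lc; have L := LL_Z w Lc; split; first exact: (op_LL bS).
  apply: le_trans (op_N2 bS L) _.
  by rewrite N2Z// exprMn sqr_sqrtr ?sqn_ge0// mulrA.
move=> c /(@l2_LL R I i0) Lc; have [_ e1 _ _] := hS c Lc; split; first exact: e1.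
have [_ _ e2 _] := hS _ (LL_Z w Lc).
apply/funext => i; have /(congr1 (fun f => f i)) := e2.
by rewrite /T' => /(mulfI w0).
Qed.

End Spectrum.

(** * Infinite matrices *)

Section RealAux.
Variable R : realType.

Lemma abs_le_trans (p q M e : R) : `|p - q| <= e -> q <= M -> p <= M + e.
Proof. by rewrite ler_norml => /andP[_]; lra. Qed.

Lemma perturbed_lower (a b nc nt x nd tt tc td e : R) : 0 <= a -> 0 <= b -> 0 <= x ->
  nc <= nt + nd -> nd <= x -> a * nt <= tt -> tt <= tc + td -> td <= b * nd ->
  x * (a + b + 1) = e -> a * nc <= tc + e.
Proof.
move=> a0 b0 x0 h1 h2 h3 h4 h5 <-.
have h6 : a * nc <= a * (nt + x) by rewrite ler_wpM2l//; lra.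
have h7 : b * nd <= b * x by rewrite ler_wpM2l.
nra.
Qed.

End RealAux.

Section Matrices.
Context {R : realType} {I : countType} {i0 : I}.
Implicit Types (c d u : I -> R[i]) (K : {fset I}) (M : I -> I -> R[i]) (A B C : R).
Local Notation cnt := (@cnt R I i0).
Local Notation LLc := (@LL _ (disc i0) R cnt).
Local Notation N2c := (@N2 _ (disc i0) R cnt).
Local Notation Nmc := (@Nm _ (disc i0) R cnt).
Local Notation ipc := (@ip _ (disc i0) R cnt).
Local Notation adjc := (@adj R I i0).

Definition fin_norm M K c : \bar R :=
  (\esum_(j in setT) (sqn (\sum_(k <- K) M j k * c k))%:E)%E.
Definition fin_upper B M := forall K c,
  (fin_norm M K c <= (B * \sum_(k <- K) sqn (c k))%:E)%E.
Definition fin_lower A M := forall K c,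
  ((A * \sum_(k <- K) sqn (c k))%:E <= fin_norm M K c)%E.

Lemma mx_op_trunc M K c : mx_op M (trunc c K) = fun j => \sum_(k <- K) M j k * c k.
Proof.
apply/funext => j; apply: csum_eq.
rewrite (_ : \sum_(k <- K) _ = \sum_(k <- K) M j k * trunc c K k).
  by apply: has_csum_fin => i; rewrite /trunc => /negbTE ->; rewrite mulr0.
by rewrite big_seq [RHS]big_seq; apply: eq_bigr => k kK; rewrite /trunc kK.
Qed.

Lemma fin_normE M K c : fin_norm M K c = n2 cnt (mx_op M (trunc c K)).
Proof. by rewrite n2_esum mx_op_trunc. Qed.

Lemma mx_op_delta M k : mx_op M (delta k) = M ^~ k.
Proof.
rewrite (_ : delta k = trunc (fun=> 1) [fset k]%fset); last first.
  by rewrite trunc_sum; apply/funext => j; rewrite big_seq_fset1 mul1r.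
by rewrite mx_op_trunc; apply/funext => j; rewrite big_seq_fset1 mulr1.
Qed.

Lemma bounded_fin_upper C M : bounded_mx C M -> fin_upper (C ^+ 2) M.
Proof.
move=> [_ bT] K c; rewrite fin_normE.
have [L h] := bounded_opP bT (@LL_trunc R I i0 c K).
rewrite LL_fin// lee_fin; apply: le_trans h _.
by have [_ ->] := @N2_trunc R I i0 c K.
Qed.

(** Tested on the conjugate of the row itself, cut to K: the j-th coordinate of the image is the
    partial sum s of the squares, so s^2 <= B s. *)
Lemma row_bound B M j : 0 <= B -> fin_upper B M ->
  LLc (fun k => conjc (M j k)).
Proof.
move=> B0 hB; apply: (proj1 (@LL_cnt_bound R I i0 _ B _)) => K.
set s := \sum_(i <- K) _.
have := hB K (fun k => conjc (M j k)) => /(le_trans _).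
move=> /(_ (sqn (\sum_(k <- K) M j k * conjc (M j k)))%:E).
rewrite lee_fin; have -> : \sum_(k <- K) M j k * conjc (M j k) = (s%:C)%C.
  by rewrite /s RC_sum; apply: eq_bigr => k _; rewrite mulcJ sqnJ.
rewrite sqnR -/s => h.
have : s ^+ 2 <= B * s.
  apply: h; have := @fset_le_esum R I (fun j' => (sqn (\sum_(k <- K) M j' k * conjc (M j k)))%:E) [fset j]%fset.
  rewrite big_seq_fset1 (_ : \sum_(k <- K) M j k * conjc (M j k) = (s%:C)%C) ?sqnR.
    by apply => i; rewrite lee_fin sqn_ge0.
  by rewrite /s RC_sum; apply: eq_bigr => k _; rewrite mulcJ sqnJ.
have s0 : 0 <= s by apply: sumr_ge0 => i _; exact: sqn_ge0.
have [->|sn0] := eqVneq s 0; first by [].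
have sp : 0 < s by rewrite lt_neqAle eq_sym sn0.
by rewrite expr2 ler_pM2r.
Qed.

Section Bounded.
Variables (B : R) (M : I -> I -> R[i]).
Hypotheses (B0 : 0 <= B) (hB : fin_upper B M).
Let row j : I -> R[i] := fun k => conjc (M j k).
Let Lrow j : LLc (row j). Proof. exact: row_bound hB. Qed.

Lemma fin_csum c j : LLc c -> has_csum (fun k => M j k * c k) (ipc c (row j)).
Proof.
move=> Lc; apply: has_csum_eq (ip_csum Lc (Lrow j)) => k.
by rewrite /row conjcK mulrC.
Qed.

Lemma fin_mx_op c : LLc c -> mx_op M c = fun j => ipc c (row j).
Proof. by move=> Lc; apply/funext => j; apply: csum_eq; exact: fin_csum. Qed.

(** Only finitely many coordinates of M c are estimated at a time. They depend continuously on c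
    because the rows lie in l2, so the bound passes from truncations to c. *)
Lemma fin_upper_N2 c : LLc c -> LLc (mx_op M c) /\ N2c (mx_op M c) <= B * N2c c.
Proof.
move=> Lc; apply: LL_cnt_bound => J; rewrite fin_mx_op//.
apply/ler_addgt0Pr => e e0.
have [d d0 hd] := sum_ip_cont J Lc Lrow e0.
have [A hA] := trunc_approxN Lc d0.
have := hd _ (LL_trunc c A) (hA A (fsubset_refl A)).
have := hB A c; rewrite fin_normE => h.
have h2 : \sum_(i <- J) sqn (ipc (trunc c A) (row i)) <= B * N2c c.
  rewrite -lee_fin; apply: le_trans (le_trans h _); last first.
    by rewrite lee_fin ler_wpM2l// sum_sqn_le.
  rewrite n2_esum -sumEFin.
  have E j : ipc (trunc c A) (row j) = mx_op M (trunc c A) j.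
    by rewrite (fin_mx_op (@LL_trunc R I i0 c A)).
  under eq_bigr do rewrite E.
  by apply: fset_le_esum => i; rewrite lee_fin sqn_ge0.
by move=> h3; exact: abs_le_trans h3 h2.
Qed.

Lemma fin_upper_bounded : bounded_mx (Num.sqrt B) M.
Proof.
split.
  move=> c /(@l2_LL R I i0) Lc j.
  by exists (ipc c (row j)); exact: fin_csum.
apply: (@bounded_opI _ _ i0); first exact: sqrtr_ge0.
  move=> a c c' Lc Lc'; rewrite !fin_mx_op//; last first.
    by apply: LL_D => //; exact: LL_Z.
  by apply/funext => j; rewrite ipDl ?ipZl//; exact: LL_Z.
by move=> c Lc; rewrite sqr_sqrtr//; exact: fin_upper_N2.
Qed.

Lemma fin_lower_N2 A c : 0 <= A -> fin_lower A M -> LLc c ->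
  A * N2c c <= N2c (mx_op M c).
Proof.
move=> A0 hA Lc; have bT := (proj2 fin_upper_bounded).
rewrite -!Nm2 -(sqr_sqrtr A0) -exprMn ler_pXn2r ?nnegrE ?mulr_ge0 ?sqrtr_ge0 ?Nm_ge0//.
apply/ler_addgt0Pr => e e0.
pose x := e / (Num.sqrt A + Num.sqrt B + 1).
have s0 : 0 < Num.sqrt A + Num.sqrt B + 1 by rewrite ltr_wpDl// addr_ge0 ?sqrtr_ge0.
have x0 : 0 < x by rewrite divr_gt0.
have [K hK] := trunc_approxN Lc x0.
have h0 := hK K (fsubset_refl K).
have Lt : LLc (trunc c K) by exact: LL_trunc.
have h1 : Num.sqrt A * Nmc (trunc c K) <= Nmc (mx_op M (trunc c K)).
  rewrite -(@ler_pXn2r _ 2) ?nnegrE ?mulr_ge0 ?sqrtr_ge0 ?Nm_ge0//.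
  rewrite exprMn !Nm2 sqr_sqrtr// -lee_fin -LL_fin; last exact: (op_LL bT).
  rewrite -fin_normE; apply: le_trans (hA K c); rewrite lee_fin.
  by have [_ ->] := @N2_trunc R I i0 c K.
have h2 := Nm_le_D Lc Lt.
have LD := LL_B Lc Lt.
have h3 := op_Nm bT LD.
have h4 : Nmc (mx_op M (trunc c K)) <= Nmc (mx_op M c) + Nmc (mx_op M (fun j => c j - trunc c K j)).
  rewrite (op_B bT Lc Lt); have := Nm_le_D (op_LL bT Lt) (op_LL bT Lc).
  by rewrite (NmBC _ (mx_op M (trunc c K) : disc i0 -> _)).
have xe : x * (Num.sqrt A + Num.sqrt B + 1) = e by rewrite /x divfK// gt_eqF.
exact: (perturbed_lower (sqrtr_ge0 A) (sqrtr_ge0 B) (ltW x0) h2 h0 h1 h4 h3 xe).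
Qed.

End Bounded.

Definition gram M : I -> I -> R[i] := fun k l =>
  csum (fun j => conjc (M j k) * M j l).

Lemma gramE M k l : (forall k, LLc (M ^~ k)) ->
  gram M k l = ipc (M ^~ l) (M ^~ k).
Proof.
move=> LM; apply: csum_eq.
by apply: has_csum_eq (ip_csum (LM l) (LM k)) => j; rewrite mulrC.
Qed.

Lemma bounded_col C M : bounded_mx C M -> forall k, LLc (M ^~ k).
Proof.
move=> [_ bT] k; rewrite -mx_op_delta; apply: (op_LL bT); exact: LL_delta.
Qed.

(** As a functional of c, the k-th coordinate of the adjoint of M applied to M c is bounded, and its
    value at [delta l] is [gram M k l]. This replaces an exchange of two infinite sums. *)
Lemma gram_csum C M c k : bounded_mx C M -> LLc c ->
  has_csum (fun l => gram M k l * c l) (adjc (mx_op M) (mx_op M c) k).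
Proof.
move=> bM Lc; have LM := bounded_col bM; have [_ bT] := bM.
have bA := adj_op (i0 := i0) bT.
have := @functional_csum R I i0 (fun c => adjc (mx_op M) (mx_op M c) k) (C ^+ 2 * C ^+ 2) c.
move=> h.
have /h{}h : forall c c' : I -> R[i], LLc c -> LLc c' ->
   adjc (mx_op M) (mx_op M (fun i => c i + c' i)) k =
   adjc (mx_op M) (mx_op M c) k + adjc (mx_op M) (mx_op M c') k.
  move=> c1 c2 L1 L2; rewrite (op_D bT L1 L2).
  by rewrite (op_D bA (op_LL bT L1) (op_LL bT L2)).
have /h{}h : forall (a : R[i]) (c : I -> R[i]), LLc c ->
   adjc (mx_op M) (mx_op M (fun i => a * c i)) k =
   a * adjc (mx_op M) (mx_op M c) k.
  move=> a c1 L1; rewrite (op_Z bT a L1).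
  by rewrite (op_Z bA a (op_LL bT L1)).
have /h/(_ Lc){}h : forall c : I -> R[i], LLc c ->
   sqn (adjc (mx_op M) (mx_op M c) k) <= C ^+ 2 * C ^+ 2 * N2c c.
  move=> c1 L1; have L2 := op_LL bT L1.
  apply: le_trans (sqn_le_N2 k (op_LL bA L2)) _.
  apply: le_trans (op_N2 bA L2) _.
  by rewrite -mulrA ler_wpM2l ?sqr_ge0// (op_N2 bT).
apply: has_csum_eq h => l.
by rewrite mulrC (gramE k l LM) /adj !mx_op_delta.
Qed.

Lemma gram_op C M c : bounded_mx C M -> LLc c ->
  mx_op (gram M) c = adjc (mx_op M) (mx_op M c).
Proof.
by move=> bM Lc; apply/funext => k; apply: csum_eq; exact: gram_csum bM Lc.
Qed.

Lemma gram_bounded C M : bounded_mx C M -> bounded_mx (C ^+ 2) (gram M).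
Proof.
move=> bM; have [_ bT] := bM; have bA := adj_op (i0 := i0) bT; split.
  move=> c /(@l2_LL R I i0) Lc k.
  by exists (adjc (mx_op M) (mx_op M c) k); exact: gram_csum bM Lc.
apply: (@bounded_opI _ _ i0); first exact: sqr_ge0.
  move=> a c c' Lc Lc'; rewrite !(gram_op bM)//; last first.
    by apply: LL_D => //; exact: LL_Z.
  by rewrite (op_lin bT a Lc Lc') (op_lin bA a (op_LL bT Lc) (op_LL bT Lc')).
move=> c Lc; rewrite (gram_op bM Lc); have L := op_LL bT Lc.
split; first exact: (op_LL bA).
apply: le_trans (op_N2 bA L) _.
by rewrite [C ^+ 2 ^+ 2]expr2 -mulrA ler_wpM2l ?sqr_ge0// (op_N2 bT).
Qed.

Lemma gram_form C M c d : bounded_mx C M -> LLc c -> LLc d ->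
  ipc (mx_op (gram M) c) d = ipc (mx_op M c) (mx_op M d).
Proof.
move=> bM Lc Lq; have [_ bT] := bM; rewrite (gram_op bM Lc).
have LT := op_LL bT Lc.
rewrite (ipJ Lq); last exact: (op_LL (adj_op bT)).
by rewrite -(adj_ip bT Lq LT) -(ipJ (op_LL bT Lq) LT).
Qed.

(** M itself is not known to be bounded here: its columns lie in l2 and its Gram matrix is bounded.
    Therefore |M c|^2 is compared with the form of the Gram matrix by expanding both over finitely
    supported c. The Gram matrix is Hermitian and bounded, hence self-adjoint, and its spectrum
    controls its form. *)
Lemma gram_spectrum_fin C A B M : (forall k, LLc (M ^~ k)) ->
  bounded_mx C (gram M) ->
  spectrum (mx_op (gram M)) `<=` [set (r%:C)%C | r in `[A, B]] ->
  fin_upper B M /\ fin_lower A M.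
Proof.
move=> LM [cs bT] sp.
have herm k l : gram M k l = conjc (gram M l k).
  by rewrite !gramE// -ipJ.
have Ld k : LLc (delta k) by exact: LL_delta.
have selfadj c d : LLc c -> LLc d ->
    ipc (mx_op (gram M) c) d = ipc c (mx_op (gram M) d).
  move=> Lc Lq; rewrite (adj_ip bT Lc Lq); congr ip; apply/funext => k.
  rewrite -[RHS]/(csum _) [RHS](@csum_eq _ _ _ (adjc (mx_op (gram M)) d k))//.
  have LTd := op_LL bT (Ld k).
  apply: has_csum_eq (ip_csum Lq LTd) => l.
  by rewrite mx_op_delta -herm mulrC.
have bds := spectrum_bounds bT selfadj sp.
have fin K c : fin_norm M K c = (complex.Re (ipc (mx_op (gram M) (trunc c K)) (trunc c K)))%:E.
  rewrite fin_normE mx_op_trunc.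
  have LS : LLc (fun j => \sum_(k <- K) M j k * c k).
    by apply: LL_sum => k; under eq_fun do rewrite mulrC; exact: LL_Z.
  rewrite LL_fin//; congr EFin.
  rewrite -[LHS]/(complex.Re ((N2c (fun j => \sum_(k <- K) M j k * c k))%:C)%C).
  rewrite -ipff; congr complex.Re.
  have LMZ k : LLc (fun j => M j k * c k) by under eq_fun do rewrite mulrC; exact: LL_Z.
  rewrite ip_sumr//.
  have LT : LLc (mx_op (gram M) (trunc c K)) by apply: (op_LL bT); exact: LL_trunc.
  rewrite [X in _ = ip _ _ X]trunc_sum ip_sumr//; last by move=> k; exact: LL_Z.
  apply: eq_bigr => k _.
  under [X in ip _ _ X]eq_fun do rewrite mulrC.
  rewrite !ipZr// ip_deltar//; congr (_ * _).
  rewrite mx_op_trunc ip_suml//; apply: eq_bigr => l _.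
  under [X in ip _ X _]eq_fun do rewrite mulrC.
  by rewrite ipZl// gramE// mulrC.
split=> K c; rewrite fin lee_fin; have [_ <-] := @N2_trunc R I i0 c K.
  by have /andP[] := bds _ (LL_trunc c K).
by have /andP[] := bds _ (LL_trunc c K).
Qed.

Lemma fin_gram_spectrum A B M : 0 <= A -> 0 <= B -> fin_upper B M -> fin_lower A M ->
  spectrum (mx_op (gram M)) `<=` [set (r%:C)%C | r in `[A, B]].
Proof.
move=> A0 B0 hB hA; have bM := fin_upper_bounded B0 hB.
have [_ bT] := gram_bounded bM.
apply: (@numrange_spectrum _ _ i0 _ _ _ _ bT) => c Lc.
  rewrite (gram_form bM Lc Lc) ipff ReR.
  by rewrite (fin_lower_N2 B0 hB A0 hA Lc); have [_ ->] := fin_upper_N2 B0 hB Lc.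
by rewrite (gram_form bM Lc Lc) ipff ImR.
Qed.

End Matrices.

(** * Lebesgue measure on R^d *)

Section Lebesgue.
Context {R : realType}.
Local Notation mu1 := (@lebesgue_measure R).

(** The translated measure agrees with Lebesgue measure on half-open intervals, hence everywhere by
    uniqueness. *)
Lemma integral_shift1 (a : R) (f : measurableTypeR R -> \bar R) :
  measurable_fun setT f -> (forall x, (0 <= f x)%E) ->
  (\int[mu1]_x f (x + a)%R = \int[mu1]_x f x)%E.
Proof.
move=> mf f0; pose phi : measurableTypeR R -> measurableTypeR R := fun x => x + a.
have mphi : measurable_fun setT phi by apply: measurable_funD => //; exact: measurable_cst.
transitivity (\int[pushforward mu1 phi]_x f x)%E.
  by rewrite ge0_integral_pushforward// preimage_setT.
apply: eq_measure_integral => A mA _; apply/esym.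
apply: (@lebesgue_measure_unique R
  (@measure_function_pushforward__canonical__measure_function_Measure _ _ _ _ _ mu1 phi mphi)) => //.
move=> _ [[u v]] _ <-; rewrite /= /pushforward.
rewrite (_ : phi @^-1` _ = `]u - a, v - a]%classic); last first.
  by apply/seteqP; split => x /=; rewrite /phi !in_itv/= ltrBlDr lerBrDr.
by rewrite !lebesgue_measure_itv/= !lte_fin ltrD2r -!EFinB opprB addrA subrK.
Qed.

(** [lebesgue R d.+1] is by definition the image of a product measure under this map, so integrals
    over R^d can be iterated and treated by induction on d. *)
Definition consd d (p : measurableTypeR R * Rd R d) : Rd R d.+1 := cons_tuple p.1 p.2.

Lemma measurable_consd d : measurable_fun setT (@consd d).
Proof. by apply: measurable_cons. Qed.

Lemma measurable_consd1 d (t : Rd R d) : measurable_fun setT (fun x : measurableTypeR R => consd (x, t)).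
Proof.
apply: (measurableT_comp (@measurable_consd d)).
by apply: measurable_fun_pair => //; exact: measurable_cst.
Qed.

Lemma integral_consE d (f : Rd R d.+1 -> \bar R) :
  (\int[lebesgue R d.+1]_x f x =
   \int[pushforward (@lebesgue_measure R \x lebesgue R d) (@consd d)]_x f x)%E.
Proof. by []. Qed.

Lemma integral_cons12 d (f : Rd R d.+1 -> \bar R) :
  measurable_fun setT f -> (forall x, (0 <= f x)%E) ->
  (\int[lebesgue R d.+1]_x f x =
   \int[mu1]_x \int[lebesgue R d]_t f (consd (x, t)))%E.
Proof.
move=> mf f0; rewrite integral_consE ge0_integral_pushforward//; last first.
  exact: measurable_consd.
rewrite preimage_setT fubini_tonelli1//; last by move=> p; exact: f0.
exact: measurableT_comp mf (@measurable_consd d).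
Qed.

Lemma integral_cons21 d (f : Rd R d.+1 -> \bar R) :
  measurable_fun setT f -> (forall x, (0 <= f x)%E) ->
  (\int[lebesgue R d.+1]_x f x =
   \int[lebesgue R d]_t \int[mu1]_x f (consd (x, t)))%E.
Proof.
move=> mf f0; rewrite integral_cons12//.
rewrite (@fubini_tonelli _ _ _ _ _ mu1 (lebesgue R d) (fun p => f (consd p)))//.
exact: measurableT_comp mf (@measurable_consd d).
Qed.

Definition tadd d (x a : Rd R d) : Rd R d := [tuple tnth x i + tnth a i | i < d].

Lemma tnth_tadd d (x a : Rd R d) i : tnth (tadd x a) i = tnth x i + tnth a i.
Proof. by rewrite tnth_mktuple. Qed.

Lemma taddA d (x a b : Rd R d) : tadd (tadd x a) b = tadd x (tadd a b).
Proof. by apply: eq_from_tnth => i; rewrite !tnth_tadd addrA. Qed.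

Lemma measurable_tadd d (a : Rd R d) : measurable_fun setT (fun x => tadd x a).
Proof.
apply/measurable_fun_tnthP => i.
rewrite (_ : _ \o _ = fun x : Rd R d => tnth x i + tnth a i); last first.
  by apply/funext => x /=; rewrite tnth_tadd.
by apply: measurable_funD; [exact: measurable_tnth|exact: measurable_cst].
Qed.

Lemma tadd_cons d (x a : R) (t b : Rd R d) :
  tadd (consd (x, t)) (consd (a, b)) = consd (x + a, tadd t b).
Proof.
apply: eq_from_tnth => i; rewrite tnth_tadd.
case: (unliftP ord0 i) => [j|] ->; last by rewrite !tnth0.
by rewrite !tnthS tnth_tadd.
Qed.

Lemma consd_eta d (a : Rd R d.+1) : a = consd (thead a, [tuple of behead a]).
Proof. by rewrite [LHS]tuple_eta; apply/val_inj. Qed.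

Lemma integral_shift d (a : Rd R d) (f : Rd R d -> \bar R) :
  measurable_fun setT f -> (forall x, (0 <= f x)%E) ->
  (\int[lebesgue R d]_x f (tadd x a) = \int[lebesgue R d]_x f x)%E.
Proof.
elim: d a f => [|d ih] a f mf f0.
  by apply: eq_integral => x _; congr f; apply: eq_from_tnth => -[].
have mf' : measurable_fun setT (fun x => f (tadd x a)).
  exact: measurableT_comp mf (measurable_tadd a).
rewrite !integral_cons21// (consd_eta a).
set b := [tuple of behead a]; set a0 := thead a.
pose F t := (\int[mu1]_x f (consd (x, t)))%E.
have -> : (\int[lebesgue R d]_t F t = \int[lebesgue R d]_t F (tadd t b))%E.
  rewrite ih//; last by move=> x; exact: integral_ge0.
  apply: (@measurable_fun_fubini_tonelli_G _ _ _ _ _ mu1 (fun p => f (consd p))) => //.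
  exact: measurableT_comp mf (@measurable_consd d).
apply: eq_integral => t _; rewrite /F.
rewrite -(@integral_shift1 a0 (fun x => f (consd (x, tadd t b))))//; last first.
  exact: measurableT_comp mf (measurable_consd1 _).
by apply: eq_integral => x _; rewrite tadd_cons.
Qed.

Definition cube d (s : R) : set (Rd R d) := [set x | forall i, 0 <= tnth x i < s].
Arguments cube d s : clear implicits.

Lemma measurable_cube d s : measurable (cube d s).
Proof.
rewrite (_ : cube d s = \bigcap_i ((fun x : Rd R d => tnth x i) @^-1` `[0, s[%classic)); last first.
  apply/seteqP; split => x /= h.
    by move=> i _; rewrite /= in_itv/=; exact: h.
  by move=> i; have := h i I; rewrite /= in_itv.
apply: fin_bigcap_measurable => [|i _]; first exact: finite_finset.
by rewrite -[X in measurable X]setTI; exact: measurable_tnth.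
Qed.

Lemma lebesgue_cube d s : 0 <= s -> lebesgue R d (cube d s) = (s ^+ d)%:E.
Proof.
move=> s0; have := @lebesgue_box R d (fun=> `[0, s[%classic) (fun i => measurable_itv _).
rewrite (_ : [set x | _] = cube d s); last first.
  by apply/seteqP; split => x /= h i; have := h i; rewrite in_itv.
move=> ->; rewrite (eq_bigr (fun=> s%:E)); last first.
  move=> i _; rewrite lebesgue_measure_itv/= lte_fin; move: s0; rewrite le_eqVlt => /orP[/eqP <-|->].
    by rewrite ltxx.
  by rewrite oppr0 adde0.
elim: d => [|d ih]; first by rewrite big_ord0 expr0.
by rewrite big_ord_recl ih exprS EFinM.
Qed.

Lemma cube_cons d s (x : R) (t : Rd R d) :
  cube d.+1 s (consd (x, t)) <-> (0 <= x < s) /\ cube d s t.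
Proof.
split=> [h|[hx ht] i].
  split; first by have := h ord0; rewrite tnth0.
  by move=> i; have := h (lift ord0 i); rewrite tnthS.
case: (unliftP ord0 i) => [j|] ->; last by rewrite tnth0.
by rewrite tnthS; exact: ht.
Qed.

Definition lat d (s : R) (k : Zd d) : Rd R d := [tuple s * (k i)%:~R | i < d].

Lemma tnth_lat d s (k : Zd d) i : tnth (lat s k) i = s * (k i)%:~R.
Proof. by rewrite tnth_mktuple. Qed.

Lemma tadd_latNK d s (k : Zd d) x : tadd (tadd x (lat s k)) (lat s (- k)) = x.
Proof.
apply: eq_from_tnth => i; rewrite !tnth_tadd !tnth_lat ffunE mulrNz mulrN.
by rewrite addrK.
Qed.

Lemma lat_add d s (k l : Zd d) : tadd (lat s k) (lat s l) = lat s (k + l).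
Proof. by apply: eq_from_tnth => i; rewrite tnth_tadd !tnth_lat ffunE intrD mulrDr. Qed.

Definition cell d (s : R) (x : Rd R d) : Zd d := [ffun i => Num.floor (tnth x i / s)].

Lemma cube_cell d s x (k : Zd d) : 0 < s ->
  cube d s (tadd x (lat s (- k))) <-> k = cell s x.
Proof.
move=> s0; split=> [h|-> i].
  apply/ffunP => i; rewrite ffunE; apply/esym/floor_def.
  have := h i; rewrite tnth_tadd tnth_lat ffunE mulrNz mulrN subr_ge0 => /andP[h1 h2].
  rewrite ler_pdivlMr// mulrC h1/= ltr_pdivrMr// intrD mulrDl mul1r.
  by rewrite -ltrBlDl mulrC.
rewrite tnth_tadd tnth_lat !ffunE mulrNz mulrN subr_ge0.
have /andP[h1 h2] := floor_itv (tnth x i / s).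
rewrite -[_ <= _]ler_pdivlMl// [s^-1 * _]mulrC h1/=.
move: h2; rewrite intrD ltr_pdivrMr// mulrDl mul1r [s * _]mulrC; lra.
Qed.

Local Notation mu d := (lebesgue R d).

(** Each x lies in exactly one translate of the half-open cube; f is split accordingly, integrated
    termwise, and each piece is moved back to the cube. *)
Lemma tiling d s (f : Rd R d -> \bar R) : 0 < s ->
  measurable_fun setT f -> (forall x, (0 <= f x)%E) ->
  (\int[mu d]_x f x =
   \esum_(k in [set: Zd d]) \int[mu d]_(x in cube d s) f (tadd x (lat s k)))%E.
Proof.
move=> s0 mf f0.
have mC : measurable (cube d s) by exact: measurable_cube.
pose g k x := (f x * (\1_(cube d s) (tadd x (lat s (- k))))%:E)%E.
have mi : measurable_fun setT (fun x => (\1_(cube d s) x : R)%:E).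
  by apply/measurable_EFinP; exact: measurable_indic.
have mg k : measurable_fun setT (g k).
  apply: emeasurable_funM => //.
  exact: (measurableT_comp mi (measurable_tadd _)).
have g0 k x : (0 <= g k x)%E by rewrite mule_ge0// lee_fin.
transitivity (\int[mu d]_x \esum_(k in [set: Zd d]) g k x)%E.
  apply: eq_integral => x _.
  rewrite (esumID [set cell s x]); last by move=> k _; exact: g0.
  rewrite setTI esum_set1// esum1 ?adde0; last first.
    move=> k [_ /= nk]; rewrite /g indicE memNset ?mule0//= => h; apply: nk.
    exact/(cube_cell x k s0).
  rewrite /g indicE mem_set ?mule1//=.
  exact/(cube_cell x _ s0).
rewrite integral_esum//; apply: eq_esum => k _.
rewrite -(integral_shift (lat s k))// [RHS]integral_mkcond.
apply: eq_integral => x _; rewrite /g tadd_latNK patchE indicE.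
by case: ifPn => _; rewrite ?mule1 ?mule0.
Qed.

Lemma tiling_in d s (f : Rd R d -> \bar R) : 0 < s ->
  measurable_fun setT f -> (forall x, (0 <= f x)%E) ->
  (\int[mu d]_x f x =
   \int[mu d]_(x in cube d s) \esum_(k in [set: Zd d]) f (tadd x (lat s k)))%E.
Proof.
move=> s0 mf f0; rewrite (tiling s0)//; have mC : measurable (cube d s) by exact: measurable_cube.
have mfk k : measurable_fun setT (fun x => f (tadd x (lat s k))).
  exact: measurableT_comp mf (measurable_tadd _).
under eq_esum do rewrite integral_mkcond.
rewrite -integral_esum; last 2 first.
- move=> k; apply/(measurable_restrictT _ mC).
  by apply: measurable_funTS.
- by move=> k x; rewrite patchE; case: ifP.
rewrite [RHS]integral_mkcond; apply: eq_integral => x _; rewrite patchE.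
case: ifPn => xC; first by apply: eq_esum => k _; rewrite patchE xC.
by rewrite esum1// => k _; rewrite patchE (negbTE xC).
Qed.

Section AE.
Context (d : nat).
Implicit Types (P : Rd R d -> Prop).

Lemma ae_shift P a : {ae mu d, forall x, P x} -> {ae mu d, forall x, P (tadd x a)}.
Proof.
move=> [N [mN N0 sN]]; exists ((fun x => tadd x a) @^-1` N); split.
- by rewrite -[X in measurable X]setTI; exact: measurable_tadd.
- have mi : measurable_fun setT (fun x => (\1_N x : R)%:E).
    by apply/measurable_EFinP; exact: measurable_indic.
  have := @integral_shift d a (fun x => (\1_N x)%:E) mi (fun x => ltac:(by rewrite lee_fin)).
  have -> : (\int[mu d]_x (\1_N x)%:E = 0)%E by rewrite integral_indic// setIT.
  move=> <-.
  have mA : measurable ((fun x => tadd x a) @^-1` N).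
    by rewrite -[X in measurable X]setTI; exact: measurable_tadd.
  by rewrite -[X in mu d X]setIT -integral_indic.
- by move=> x /= h; apply: sN.
Qed.

Lemma ae_all (I : countType) (P : I -> Rd R d -> Prop) :
  (forall i, {ae mu d, forall x, P i x}) -> {ae mu d, forall x, forall i, P i x}.
Proof.
move=> h.
have h' (n : nat) : {ae mu d, forall x, if pickle_inv n is Some i then P i x else True}.
  by case: (pickle_inv n) => [i|]; [exact: h|exact: aeW].
have : {ae mu d, forall x, forall n : nat, if pickle_inv n is Some i then P i x else True}.
  exact/ae_foralln.
apply: filterS => x hx i; have := hx (choice.pickle i).
by rewrite (@pickleK_inv I).
Qed.

Lemma ae_and P Q : {ae mu d, forall x, P x} -> {ae mu d, forall x, Q x} ->
  {ae mu d, forall x, P x /\ Q x}.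
Proof. by move=> hP hQ; apply: filterS2 hP hQ. Qed.

(** Every x has a lattice translate in the cube, and the countably many translates of the
    exceptional set are null. Properties that are invariant under the lattice thus need proof only
    on a set of finite measure. *)
Lemma ae_cube s P : 0 < s -> (forall x k, P x -> P (tadd x (lat s k))) ->
  {ae mu d, forall x, cube d s x -> P x} -> {ae mu d, forall x, P x}.
Proof.
move=> s0 PP h.
have : {ae mu d, forall x, forall k : Zd d, cube d s (tadd x (lat s k)) -> P (tadd x (lat s k))}.
  by apply: ae_all => k; exact: (ae_shift (lat s k) h).
apply: filterS => x hx.
have hc : cube d s (tadd x (lat s (- cell s x))) by exact/cube_cell.
have := PP _ (cell s x) (hx _ hc).
by rewrite -{2}[cell s x]opprK tadd_latNK.
Qed.

End AE.

End Lebesgue.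
Arguments cube {R} d s.

(** * Orthogonal systems and Fourier series *)

Section Orthogonal.
Context d (T : measurableType d) (R : realType).
Variable mu : {measure set T -> \bar R}.
Context (I : countType) (E : I -> T -> R[i]) (S : R).
Hypotheses (S0 : 0 < S) (LE : forall i, LL mu (E i)).
Hypothesis orth : forall i j, ip mu (E i) (E j) = ((if i == j then S else 0)%:C)%C.
Implicit Types f g h : T -> R[i].

Definition lincomb (s : seq (I * R[i])) : T -> R[i] :=
  fun x => \sum_(p <- s) p.2 * E p.1 x.

(** The closed linear span of [E]; a list may repeat an index. *)
Definition clo f := LL mu f /\ forall e : R, 0 < e ->
  exists s, Nm mu (fun x => f x - lincomb s x) <= e.

Lemma LL_lincomb s : LL mu (lincomb s).
Proof. by apply: LL_sum => p; exact: LL_Z. Qed.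

Lemma clo_lim f : LL mu f ->
  (forall e : R, 0 < e -> exists2 g, clo g & Nm mu (fun x => f x - g x) <= e) -> clo f.
Proof.
move=> Lf h; split => // e e0; have e2 : 0 < e / 2 by lra.
have [g [Lg cg] fg] := h _ e2; have [s hs] := cg _ e2; exists s.
apply: le_trans (Nm_dist Lf Lg (LL_lincomb s)) _; lra.
Qed.

Lemma cloD f g : clo f -> clo g -> clo (fun x => f x + g x).
Proof.
move=> [Lf cf] [Lg cg]; split; first exact: LL_D.
move=> e e0; have e2 : 0 < e / 2 by lra.
have [s hs] := cf _ e2; have [s' hs'] := cg _ e2; exists (s ++ s').
have -> : (fun x => f x + g x - lincomb (s ++ s') x) =
  (fun x => (f x - lincomb s x) + (g x - lincomb s' x)).
  by apply/funext => x; rewrite /lincomb big_cat/=; ring.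
have Ls := LL_lincomb s; have Ls' := LL_lincomb s'.
apply: le_trans (Nm_triangle (LL_B Lf Ls) (LL_B Lg Ls')) _; lra.
Qed.

Lemma cloZ (a : R[i]) f : clo f -> clo (fun x => a * f x).
Proof.
move=> [Lf cf]; split; first exact: LL_Z.
move=> e e0; pose M := Num.sqrt (sqn a) + 1.
have M0 : 0 < M by rewrite /M ltr_wpDl ?sqrtr_ge0.
have [s hs] := cf _ (divr_gt0 e0 M0); exists [seq (p.1, a * p.2) | p <- s].
have -> : (fun x => a * f x - lincomb [seq (p.1, a * p.2) | p <- s] x) =
  (fun x => a * (f x - lincomb s x)).
  apply/funext => x; rewrite /lincomb big_map mulrBr mulr_sumr; congr (_ - _).
  by apply: eq_bigr => p _; rewrite mulrA.
have Ls := LL_lincomb s.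
rewrite NmZ; last exact: LL_B.
apply: (@le_trans _ _ (M * (e / M))); last by rewrite mulrC divfK// gt_eqF.
by apply: ler_pM => //; rewrite ?sqrtr_ge0 ?Nm_ge0// /M lerDl.
Qed.

Definition proj f (J : {fset I}) : T -> R[i] :=
  fun x => \sum_(i <- J) (((S^-1)%:C)%C * ip mu f (E i)) * E i x.

Lemma LL_proj f J : LL mu (proj f J).
Proof. by apply: LL_sum => i; exact: LL_Z. Qed.

Lemma ip_proj f (J : {fset I}) i : i \in J -> ip mu (proj f J) (E i) = ip mu f (E i).
Proof.
move=> iJ; rewrite ip_suml//; last by move=> j; exact: LL_Z.
rewrite (big_fsetD1 i)//= big_seq big1 ?addr0; last first.
  move=> j; rewrite in_fsetD1 => /andP[/negbTE ji _].
  by rewrite ipZl// orth ji mulr0.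
rewrite ipZl// orth eqxx mulrAC -rmorphM/= mulVf ?gt_eqF//.
by rewrite mul1r.
Qed.

Lemma N2_proj f (J : {fset I}) : LL mu f ->
  N2 mu (fun x => f x - proj f J x) = N2 mu f - S^-1 * \sum_(i <- J) sqn (ip mu f (E i)).
Proof.
move=> Lf; have LP := LL_proj f J.
have h : ip mu f (proj f J) = ((S^-1 * \sum_(i <- J) sqn (ip mu f (E i)))%:C)%C.
  rewrite ip_sumr//; last by move=> j; exact: LL_Z.
  rewrite rmorphM/= RC_sum mulr_sumr; apply: eq_bigr => i _.
  by rewrite ipZr// conjcM conjc_real -mulrA [_ * ip _ _ _]mulrC mulcJ.
have h' : ip mu (proj f J) (proj f J) = ip mu f (proj f J).
  rewrite ip_sumr//; last by move=> j; exact: LL_Z.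
  rewrite [RHS]ip_sumr//; last by move=> j; exact: LL_Z.
  rewrite big_seq [RHS]big_seq; apply: eq_bigr => i iJ.
  by rewrite !ipZr// ip_proj.
have h2 : N2 mu (proj f J) = S^-1 * \sum_(i <- J) sqn (ip mu f (E i)).
  have := ipff mu (proj f J); rewrite h' h => /(congr1 (@complex.Re R)).
  by rewrite !ReR.
by rewrite N2BE// h2 h ReR; ring.
Qed.

Lemma bessel f (J : {fset I}) : LL mu f ->
  \sum_(i <- J) sqn (ip mu f (E i)) <= S * N2 mu f.
Proof.
move=> Lf; have := N2_ge0 mu (fun x => f x - proj f J x).
by rewrite N2_proj// subr_ge0 ler_pdivrMl// mulrC.
Qed.

(** The residual of the projection on the indices that occur in s is orthogonal to their span, so
    the theorem of Pythagoras applies. *)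
Lemma best f (s : seq (I * R[i])) : LL mu f -> exists J : {fset I},
  N2 mu (fun x => f x - proj f J x) <= N2 mu (fun x => f x - lincomb s x).
Proof.
move=> Lf; pose J := [fset p.1 | p in s]%fset; exists J.
have LP := LL_proj f J; have Ls := LL_lincomb s.
pose h x := f x - proj f J x; have Lh : LL mu h by exact: LL_B.
have hE i : i \in J -> ip mu h (E i) = 0.
  by move=> iJ; rewrite ipBl// ip_proj// subrr.
have -> : (fun x => f x - lincomb s x) = (fun x => h x + (proj f J x - lincomb s x)).
  by apply/funext => x; rewrite /h; ring.
rewrite [leRHS]N2DE//; last exact: LL_B.
suff -> : ip mu h (fun x => proj f J x - lincomb s x) = 0.
  by rewrite mulr0 addr0 lerDl N2_ge0.
rewrite ipBr// [X in X - _]ip_sumr//; last by move=> j; exact: LL_Z.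
rewrite [X in _ - X]ip_sumr//; last by move=> j; exact: LL_Z.
rewrite big_seq big1 ?sub0r; last by move=> i iJ; rewrite ipZr// hE// mulr0.
rewrite big_seq big1 ?oppr0// => p ps; rewrite ipZr// hE ?mulr0//.
by apply/imfsetP; exists p.
Qed.

Lemma clo_parseval f : clo f ->
  (\esum_(i in setT) (sqn (ip mu f (E i)))%:E = S%:E * n2 mu f)%E.
Proof.
move=> [Lf cf]; rewrite LL_fin// -EFinM; apply/eqP; rewrite eq_le; apply/andP; split.
  by apply: esum_le_fset => J; rewrite sumEFin lee_fin bessel.
apply/lee_addgt0Pr => e e0.
have eS : 0 < Num.sqrt (e / S) by rewrite sqrtr_gt0 divr_gt0.
have [s hs] := cf _ eS; have [J hJ] := best s Lf.
apply: (@le_trans _ _ ((\sum_(i <- J) sqn (ip mu f (E i)) + e)%:E)); last first.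
  rewrite EFinD leeD2r// -sumEFin; apply: fset_le_esum => i.
  by rewrite lee_fin sqn_ge0.
rewrite lee_fin; have : N2 mu (fun x => f x - proj f J x) <= e / S.
  apply: le_trans hJ _; rewrite -Nm2 -(sqr_sqrtr (ltW (divr_gt0 e0 S0))).
  by rewrite ler_pXn2r ?nnegrE ?Nm_ge0 ?sqrtr_ge0.
rewrite N2_proj// ler_pdivlMr// mulrBl mulrAC mulVf ?gt_eqF// mul1r [S * _]mulrC.
lra.
Qed.

(** In several variables Parseval's identity is established first, for bounded functions, and the
    completeness of the exponentials is deduced from it in this way. *)
Lemma parseval_clo f : LL mu f ->
  (\esum_(i in setT) (sqn (ip mu f (E i)))%:E = S%:E * n2 mu f)%E -> clo f.
Proof.
move=> Lf pf; split => // e e0.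
have e2 : 0 < e ^+ 2 by exact: exprn_gt0.
have : ((S * N2 mu f - S * e ^+ 2)%:E < \esum_(i in setT) (sqn (ip mu f (E i)))%:E)%E.
  by rewrite pf LL_fin// -EFinM lte_fin ltrBlDr ltrDl mulr_gt0.
move=> /esum_gt_fset[J]; rewrite sumEFin lte_fin => hJ.
exists [seq (i, ((S^-1)%:C)%C * ip mu f (E i)) | i <- J].
have -> : (fun x => f x - lincomb [seq (i, ((S^-1)%:C)%C * ip mu f (E i)) | i <- J] x) =
  (fun x => f x - proj f J x).
  by apply/funext => x; rewrite /lincomb big_map.
rewrite -(@ler_pXn2r _ 2)// ?nnegrE ?Nm_ge0 ?(ltW e0)// Nm2 N2_proj//.
rewrite -(ler_pM2l S0) mulrBr mulrA mulfV ?gt_eqF// mul1r; lra.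
Qed.

End Orthogonal.

Section Cis.
Context {R : realType}.
Implicit Types (t u : R) (l m n : int).

Definition cis t : R[i] := (cos t +i* sin t)%C.

Lemma cisD t u : cis (t + u) = cis t * cis u.
Proof. by apply: cplxP; rewrite ?ReM ?ImM /= ?cosD ?sinD; ring. Qed.
Lemma cis0 : cis 0 = 1. Proof. by rewrite /cis cos0 sin0. Qed.
Lemma cisN t : cis (- t) = conjc (cis t).
Proof. by apply: cplxP; rewrite /= ?cosN ?sinN. Qed.
Lemma sqn_cis t : sqn (cis t) = 1.
Proof. by rewrite /sqn /= cos2Dsin2. Qed.

Lemma cis2pi n : cis (2 * pi * n%:~R) = 1.
Proof.
have h (m : nat) : cis (2 * pi * m%:R) = 1.
  elim: m => [|m ih]; first by rewrite mulr0 cis0.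
  rewrite -[m.+1]addn1 natrD mulrDr cisD ih mul1r mulr1 mulr_natl.
  by apply: cplxP; rewrite /= ?cos2pi ?sin2pi.
case: n => n; first exact: h.
by rewrite NegzE mulrNz mulrN cisN h conjc1.
Qed.

End Cis.

Section Bounded.
Context d (T : measurableType d) (R : realType).
Variable mu : {measure set T -> \bar R}.

Lemma integrable_bounded (A : set T) (h : T -> R) (M : R) : measurable A ->
  (mu A < +oo)%E -> measurable_fun setT h -> (forall x, `|h x| <= M) ->
  mu.-integrable A (EFin \o h).
Proof.
move=> mA Aoo mh hM; apply: measurable_bounded_integrable => //.
  exact: measurable_funTS.
exists M; split; first exact: num_real.
by move=> y My x _ /=; apply: le_trans (hM x) (ltW My).
Qed.

Lemma LL_bounded (A : set T) (f : T -> R[i]) (M : R) : measurable A ->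
  (mu A < +oo)%E -> cmeas f -> (forall x, ~ A x -> f x = 0) ->
  (forall x, sqn (f x) <= M) -> LL mu f.
Proof.
move=> mA Aoo mf f0 fM; split => //.
have M0 : 0 <= `|M| by [].
apply: (@le_lt_trans _ _ (\int[mu]_x (`|M|%:E * (\1_A x)%:E))%E).
  apply: ge0_le_integral => //.
  - by move=> x _; rewrite lee_fin sqn_ge0.
  - by apply/measurable_EFinP; exact: measurable_sqn.
  - by apply: measurable_funeM; apply/measurable_EFinP; exact: measurable_indic.
  - move=> x _; rewrite indicE -EFinM lee_fin.
    have [Ax|nAx] := pselect (A x).
      by rewrite mem_set// mulr1 (le_trans (fM x))// ler_norm.
    by rewrite memNset// mulr0 f0// sqn0.
rewrite ge0_integralZl_EFin//; last first.
  by apply/measurable_EFinP; exact: measurable_indic.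
by rewrite integral_indic// setIT lte_mul_pinfty.
Qed.

Lemma cintR (h : T -> R) : cint mu (fun x => ((h x)%:C)%C) = ((\int[mu]_x h x)%:C)%C.
Proof.
apply: cplxP; first by [].
by rewrite Im_cint [RHS]/= /Rintegral integral0_eq.
Qed.

(** Extension by zero: functions on A are kept as functions on the whole space, so that norms and
    inner products over A need no restricted measure. *)
Definition ind (A : set T) (f : T -> R[i]) : T -> R[i] :=
  fun x => ((\1_A x : R)%:C)%C * f x.

Arguments ind A f x : simpl never.

Lemma ind_in A f x : A x -> ind A f x = f x.
Proof. by move=> Ax; rewrite /ind indicE mem_set// mul1r. Qed.

Lemma ind_out A f x : ~ A x -> ind A f x = 0.
Proof. by move=> Ax; rewrite /ind indicE memNset// mul0r. Qed.

Lemma cmeas_ind A f : measurable A -> cmeas f -> cmeas (ind A f).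
Proof.
by move=> mA mf; apply: cmeasM => //; apply: cmeasR; exact: measurable_indic.
Qed.

Lemma sqn_ind A f x : sqn (ind A f x) <= sqn (f x).
Proof.
have [Ax|nAx] := pselect (A x); first by rewrite ind_in.
by rewrite ind_out// sqn0 sqn_ge0.
Qed.

Lemma LL_ind A f : measurable A -> LL mu f -> LL mu (ind A f).
Proof.
move=> mA Lf; apply: LL_le (Lf); first exact: cmeas_ind (LL_meas Lf).
by move=> x; exact: sqn_ind.
Qed.

Lemma LL_ind_bounded A f M : measurable A -> (mu A < +oo)%E -> cmeas f ->
  (forall x, sqn (f x) <= M) -> LL mu (ind A f).
Proof.
move=> mA Aoo mf fM; apply: (LL_bounded mA Aoo (M := M)).
- exact: cmeas_ind.
- by move=> x; exact: ind_out.
- by move=> x; exact: le_trans (sqn_ind _ _ _) (fM x).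
Qed.

Lemma cint_ind A f : cint mu (ind A f) =
  ((\int[mu]_(x in A) complex.Re (f x))%R +i* (\int[mu]_(x in A) complex.Im (f x))%R)%C.
Proof.
apply: cplxP.
  rewrite Re_cint [RHS]/= [RHS]Rintegral_mkcond; apply: eq_Rintegral => x _.
  rewrite patchE; case: ifPn => [/set_mem Ax|/negP nAx]; first by rewrite ind_in.
  by rewrite ind_out// => Ax; apply: nAx; rewrite inE.
rewrite Im_cint [RHS]/= [RHS]Rintegral_mkcond; apply: eq_Rintegral => x _.
rewrite patchE; case: ifPn => [/set_mem Ax|/negP nAx]; first by rewrite ind_in.
by rewrite ind_out// => Ax; apply: nAx; rewrite inE.
Qed.

End Bounded.

Lemma RCM (R : realType) (a c : R) : ((a * c)%:C)%C = (a%:C)%C * (c%:C)%C.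
Proof. exact: rmorphM. Qed.

(** * Completeness of the exponentials on an interval *)

Section Fourier1.
Context {R : realType}.
Local Notation T := (measurableTypeR R).
Local Notation mu := (@lebesgue_measure R : {measure set (measurableTypeR R) -> \bar R}).
Variable b : R.
Hypothesis b0 : 0 < b.
Let s := b^-1.
Let s0 : 0 < s. Proof. by rewrite invr_gt0. Qed.
Let bs : b * s = 1. Proof. by rewrite /s divff// gt_eqF. Qed.
Let Q : set T := `[0, s[%classic.

Let mQ : measurable Q. Proof. exact: measurable_itv. Qed.
Let muQ : mu Q = s%:E.
Proof. by rewrite /= lebesgue_measure_itv/= lte_fin s0 oppr0 adde0. Qed.
Let Qoo : (mu Q < +oo)%E. Proof. by rewrite muQ ltry. Qed.

Definition expo (l : int) : T -> R[i] := fun x => cis (2 * pi * (b * l%:~R * x)).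

Arguments expo l x : simpl never.

Lemma expoD l m x : expo (l + m) x = expo l x * expo m x.
Proof. by rewrite /expo -cisD intrD; congr cis; ring. Qed.

Lemma expoN l x : expo (- l) x = conjc (expo l x).
Proof. by rewrite /expo -cisN mulrNz; congr cis; ring. Qed.

Lemma expoB l x y : expo l (x - y) = expo l x * conjc (expo l y).
Proof. by rewrite /expo -cisN -cisD; congr cis; ring. Qed.

Lemma cmeas_expo l : cmeas (expo l).
Proof.
have m : measurable_fun setT (fun x : T => 2 * pi * (b * l%:~R * x) : T).
  apply: measurable_funM; first exact: measurable_cst.
  by apply: measurable_funM => //; exact: measurable_cst.
split.
  apply: (measurableT_comp _ m); apply: continuous_measurable_fun.
  exact: continuous_cos.
apply: (measurableT_comp _ m); apply: continuous_measurable_fun.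
exact: continuous_sin.
Qed.

Lemma sqn_expo l x : sqn (expo l x) = 1. Proof. exact: sqn_cis. Qed.

Lemma int_cossin (c : R) (n : int) : c != 0 -> c * s = 2 * pi * n%:~R ->
  \int[mu]_(x in Q) cos (c * x) = 0 /\ \int[mu]_(x in Q) sin (c * x) = 0.
Proof.
move=> c0 cs.
have csin : continuous (fun x : R => sin (c * x)).
  move=> x; apply: continuous_comp; last exact: continuous_sin.
  by apply: cvgM; [exact: cvg_cst|exact: cvg_id].
have ccos : continuous (fun x : R => cos (c * x)).
  move=> x; apply: continuous_comp; last exact: continuous_cos.
  by apply: cvgM; [exact: cvg_cst|exact: cvg_id].
have /(congr1 (@complex.Re R)) := @cis2pi R n; rewrite -cs /= => cos1.
have /(congr1 (@complex.Im R)) := @cis2pi R n; rewrite -cs /= => sin0'.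
have dsin (x : R) : is_derive x 1 (fun x => sin (c * x) / c) (cos (c * x)).
  apply: is_derive_eq; rewrite /GRing.scale/=; field.
  exact: c0.
have dcos (x : R) : is_derive x 1 (fun x => - cos (c * x) / c) (sin (c * x)).
  apply: is_derive_eq; rewrite /GRing.scale/=; field.
  exact: c0.
have ib h : continuous h -> (forall x, `|h x| <= 1) -> mu.-integrable Q (EFin \o h).
  move=> ch h1; apply: (integrable_bounded mQ Qoo _ h1).
  exact: continuous_measurable_fun.
split.
  rewrite Rintegral_itv_bndo_bndc; last first.
    by apply: ib => // x; rewrite ler_norml cos_geN1 cos_le1.
  rewrite /Rintegral (@continuous_FTC2 _ _ (fun x => sin (c * x) / c))//.
  - by rewrite cs -cs sin0' mulr0 sin0 mul0r subee.
  - by apply: continuous_subspaceT.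
  - split.
    + by move=> x _; exact: (@ex_derive _ _ _ _ _ _ _ (dsin x)).
    + apply: cvg_at_right_filter; apply: cvgM; last exact: cvg_cst.
      exact: csin.
    + apply: cvg_at_left_filter; apply: cvgM; last exact: cvg_cst.
      exact: csin.
  - by move=> x _; rewrite derive1E; exact: (@derive_val _ _ _ _ _ _ _ (dsin x)).
rewrite Rintegral_itv_bndo_bndc; last first.
  by apply: ib => // x; rewrite ler_norml sin_geN1 sin_le1.
rewrite /Rintegral (@continuous_FTC2 _ _ (fun x => - cos (c * x) / c))//.
- by rewrite cos1 mulr0 cos0 subee.
- by apply: continuous_subspaceT.
- split.
  + by move=> x _; exact: (@ex_derive _ _ _ _ _ _ _ (dcos x)).
  + apply: cvg_at_right_filter; apply: cvgM; last exact: cvg_cst.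
    by apply: cvgN; exact: ccos.
  + apply: cvg_at_left_filter; apply: cvgM; last exact: cvg_cst.
    by apply: cvgN; exact: ccos.
- by move=> x _; rewrite derive1E; exact: (@derive_val _ _ _ _ _ _ _ (dcos x)).
Qed.

Lemma cint_expo l : cint mu (ind Q (expo l)) = ((if l == 0 then s else 0)%:C)%C.
Proof.
rewrite cint_ind; have [->|l0] := eqVneq l 0.
  apply: cplxP => /=.
    transitivity (\int[mu]_(x in Q) cst 1 x).
      by apply: eq_Rintegral => x _; rewrite /expo /= mulr0 mul0r mulr0 cos0.
    by rewrite Rintegral_cst// muQ mul1r.
  transitivity (\int[mu]_(x in Q) cst 0 x).
    by apply: eq_Rintegral => x _; rewrite /expo /= mulr0 mul0r mulr0 sin0.
  by rewrite Rintegral_cst// mul0r.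
have pi0 : (pi : R) != 0 by rewrite gt_eqF// pi_gt0.
have c0 : 2 * pi * (b * l%:~R) != 0.
  by rewrite !mulf_neq0// ?intr_eq0// gt_eqF.
have cs : 2 * pi * (b * l%:~R) * s = 2 * pi * l%:~R.
  by rewrite -mulrA; congr (_ * _); rewrite mulrAC bs mul1r.
have [h1 h2] := int_cossin c0 cs.
apply: cplxP; [rewrite -[RHS]h1|rewrite -[RHS]h2]; apply: eq_Rintegral => x _;
  by rewrite /expo /= mulrA.
Qed.

Let E (l : int) : T -> R[i] := ind Q (expo l).

Let LE l : LL mu (E l).
Proof. by apply: (LL_ind_bounded mQ Qoo (cmeas_expo l)) => x; rewrite sqn_expo. Qed.

Let orth l m : ip mu (E l) (E m) = ((if l == m then s else 0)%:C)%C.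
Proof.
rewrite -(subr_eq0 l m) -cint_expo; apply: eq_cint => x.
have [Qx|nQx] := pselect (Q x); last by rewrite /E !ind_out// mul0r.
by rewrite /E !ind_in// -expoN -expoD.
Qed.

Local Notation cloE := (clo mu E).

(* A positive trigonometric polynomial which, normalized, concentrates at the
   multiples of the period as n grows. *)
Definition Kn (n : nat) (t : R) : R := ((1 + cos (2 * pi * (b * t))) / 2) ^+ n.

Lemma Kn_rep n : exists r : seq (int * R), forall t,
  ((Kn n t)%:C)%C = \sum_(p <- r) ((p.2)%:C)%C * expo p.1 t.
Proof.
elim: n => [|n [r hr]].
  exists [:: (0, 1)] => t; rewrite big_seq1 /= /expo /Kn expr0.
  by rewrite mulr0 mul0r mulr0 cis0 mulr1.
(* One more factor (1 + cos)/2 is 1/2 plus 1/4 times the sum of the exponentials of index 1 and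
   -1. *)
exists ([seq (p.1, p.2 / 2) | p <- r] ++ [seq (p.1 + 1, p.2 / 4) | p <- r]
  ++ [seq (p.1 - 1, p.2 / 4) | p <- r]) => t.
have st : (((1 + cos (2 * pi * (b * t))) / 2)%:C)%C =
  ((2^-1)%:C)%C + ((4^-1)%:C)%C * (expo 1 t + conjc (expo 1 t)).
  by rewrite /expo mulr1; apply: cplxP => /=; field.
rewrite !big_cat !big_map /= /Kn exprSr -/(Kn n t) rmorphM/= st hr mulr_suml.
rewrite -!big_split/=; apply: eq_bigr => p _.
by rewrite !expoD expoN !rmorphM/=; ring.
Qed.

Lemma half_cos_ge0 (t : R) : 0 <= (1 + cos t) / 2.
Proof. by rewrite divr_ge0// -lerBlDl sub0r cos_geN1. Qed.

Lemma Kn_ge0 n t : 0 <= Kn n t.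
Proof. by rewrite exprn_ge0// divr_ge0// -lerBlDl sub0r cos_geN1. Qed.

Lemma Kn_le1 n t : Kn n t <= 1.
Proof.
apply: exprn_ile1; first by rewrite divr_ge0// -lerBlDl sub0r cos_geN1.
by rewrite ler_pdivrMr// mul1r -lerBrDl (le_trans (cos_le1 _))//; lra.
Qed.

Lemma measurable_Kn n : measurable_fun setT (Kn n : T -> R).
Proof.
apply: measurable_funX; apply: measurable_funM; last exact: measurable_cst.
apply: measurable_funD; first exact: measurable_cst.
have [h _] := cmeas_expo 1.
by move: h; under eq_fun do rewrite /expo /= mulr1.
Qed.

Lemma measurable_KnB n x : measurable_fun setT (fun y : T => Kn n (x - y)).
Proof.
apply: (measurableT_comp (measurable_Kn n)).
by apply: measurable_funB => //; exact: measurable_cst.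
Qed.

Definition kap n x := \int[mu]_(y in Q) Kn n (x - y).

Section Convolve.
Variables (g : T -> R) (M : R).
Hypotheses (mg : measurable_fun setT g) (gM : forall x, `|g x| <= M).
Let M0 : 0 <= M. Proof. exact: le_trans (gM 0). Qed.
Let G : T -> R[i] := ind Q (fun x => ((g x)%:C)%C).

Let LG : LL mu G.
Proof.
apply: (LL_ind_bounded mQ Qoo (M := M ^+ 2)); first exact: cmeasR.
by move=> x; rewrite sqnR -real_normK ?num_real// ler_pXn2r ?nnegrE.
Qed.

Lemma convolve_rep n : exists r : seq (int * R), forall x,
  ((\int[mu]_(y in Q) (g y * Kn n (x - y)))%:C)%C =
  \sum_(p <- r) (((p.2)%:C)%C * ip mu G (E p.1)) * expo p.1 x.
Proof.
have [r hr] := Kn_rep n; exists r => x.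
rewrite Rintegral_mkcond -cintR.
transitivity (cint mu (fun y => \sum_(p <- r) (((p.2)%:C)%C * expo p.1 x) * (G y * conjc (E p.1 y)))).
  apply: eq_cint => y; rewrite patchE; have [Qy|nQy] := pselect (Q y).
    rewrite mem_set// RCM hr mulr_sumr; apply: eq_bigr => p _.
    by rewrite expoB /G /E !ind_in//; ring.
  rewrite memNset// big1// => p _.
  by rewrite /G ind_out// mul0r mulr0.
rewrite cint_sum; last by move=> p; apply: cintbZ; exact: cintb_LL.
apply: eq_bigr => p _; rewrite cintZ; last exact: cintb_LL.
by rewrite mulrAC.
Qed.

End Convolve.

(** Only the constant Fourier mode of the kernel survives integration over a full period. *)
Lemma kap_cst n x : kap n x = kap n 0.
Proof.
have [r hr] := @convolve_rep (cst 1) 1 (measurable_cst _) (fun x => ltac:(by rewrite normr1)) n.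
suff h y : ((kap n y)%:C)%C = \sum_(p <- r | p.1 == 0) ((p.2 * s)%:C)%C.
  have := h x; rewrite -(h 0) => /(congr1 (@complex.Re R)).
  by rewrite !ReR.
transitivity ((\int[mu]_(z in Q) (cst 1 z * Kn n (y - z)))%:C)%C.
  by congr (_%:C)%C; apply: eq_Rintegral => z _; rewrite mul1r.
rewrite hr [RHS]big_mkcond; apply: eq_bigr => p _.
have -> : ip mu (ind Q (fun x => ((cst 1 x)%:C)%C)) (E p.1) = ((if p.1 == 0 then s else 0)%:C)%C.
  rewrite -oppr_eq0 -cint_expo; apply: eq_cint => z.
  have [Qz|nQz] := pselect (Q z); last by rewrite !ind_out// mul0r.
  by rewrite /E !ind_in// mul1r expoN.
case: eqVneq => [->|_]; last by rewrite mulr0 mul0r.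
by rewrite /expo mulr0 mul0r mulr0 cis0 mulr1 rmorphM.
Qed.

Lemma cos_mono (u v : R) : 0 <= u -> u <= v -> 2 * (b * v) <= 1 ->
  cos (2 * pi * (b * v)) <= cos (2 * pi * (b * u)).
Proof.
move=> u0 uv v1; have pi0 : 0 < (pi : R) by exact: pi_gt0.
have bu : 0 <= b * u by rewrite mulr_ge0// ltW.
have buv : b * u <= b * v by rewrite ler_pM2l.
have in1 (z : R) : 0 <= z -> 2 * z <= 1 -> 2 * pi * z \in `[0, pi].
  move=> z0 z1; rewrite in_itv/=; apply/andP; split.
    by rewrite mulr_ge0// mulr_ge0// ltW.
  by rewrite mulrAC; apply: ler_piMl => //; exact: ltW.
have u1 : 2 * (b * u) <= 1 by apply: le_trans v1; rewrite ler_pM2l.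
rewrite leNgt ltr_cos ?in1//; first by rewrite -leNgt ler_pM2l// mulr_gt0.
exact: le_trans buv.
Qed.

Lemma cos_absr (t : R) : cos (2 * pi * (b * t)) = cos (2 * pi * (b * `|t|)).
Proof.
have [t0|t0] := leP 0 t; first by rewrite ger0_norm.
by rewrite ltr0_norm// !mulrN cosN.
Qed.

(** The hypotheses keep t at distance at least [dl] from all multiples of the period. Beyond half a
    period the reflection t -> s - t returns to the range where the cosine decreases. *)
Lemma cos_far (dl t : R) : 0 < dl -> dl <= `|t| -> `|t| <= s - dl ->
  cos (2 * pi * (b * t)) <= cos (2 * pi * (b * dl)).
Proof.
move=> dl0; rewrite cos_absr; move: `|t| => {}t dt ts.
have [t1|t1] := leP (2 * (b * t)) 1; first exact: cos_mono (ltW dl0) dt t1.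
have -> : cos (2 * pi * (b * t)) = cos (2 * pi * (b * (s - t))).
  rewrite mulrBr bs mulrBr mulr1 mulr_natl cosB cos2pi sin2pi mul1r mul0r addr0.
  by [].
apply: cos_mono; first exact: ltW.
  by rewrite lerBrDl -lerBrDr.
rewrite mulrBr bs; move: t1; move: (b * t) => w; lra.
Qed.

Section Approx.
Variables (g : T -> R) (M : R).
Hypotheses (cg : continuous (g : R -> R)) (gM : forall x, `|g x| <= M).
Let M0 : 0 <= M. Proof. exact: le_trans (gM 0). Qed.
Let mg : measurable_fun setT g. Proof. exact: continuous_measurable_fun. Qed.

Let iK n x : mu.-integrable Q (EFin \o (fun y => Kn n (x - y))).
Proof.
apply: (integrable_bounded mQ Qoo (M := 1)); first exact: measurable_KnB.
by move=> y; rewrite ger0_norm ?Kn_ge0// Kn_le1.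
Qed.

Let igK n x (h : T -> R) (H : R) : measurable_fun setT h -> (forall y, `|h y| <= H) ->
  mu.-integrable Q (EFin \o (fun y => h y * Kn n (x - y))).
Proof.
move=> mh hH; apply: (integrable_bounded mQ Qoo (M := H)).
  by apply: measurable_funM => //; exact: measurable_KnB.
move=> y; rewrite normrM (ger0_norm (Kn_ge0 _ _)).
by apply: le_trans (hH y); rewrite ler_piMr// Kn_le1.
Qed.

Let icst (c : R) : mu.-integrable Q (EFin \o (fun=> c)).
Proof.
by apply: (integrable_bounded mQ Qoo (M := `|c|)); [exact: measurable_cst|].
Qed.

Definition conv n x := (kap n 0)^-1 * \int[mu]_(y in Q) (g y * Kn n (x - y)).

(** On an interval of length [dl] around x the kernel is at least its value at distance dl/2; the
    conditions on x keep this interval inside the period. *)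
Lemma kap_lower n (x dl : R) : 0 < dl -> dl < x -> dl < s - x ->
  dl * ((1 + cos (2 * pi * (b * (dl / 2)))) / 2) ^+ n <= kap n 0.
Proof.
move=> dl0 dx ds; rewrite -(kap_cst n x).
set r := (1 + _) / 2.
pose I : set T := `[x - dl / 2, x + dl / 2]%classic.
have mI : measurable I by exact: measurable_itv.
have muI : mu I = dl%:E.
  rewrite /= lebesgue_measure_itv/= lte_fin ifT; last lra.
  by rewrite -EFinB; congr EFin; field.
have IQ : I `<=` Q.
  by move=> y; rewrite /I /Q /= !in_itv/= => /andP[h1 h2]; apply/andP; split; lra.
have pi0 : 0 < (pi : R) by exact: pi_gt0.
apply: (@le_trans _ _ (\int[mu]_(y in Q) (r ^+ n * \1_I y))).
  have -> : \int[mu]_(y in Q) (r ^+ n * \1_I y) = r ^+ n * \int[mu]_(y in Q) \1_I y.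
    rewrite RintegralZl//; apply: (integrable_bounded mQ Qoo (M := 1)).
      exact: measurable_indic.
    by move=> y; rewrite indicE; case: (_ \in _); rewrite ?normr1 ?normr0.
  rewrite /Rintegral integral_indic// (setIidl IQ) -[X in fine X]/(mu I) muI /=.
  by rewrite mulrC.
apply: le_Rintegral => //.
- apply: (integrable_bounded mQ Qoo (M := `|r ^+ n|)).
    apply: measurable_funM; first exact: measurable_cst.
    exact: measurable_indic.
  move=> y; rewrite normrM indicE; case: (_ \in _); rewrite ?normr1 ?normr0 ?mulr1//.
  by rewrite mulr0.
move=> y Qy; rewrite indicE; have [Iy|nIy] := pselect (I y); last first.
  by rewrite memNset// mulr0 Kn_ge0.
rewrite mem_set// mulr1; apply: lerXn2r; rewrite ?nnegrE ?half_cos_ge0//.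
rewrite ler_pM2r// lerD2l [leRHS]cos_absr; apply: cos_mono => //.
  move: Iy; rewrite /I /= in_itv/= => /andP[h1 h2].
  by rewrite ler_norml; apply/andP; split; lra.
have : 2 * dl <= s by lra.
rewrite -(ler_pM2l b0) bs => h; lra.
Qed.

Lemma conv_diff n x : conv n x - g x =
  (kap n 0)^-1 * \int[mu]_(y in Q) ((g y - g x) * Kn n (x - y)) \/ kap n 0 = 0.
Proof.
have [k0|k0] := eqVneq (kap n 0) 0; [by right|left].
have -> : \int[mu]_(y in Q) ((g y - g x) * Kn n (x - y)) =
   \int[mu]_(y in Q) (g y * Kn n (x - y)) - \int[mu]_(y in Q) (g x * Kn n (x - y)).
  rewrite -RintegralB//; last 2 first.
  - exact: igK gM.
  - by apply: (@igK n x (cst (g x)) `|g x|) => //; exact: measurable_cst.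
  by apply: eq_Rintegral => y _; rewrite mulrBl.
rewrite RintegralZl// -/(kap n x) kap_cst mulrBr /conv; congr (_ - _).
by rewrite mulrCA mulVf// mulr1.
Qed.

(** The kernel is an approximate identity: at distance below [dl] the continuity of g decides, and
    beyond it the kernel is at most q^n, while its mass is at least dl r^n with r > q. The end
    points are left out because g need not be periodic. *)
Lemma conv_cvg x : 0 < x < s -> conv ^~ x @ \oo --> g x.
Proof.
move=> /andP[x0 xs]; apply/cvgrPdist_le => e e0.
have e2 : 0 < e / 2 by lra.
have /cvgrPdist_le/(_ _ e2)[d d0 hd] : (g : R -> R) y @[y --> x] --> g x by exact: cg.
have {}d0 : 0 < d by exact: d0.
(* Half of the modulus of continuity bounds [dl], and the halves of x and s - x keep the interval
   around x inside the period. *)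
pose dl := Num.min (d / 2) (Num.min (x / 2) ((s - x) / 2)).
have sx : 0 < s - x by lra.
have dl0 : 0 < dl by rewrite !lt_min; apply/and3P; split; lra.
have dld : dl <= d / 2 by rewrite ge_min lexx.
have dlx : dl <= x / 2 by rewrite !ge_min lexx orbT.
have dls : dl <= (s - x) / 2 by rewrite !ge_min lexx !orbT.
have dlx' : dl < x by lra.
have dls' : dl < s - x by lra.
pose q := (1 + cos (2 * pi * (b * dl))) / 2.
pose r := (1 + cos (2 * pi * (b * (dl / 2)))) / 2.
have pi0 : 0 < (pi : R) by exact: pi_gt0.
have bdl : 0 < b * dl by rewrite mulr_gt0.
have bdl2 : 2 * (b * dl) <= 1.
  have : 2 * dl <= s by lra.
  rewrite -(ler_pM2l b0) bs => h; lra.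
have q0 : 0 <= q by rewrite divr_ge0// -lerBlDl sub0r cos_geN1.
have qr : q < r.
  rewrite /q /r ltr_pM2r// ltrD2l ltr_cos.
  - rewrite ltr_pM2l ?mulr_gt0// ltr_pM2l//; lra.
  - rewrite in_itv/= mulr_ge0/= ?mulr_ge0 ?(ltW pi0) ?(ltW b0) ?divr_ge0 ?(ltW dl0)//.
    rewrite mulrAC; apply: ler_piMl; first exact: ltW.
    by rewrite (_ : b * (dl / 2) = b * dl / 2); [lra|ring].
  - rewrite in_itv/= mulr_ge0/= ?mulr_ge0 ?(ltW pi0) ?(ltW b0) ?(ltW dl0)//.
    by rewrite mulrAC; apply: ler_piMl => //; exact: ltW.
have r0 : 0 < r by exact: le_lt_trans qr.
(* The far part contributes at most 2 M s q^n; divided by the mass dl r^n this is C (q/r)^n. *)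
pose C := 2 * M * s / dl.
have C0 : 0 <= C by rewrite /C divr_ge0 ?mulr_ge0 ?(ltW s0) ?(ltW dl0).
have : geometric C (q / r) @ \oo --> 0.
  apply: cvg_geometric; rewrite ger0_norm; last by rewrite divr_ge0// ltW.
  by rewrite ltr_pdivrMr// mul1r.
move=> /cvgrPdist_le/(_ _ e2)[N _ hN]; exists N => // n /= Nn.
have kl := @kap_lower n x dl dl0 dlx' dls'; rewrite -/r in kl.
have k0 : 0 < kap n 0 by apply: lt_le_trans kl; rewrite mulr_gt0// exprn_gt0.
rewrite distrC; case: (conv_diff n x) => [->|k00]; last by rewrite k00 ltxx in k0.
rewrite normrM ger0_norm ?invr_ge0 ?(ltW k0)// mulrC ler_pdivrMr//.
have igx : mu.-integrable Q (EFin \o (fun y => (g y - g x) * Kn n (x - y))).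
  apply: (@igK n x (fun y => g y - g x) (M + M)).
    by apply: measurable_funB => //; exact: measurable_cst.
  by move=> y; apply: le_trans (ler_normB _ _) _; apply: lerD.
apply: le_trans (le_normr_Rintegral mQ igx) _.
apply: (@le_trans _ _ (\int[mu]_(y in Q) (e / 2 * Kn n (x - y) + 2 * M * q ^+ n))).
  apply: le_Rintegral => //.
  - by have := integrable_norm igx.
  - have := @integrableD _ _ _ mu Q mQ _ _ (integrableZl mQ (e / 2) (iK n x)) (icst (2 * M * q ^+ n)).
    by [].
  move=> y Qy; rewrite normrM (ger0_norm (Kn_ge0 _ _)).
  have [near|far] := ltP `|x - y| dl.
    have h : `|g y - g x| <= e / 2.
      rewrite distrC; apply: hd => /=.
      by apply: lt_le_trans near _; lra.
    apply: (@le_trans _ _ (e / 2 * Kn n (x - y))); first by rewrite ler_wpM2r// Kn_ge0.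
    by rewrite lerDl mulr_ge0 ?exprn_ge0// mulr_ge0.
  have h1 : Kn n (x - y) <= q ^+ n.
    apply: lerXn2r; rewrite ?nnegrE ?half_cos_ge0//.
    rewrite ler_pM2r// lerD2l; apply: cos_far => //.
    move: Qy; rewrite /Q /= in_itv/= => /andP[y0 ys].
    by rewrite ler_norml; apply/andP; split; lra.
  have h2 : `|g y - g x| <= 2 * M.
    apply: le_trans (ler_normB _ _) _; rewrite mulrDl !mul1r; exact: lerD.
  apply: (@le_trans _ _ (2 * M * q ^+ n)).
    by apply: ler_pM => //; exact: Kn_ge0.
  by rewrite lerDr mulr_ge0 ?Kn_ge0// ltW.
have -> : \int[mu]_(y in Q) (e / 2 * Kn n (x - y) + 2 * M * q ^+ n) =
   e / 2 * kap n 0 + 2 * M * q ^+ n * s.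
  rewrite RintegralD//; last by have := integrableZl mQ (e / 2) (iK n x).
  by rewrite Rintegral_cst// muQ; congr (_ + _); rewrite RintegralZl// -(kap_cst n x).
have := hN n Nn; rewrite /= sub0r normrN ger0_norm; last first.
  by rewrite mulr_ge0// exprn_ge0// divr_ge0// ltW.
rewrite /C expr_div_n => h3.
suff : 2 * M * q ^+ n * s <= e / 2 * kap n 0 by lra.
apply: le_trans (ler_wpM2l (ltW e2) kl).
have rn : 0 < r ^+ n by exact: exprn_gt0.
have drn : 0 < dl * r ^+ n by rewrite mulr_gt0.
rewrite -ler_pdivrMr//; apply: le_trans h3.
rewrite le_eqVlt; apply/orP; left; apply/eqP; field.
by rewrite !gt_eqF.
Qed.

Lemma conv_bound n x : `|conv n x| <= M.
Proof.
have kge : 0 <= kap n 0 by apply: Rintegral_ge0 => y _; exact: Kn_ge0.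
have [k0|k0] := eqVneq (kap n 0) 0.
  by rewrite /conv k0 invr0 mul0r normr0.
have kp : 0 < kap n 0 by rewrite lt_neqAle eq_sym k0.
rewrite /conv normrM ger0_norm ?invr_ge0// mulrC ler_pdivrMr//.
have ig : mu.-integrable Q (EFin \o (fun y => g y * Kn n (x - y))) by exact: igK gM.
apply: le_trans (le_normr_Rintegral mQ ig) _.
rewrite -(kap_cst n x) /kap -RintegralZl//.
apply: le_Rintegral => //.
- by have := integrable_norm ig.
- by have := integrableZl mQ M (iK n x).
by move=> y _; rewrite normrM (ger0_norm (Kn_ge0 _ _)) ler_wpM2r// Kn_ge0.
Qed.

Let G : T -> R[i] := ind Q (fun x => ((g x)%:C)%C).

Lemma conv_lincomb n : exists r : seq (int * R[i]),
  ind Q (fun x => ((conv n x)%:C)%C) = lincomb E r.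
Proof.
have [r hr] := @convolve_rep g M mg gM n.
exists [seq (p.1, (((kap n 0)^-1)%:C)%C * (((p.2)%:C)%C * ip mu G (E p.1))) | p <- r].
apply/funext => x; rewrite /lincomb big_map.
have [Qx|nQx] := pselect (Q x); last first.
  by rewrite ind_out// big1// => p _; rewrite /E ind_out// mulr0.
rewrite ind_in// /conv RCM hr mulr_sumr; apply: eq_bigr => p _.
by rewrite /E ind_in// mulrA.
Qed.

Lemma clo_continuous : cloE G.
Proof.
have LGM (h : T -> R) : measurable_fun setT h -> (forall x, `|h x| <= M) ->
    LL mu (ind Q (fun x => ((h x)%:C)%C)).
  move=> mh hM; apply: (LL_ind_bounded mQ Qoo (M := M ^+ 2)); first exact: cmeasR.
  by move=> x; rewrite sqnR -real_normK ?num_real// ler_pXn2r ?nnegrE.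
have LG : LL mu G by exact: LGM.
split => // e e0.
pose F n : T -> R[i] := ind Q (fun x => ((conv n x)%:C)%C).
have LF n : LL mu (F n) by have [r hr] := conv_lincomb n; rewrite /F hr; exact: LL_lincomb.
have : (\int[mu]_x (sqn (G x - F n x))%:E @[n --> \oo] --> \int[mu]_x (cst 0%:E x))%E.
  have mGF n : measurable_fun setT (fun x => (sqn (G x - F n x))%:E).
    apply/measurable_EFinP/measurable_sqn.
    exact: cmeasB (LL_meas LG) (LL_meas (LF n)).
  have mB : measurable_fun setT (fun x : T => ((4 * M ^+ 2) * \1_Q x)%:E).
    apply/measurable_EFinP; apply: measurable_funM; first exact: measurable_cst.
    exact: measurable_indic.
  have [] := @dominated_convergence _ _ _ mu setT measurableT
    (fun n x => (sqn (G x - F n x))%:E) (cst 0%:E) (fun x => ((4 * M ^+ 2) * \1_Q x)%:E) mGF (measurable_cst _).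
  (* At the left end point of Q the convergence may fail, but a point is null. *)
  - have Z0 : mu [set 0] = 0%E by exact: (@lebesgue_measure_set1 R 0).
    exists [set 0]; split => // x /= /not_implyP[_]; apply: contra_notP => /eqP x0.
    have [Qx|nQx] := pselect (Q x); last first.
      have -> : (fun n => (sqn (G x - F n x))%:E) = cst 0%:E.
        by apply/funext => n; rewrite /G /F !ind_out// subrr sqn0.
      exact: cvg_cst.
    have -> : (fun n => (sqn (G x - F n x))%:E) = (fun n => ((g x - conv n x) ^+ 2)%:E).
      apply/funext => n; rewrite /G /F !ind_in//.
      by rewrite (_ : _ - _ = ((g x - conv n x)%:C)%C) ?sqnR// rmorphB.
    apply: cvg_EFin; first exact: nearW.
    have x01 : 0 < x < s.
      by move: Qx; rewrite /Q /= in_itv/= => /andP[h1 ->]; rewrite lt_neqAle eq_sym x0 h1.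
    have : (fun n => (g x - conv n x) * (g x - conv n x)) @ \oo --> (g x - g x) * (g x - g x).
      by apply: cvgM; apply: cvgB; [exact: cvg_cst|exact: conv_cvg|exact: cvg_cst|exact: conv_cvg].
    by rewrite subrr mul0r; apply: cvg_trans; apply: near_eq_cvg; near=> n; rewrite /= expr2.
  - apply/integrableP; split => //.
    rewrite (_ : (fun x => `|_|)%E = (fun x => (4 * M ^+ 2)%:E * (\1_Q x)%:E)%E); last first.
      by apply/funext => x; rewrite /= ger0_norm// mulr_ge0// mulr_ge0// sqr_ge0.
    rewrite ge0_integralZl_EFin//; last 2 first.
    + by apply/measurable_EFinP; exact: measurable_indic.
    + by rewrite mulr_ge0// sqr_ge0.
    by rewrite integral_indic// setIT lte_mul_pinfty// lee_fin mulr_ge0// sqr_ge0.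
  - apply: aeW => x n _; rewrite /= ger0_norm ?sqn_ge0// lee_fin indicE.
    have [Qx|nQx] := pselect (Q x); last first.
      by rewrite memNset// mulr0 /G /F !ind_out// subrr sqn0.
    rewrite mem_set// mulr1 /G /F !ind_in//.
    apply: le_trans (sqnD2 _ _) _; rewrite sqnN !sqnR.
    have h1 : g x ^+ 2 <= M ^+ 2.
      by rewrite -real_normK ?num_real// ler_pXn2r ?nnegrE.
    have h2 : conv n x ^+ 2 <= M ^+ 2.
      by rewrite -real_normK ?num_real// ler_pXn2r ?nnegrE// conv_bound.
    lra.
  by [].
rewrite integral0 => /fine_cvgP[_] /cvgrPdist_le/(_ (e ^+ 2) (exprn_gt0 2 e0))[N _ hN].
have [r hr] := conv_lincomb N; exists r.
rewrite -hr -(@ler_pXn2r _ 2)// ?nnegrE ?Nm_ge0 ?(ltW e0)// Nm2.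
have := hN N (leqnn N); rewrite /= sub0r normrN.
by apply: le_trans; exact: ler_norm.
Unshelve. all: by end_near.
Qed.

End Approx.

Lemma clip_le (t u M : R) : `|t| <= M -> `|t - Num.max (- M) (Num.min u M)| <= `|t - u|.
Proof.
rewrite ler_norml => /andP[t1 t2].
have [h1|h1] := leP u M; last first.
  have MM : - M <= M by lra.
  by rewrite (max_idPr MM) !ler0_norm; lra.
have [h2|h2] := leP (- M) u; first by [].
by rewrite !ger0_norm; lra.
Qed.

Lemma clip_bound (u M : R) : 0 <= M -> `|Num.max (- M) (Num.min u M)| <= M.
Proof.
move=> M0; rewrite ler_norml le_max lexx/= ge_max ge_min lexx orbT andbT; lra.
Qed.

(** Continuous functions are dense in L1 of the interval. Clipping the approximants at M keeps them
    continuous and takes them no farther from u, and then the squared L2 error is at most 2 M times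
    the L1 error. *)
Lemma clo_real (u : T -> R) (M : R) : measurable_fun setT u -> (forall x, `|u x| <= M) ->
  cloE (ind Q (fun x => ((u x)%:C)%C)).
Proof.
move=> mu_ uM; have M0 : 0 <= M := le_trans (normr_ge0 (u 0)) (uM 0).
have Lr (h : T -> R) : measurable_fun setT h -> (forall x, `|h x| <= M) ->
    LL mu (ind Q (fun x => ((h x)%:C)%C)).
  move=> mh hM; apply: (LL_ind_bounded mQ Qoo (M := M ^+ 2)); first exact: cmeasR.
  by move=> x; rewrite sqnR -real_normK ?num_real// ler_pXn2r ?nnegrE.
apply: (clo_lim LE) => [|e e0]; first exact: Lr.
have iu : mu.-integrable Q (EFin \o u) by exact: (integrable_bounded mQ Qoo mu_ uM).
have [g [cg ig]] := approximation_continuous_integrable mQ Qoo iu.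
have d0 : 0 < e ^+ 2 / (2 * M + 1) by rewrite divr_gt0 ?exprn_gt0//; lra.
move=> /fine_cvgP[fn] /cvgrPdist_le/(_ _ d0)[N2 _ hN2].
have [N1 _ hN1] := fn.
pose N := maxn N1 N2; have := hN2 N (leq_maxr _ _); have := hN1 N (leq_maxl _ _).
rewrite /= sub0r normrN => ff hN.
pose v x := Num.max (- M) (Num.min (g N x) M).
have cv : continuous (v : R -> R).
  move=> x; apply: (@continuous_max R R (cst (- M)) (fun x => Num.min (g N x) M)); first exact: cvg_cst.
  by apply: (@continuous_min R R (g N) (cst M)); [exact: cg|exact: cvg_cst].
have vM x : `|v x| <= M by exact: clip_bound.
have mv : measurable_fun setT (v : T -> R) by exact: continuous_measurable_fun.
exists (ind Q (fun x => ((v x)%:C)%C)); first exact: (clo_continuous (M := M)).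
rewrite -(@ler_pXn2r _ 2)// ?nnegrE ?Nm_ge0 ?(ltW e0)// Nm2.
rewrite -lee_fin -LL_fin; last by apply: LL_B; exact: Lr.
have mgN : measurable_fun setT (g N : T -> R) by exact: continuous_measurable_fun.
have mug : measurable_fun setT (fun x : T => `|(u x - g N x)%:E|%E).
  by apply: measurableT_comp => //; apply/measurable_EFinP; exact: measurable_funB.
apply: (@le_trans _ _ ((2 * M)%:E * \int[mu]_(x in Q) `|(u x - g N x)%:E|)%E).
  rewrite -ge0_integralZl//; last 2 first.
  - exact: measurable_funTS.
  - by rewrite lee_fin mulr_ge0.
  rewrite [leRHS]integral_mkcond; apply: ge0_le_integral => //.
  - by move=> x _; rewrite lee_fin sqn_ge0.
  - by apply/measurable_EFinP/measurable_sqn/LL_meas/LL_B; exact: Lr.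
  - apply/(measurable_restrictT _ mQ)/measurable_funTS.
    by apply: measurable_funeM.
  move=> x _; rewrite patchE; case: ifPn => [/set_mem Qx|/negP nQx]; last first.
    by rewrite !ind_out ?subrr ?sqn0// => Qx; apply: nQx; rewrite inE.
  rewrite !ind_in// -rmorphB sqnR -real_normK ?num_real// expr2 -EFinM lee_fin.
  apply: ler_pM => //; last exact: clip_le.
  apply: le_trans (ler_normB _ _) _; rewrite mulrDl !mul1r; exact: lerD.
rewrite -(fineK ff) -EFinM lee_fin.
move: hN; rewrite ger0_norm; last by apply: fine_ge0; exact: integral_ge0.
rewrite ler_pdivlMr; last lra.
apply: le_trans; rewrite mulrC ler_wpM2l//; last by lra.
by apply: fine_ge0; exact: integral_ge0.
Qed.

Lemma clo_bounded (f : T -> R[i]) (M : R) : cmeas f -> (forall x, sqn (f x) <= M) ->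
  cloE (ind Q f).
Proof.
move=> [mr mi] fM.
have M1 : 0 <= M by apply: le_trans (fM 0); exact: sqn_ge0.
have b1 x : `|complex.Re (f x)| <= M + 1.
  have := fM x; rewrite /sqn; move: (complex.Re _) (complex.Im _) => a c h.
  by rewrite ler_norml; apply/andP; split; nra.
have b2 x : `|complex.Im (f x)| <= M + 1.
  have := fM x; rewrite /sqn; move: (complex.Re _) (complex.Im _) => a c h.
  by rewrite ler_norml; apply/andP; split; nra.
have -> : ind Q f = fun x => ind Q (fun x => ((complex.Re (f x))%:C)%C) x +
    'i%C * ind Q (fun x => ((complex.Im (f x))%:C)%C) x.
  apply/funext => x; have [Qx|nQx] := pselect (Q x).
    by rewrite !ind_in// [LHS]complexE.
  by rewrite !ind_out// mulr0 addr0.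
by apply: cloD => //; [exact: clo_real mr b1|apply: cloZ => //; exact: clo_real mi b2].
Qed.

Lemma parseval1 (f : T -> R[i]) (M : R) : cmeas f -> (forall x, sqn (f x) <= M) ->
  (\esum_(l in setT) (sqn (ip mu (ind Q f) (ind Q (expo l))))%:E = s%:E * n2 mu (ind Q f))%E.
Proof. by move=> mf fM; apply: clo_parseval => //; exact: clo_bounded mf fM. Qed.

End Fourier1.

Lemma LL_ind_cvg d (T : measurableType d) (R : realType) (mu : {measure set T -> \bar R})
    (f : T -> R[i]) (A : nat -> set T) : LL mu f -> (forall n, measurable (A n)) ->
  (forall x, exists N, forall n, (N <= n)%N -> A n x) ->
  forall e : R, 0 < e -> exists N, forall n, (N <= n)%N -> Nm mu (fun x => f x - ind (A n) f x) <= e.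
Proof.
move=> Lf mA cA e e0.
have LA n : LL mu (ind (A n) f) by exact: LL_ind.
have : (\int[mu]_x (sqn (f x - ind (A n) f x))%:E @[n --> \oo] --> \int[mu]_x (cst 0%:E x))%E.
  have mfn n : measurable_fun setT (fun x => (sqn (f x - ind (A n) f x))%:E).
    by apply/measurable_EFinP/measurable_sqn; exact: LL_meas (LL_B Lf (LA n)).
  have [] := @dominated_convergence _ _ _ mu setT measurableT
    (fun n x => (sqn (f x - ind (A n) f x))%:E) (cst 0%:E) (fun x => (sqn (f x))%:E)
    mfn (measurable_cst _).
  - apply: aeW => x _; have [N hN] := cA x; apply: cvg_near_cst; exists N => // n /= Nn.
    by rewrite ind_in ?subrr ?sqn0//; exact: hN.
  - exact: integrable_sqn.
  - apply: aeW => x n _; rewrite /= ger0_norm ?sqn_ge0// lee_fin.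
    have [Ax|nAx] := pselect (A n x); first by rewrite ind_in// subrr sqn0 sqn_ge0.
    by rewrite ind_out// subr0.
  by [].
rewrite integral0 => /fine_cvgP[_] /cvgrPdist_le/(_ (e ^+ 2) (exprn_gt0 2 e0))[N _ hN].
exists N => n Nn; rewrite -(@ler_pXn2r _ 2)// ?nnegrE ?Nm_ge0 ?(ltW e0)// Nm2.
by have := hN n Nn; rewrite /= sub0r normrN; apply: le_trans; exact: ler_norm.
Qed.

(** * Fourier series on cubes, by induction on the dimension *)

Section Cubes.
Context {R : realType}.
Local Notation mu1 := (@lebesgue_measure R : {measure set (measurableTypeR R) -> \bar R}).
Local Notation mu d := (lebesgue R d).

Lemma esumZl (I : countType) (c : R) (a : I -> \bar R) : 0 <= c -> (forall i, 0 <= a i)%E ->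
  (\esum_(i in setT) (c%:E * a i) = c%:E * \esum_(i in setT) a i)%E.
Proof.
move=> c0 a0; rewrite !esum_nneseries//; last by move=> i; rewrite mule_ge0// lee_fin.
rewrite -nneseriesZl//; last by move=> n _; rewrite /enumf; case: pickle_inv => //= i.
apply: eq_eseriesr => n _; rewrite /enumf; case: pickle_inv => //=.
by rewrite mule0.
Qed.

(** Every slice is supposed integrable, not only almost every one, so that the inner integral is a
    real function of t with no exceptional set. Bounded functions cut to a cube satisfy this. *)
Lemma Rintegral_cons21 d (h : Rd R d.+1 -> R) :
  (mu d.+1).-integrable setT (EFin \o h) ->
  (forall t, mu1.-integrable setT (EFin \o (fun x => h (consd (x, t))))) ->
  \int[mu d.+1]_x h x = \int[mu d]_t \int[mu1]_x h (consd (x, t)) /\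
  measurable_fun setT (fun t => \int[mu1]_x h (consd (x, t))).
Proof.
move=> ih it; have mh : measurable_fun setT h by apply/measurable_EFinP; exact: measurable_int ih.
have mc : measurable_fun setT (fun p => (h (@consd R d p))%:E).
  by apply/measurable_EFinP; exact: measurableT_comp mh (@measurable_consd R d).
have ic : (mu1 \x mu d)%E.-integrable setT (fun p => (h (@consd R d p))%:E).
  apply/integrableP; split => //; case/integrableP: ih => _.
  rewrite integral_consE ge0_integral_pushforward//.
  - exact: measurable_consd.
  - by apply/measurable_EFinP; exact: measurableT_comp.
have E t : (\int[mu1]_x (h (consd (x, t)))%:E = (\int[mu1]_x h (consd (x, t)))%:E)%E.
  by rewrite /Rintegral fineK//; exact: integrable_fin_num (it t).
split.
  congr fine; rewrite integral_consE (integral_pushforward (@measurable_consd R d))//; last first.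
    exact/measurable_EFinP.
  rewrite preimage_setT -(integral21_prod_meas1 ic).
  by apply: eq_integral => t _; rewrite -E.
have := measurable_fubini_G ic; rewrite /fubini_G.
by rewrite (_ : (fun t => _) = EFin \o (fun t => \int[mu1]_x h (consd (x, t)))) => [/measurable_EFinP|]//;
  apply/funext => t; exact: E.
Qed.

Lemma cint_cons21 d (f : Rd R d.+1 -> R[i]) : cintb (mu d.+1) f ->
  (forall t, cintb mu1 (fun x => f (consd (x, t)))) ->
  cint (mu d.+1) f = cint (mu d) (fun t => cint mu1 (fun x => f (consd (x, t)))) /\
  cmeas (fun t => cint mu1 (fun x => f (consd (x, t)))).
Proof.
move=> [fr fi] h.
have [E1 m1] := Rintegral_cons21 fr (fun t => (h t).1).
have [E2 m2] := Rintegral_cons21 fi (fun t => (h t).2).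
by split; [apply: cplxP|split].
Qed.

Section Parseval.
Variable b : R.
Hypothesis b0 : 0 < b.
Local Notation s := (b^-1).
Let s0 : 0 < s. Proof. by rewrite invr_gt0. Qed.

Definition expd d (l : Zd d) : Rd R d -> R[i] := fun x =>
  cis (2 * pi * \sum_(i < d) b * (l i)%:~R * tnth x i).

Arguments expd d l x : simpl never.

Lemma cmeas_expd d (l : Zd d) : cmeas (expd l).
Proof.
have m : measurable_fun setT (fun x : Rd R d => 2 * pi * \sum_(i < d) b * (l i)%:~R * tnth x i : R).
  apply: measurable_funM; first exact: measurable_cst.
  apply: measurable_sum => i; apply: measurable_funM; first exact: measurable_cst.
  exact: measurable_tnth.
split.
  apply: (measurableT_comp _ m); apply: continuous_measurable_fun.
  exact: continuous_cos.
apply: (measurableT_comp _ m); apply: continuous_measurable_fun.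
exact: continuous_sin.
Qed.

Lemma sqn_expd d (l : Zd d) x : sqn (expd l x) = 1. Proof. exact: sqn_cis. Qed.

Lemma expd_per d (l k : Zd d) x : expd l (tadd x (lat s k)) = expd l x.
Proof.
rewrite /expd (_ : _ * _ = 2 * pi * (\sum_(i < d) b * (l i)%:~R * tnth x i) +
  2 * pi * (\sum_(i < d) l i * k i)%:~R).
  by rewrite cisD cis2pi mulr1.
rewrite -mulrDr; congr (_ * _); rewrite rmorph_sum -big_split/=; apply: eq_bigr => i _.
rewrite tnth_tadd tnth_lat intrM; field.
by rewrite gt_eqF.
Qed.

Definition zcons d (p : int * Zd d) : Zd d.+1 :=
  [ffun i => if unlift ord0 i is Some j then p.2 j else p.1].

Lemma zcons0 d (p : int * Zd d) : zcons p ord0 = p.1.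
Proof. by rewrite ffunE unlift_none. Qed.

Lemma zconsS d (p : int * Zd d) i : zcons p (lift ord0 i) = p.2 i.
Proof. by rewrite ffunE liftK. Qed.

Lemma zcons_bij d : set_bij [set: int * Zd d] [set: Zd d.+1] (@zcons d).
Proof.
split=> //.
  move=> [m l] [m' l'] _ _ h; congr pair.
    by have := congr1 (fun f : Zd d.+1 => f ord0) h; rewrite !zcons0.
  apply/ffunP => i; have := congr1 (fun f : Zd d.+1 => f (lift ord0 i)) h.
  by rewrite !zconsS.
move=> l _; exists (l ord0, [ffun i => l (lift ord0 i)]) => //.
apply/ffunP => i; case: (unliftP ord0 i) => [j|] ->; last by rewrite zcons0.
by rewrite zconsS ffunE.
Qed.

Lemma expd_cons d m (l : Zd d) x t :
  expd (zcons (m, l)) (consd (x, t)) = expo b m x * expd l t.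
Proof.
rewrite /expd /expo -cisD -mulrDr big_ord_recl zcons0 tnth0; congr (cis (_ * (_ + _))).
by apply: eq_bigr => i _; rewrite zconsS tnthS.
Qed.

Let Q : set (measurableTypeR R) := `[0, s[%classic.

Lemma ind_cube_cons d (f : Rd R d.+1 -> R[i]) x t :
  ind (cube d.+1 s) f (consd (x, t)) =
  ind (cube d s) (fun t => ind Q (fun x => f (consd (x, t))) x) t.
Proof.
have e : Q x <-> 0 <= x < s by rewrite /Q /= in_itv.
have [[Qx Ct]|h] := pselect (Q x /\ cube d s t).
  by rewrite !ind_in//; apply/cube_cons; rewrite -e.
rewrite [LHS]ind_out; last by move=> /cube_cons; rewrite -e.
have [Ct|nCt] := pselect (cube d s t); last by rewrite ind_out.
by rewrite ind_in// ind_out// => Qx; apply: h.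
Qed.

Let mQ : measurable Q. Proof. exact: measurable_itv. Qed.

Let Qoo : (mu1 Q < +oo)%E.
Proof. by rewrite /Q /= lebesgue_measure_itv/= lte_fin s0 -EFinB ltry. Qed.

Let Coo d : (mu d (cube d s) < +oo)%E.
Proof. by rewrite lebesgue_cube ?ltry// ltW. Qed.

Let mC d : measurable (cube d s). Proof. exact: measurable_cube. Qed.

Lemma LL_cube d (f : Rd R d -> R[i]) M : cmeas f -> (forall x, sqn (f x) <= M) ->
  LL (mu d) (ind (cube d s) f).
Proof. by move=> mf fM; exact: LL_ind_bounded (@mC d) (@Coo d) mf fM. Qed.

Lemma LL_expd d (l : Zd d) : LL (mu d) (ind (cube d s) (expd l)).
Proof. by apply: (LL_cube (M := 1)) => [|x]; [exact: cmeas_expd|rewrite sqn_expd]. Qed.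

Lemma indM di (T : measurableType di) (A : set T) (f g : T -> R[i]) x :
  ind A f x * conjc (ind A g x) = ind A (fun x => f x * conjc (g x)) x.
Proof.
have [Ax|nAx] := pselect (A x); first by rewrite !ind_in.
by rewrite !ind_out// mul0r.
Qed.

Lemma indK di (T : measurableType di) (A : set T) (f : T -> R[i]) : ind A (ind A f) = ind A f.
Proof.
apply/funext => x; have [Ax|nAx] := pselect (A x); first by rewrite ind_in.
by rewrite !(ind_out _ nAx).
Qed.

(** Let F_m(t) be the m-th Fourier coefficient of f in the first variable. The coefficient of f at
    (m, l) is the l-th coefficient of F_m, so the claim follows from the induction hypothesis for
    each F_m and Parseval's identity on the interval for each t. Boundedness is the hypothesis that
    passes to every slice and to F_m. *)
Lemma parseval_bounded d (f : Rd R d -> R[i]) M : cmeas f -> (forall x, sqn (f x) <= M) ->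
  (\esum_(l in setT) (sqn (ip (mu d) (ind (cube d s) f) (ind (cube d s) (expd l))))%:E
   = (s ^+ d)%:E * n2 (mu d) (ind (cube d s) f))%E.
Proof.
elim: d f M => [|d ih] f M mf fM.
  have C0 (x : Rd R 0) : cube 0 s x by case.
  rewrite (_ : setT = [set 0]); last by apply/seteqP; split => // l _; apply/ffunP => -[].
  rewrite esum_set1; last by rewrite lee_fin sqn_ge0.
  rewrite expr0 mul1e (_ : ind _ f = fun=> f [tuple]); last first.
    by apply/funext => x; rewrite ind_in//; congr f; exact: tuple0.
  rewrite /n2 /ip /= (@integral_dirac _ _ _ _ _ measurableT _ (measurable_cst _)) diracE mem_set// mul1e.
  have -> : cint \d_[tuple] (fun x => f [tuple] * conjc (ind (cube 0 s) (expd 0) x)) = f [tuple] * 1.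
    rewrite (_ : (fun x => _) = fun=> f [tuple] * 1); last first.
      apply/funext => x; rewrite ind_in// /expd big_ord0 mulr0 cis0.
      by rewrite conjc1.
    apply: cplxP; rewrite ?Re_cint ?Im_cint /Rintegral;
    by rewrite (@integral_dirac _ _ _ _ _ measurableT _ (measurable_cst _)) diracE mem_set// mul1e.
  by rewrite mulr1.
pose F m t := ip mu1 (ind Q (fun x => f (consd (x, t)))) (ind Q (expo b m)).
have mft t : cmeas (fun x => f (consd (x, t))) by exact: cmeas_comp (measurable_consd1 t) mf.
have Lt t : LL mu1 (ind Q (fun x => f (consd (x, t)))).
  exact: (@LL_ind_bounded _ _ R mu1 Q _ M mQ Qoo).
have LE m : LL mu1 (ind Q (expo b m)).
  apply: (@LL_ind_bounded _ _ R mu1 Q _ 1 mQ Qoo); first exact: cmeas_expo.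
  by move=> x; rewrite sqn_expo.
have h m l : ip (mu d.+1) (ind (cube d.+1 s) f) (ind (cube d.+1 s) (expd (zcons (m, l)))) =
    ip (mu d) (ind (cube d s) (F m)) (ind (cube d s) (expd l)) /\ cmeas (ind (cube d s) (F m)).
  have E t x : (ind (cube d.+1 s) f (consd (x, t)) *
      conjc (ind (cube d.+1 s) (expd (zcons (m, l))) (consd (x, t)))) =
      ind (cube d s) (fun t => conjc (expd l t)) t *
      (ind Q (fun x => f (consd (x, t))) x * conjc (ind Q (expo b m) x)).
    rewrite !ind_cube_cons; have [Ct|nCt] := pselect (cube d s t); last first.
      by rewrite 3?(ind_out _ nCt)// !mul0r.
    rewrite 3?(ind_in _ Ct)//; have [Qx|nQx] := pselect (Q x); last first.
      by rewrite 3?(ind_out _ nQx)// mul0r !mulr0.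
    by rewrite 3?(ind_in _ Qx)// expd_cons conjcM; ring.
  have [|t|h1 h2] := @cint_cons21 d (fun x => ind (cube d.+1 s) f x *
      conjc (ind (cube d.+1 s) (expd (zcons (m, l))) x)).
  - by apply: cintb_LL; [exact: (LL_cube (M := M))|exact: LL_expd].
  - rewrite (_ : (fun x => _) = (fun x => ind (cube d s) (fun t => conjc (expd l t)) t *
      (ind Q (fun x => f (consd (x, t))) x * conjc (ind Q (expo b m) x)))).
      by apply: cintbZ; apply: cintb_LL.
    by apply/funext => x; exact: E.
  have E' t : cint mu1 (fun x => ind (cube d.+1 s) f (consd (x, t)) *
       conjc (ind (cube d.+1 s) (expd (zcons (m, l))) (consd (x, t)))) =
     ind (cube d s) (F m) t * conjc (ind (cube d s) (expd l) t).
    rewrite (eq_cint _ (E t)) cintZ; last by apply: cintb_LL.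
    rewrite indM; have [Ct|nCt] := pselect (cube d s t); last by rewrite !ind_out// mul0r.
    by rewrite !ind_in// mulrC.
  split; first by rewrite /ip h1; apply: eq_cint.
  (* Fubini's theorem makes the product of [F m] with a conjugate exponential measurable;
     multiplying by the exponential, of modulus 1, recovers [F m]. *)
  have := cmeasM h2 (cmeas_ind (@mC d) (cmeas_expd l)).
  congr (cmeas _); apply/funext => t; rewrite E' -mulrA [conjc _ * _]mulrC mulcJ.
  have [Ct|nCt] := pselect (cube d s t); last by rewrite !ind_out// mul0r.
  by rewrite !ind_in// sqn_expd mulr1.
have FM m t : sqn (ind (cube d s) (F m) t) <= M * s * s.
  apply: le_trans (sqn_ind _ _ _) _; apply: le_trans (CS (Lt t) (LE m)) _.
  have b2 (h0 : measurableTypeR R -> R[i]) (c : R) : LL mu1 (ind Q h0) -> (forall x, sqn (h0 x) <= c) ->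
      N2 mu1 (ind Q h0) <= c * s.
    move=> L0 hc; rewrite -lee_fin -LL_fin//.
    apply: (@le_trans _ _ (\int[mu1]_(x in Q) (cst c%:E x))%E).
      rewrite [leRHS]integral_mkcond; apply: ge0_le_integral => //.
      - by move=> x _; rewrite lee_fin sqn_ge0.
      - by apply/measurable_EFinP/measurable_sqn; exact: LL_meas L0.
      - apply/(measurable_restrictT _ mQ); exact: measurable_cst.
      move=> x _; rewrite patchE; case: ifPn => [/set_mem Qx|/negP nQx].
        by rewrite ind_in// lee_fin.
      by rewrite ind_out ?sqn0// => Qx; apply: nQx; rewrite inE.
    by rewrite integral_cst// [mu1 Q]lebesgue_measure_itv/= lte_fin s0 oppr0 adde0 EFinM.
  apply: ler_pM; rewrite ?N2_ge0//; first exact: b2.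
  by rewrite -[s]mul1r; apply: b2 => // x; rewrite sqn_expo.
rewrite (reindex_esum [set: int * Zd d] setT (@zcons d)); last exact: zcons_bij.
have -> : [set: int * Zd d] = [set: int] `*`` (fun=> [set: Zd d]) by apply/seteqP; split.
rewrite -(@esum_esum _ _ _ setT (fun=> setT)
  (fun m l => (sqn (ip (mu d.+1) (ind (cube d.+1 s) f) (ind (cube d.+1 s) (expd (zcons (m, l))))))%:E)); last first.
  by move=> i j _ _; rewrite lee_fin sqn_ge0.
transitivity (\esum_(m in [set: int]) ((s ^+ d)%:E * n2 (mu d) (ind (cube d s) (F m))))%E.
  apply: eq_esum => m _; have := ih _ _ (h m 0).2 (FM m); rewrite indK => <-.
  by apply: eq_esum => l _; rewrite (h m l).1.
transitivity ((s ^+ d)%:E * \esum_(m in [set: int]) n2 (mu d) (ind (cube d s) (F m)))%E.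
  rewrite esumZl//; first by rewrite exprn_ge0// ltW.
  by move=> m; exact: n2_ge0.
rewrite exprSr EFinM -muleA; congr (_ * _)%E.
rewrite /n2 -integral_esum//; last 2 first.
- by move=> m; apply/measurable_EFinP/measurable_sqn; exact: (h m 0).2.
- by move=> m t; rewrite lee_fin sqn_ge0.
rewrite integral_cons21//; last 2 first.
- by apply/measurable_EFinP/measurable_sqn/(cmeas_ind (@mC _)).
- by move=> x; rewrite lee_fin sqn_ge0.
rewrite -ge0_integralZl//; last 3 first.
- have mfi : measurable_fun setT (fun x => (sqn (ind (cube d.+1 s) f x))%:E).
    by apply/measurable_EFinP/measurable_sqn/(cmeas_ind (@mC _)).
  apply: (@measurable_fun_fubini_tonelli_G _ _ _ _ _ mu1
    (fun p => (sqn (ind (cube d.+1 s) f (consd p)))%:E)).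
  - exact: measurableT_comp mfi (@measurable_consd R d).
  - by move=> p; rewrite lee_fin sqn_ge0.
- by move=> t _; apply: integral_ge0 => x _; rewrite lee_fin sqn_ge0.
- by rewrite lee_fin ltW.
apply: eq_integral => t _; have [Ct|nCt] := pselect (cube d s t); last first.
  rewrite esum1; last by move=> m _; rewrite ind_out// sqn0.
  rewrite integral0_eq ?mule0// => x _.
  by rewrite ind_cube_cons ind_out// sqn0.
have := @parseval1 R b b0 (fun x => f (consd (x, t))) M (mft t) (fun x => fM _).
rewrite /n2 => P1; under eq_esum do rewrite ind_in//.
rewrite P1; congr (_ * _)%E; apply: eq_integral => x _.
rewrite ind_cube_cons (ind_in (fun t => ind Q (fun x => f (consd (x, t))) x) Ct).
by [].
Qed.

(** Read off from Parseval's identity for the exponential of index l: its own coefficient already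
    accounts for the whole sum, so all the others vanish. *)
Lemma orth_expd d (l m : Zd d) :
  ip (mu d) (ind (cube d s) (expd l)) (ind (cube d s) (expd m)) =
  ((if l == m then s ^+ d else 0)%:C)%C.
Proof.
have n2e : n2 (mu d) (ind (cube d s) (expd l)) = (s ^+ d)%:E.
  have s0' : 0 <= s by exact: ltW.
  rewrite -(@lebesgue_cube R d _ s0') -[X in mu d X]setIT -integral_indic//; last exact: measurable_cube.
  apply: eq_integral => x _; rewrite indicE.
  have [Cx|nCx] := pselect (cube d s x); first by rewrite ind_in// sqn_expd mem_set.
  by rewrite ind_out// sqn0 memNset.
have N2e : N2 (mu d) (ind (cube d s) (expd l)) = s ^+ d by rewrite /N2 n2e.
case: eqVneq => [<-|lm]; first by rewrite ipff N2e.
apply: sqn_eq0; apply/eqP; rewrite eq_le sqn_ge0 andbT.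
have := @parseval_bounded d (expd l) 1 (cmeas_expd l) (fun x => ltac:(by rewrite sqn_expd)).
rewrite n2e => h.
have := @fset_le_esum R _ (fun m => (sqn (ip (mu d) (ind (cube d s) (expd l)) (ind (cube d s) (expd m))))%:E)
  [fset l; m]%fset (fun m => ltac:(by rewrite lee_fin sqn_ge0)).
rewrite h big_fsetU1/= ?in_fset1// big_seq_fset1 ipff N2e sqnR -EFinD -EFinM lee_fin.
by rewrite expr2 gerDl.
Qed.

(** Bounded functions belong to the closed span by the converse of Parseval's identity; cutting f
    where |f|^2 > n approximates it by such functions. *)
Lemma clo_cube d (f : Rd R d -> R[i]) : LL (mu d) f ->
  clo (mu d) (fun l => ind (cube d s) (expd l)) (ind (cube d s) f).
Proof.
move=> Lf; have LE := @LL_expd d; apply: (clo_lim LE) => [|e e0]; first exact: LL_ind (@mC d) Lf.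
pose A n := [set x | sqn (f x) <= n%:R].
have mA n : measurable (A n).
  have := measurable_sqn (LL_meas Lf) measurableT (measurable_itv `]-oo, n%:R]).
  rewrite setTI; congr measurable; apply/seteqP; split=> x /=; by rewrite in_itv.
have LC := LL_ind (@mC d) Lf.
have [|N hN] := LL_ind_cvg LC mA _ e0.
  move=> x; exists (Num.truncn (sqn (f x))).+1 => n Nn; rewrite /A /=.
  apply: le_trans (ltW (truncnS_gt _)) _; by rewrite ler_nat.
exists (ind (A N) (ind (cube d s) f)); last exact: hN.
have mAf : cmeas (ind (A N) f) by exact: cmeas_ind (mA N) (LL_meas Lf).
have AfM x : sqn (ind (A N) f x) <= N%:R.
  have [Ax|nAx] := pselect (A N x); first by rewrite ind_in.
  by rewrite ind_out// sqn0.
rewrite (_ : ind _ _ = ind (cube d s) (ind (A N) f)); last first.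
  by apply/funext => x; rewrite /ind mulrCA.
apply: (parseval_clo _ LE (@orth_expd d)); first by rewrite exprn_gt0.
  exact: LL_cube mAf AfM.
exact: parseval_bounded mAf AfM.
Qed.

Lemma parseval_cube d (f : Rd R d -> R[i]) : LL (mu d) f ->
  (\esum_(l in setT) (sqn (ip (mu d) (ind (cube d s) f) (ind (cube d s) (expd l))))%:E
   = (s ^+ d)%:E * n2 (mu d) (ind (cube d s) f))%E.
Proof.
move=> Lf; apply: (clo_parseval _ (@LL_expd d) (@orth_expd d)); last exact: clo_cube.
by rewrite exprn_gt0.
Qed.

End Parseval.
End Cubes.

(** * Fibers of Gabor systems *)

Lemma fset_pick (V : nmodType) (I : choiceType) (K : {fset I}) (k0 : I) (a : V) :
  k0 \in K -> \sum_(k <- K) (if k == k0 then a else 0) = a.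
Proof.
by move=> h; rewrite (big_fsetD1 k0)//= eqxx big_seq big1 ?addr0// => k; rewrite in_fsetD1 => /andP[/negbTE ->].
Qed.

Lemma sum_rectangle (V : nmodType) (I I' : choiceType) (J : {fset I * I'}) (K : {fset I})
    (L : {fset I'}) (F : I * I' -> V) : (forall p, p \in J -> p.1 \in K /\ p.2 \in L) ->
  \sum_(p <- J) F p = \sum_(k <- K) \sum_(l <- L) if (k, l) \in J then F (k, l) else 0.
Proof.
move=> JKL.
transitivity (\sum_(k <- K) \sum_(l <- L) \sum_(p <- J) if p == (k, l) then F p else 0); last first.
  apply: eq_bigr => k _; apply: eq_bigr => l _; case: ifPn => h.
    rewrite -[RHS](fset_pick (F (k, l)) h); apply: eq_bigr => p _.
    by case: eqVneq => // ->.
  by rewrite big_seq big1// => p pJ; case: eqVneq => // E; rewrite -E pJ in h.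
under [RHS]eq_bigr => k _ do rewrite exchange_big/=.
rewrite exchange_big/= big_seq [RHS]big_seq; apply: eq_bigr => p pJ.
have [pK pL] := JKL p pJ.
rewrite -[LHS](fset_pick _ pK); apply: eq_bigr => k _.
case: eqVneq => [->|kp].
  rewrite -[LHS](fset_pick (F p) pL); apply: eq_bigr => l _.
  by rewrite -pair_eqE /= eqxx/= eq_sym.
by rewrite big1// => l _; rewrite -pair_eqE /= eq_sym (negbTE kp).
Qed.

Lemma esum_fin (R : realType) (I : choiceType) (K : {fset I}) (a : I -> \bar R) :
  (forall i, 0 <= a i)%E -> (forall i, i \notin K -> a i = 0)%E ->
  (\esum_(i in setT) a i = \sum_(i <- K) a i)%E.
Proof.
move=> a0 aK; apply/eqP; rewrite eq_le; apply/andP; split; last exact: fset_le_esum.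
apply: esum_le_fset => B.
rewrite (big_fsetID _ (mem K))/= [X in (_ + X)%E]big_seq [X in (_ + X)%E]big1 ?adde0; last first.
  by move=> i; rewrite !inE/= => /andP[_ /aK].
rewrite [leRHS](big_fsetID _ (mem B))/=.
rewrite (_ : [fset x in K | x \in B]%fset = [fset x in B | x \in K]%fset) ?leeDl ?sume_ge0//.
by apply/fsetP => i; rewrite !inE andbC.
Qed.

Lemma esum_opp (R : realType) (V : zmodType) (a : V -> \bar R) :
  (\esum_(i in setT) a i = \esum_(i in setT) a (- i)%R)%E.
Proof.
apply: (@reindex_esum R V V setT setT (fun i => - i) a).
split=> [//|x y _ _|x _]; first exact: oppr_inj.
by exists (- x) => //; rewrite opprK.
Qed.

Lemma esum_addr (R : realType) (V : zmodType) (a : V -> \bar R) (k : V) :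
  (\esum_(i in setT) a i = \esum_(i in setT) a (i + k)%R)%E.
Proof.
apply: (@reindex_esum R V V setT setT (fun i => i + k) a).
split=> [//|x y _ _|x _]; first exact: addIr.
by exists (x - k) => //; rewrite subrK.
Qed.

Lemma taddAC (R : realType) d (x a b : Rd R d) : tadd (tadd x a) b = tadd (tadd x b) a.
Proof. by apply: eq_from_tnth => i; rewrite !tnth_tadd addrAC. Qed.

Section Basics.
Context {R : realType} {d : nat}.
Local Notation mu := (lebesgue R d).
Implicit Types (f g h : Rd R d -> R[i]) (x : Rd R d).

Lemma sqnorm_L2E f : sqnorm_L2 f = n2 mu f.
Proof. by apply: eq_integral => x _; rewrite normc_sqn. Qed.

Lemma L2E f : L2 f <-> LL mu f.
Proof.
rewrite /L2 /LL /= sqnorm_L2E; split=> [[h1 h2 h3]|[[h1 h2] h3]]; first by split.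
by split.
Qed.

Lemma cmeas_shift f a : cmeas f -> cmeas (fun x => f (tadd x a)).
Proof. by move=> mf; apply: cmeas_comp mf; exact: measurable_tadd. Qed.

Lemma n2_shift f a : cmeas f -> n2 mu (fun x => f (tadd x a)) = n2 mu f.
Proof.
move=> mf; apply: (integral_shift a (f := fun x => (sqn (f x))%:E)).
  by apply/measurable_EFinP; exact: measurable_sqn.
by move=> x; rewrite lee_fin sqn_ge0.
Qed.

Lemma LL_shift f a : LL mu f -> LL mu (fun x => f (tadd x a)).
Proof. by move=> [mf nf]; split; [exact: cmeas_shift|rewrite n2_shift]. Qed.

Lemma Rintegral_shift (h : Rd R d -> R) a : measurable_fun setT h ->
  \int[mu]_x h (tadd x a) = \int[mu]_x h x.
Proof.
move=> mh; congr fine; rewrite integralE [RHS]integralE; congr (_ - _)%E.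
  transitivity (\int[mu]_x ((EFin \o h)^\+%E (tadd x a)))%E.
    by apply: eq_integral => x _; rewrite !funeposE.
  rewrite (integral_shift a) => [//||x]; last by rewrite funepos_ge0.
  by apply: measurable_funepos; exact/measurable_EFinP.
transitivity (\int[mu]_x ((EFin \o h)^\-%E (tadd x a)))%E.
    by apply: eq_integral => x _; rewrite !funenegE.
  rewrite (integral_shift a) => [//||x]; last by rewrite funeneg_ge0.
by apply: measurable_funeneg; exact/measurable_EFinP.
Qed.

Lemma cint_shift f a : cmeas f -> cint mu (fun x => f (tadd x a)) = cint mu f.
Proof.
move=> [mr mi]; apply: cplxP; rewrite !(Re_cint, Im_cint).
  exact: (Rintegral_shift a mr).
exact: (Rintegral_shift a mi).
Qed.

Lemma cintb_shift f a : cintb mu f -> cmeas f -> cintb mu (fun x => f (tadd x a)).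
Proof.
have h (u : Rd R d -> R) : measurable_fun setT u -> mu.-integrable setT (EFin \o u) ->
    mu.-integrable setT (EFin \o (fun x => u (tadd x a))).
  move=> mu_ /integrableP[_ iu]; apply/integrableP; split.
    by apply/measurable_EFinP; exact: measurableT_comp mu_ (measurable_tadd a).
  rewrite (integral_shift a (f := fun x => `|(u x)%:E|%E))//.
  by apply: measurableT_comp => //; exact/measurable_EFinP.
by move=> [i1 i2] [m1 m2]; split; [exact: h m1 i1|exact: h m2 i2].
Qed.

Lemma shift_ptE (a b : R) x (j k : Zd d) :
  shift_pt a b x j k = tadd (tadd x (lat a j)) (lat b^-1 (- k)).
Proof.
apply: eq_from_tnth => i; rewrite !tnth_tadd !tnth_lat tnth_mktuple ffunE mulrNz mulrN.
by rewrite [b^-1 * _]mulrC.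
Qed.

Lemma gaborE g (a b : R) (p : Zd d * Zd d) :
  gabor g a b p = fun t => expd b p.2 t * g (tadd t (lat a (- p.1))).
Proof.
apply/funext => t; rewrite /gabor /tf_shift /=; congr (_ * g _).
  rewrite /expd -[LHS]/(cis _); congr (cis (_ * _)).
  by apply: eq_bigr => i _; rewrite tnth_mktuple.
by apply: eq_from_tnth => i; rewrite tnth_tadd tnth_lat !tnth_mktuple ffunE mulrNz mulrN.
Qed.

Lemma LL_expdM (b : R) (l : Zd d) f : LL mu f -> LL mu (fun t => expd b l t * f t).
Proof.
move=> Lf; apply: (LL_bM (M := 1)) => //; first exact: cmeas_expd.
by move=> x; rewrite sqn_expd.
Qed.

Lemma LL_gabor g (a b : R) p : LL mu g -> LL mu (gabor g a b p).
Proof. by move=> Lg; rewrite gaborE; apply: LL_expdM; exact: LL_shift. Qed.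

Section Fiber.
Variables (g : Rd R d -> R[i]) (a b : R).
Hypotheses (Lg : LL mu g) (a0 : 0 < a) (b0 : 0 < b).
Local Notation s := (b^-1).
Let s0 : 0 < s. Proof. by rewrite invr_gt0. Qed.
Let mC t : measurable (@cube R d t). Proof. exact: measurable_cube. Qed.
Local Notation P := (pre_gramian g a b).
Local Notation e := (lat s).

Lemma cmeas_pre j k : cmeas (fun x => P x j k).
Proof.
apply: cmeasJ; rewrite (_ : (fun x => _) = fun x => g (tadd (tadd x (lat a j)) (e (- k)))).
  apply: (cmeas_shift (f := fun x => g (tadd x (e (- k))))).
  by apply: cmeas_shift; exact: LL_meas Lg.
by apply/funext => x; rewrite shift_ptE.
Qed.

Lemma measurable_fin_norm K (c : Zd d -> Rd R d -> R[i]) : (forall k, cmeas (c k)) ->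
  measurable_fun setT (fun x => fin_norm (P x) K (fun k => c k x)).
Proof.
move=> mc; apply: (emeasurable_esum (f := fun j x => (sqn (\sum_(k <- K) P x j k * c k x))%:E)).
  move=> j; apply/measurable_EFinP/measurable_sqn/cmeas_sum => k.
  by apply: cmeasM => //; exact: cmeas_pre.
by move=> j x; rewrite lee_fin sqn_ge0.
Qed.

Lemma fin_norm_ge0 M K (c : Zd d -> R[i]) : (0 <= fin_norm M K c)%E.
Proof. by apply: esum_ge0 => j _; rewrite lee_fin sqn_ge0. Qed.

Section Supp.
Variables (F : Rd R d -> R[i]) (K : {fset Zd d}) (M : R).
Hypotheses (mF : cmeas F) (FM : forall x, sqn (F x) <= M).
Hypothesis FK : forall x, F x <> 0 -> - cell s x \in K.

Lemma cube_shift x k : cube d s x -> F (tadd x (e (- k))) <> 0 -> k \in K.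
Proof.
move=> Cx /FK; rewrite (_ : cell s _ = - k) ?opprK//; apply/esym/cube_cell => //.
by rewrite tadd_latNK.
Qed.

Lemma n2_fiber : (n2 mu F = \int[mu]_(x in cube d s) (\sum_(k <- K) sqn (F (tadd x (e (- k)))))%R%:E)%E.
Proof.
have mf : measurable_fun setT (fun x => (sqn (F x))%:E) by apply/measurable_EFinP/measurable_sqn.
rewrite /n2 (tiling_in s0 mf) => [|x]; last by rewrite lee_fin sqn_ge0.
apply: eq_integral => x /set_mem Cx; rewrite esum_opp (@esum_fin _ _ K) ?sumEFin//.
  by move=> i; rewrite lee_fin sqn_ge0.
move=> k kK; have [->|/eqP h] := eqVneq (F (tadd x (e (- k)))) 0; first by rewrite sqn0.
by rewrite (cube_shift Cx h) in kK.
Qed.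

Lemma cint_tile h : cmeas h -> (forall x, F x = 0 -> h x = 0) ->
  (forall k, cintb mu (ind (cube d s) (fun x => h (tadd x (e (- k)))))) ->
  cint mu h = \sum_(k <- K) cint mu (ind (cube d s) (fun x => h (tadd x (e (- k))))).
Proof.
move=> mh Fh ih.
have mt k : cmeas (ind (cube d s) (fun x => h (tadd x (e (- k))))).
  by apply: cmeas_ind => //; exact: cmeas_shift.
transitivity (cint mu (fun x => \sum_(k <- K) ind (cube d s) (fun x => h (tadd x (e (- k)))) (tadd x (e k)))).
  apply: eq_cint => x.
  have [Fx|/eqP Fx] := eqVneq (F x) 0.
    rewrite Fh// big1// => k _; rewrite /ind -[X in _ * h X]/(tadd (tadd x (e k)) (e (- k))).
    by rewrite tadd_latNK Fh// mulr0.
  rewrite (big_fsetD1 (- cell s x)) /=; last exact: FK.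
  rewrite ind_in ?tadd_latNK; last exact/cube_cell.
  rewrite big_seq big1 ?addr0// => k; rewrite in_fsetD1 => /andP[kx _].
  rewrite ind_out// => Cx; have /(cube_cell x (- k) s0) E : cube d s (tadd x (e (- - k))) by rewrite opprK.
  by rewrite -E opprK eqxx in kx.
rewrite cint_sum; last first.
  by move=> k; apply: cintb_shift; [exact: ih|exact: mt].
by apply: eq_bigr => k _; rewrite cint_shift.
Qed.

Let hj j x := \sum_(k <- K) P x j k * F (tadd x (e (- k))).

(** The modulations have period 1/b, hence the inner product with the element (-j, l) is the l-th
    Fourier coefficient on the cube of sum_k P(x)_jk F(x - k/b). Since F is bounded and meets
    finitely many cells, this sum is finite and square-integrable, and Parseval's identity applies
    for each j. *)
Lemma fiber_identity :
  (\esum_(p in setT) (sqn (ip mu F (gabor g a b p)))%:E =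
   (s ^+ d)%:E * \int[mu]_(x in cube d s) fin_norm (P x) K (fun k => F (tadd x (e (- k))%R)))%E.
Proof.
have LP j k : LL mu (fun x => P x j k).
  apply: LL_J; rewrite (_ : (fun x => _) = fun x => g (tadd (tadd x (lat a j)) (e (- k)))).
    by apply: (LL_shift (f := fun x => g (tadd x (e (- k))))); exact: LL_shift.
  by apply/funext => x; rewrite shift_ptE.
have Lh j : LL mu (hj j).
  apply: LL_sum => k.
  have -> : (fun x => P x j k * F (tadd x (e (- k)))) = (fun x => F (tadd x (e (- k))) * P x j k).
    by apply/funext => x; rewrite mulrC.
  by apply: (LL_bM (M := M)) => //; exact: cmeas_shift.
(* The index is -j because translation by -a j evaluates g at x + a j, as row j of P(x) does;
   [esum_opp] absorbs the sign. *)
have E j l : ip mu F (gabor g a b (- j, l)) = ip mu (ind (cube d s) (hj j)) (ind (cube d s) (expd b l)).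
  have gE t : gabor g a b (- j, l) t = expd b l t * g (tadd t (lat a j)) by rewrite gaborE opprK.
  have Lgb := LL_gabor a b (- j, l) Lg.
  have LFk k : LL mu (ind (cube d s) (fun x => F (tadd x (e (- k))))).
    by apply: (LL_cube b0 (M := M)) => //; exact: cmeas_shift.
  have F0 x : F x = 0 -> F x * conjc (gabor g a b (- j, l) x) = 0 by move=> ->; rewrite mul0r.
  have q k : ind (cube d s) (fun x => F (tadd x (e (- k))) * conjc (gabor g a b (- j, l) (tadd x (e (- k))))) =
     fun x => ind (cube d s) (fun x => F (tadd x (e (- k)))) x * conjc (gabor g a b (- j, l) (tadd x (e (- k)))).
    by apply/funext => x; rewrite /ind mulrA.
  rewrite /ip (cint_tile _ F0); last 2 first.
  - by apply: cmeasM => //; exact: cmeasJ (LL_meas Lgb).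
  - by move=> k; rewrite q; apply: cintb_LL => //; exact: LL_shift.
  rewrite -cint_sum; last by move=> k; rewrite q; apply: cintb_LL => //; exact: LL_shift.
  apply: eq_cint => x; have [Cx|nCx] := pselect (cube d s x); last first.
    by rewrite (ind_out _ nCx) mul0r big1// => k _; rewrite (ind_out _ nCx).
  rewrite !(ind_in _ Cx) /hj mulr_suml; apply: eq_bigr => k _.
  rewrite (ind_in _ Cx) gE expd_per// conjcM /pre_gramian shift_ptE.
  rewrite [tadd (tadd x (e _)) _]taddAC mulrA [RHS]mulrC.
  by rewrite [F _ * _]mulrC -mulrA; congr (_ * _); exact: mulrC.
rewrite (_ : setT = [set: Zd d] `*`` (fun=> [set: Zd d])); last by apply/seteqP; split.
rewrite -(@esum_esum _ _ _ setT (fun=> setT)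
  (fun j l => (sqn (ip mu F (gabor g a b (j, l))))%:E)); last first.
  by move=> i j _ _; rewrite lee_fin sqn_ge0.
rewrite esum_opp.
transitivity (\esum_(j in [set: Zd d]) ((s ^+ d)%:E * n2 mu (ind (cube d s) (hj j))))%E.
  apply: eq_esum => j _; rewrite -parseval_cube//.
  by apply: eq_esum => l _; rewrite E.
rewrite esumZl; [|by rewrite exprn_ge0// ltW|by move=> j; exact: n2_ge0].
congr (_ * _)%E; rewrite /n2 -integral_esum; last 2 first.
- by move=> j; apply/measurable_EFinP/measurable_sqn/LL_meas/LL_ind.
- by move=> j x; rewrite lee_fin sqn_ge0.
rewrite [RHS]integral_mkcond; apply: eq_integral => x _; rewrite patchE.
case: ifPn => [/set_mem Cx|/negP nCx].
  by apply: eq_esum => j _; rewrite ind_in.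
by rewrite esum1// => j _; rewrite ind_out ?sqn0// => Cx; apply: nCx; rewrite inE.
Qed.

End Supp.

End Fiber.
End Basics.

(** * From integral inequalities to pointwise ones *)

Section AEbounds.
Context d (T : measurableType d) (R : realType).
Variable mu : {measure set T -> \bar R}.
Variables (D : set T) (h : T -> \bar R) (C : R).
Hypotheses (mD : measurable D) (Doo : (mu D < +oo)%E).
Hypotheses (mh : measurable_fun setT h) (h0 : forall x, (0 <= h x)%E) (C0 : 0 <= C).

Let slack n : R := n.+1%:R^-1.
Let slack0 n : 0 < slack n. Proof. by rewrite invr_gt0. Qed.

Let slack_small (e : R) : 0 < e -> exists n, slack n <= e.
Proof.
move=> e0; exists (Num.truncn e^-1); rewrite /slack -[leRHS]invrK lef_pV2 ?posrE ?invr_gt0//.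
by rewrite ltW// truncnS_gt.
Qed.

Let null (E : set T) : measurable E -> E `<=` D -> (mu E <= 0)%E -> {ae mu, forall x, ~ E x}.
Proof.
move=> mE ED E0; exists E; split=> //; last by move=> x /contrapT.
by apply/eqP; rewrite eq_le E0 measure_ge0.
Qed.

Let muE (E : set T) : measurable E -> E `<=` D -> mu E = (fine (mu E))%:E.
Proof.
move=> mE ED; rewrite fineK// ge0_fin_numE//; apply: le_lt_trans Doo.
by apply: le_measure => //; rewrite inE.
Qed.

(** On the part of D where h >= C + 1/(n+1) the integral inequality forces measure 0; the finite
    measure of D allows the subtraction. *)
Lemma ae_le_of_int :
  (forall E, measurable E -> E `<=` D -> (\int[mu]_(x in E) h x <= C%:E * mu E)%E) ->
  {ae mu, forall x, D x -> (h x <= C%:E)%E}.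
Proof.
move=> hE; pose E n := D `&` [set x | ((C + slack n)%:E <= h x)%E].
have mE n : measurable (E n).
  by apply: measurableI => //; rewrite -[X in measurable X]setTI; exact: emeasurable_fun_c_infty.
have ED n : E n `<=` D by move=> x [].
have : {ae mu, forall x, forall n, ~ E n x}.
  apply: ae_foralln => n; apply: null => //.
  have h1 : ((C + slack n)%:E * mu (E n) <= C%:E * mu (E n))%E.
    apply: le_trans (hE _ (mE n) (ED n)).
    rewrite -(integral_cst mu (mE n)); apply: ge0_le_integral => //.
    - by move=> x _; rewrite lee_fin addr_ge0// ltW.
    - exact: measurable_funTS.
    - by move=> x [].
  rewrite (muE (mE n) (@ED n)) -!EFinM !lee_fin in h1 *.
  by move: h1; rewrite mulrDl gerDl pmulr_rle0.
apply: filterS => x hx Dx; apply/lee_addgt0Pr => e /slack_small[n ne].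
rewrite leNgt; apply/negP => hC; apply: (hx n); split => //=.
by apply: le_trans (ltW hC); rewrite -EFinD lee_fin lerD2l.
Qed.

Lemma ae_ge_of_int :
  (forall E, measurable E -> E `<=` D -> (C%:E * mu E <= \int[mu]_(x in E) h x)%E) ->
  {ae mu, forall x, D x -> (C%:E <= h x)%E}.
Proof.
move=> hE; pose E n := D `&` [set x | (h x <= (C - slack n)%:E)%E].
have mE n : measurable (E n).
  by apply: measurableI => //; rewrite -[X in measurable X]setTI; exact: emeasurable_fun_infty_c.
have ED n : E n `<=` D by move=> x [].
have : {ae mu, forall x, forall n, ~ E n x}.
  apply: ae_foralln => n; apply: null => //.
  (* A negative threshold makes [E n] empty because h >= 0; otherwise the threshold can be
     integrated as a nonnegative constant. *)
  have [Cn|Cn] := leP 0 (C - slack n); last first.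
    rewrite (_ : E n = set0) ?measure0//; apply/seteqP; split => // x [_ /=] hx.
    by have := le_trans (h0 x) hx; rewrite lee_fin leNgt Cn.
  have h1 : (C%:E * mu (E n) <= (C - slack n)%:E * mu (E n))%E.
    apply: le_trans (hE _ (mE n) (@ED n)) _.
    rewrite -(integral_cst mu (mE n)); apply: ge0_le_integral => //.
    - exact: measurable_funTS.
    - by move=> x [].
  rewrite (muE (mE n) (@ED n)) -!EFinM !lee_fin in h1 *.
  by move: h1; rewrite mulrBl lerBrDr gerDl pmulr_rle0.
apply: filterS => x hx Dx; apply/lee_subgt0Pr => e /slack_small[n ne].
rewrite leNgt; apply/negP => hC; apply: (hx n); split => //=.
by apply: le_trans (ltW hC) _; rewrite -EFinB lee_fin lerD2l lerN2.
Qed.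

End AEbounds.

(** * Reduction to rational coefficients *)

Section Density.
Context {R : realType} {I : countType} {i0 : I}.
Implicit Types (c : I -> R[i]) (K : {fset I}) (M : I -> I -> R[i]).
Local Notation cnt := (@cnt R I i0).
Local Notation LLc := (@LL _ (disc i0) R cnt).
Local Notation Nmc := (@Nm _ (disc i0) R cnt).

(* Countably many coefficient vectors, so that null sets depending on the vector
   can be united. *)
Definition ratc K (q : seq (rat * rat)) : I -> R[i] := fun k =>
  let p := nth (0, 0) q (index k (enum_fset K)) in (ratr p.1 +i* ratr p.2)%C.

Lemma rat_approx (x e : R) : 0 < e -> exists q : rat, `|x - ratr q| <= e.
Proof.
move=> e0; have [|q] := @rat_in_itvoo R (x - e) (x + e); first lra.
rewrite in_itv/= => /andP[h1 h2]; exists q; rewrite ler_norml; lra.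
Qed.

Lemma sqrt_sqn_le (a b e : R) : `|a| <= e / 2 -> `|b| <= e / 2 -> Num.sqrt (sqn (a +i* b)%C) <= e.
Proof.
move=> h1 h2; have e0 : 0 <= e by have := le_trans (normr_ge0 a) h1; lra.
rewrite -[leRHS](ger0_norm e0) -sqrtr_sqr ler_wsqrtr// /sqn /=.
have : a ^+ 2 <= (e / 2) ^+ 2 by rewrite -real_normK ?num_real// ler_pXn2r ?nnegrE ?divr_ge0.
have : b ^+ 2 <= (e / 2) ^+ 2 by rewrite -real_normK ?num_real// ler_pXn2r ?nnegrE ?divr_ge0.
nra.
Qed.

Lemma ratc_approx c K (e : R) : 0 < e -> exists q, forall k, k \in K ->
  Num.sqrt (sqn (c k - ratc K q k)) <= e.
Proof.
move=> e0; have e2 : 0 < e / 2 by lra.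
have h (k : I) : exists p : rat * rat, Num.sqrt (sqn (c k - (ratr p.1 +i* ratr p.2)%C)) <= e.
  have [p hp] := rat_approx (complex.Re (c k)) e2.
  have [q hq] := rat_approx (complex.Im (c k)) e2.
  exists (p, q); rewrite (_ : _ - _ = ((complex.Re (c k) - ratr p) +i* (complex.Im (c k) - ratr q))%C).
    exact: sqrt_sqn_le.
  by case: (c k).
have [f hf] := choice h; exists [seq f k | k <- enum_fset K] => k kK.
by rewrite /ratc (nth_map k) ?index_mem// nth_index.
Qed.

Lemma Nm_sum_le (s : seq I) (u : I -> I -> R[i]) : (forall k, LLc (u k)) ->
  Nmc (fun j => \sum_(k <- s) u k j) <= \sum_(k <- s) Nmc (u k).
Proof.
move=> Lu; elim: s => [|k s ih].
  rewrite big_nil (_ : (fun j => _) = fun=> 0); last by apply/funext => j; rewrite big_nil.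
  by rewrite /Nm /N2 /n2 integral0_eq ?sqrtr0// => x _; rewrite sqn0.
rewrite big_cons (_ : (fun j => _) = fun j => u k j + \sum_(k <- s) u k j); last first.
  by apply/funext => j; rewrite big_cons.
by apply: le_trans (Nm_triangle (Lu k) _) _; [exact: LL_sum|rewrite lerD2l].
Qed.

Lemma comb_close M c c' K (e : R) : (forall k, LLc (M ^~ k)) ->
  (forall k, k \in K -> Num.sqrt (sqn (c k - c' k)) <= e) ->
  Nmc (fun j => \sum_(k <- K) M j k * c k - \sum_(k <- K) M j k * c' k) <=
  e * \sum_(k <- K) Nmc (M ^~ k).
Proof.
move=> LM h.
have -> : (fun j => \sum_(k <- K) M j k * c k - \sum_(k <- K) M j k * c' k) =
  (fun j => \sum_(k <- K) (c k - c' k) * M j k).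
  by apply/funext => j; rewrite -sumrB; apply: eq_bigr => k _; rewrite -mulrBr mulrC.
apply: le_trans (Nm_sum_le _ _) _ => [k|]; first exact: LL_Z.
rewrite mulr_sumr big_seq [leRHS]big_seq; apply: ler_sum => k kK.
by rewrite NmZ// ler_wpM2r ?Nm_ge0// h.
Qed.

(** One rational vector must serve twice, for the image under M and for the vector itself; the
    second estimate is the first one for the identity matrix [D]. *)
Lemma comb_approx M c K (e : R) : (forall k, LLc (M ^~ k)) -> 0 < e ->
  exists q, Nmc (fun j => \sum_(k <- K) M j k * c k - \sum_(k <- K) M j k * ratc K q k) <= e /\
    Nmc (fun j => trunc c K j - trunc (ratc K q) K j) <= e.
Proof.
move=> LM e0; pose D (j k : I) : R[i] := delta k j.
have LD k : LLc (D ^~ k) by exact: LL_delta.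
pose S := \sum_(k <- K) Nmc (M ^~ k) + \sum_(k <- K) Nmc (D ^~ k).
have S1 : 0 <= \sum_(k <- K) Nmc (M ^~ k) by apply: sumr_ge0 => k _; exact: Nm_ge0.
have S2 : 0 <= \sum_(k <- K) Nmc (D ^~ k) by apply: sumr_ge0 => k _; exact: Nm_ge0.
have S0 : 0 < 1 + S by rewrite ltr_wpDr// addr_ge0.
have d0 : 0 < e / (1 + S) by rewrite divr_gt0.
have [q hq] := ratc_approx c K d0; exists q.
have le_e (x : R) : 0 <= x -> x <= S -> e / (1 + S) * x <= e.
  by move=> x0 xS; rewrite mulrAC ler_pdivrMr// ler_pM2l// (le_trans xS)// lerDr.
split; first by apply: le_trans (comb_close LM hq) _; apply: le_e => //; rewrite /S lerDl.
have := comb_close LD hq; rewrite (_ : (fun j => _ - _) = fun j => trunc c K j - trunc (ratc K q) K j).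
  by move=> h; apply: le_trans h _; apply: le_e => //; rewrite /S lerDr.
by apply/funext => j; rewrite !trunc_sum; congr (_ - _); apply: eq_bigr => k _; rewrite mulrC.
Qed.

Section Comb.
Variable M : I -> I -> R[i].
Hypothesis LM : forall k, LLc (M ^~ k).

Lemma LL_comb K c : LLc (fun j => \sum_(k <- K) M j k * c k).
Proof.
rewrite (_ : (fun j => _) = (fun j => \sum_(k <- K) c k * M j k)).
  by apply: LL_sum => k; exact: LL_Z.
by apply/funext => j; apply: eq_bigr => k _; rewrite mulrC.
Qed.

Lemma fin_norm_comb K c : fin_norm M K c = ((Nmc (fun j => \sum_(k <- K) M j k * c k)) ^+ 2)%:E.
Proof. by rewrite (@fin_normE _ _ i0) mx_op_trunc Nm2 LL_fin//; exact: LL_comb. Qed.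

Lemma sum_trunc K c : \sum_(k <- K) sqn (c k) = (Nmc (trunc c K)) ^+ 2.
Proof. by rewrite Nm2 (N2_trunc c K).2. Qed.

Lemma fin_upper_dense B : 0 <= B -> (forall K q, (fin_norm M K (ratc K q) <=
  (B * \sum_(k <- K) sqn (ratc K q k))%:E)%E) -> fin_upper B M.
Proof.
move=> B0 h K c; rewrite fin_norm_comb lee_fin sum_trunc.
pose r := Num.sqrt B; have r0 : 0 <= r by exact: sqrtr_ge0.
have rE : B = r ^+ 2 by rewrite sqr_sqrtr.
rewrite rE -exprMn ler_pXn2r ?nnegrE ?mulr_ge0 ?Nm_ge0//.
apply/ler_addgt0Pr => e e0.
have d0 : 0 < e / (1 + r) by rewrite divr_gt0//; lra.
have [q [h1 h2]] := comb_approx c K LM d0.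
have := h K q; rewrite fin_norm_comb lee_fin sum_trunc.
rewrite rE -exprMn ler_pXn2r ?nnegrE ?mulr_ge0 ?Nm_ge0// => h3.
have h4 := Nm_le_D (LL_comb K c) (LL_comb K (ratc K q)).
rewrite NmBC in h2.
have h5 := Nm_le_D (@LL_trunc R I i0 (ratc K q) K) (@LL_trunc R I i0 c K).
have h6 : r * Nmc (trunc (ratc K q) K) <= r * (Nmc (trunc c K) + e / (1 + r)).
  by apply: ler_wpM2l => //; apply: le_trans h5 _; rewrite lerD2l.
have h7 : (1 + r) * (e / (1 + r)) = e by rewrite mulrC divfK// gt_eqF//; lra.
move: h7; rewrite mulrDl mul1r mulrDr in h6 * => h7; lra.
Qed.

Lemma fin_lower_dense A : 0 <= A -> (forall K q, ((A * \sum_(k <- K) sqn (ratc K q k))%:E <=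
  fin_norm M K (ratc K q))%E) -> fin_lower A M.
Proof.
move=> B0 h K c; rewrite fin_norm_comb lee_fin sum_trunc.
pose r := Num.sqrt A; have r0 : 0 <= r by exact: sqrtr_ge0.
have rE : A = r ^+ 2 by rewrite sqr_sqrtr.
rewrite rE -exprMn ler_pXn2r ?nnegrE ?mulr_ge0 ?Nm_ge0//.
apply/ler_addgt0Pr => e e0.
have d0 : 0 < e / (1 + r) by rewrite divr_gt0//; lra.
have [q [h1 h2]] := comb_approx c K LM d0.
have := h K q; rewrite fin_norm_comb lee_fin sum_trunc.
rewrite rE -exprMn ler_pXn2r ?nnegrE ?mulr_ge0 ?Nm_ge0// => h3.
rewrite NmBC in h1.
have h4 := Nm_le_D (LL_comb K (ratc K q)) (LL_comb K c).
have h5 := Nm_le_D (@LL_trunc R I i0 c K) (@LL_trunc R I i0 (ratc K q) K).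
have h6 : r * Nmc (trunc c K) <= r * (Nmc (trunc (ratc K q) K) + e / (1 + r)).
  by apply: ler_wpM2l => //; apply: le_trans h5 _; rewrite lerD2l.
have h7 : (1 + r) * (e / (1 + r)) = e by rewrite mulrC divfK// gt_eqF//; lra.
move: h7; rewrite mulrDl mul1r mulrDr in h6 * => h7; lra.
Qed.

End Comb.
End Density.

Lemma Nm_le_addl d (T : measurableType d) (R : realType) (mu : {measure set T -> \bar R})
    (f g : T -> R[i]) (e : R) : LL mu f -> LL mu g ->
  Nm mu (fun x => f x - g x) <= e -> Nm mu f <= Nm mu g + e.
Proof. by move=> Lf Lg h; apply: le_trans (Nm_le_D Lf Lg) _; rewrite lerD2l. Qed.

Section FinShift.
Context {R : realType} {d : nat}.
Local Notation V := (Zd d).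
Implicit Types (M : V -> V -> R[i]) (K : {fset V}) (c : V -> R[i]).

Lemma big_shift (W : nmodType) K (m : V) (F : V -> W) :
  \sum_(k <- [fset k - m | k in K]%fset) F k = \sum_(k <- K) F (k - m).
Proof. by rewrite big_imfset//= => x y _ _; exact: addIr. Qed.

Lemma fin_norm_col M K c (m : V) : fin_norm (fun j k : V => M j (k - m)) K c =
  fin_norm M [fset k - m | k in K]%fset (fun k : V => c (k + m)).
Proof.
apply: eq_esum => j _; rewrite big_shift; congr (sqn _)%:E.
by apply: eq_bigr => k _; rewrite subrK.
Qed.

Lemma sum_sqn_col K c (m : V) :
  \sum_(k <- K) sqn (c k) = \sum_(k <- [fset k - m | k in K]%fset) sqn (c (k + m)).
Proof. by rewrite big_shift; apply: eq_bigr => k _; rewrite subrK. Qed.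

Lemma fin_norm_row M K c (m : V) : fin_norm (fun j k : V => M (j + m) k) K c = fin_norm M K c.
Proof. by rewrite /fin_norm [RHS](esum_addr _ m). Qed.

Lemma fin_upper_col M B (m : V) : fin_upper B M -> fin_upper B (fun j k : V => M j (k - m)).
Proof. by move=> h K c; rewrite fin_norm_col (sum_sqn_col K c m). Qed.

Lemma fin_lower_col M A (m : V) : fin_lower A M -> fin_lower A (fun j k : V => M j (k - m)).
Proof. by move=> h K c; rewrite fin_norm_col (sum_sqn_col K c m). Qed.

Lemma fin_upper_row M B (m : V) : fin_upper B M -> fin_upper B (fun j k : V => M (j + m) k).
Proof. by move=> h K c; rewrite fin_norm_row. Qed.

Lemma fin_lower_row M A (m : V) : fin_lower A M -> fin_lower A (fun j k : V => M (j + m) k).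
Proof. by move=> h K c; rewrite fin_norm_row. Qed.

End FinShift.

Section Frame.
Context {R : realType} {d : nat}.
Local Notation mu := (lebesgue R d).
Variables (g : Rd R d -> R[i]) (a b : R).
Hypotheses (Lg : LL mu g) (a0 : 0 < a) (b0 : 0 < b).
Local Notation s := (b^-1).
Let s0 : 0 < s. Proof. by rewrite invr_gt0. Qed.
Let mC t : measurable (@cube R d t). Proof. exact: measurable_cube. Qed.
Local Notation P := (pre_gramian g a b).
Local Notation e := (lat s).
Local Notation cntZ := (@cnt R (Zd d) 0).

(** With [pre_shift_row] it shows that moving x by either lattice renumbers columns or rows only.
    Fiber bounds at x hence pass to its whole orbit, and a cube of side s or of side a suffices. *)
Lemma pre_shift_col x m : P (tadd x (e m)) = fun j k => P x j (k - m).
Proof.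
apply/funext => j; apply/funext => k; rewrite /pre_gramian !shift_ptE.
by rewrite [tadd (tadd x _) _]taddAC taddA lat_add opprB.
Qed.

Lemma pre_shift_row x m : P (tadd x (lat a m)) = fun j k => P x (j + m) k.
Proof.
apply/funext => j; apply/funext => k; rewrite /pre_gramian !shift_ptE.
by rewrite [tadd (tadd x _) _]taddA lat_add addrC.
Qed.

(** The squared norm of the k-th column, integrated over the cube of side a, is at most the squared
    norm of g, hence it is finite for almost every x. *)
Lemma ae_columns : {ae mu, forall x, forall k, @LL _ (disc (0 : Zd d)) R cntZ ((P x) ^~ k)}.
Proof.
apply: ae_all => k; apply: (ae_cube a0).
  move=> x m [_ h]; split; first exact: cmeas_disc.
  rewrite n2_esum pre_shift_row; rewrite n2_esum in h.
  by rewrite -(esum_addr (fun j => (sqn (P x j k))%:E)).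
pose f x := g (tadd x (e (- k))); have Lf : LL mu f by exact: LL_shift.
have mf : measurable_fun setT (fun x => (sqn (f x))%:E).
  by apply/measurable_EFinP/measurable_sqn; exact: LL_meas Lf.
have mE : measurable_fun setT (fun x => \esum_(j in [set: Zd d]) (sqn (f (tadd x (lat a j))))%:E)%E.
  apply: (emeasurable_esum (f := fun j x => (sqn (f (tadd x (lat a j))))%:E)).
    by move=> j; exact: measurableT_comp mf (measurable_tadd _).
  by move=> j x; rewrite lee_fin sqn_ge0.
have := Lf.2; rewrite /n2 (tiling_in a0 mf) => [foo|x]; last by rewrite lee_fin sqn_ge0.
have /integrable_ae : mu.-integrable (cube d a)
    (fun x => \esum_(j in [set: Zd d]) (sqn (f (tadd x (lat a j))))%:E)%E.
  apply/integrableP; split; first exact: measurable_funTS.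
  under eq_integral => x _.
    rewrite gee0_abs; last by apply: esum_ge0 => j _; rewrite lee_fin sqn_ge0.
  over.
  exact: foo.
move=> /(_ (mC a)); apply: filterS => x hx Cx; split; first exact: cmeas_disc.
rewrite n2_esum; have := hx Cx; rewrite ge0_fin_numE; last first.
  by apply: esum_ge0 => j _; rewrite lee_fin sqn_ge0.
apply: le_lt_trans; apply: le_esum => j _.
by rewrite /pre_gramian sqnJ shift_ptE.
Qed.

Section Test.
Variables (E : set (Rd R d)) (K : {fset Zd d}) (c : Zd d -> R[i]).
Hypotheses (mE : measurable E) (EC : E `<=` cube d s).

Definition test_fun : Rd R d -> R[i] := fun t =>
  \sum_(k <- K) c k * ind E (fun=> 1) (tadd t (e k)).

(** The lattice translates of E are disjoint because E lies in one cell, so only the term of the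
    cell of t survives. *)
Lemma test_funE t : test_fun t =
  if - cell s t \in K then c (- cell s t) * ind E (fun=> 1) (tadd t (e (- cell s t))) else 0.
Proof.
have h k : c k * ind E (fun=> 1) (tadd t (e k)) =
   if k == - cell s t then c (- cell s t) * ind E (fun=> 1) (tadd t (e (- cell s t))) else 0.
  case: eqVneq => [->//|kt]; rewrite ind_out ?mulr0// => /EC Cx.
  have /(cube_cell t (- k) s0) H : cube d s (tadd t (e (- - k))) by rewrite opprK.
  by rewrite -H opprK eqxx in kt.
rewrite /test_fun (eq_bigr _ (fun k _ => h k)); case: ifPn => [tK|tK]; first exact: fset_pick tK.
by rewrite big_seq big1// => k kK; case: eqVneq => // kt; rewrite -kt kK in tK.
Qed.

Lemma test_fun_cube x k : cube d s x -> k \in K ->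
  test_fun (tadd x (e (- k))) = c k * ind E (fun=> 1) x.
Proof.
move=> Cx kK; rewrite test_funE.
have <- : - k = cell s (tadd x (e (- k))) by apply/cube_cell; rewrite ?tadd_latNK.
by have := tadd_latNK s (- k) x; rewrite opprK kK => ->.
Qed.

Lemma cmeas_test : cmeas test_fun.
Proof.
apply: cmeas_sum => k; apply: cmeasM; first exact: cmeas_cst.
apply: (cmeas_shift (f := ind E (fun=> 1))); apply: cmeas_ind => //; exact: cmeas_cst.
Qed.

Lemma test_bound t : sqn (test_fun t) <= \sum_(k <- K) sqn (c k).
Proof.
have S0 : 0 <= \sum_(k <- K) sqn (c k) by apply: sumr_ge0 => k _; exact: sqn_ge0.
rewrite test_funE; case: ifPn => [tK|_]; last by rewrite sqn0.
rewrite sqnM; apply: (@le_trans _ _ (sqn (c (- cell s t)))).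
  rewrite ler_piMr ?sqn_ge0//; apply: le_trans (sqn_ind _ _ _) _.
  by rewrite sqn1.
by rewrite (big_fsetD1 _ tK)/= lerDl sumr_ge0// => k _; exact: sqn_ge0.
Qed.

Lemma test_supp t : test_fun t <> 0 -> - cell s t \in K.
Proof. by rewrite test_funE; case: ifPn. Qed.

Lemma n2_test : n2 mu test_fun = ((\sum_(k <- K) sqn (c k))%:E * mu E)%E.
Proof.
rewrite (n2_fiber b0 cmeas_test test_supp) -[X in (_ * mu X)%E]setIT -integral_indic//.
rewrite -ge0_integralZl//; last 2 first.
- by apply/measurable_EFinP; exact: measurable_indic.
- by rewrite lee_fin sumr_ge0// => k _; exact: sqn_ge0.
rewrite [LHS]integral_mkcond; apply: eq_integral => x _; rewrite patchE.
case: ifPn => [/set_mem Cx|/negP nCx]; last first.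
  by rewrite indicE memNset ?mule0// => /EC Cx; apply: nCx; rewrite inE.
rewrite -EFinM mulr_suml; congr _%:E; rewrite big_seq [RHS]big_seq; apply: eq_bigr => k kK.
rewrite test_fun_cube// sqnM indicE; have [Ex|nEx] := pselect (E x).
  by rewrite ind_in// sqn1 mem_set.
by rewrite ind_out// sqn0 memNset.
Qed.

Lemma frame_test : (\esum_(p in setT) (sqn (ip mu test_fun (gabor g a b p)))%:E =
  (s ^+ d)%:E * \int[mu]_(x in E) fin_norm (P x) K c)%E.
Proof.
rewrite (fiber_identity a Lg b0 cmeas_test test_bound test_supp); congr (_ * _)%E.
rewrite integral_mkcond [RHS]integral_mkcond; apply: eq_integral => x _; rewrite !patchE.
have [Cx|nCx] := boolP (x \in cube d s); last first.
  by rewrite ifF//; apply: contraNF nCx => /set_mem/EC; rewrite inE.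
have fE : fin_norm (P x) K (fun k => test_fun (tadd x (e (- k)))) =
    fin_norm (P x) K (fun k => c k * ind E (fun=> 1) x).
  apply: eq_esum => j _; congr (sqn _)%:E.
  rewrite big_seq [RHS]big_seq; apply: eq_bigr => k kK.
  by rewrite test_fun_cube//; exact: set_mem.
rewrite fE; case: ifPn => [/set_mem Ex|/negP nEx].
  apply: eq_esum => j _; congr (sqn _)%:E; apply: eq_bigr => k kK.
  by rewrite ind_in// mulr1.
rewrite /fin_norm esum1// => j _; rewrite big1 ?sqn0// => k _.
by rewrite ind_out ?mulr0// => Ex; apply: nEx; rewrite inE.
Qed.

Lemma L2_test : L2 test_fun.
Proof.
apply/L2E; split; first exact: cmeas_test.
rewrite n2_test lte_mul_pinfty//; first by rewrite lee_fin sumr_ge0// => k _; exact: sqn_ge0.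
apply: (@le_lt_trans _ _ (mu (cube d s))); first by apply: le_measure; rewrite ?inE.
by rewrite lebesgue_cube ?ltry// ltW.
Qed.

End Test.
End Frame.

(** * Frames *)

Section AEintegral.
Context d0 (T : measurableType d0) (R : realType).
Variables (mu : {measure set T -> \bar R}) (D : set T).
Hypothesis mD : measurable D.

Lemma ae_integral_le (h : T -> \bar R) (u : T -> R) B :
  measurable_fun setT h -> measurable_fun setT u -> (forall x, 0 <= h x)%E -> (forall x, 0 <= u x) ->
  0 <= B -> {ae mu, forall x, (h x <= (B * u x)%:E)%E} ->
  (\int[mu]_(x in D) h x <= B%:E * \int[mu]_(x in D) (u x)%:E)%E.
Proof.
move=> mh mu_ h0 u0 B0 hu.
have mE : measurable_fun D (EFin \o u) by apply/measurable_EFinP/measurable_funTS.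
rewrite -ge0_integralZl//; last by move=> x _; rewrite lee_fin.
apply: ae_ge0_le_integral => //.
- exact: measurable_funTS.
- by move=> x _; rewrite -EFinM lee_fin mulr_ge0.
- exact: measurable_funeM.
by apply: filterS hu => x hx _; rewrite -EFinM.
Qed.

Lemma ae_integral_ge (h : T -> \bar R) (u : T -> R) A :
  measurable_fun setT h -> measurable_fun setT u -> (forall x, 0 <= h x)%E -> (forall x, 0 <= u x) ->
  0 <= A -> {ae mu, forall x, ((A * u x)%:E <= h x)%E} ->
  (A%:E * \int[mu]_(x in D) (u x)%:E <= \int[mu]_(x in D) h x)%E.
Proof.
move=> mh mu_ h0 u0 A0 hu.
have mE : measurable_fun D (EFin \o u) by apply/measurable_EFinP/measurable_funTS.
rewrite -ge0_integralZl//; last by move=> x _; rewrite lee_fin.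
apply: ae_ge0_le_integral => //.
- by move=> x _; rewrite -EFinM lee_fin mulr_ge0.
- exact: measurable_funeM.
- exact: measurable_funTS.
by apply: filterS hu => x hx _; rewrite -EFinM.
Qed.

End AEintegral.

Section FrameEquiv.
Context {R : realType} {d : nat}.
Local Notation mu := (lebesgue R d).
Variables (g : Rd R d -> R[i]) (a b : R).
Hypotheses (Lg : LL mu g) (a0 : 0 < a) (b0 : 0 < b).
Local Notation s := (b^-1).
Let s0 : 0 < s. Proof. by rewrite invr_gt0. Qed.
Let mC t : measurable (@cube R d t). Proof. exact: measurable_cube. Qed.
Let Coo : (mu (cube d s) < +oo)%E. Proof. by rewrite lebesgue_cube ?ltry// ltW. Qed.
Local Notation P := (pre_gramian g a b).
Local Notation e := (lat s).
Local Notation G := (gabor g a b).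
Local Notation T f := (fun p => ip mu f (G p)).

Let sd0 : 0 < s ^+ d. Proof. exact: exprn_gt0. Qed.
Let sbd (C : R) : s ^+ d * (C * b ^+ d) = C.
Proof. by rewrite mulrCA -exprMn mulVf ?gt_eqF// expr1n mulr1. Qed.

Let sum_ge0 K (c : Zd d -> R[i]) : 0 <= \sum_(k <- K) sqn (c k).
Proof. by apply: sumr_ge0 => k _; exact: sqn_ge0. Qed.

Let mfn K (c : Zd d -> R[i]) : measurable_fun setT (fun x => fin_norm (P x) K c).
Proof. by apply: (@measurable_fin_norm R d g a b Lg K (fun k _ => c k)) => k; exact: cmeas_cst. Qed.

(** The pairs of a finite set and a rational vector are countable in number, hence a common null
    set; [fin_upper_dense] then reaches all coefficients. The factor b^d cancels the s^d of the
    fiber identity. *)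
Lemma bessel_upper B : 0 <= B ->
  (forall f, LL mu f -> (\esum_(p in setT) (sqn (ip mu f (G p)))%:E <= B%:E * n2 mu f)%E) ->
  {ae mu, forall x, fin_upper (B * b ^+ d) (P x)}.
Proof.
move=> B0 hB; have Bb0 : 0 <= B * b ^+ d by rewrite mulr_ge0// exprn_ge0// ltW.
apply: (ae_cube s0) => [x k h|]; first by rewrite pre_shift_col//; exact: fin_upper_col.
have h (p : {fset Zd d} * seq (rat * rat)) : {ae mu, forall x, cube d s x ->
    (fin_norm (P x) p.1 (ratc p.1 p.2) <=
     (B * b ^+ d * \sum_(k <- p.1) sqn (ratc p.1 p.2 k : R[i]))%:E)%E}.
  apply: (ae_le_of_int (mC s) Coo) => //; first exact: mulr_ge0.
  move=> E mE EC; rewrite -(@lee_pmul2l _ (s ^+ d)%:E) ?lte_fin//.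
  rewrite -frame_test// muleA -EFinM mulrA sbd EFinM -muleA -(n2_test b0)//; apply: hB.
  exact/L2E/L2_test.
have := ae_and (ae_all h) (ae_columns b Lg a0); apply: filterS => x [hx cx] Cx.
by apply: (fin_upper_dense cx) => // K q; exact: hx (K, q) Cx.
Qed.

Lemma frame_lower A : 0 <= A ->
  (forall f, LL mu f -> (A%:E * n2 mu f <= \esum_(p in setT) (sqn (ip mu f (G p)))%:E)%E) ->
  {ae mu, forall x, fin_lower (A * b ^+ d) (P x)}.
Proof.
move=> A0 hA; have Ab0 : 0 <= A * b ^+ d by rewrite mulr_ge0// exprn_ge0// ltW.
apply: (ae_cube s0) => [x k h|]; first by rewrite pre_shift_col//; exact: fin_lower_col.
have h (p : {fset Zd d} * seq (rat * rat)) : {ae mu, forall x, cube d s x ->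
    ((A * b ^+ d * \sum_(k <- p.1) sqn (ratc p.1 p.2 k : R[i]))%:E <=
    fin_norm (P x) p.1 (ratc p.1 p.2))%E}.
  apply: (ae_ge_of_int (mC s) Coo) => //.
  - by move=> x; exact: fin_norm_ge0.
  move=> E mE EC; rewrite -(@lee_pmul2l _ (s ^+ d)%:E) ?lte_fin//.
  rewrite -frame_test// muleA -EFinM mulrA sbd EFinM -muleA -(n2_test b0)//; apply: hA.
  exact/L2E/L2_test.
have := ae_and (ae_all h) (ae_columns b Lg a0); apply: filterS => x [hx cx] Cx.
by apply: (fin_lower_dense cx) => // K q; exact: hx (K, q) Cx.
Qed.

(** The fiber identity is available for bounded functions that meet finitely many cells, and cutting
    f to sets that exhaust R^d yields such functions near f. *)
Lemma dense_bounded f (eps : R) : LL mu f -> 0 < eps -> exists F (K : {fset Zd d}) M,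
  [/\ LL mu F, forall x, sqn (F x) <= M, forall x, F x <> 0 -> - cell s x \in K,
      N2 mu F <= N2 mu f & Nm mu (fun x => f x - F x) <= eps].
Proof.
(* The lattice points whose code is below n: finite sets that exhaust Z^d. *)
move=> Lf e0; pose K n := seq_fset tt (pmap (@pickle_inv (Zd d)) (iota 0 n)).
have KP n (k : Zd d) : (choice.pickle k < n)%N -> k \in K n.
  move=> kn; rewrite seq_fsetE mem_pmap -(@pickleK_inv (Zd d) k); apply: map_f.
  by rewrite mem_iota.
pose A n := [set x | sqn (f x) <= n%:R] `&` [set x | - cell s x \in K n].
have mA n : measurable (A n).
  apply: measurableI.
    have := measurable_sqn (LL_meas Lf) measurableT (measurable_itv `]-oo, n%:R]).
    by rewrite setTI; congr measurable; apply/seteqP; split=> x /=; rewrite in_itv.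
  rewrite (_ : mkset _ = \bigcup_(k in [set` K n]) ((fun x => tadd x (e k)) @^-1` cube d s)).
    apply: fin_bigcup_measurable => [|k _]; first exact: finite_fset.
    by rewrite -[X in measurable X]setTI; exact: measurable_tadd.
  apply/seteqP; split => x /=.
    by move=> xK; exists (- cell s x) => //=; apply/cube_cell.
  move=> [k /= kK Cx]; have /(cube_cell x (- k) s0) <- : cube d s (tadd x (e (- - k))) by rewrite opprK.
  by rewrite opprK.
have [|N hN] := LL_ind_cvg Lf mA _ e0.
  move=> x; exists (maxn (Num.truncn (sqn (f x))).+1 (choice.pickle (- cell s x)).+1) => n.
  rewrite geq_max => /andP[n1 n2]; split; last exact: KP.
  by apply: le_trans (ltW (truncnS_gt _)) _; rewrite ler_nat.
have LF := LL_ind (mA N) Lf.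
exists (ind (A N) f), (K N), N%:R; split => //; last 1 first.
- exact: hN.
- move=> x; have [Ax|nAx] := pselect (A N x); first by rewrite ind_in//; case: Ax.
  by rewrite ind_out// sqn0.
- by move=> x; have [[]//|nAx] := pselect (A N x); rewrite ind_out.
rewrite -lee_fin -(LL_fin LF) -(LL_fin Lf).
apply: n2_le (LL_meas LF) => [|x]; last exact: sqn_ind.
exact: LL_meas Lf.
Qed.

Section Bounded.
Variables (F : Rd R d -> R[i]) (K : {fset Zd d}) (M : R).
Hypotheses (mF : cmeas F) (FM : forall x, sqn (F x) <= M).
Hypothesis FK : forall x, F x <> 0 -> - cell s x \in K.

Let mh : measurable_fun setT (fun x => fin_norm (P x) K (fun k => F (tadd x (e (- k))))).
Proof. by apply: (@measurable_fin_norm R d g a b Lg K (fun k x => F (tadd x (e (- k))))) => k; exact: cmeas_shift. Qed.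

Let mu_ : measurable_fun setT (fun x => \sum_(k <- K) sqn (F (tadd x (e (- k))))).
Proof. by apply: measurable_sum => k; apply: measurable_sqn; exact: cmeas_shift. Qed.

Lemma upper_bounded B : 0 <= B -> {ae mu, forall x, fin_upper B (P x)} ->
  (\esum_(p in setT) (sqn (ip mu F (G p)))%:E <= (s ^+ d * B)%:E * n2 mu F)%E.
Proof.
move=> B0 hB; rewrite (fiber_identity a Lg b0 mF FM FK) (n2_fiber b0 mF FK).
rewrite EFinM -muleA; apply: lee_wpmul2l; first by rewrite lee_fin ltW.
apply: ae_integral_le => //; last by apply: filterS hB => x; apply.
by move=> x; exact: fin_norm_ge0.
Qed.

Lemma lower_bounded A : 0 <= A -> {ae mu, forall x, fin_lower A (P x)} ->
  ((s ^+ d * A)%:E * n2 mu F <= \esum_(p in setT) (sqn (ip mu F (G p)))%:E)%E.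
Proof.
move=> A0 hA; rewrite (fiber_identity a Lg b0 mF FM FK) (n2_fiber b0 mF FK).
rewrite EFinM -muleA; apply: lee_wpmul2l; first by rewrite lee_fin ltW.
apply: ae_integral_ge => //; last by apply: filterS hA => x; apply.
by move=> x; exact: fin_norm_ge0.
Qed.

End Bounded.

Lemma upper_bessel B : 0 <= B -> {ae mu, forall x, fin_upper B (P x)} ->
  forall f, LL mu f -> (\esum_(p in setT) (sqn (ip mu f (G p)))%:E <= (s ^+ d * B)%:E * n2 mu f)%E.
Proof.
move=> B0 hB f Lf; have LG p : LL mu (G p) by exact: LL_gabor.
apply: esum_le_fset => J; rewrite sumEFin LL_fin// -EFinM lee_fin.
apply/ler_addgt0Pr => eps e0; have [dl d0 hd] := sum_ip_cont J Lf LG e0.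
have [F [K [M [LF FM FK Ff hF]]]] := dense_bounded Lf d0.
apply: abs_le_trans (hd F LF hF) _.
apply: (@le_trans _ _ (s ^+ d * B * N2 mu F)); last by apply: ler_wpM2l => //; rewrite mulr_ge0// ltW.
rewrite -lee_fin EFinM -LL_fin//; apply: le_trans (upper_bounded (LL_meas LF) FM FK B0 hB).
by rewrite -sumEFin; apply: fset_le_esum => p; rewrite lee_fin sqn_ge0.
Qed.

(** The lower bound is first known for cut functions. The upper bound makes the coefficient
    sequence, as an element of l2, depend continuously on f, and this lets the lower bound pass to
    the limit. *)
Lemma lower_frame A B : 0 <= A -> 0 <= B -> {ae mu, forall x, fin_upper B (P x)} ->
  {ae mu, forall x, fin_lower A (P x)} ->
  forall f, LL mu f -> ((s ^+ d * A)%:E * n2 mu f <= \esum_(p in setT) (sqn (ip mu f (G p)))%:E)%E.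
Proof.
move=> A0 B0 hB hA f Lf; have LG p : LL mu (G p) by exact: LL_gabor.
pose z : Zd d * Zd d := (0, 0).
have sA : 0 <= s ^+ d * A by rewrite mulr_ge0// ltW.
have sB : 0 <= s ^+ d * B by rewrite mulr_ge0// ltW.
have LT h : LL mu h -> @LL _ (disc z) R (cnt z) (T h) /\
    Nm (cnt z) (T h : disc z -> R[i]) <= Num.sqrt (s ^+ d * B) * Nm mu h.
  move=> Lh; have hb := upper_bessel B0 hB Lh.
  have L : @LL _ (disc z) R (cnt z) (T h).
    split; first exact: cmeas_disc.
    by rewrite n2_esum; apply: le_lt_trans hb _; rewrite (LL_fin Lh) -EFinM ltry.
  split => //; rewrite -(@ler_pXn2r _ 2)// ?nnegrE ?mulr_ge0 ?sqrtr_ge0 ?Nm_ge0//.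
  rewrite exprMn (sqr_sqrtr sB) !Nm2 -lee_fin -LL_fin// n2_esum EFinM -LL_fin//.
have [LTf _] := LT f Lf.
have -> : (\esum_(p in setT) (sqn (ip mu f (G p)))%:E = ((Nm (cnt z) (T f : disc z -> R[i])) ^+ 2)%:E)%E.
  by rewrite Nm2 -LL_fin// n2_esum.
pose r := Num.sqrt (s ^+ d * A); have r0 : 0 <= r by exact: sqrtr_ge0.
pose q := Num.sqrt (s ^+ d * B); have q0 : 0 <= q by exact: sqrtr_ge0.
have rE : s ^+ d * A = r ^+ 2 by rewrite sqr_sqrtr.
rewrite LL_fin// -EFinM lee_fin -Nm2 rE -exprMn ler_pXn2r ?nnegrE ?mulr_ge0 ?Nm_ge0//.
apply/ler_addgt0Pr => eps e0.
have qr1 : 0 < q + r + 1 by rewrite ltr_wpDl// addr_ge0.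
have d0 : 0 < eps / (q + r + 1) by exact: divr_gt0.
have [F [K [M [LF FM FK _ hF]]]] := dense_bounded Lf d0.
have [LTF _] := LT F LF.
have h1 : r * Nm mu F <= Nm (cnt z) (T F : disc z -> R[i]).
  rewrite -(@ler_pXn2r _ 2)// ?nnegrE ?mulr_ge0 ?Nm_ge0// exprMn -rE !Nm2.
  by rewrite -lee_fin EFinM -(LL_fin LF) -(LL_fin LTF) n2_esum; have := lower_bounded (LL_meas LF) FM FK A0 hA.
have h2 := Nm_le_addl Lf LF hF.
have h3 : Nm (cnt z) (T F : disc z -> R[i]) <= Nm (cnt z) (T f : disc z -> R[i]) + q * (eps / (q + r + 1)).
  have Lh := LL_B LF Lf; apply: (Nm_le_addl LTF LTf).
  rewrite (_ : (fun x => _ - _) = T (fun x => F x - f x)); last first.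
    by apply/funext => p; rewrite ipBl.
  by apply: le_trans (LT _ Lh).2 _; apply: ler_wpM2l => //; rewrite NmBC.
have h4 : r * Nm mu f <= r * (Nm mu F + eps / (q + r + 1)) by exact: ler_wpM2l.
have h5 : (q + r + 1) * (eps / (q + r + 1)) = eps by rewrite mulrC divfK// gt_eqF.
have d0' := ltW d0.
move: h1 h2 h3 h4 h5 d0'; move: (eps / _) (Nm _ _) (Nm _ _) (Nm _ _) (Nm _ _) => w x1 x2 x3 x4.
rewrite mulrDr => h1 h2 h3 h4 h5 w0; rewrite !mulrDl mul1r in h5; lra.
Qed.

End FrameEquiv.

(** * Riesz sequences *)

Lemma N2_orth d (T : measurableType d) (R : realType) (mu : {measure set T -> \bar R})
    (I : countType) (E : I -> T -> R[i]) (S : R) (L : {fset I}) (u : I -> R[i]) :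
  (forall i, LL mu (E i)) ->
  (forall i j, ip mu (E i) (E j) = ((if i == j then S else 0)%:C)%C) ->
  N2 mu (fun x => \sum_(l <- L) u l * E l x) = S * \sum_(l <- L) sqn (u l).
Proof.
move=> LE oE; set f := fun x => _.
have Lu l : LL mu (fun x => u l * E l x) by exact: LL_Z.
have Lf : LL mu f by exact: LL_sum.
have := ipff mu f; rewrite {2}/f ip_sumr// => /(congr1 (@complex.Re R)) h.
rewrite -[LHS]/(complex.Re ((N2 mu f)%:C)%C) -h Re_sum mulr_sumr.
rewrite big_seq [RHS]big_seq; apply: eq_bigr => l lL.
rewrite ipZr// /f ip_suml//.
have -> : \sum_(i <- L) ip mu (fun x => u i * E i x) (E l) =
   \sum_(i <- L) (if i == l then u l * (S%:C)%C else 0).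
  by apply: eq_bigr => i _; rewrite ipZl// oE; case: eqVneq => [->//|_]; rewrite mulr0.
rewrite fset_pick// mulrA [conjc _ * _]mulrC mulcJ -RCM mulrC.
by [].
Qed.

(** * Convergence of series with square-summable coefficients *)

Section Synthesis.
Context d (T : measurableType d) (R : realType).
Variable mu : {measure set T -> \bar R}.
Context {I : countType} {i0 : I} (v : I -> T -> R[i]) (B : R).
Hypotheses (Lv : forall i, LL mu (v i)) (B0 : 0 <= B).
Hypothesis upper : forall (J : {fset I}) (c : I -> R[i]),
  N2 mu (fun x => \sum_(i <- J) c i * v i x) <= B * \sum_(i <- J) sqn (c i).
Local Notation LLc := (@LL _ (disc i0) R (cnt i0)).
Local Notation Nmc := (@Nm _ (disc i0) R (cnt i0)).

Lemma LL_synth (J : {fset I}) c : LL mu (fun x => \sum_(i <- J) c i * v i x).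
Proof. by apply: LL_sum => i; exact: LL_Z. Qed.

Lemma synth_trunc (J K : {fset I}) c x : (J `<=` K)%fset ->
  \sum_(i <- K) trunc c J i * v i x = \sum_(i <- J) c i * v i x.
Proof.
move=> JK; rewrite (big_fsetID _ (mem J))/= [X in _ + X]big_seq [X in _ + X]big1 ?addr0; last first.
  by move=> i; rewrite !inE/= /trunc => /andP[_ /negbTE ->]; rewrite mul0r.
rewrite (_ : [fset x in K | x \in J]%fset = J); last first.
  by apply/fsetP => i; rewrite !inE/=; apply: andb_idl => /(fsubsetP JK).
by rewrite big_seq [RHS]big_seq; apply: eq_bigr => i iJ; rewrite /trunc iJ.
Qed.

Lemma synth_dist (J K : {fset I}) c :
  Nm mu (fun x => \sum_(i <- J) c i * v i x - \sum_(i <- K) c i * v i x) <=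
  Num.sqrt B * Nmc (fun i => trunc c J i - trunc c K i).
Proof.
have -> : (fun x => \sum_(i <- J) c i * v i x - \sum_(i <- K) c i * v i x) =
   (fun x => \sum_(i <- (J `|` K)%fset) (trunc c J i - trunc c K i) * v i x).
  apply/funext => x; rewrite -(@synth_trunc J (J `|` K)%fset) ?fsubsetUl//.
  rewrite -(@synth_trunc K (J `|` K)%fset) ?fsubsetUr// -sumrB.
  by apply: eq_bigr => i _; rewrite mulrBl.
rewrite -(@ler_pXn2r _ 2)// ?nnegrE ?mulr_ge0 ?sqrtr_ge0 ?Nm_ge0// exprMn (sqr_sqrtr B0) !Nm2.
apply: le_trans (upper _ _) _; apply: ler_wpM2l => //.
by apply: sum_sqn_le; apply: LL_B; exact: LL_trunc.
Qed.

(** By the upper bound the partial sums along increasing finite sets form a Cauchy sequence, and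
    completeness gives F; larger finite sets are compared with these. The truncation error of c is
    recorded as well, since [synthesis_lower] needs both errors small on the same finite set. *)
Lemma synthesis c : LLc c -> exists2 F, LL mu F & forall e : R, 0 < e ->
  exists A : {fset I}, forall J, (A `<=` J)%fset ->
    Nm mu (fun x => F x - \sum_(i <- J) c i * v i x) <= e /\
    Nmc (fun i => c i - trunc c J i) <= e.
Proof.
move=> Lc; pose r := Num.sqrt B; have r0 : 0 <= r by exact: sqrtr_ge0.
have /choice[A hA] : forall n : nat, exists A : {fset I}, forall J, (A `<=` J)%fset ->
    Nmc (fun i => c i - trunc c J i) <= n.+1%:R^-1.
  by move=> n; apply: trunc_approxN => //; rewrite invr_gt0.
have dist n J K : (A n `<=` J)%fset -> (A n `<=` K)%fset ->
    Nm mu (fun x => \sum_(i <- J) c i * v i x - \sum_(i <- K) c i * v i x) <= r * (n.+1%:R^-1 + n.+1%:R^-1).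
  move=> AJ AK; apply: le_trans (synth_dist J K c) _; apply: ler_wpM2l => //.
  have LJ := @LL_trunc R I i0 c J; have LK := @LL_trunc R I i0 c K.
  apply: le_trans (Nm_dist LJ Lc LK) _; rewrite NmBC; apply: lerD; exact: hA.
(* The sets [A n] need not be nested; these unions are. *)
pose U n := (\bigcup_(k <- iota 0 n.+1) A k)%fset.
have AU n m : (n <= m)%N -> (A n `<=` U m)%fset.
  by move=> nm; apply: (bigfcup_sup (P := predT)) => //; rewrite mem_iota.
have small (e : R) : 0 < e -> exists n : nat, r * (n.+1%:R^-1 + n.+1%:R^-1) <= e.
  move=> e0; have r1 : 0 < 1 + 2 * r by rewrite ltr_wpDr// mulr_ge0.
  exists (Num.truncn ((1 + 2 * r) / e)).
  have /ltW := truncnS_gt ((1 + 2 * r) / e).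
  set m := (Num.truncn _).+1; have m0 : 0 < m%:R :> R by rewrite ltr0n.
  rewrite ler_pdivrMr// => h.
  rewrite (_ : r * _ = 2 * r / m%:R); last by ring.
  rewrite ler_pdivrMr// [e * _]mulrC.
  by apply: le_trans h; rewrite lerDr.
have [|e e0|F [LF hF]] := @LL_complete _ _ _ mu (fun n x => \sum_(i <- U n) c i * v i x).
- by move=> n; exact: LL_synth.
- have se0 : 0 < Num.sqrt e by rewrite sqrtr_gt0.
  have [N hN] := small _ se0; exists N => n m Nn Nm_.
  rewrite -Nm2 -(sqr_sqrtr (ltW e0)) ler_pXn2r ?nnegrE ?Nm_ge0 ?sqrtr_ge0//.
  by apply: le_trans hN; apply: dist; exact: AU.
exists F => // e e0; have e2 : 0 < e / 2 by rewrite divr_gt0.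
have [N hN] := small _ e2; have [M hM] := hF _ e2.
have [k hk] : exists k : nat, k.+1%:R^-1 <= e.
  exists (Num.truncn e^-1); rewrite -[leRHS]invrK lef_pV2 ?posrE ?invr_gt0//.
  by rewrite ltW// truncnS_gt.
exists (A N `|` A k)%fset => J; rewrite fsubUset => /andP[AJ AkJ]; split; last first.
  by apply: le_trans hk; exact: hA.
have LU := LL_synth (U (maxn N M)) c; have LJ := LL_synth J c.
apply: le_trans (Nm_dist LF LU LJ) _.
rewrite [leRHS](splitr e); apply: lerD; first by apply: hM; exact: leq_maxr.
by apply: le_trans hN; apply: dist => //; apply: AU; exact: leq_maxl.
Qed.

Lemma synthesis_upper c F : LLc c -> LL mu F -> (forall e : R, 0 < e ->
    exists A : {fset I}, forall J, (A `<=` J)%fset ->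
    Nm mu (fun x => F x - \sum_(i <- J) c i * v i x) <= e /\
    Nmc (fun i => c i - trunc c J i) <= e) ->
  N2 mu F <= B * N2 (cnt i0) c.
Proof.
move=> Lc LF hF; pose r := Num.sqrt B; have r0 : 0 <= r by exact: sqrtr_ge0.
have rE : B = r ^+ 2 by rewrite sqr_sqrtr.
rewrite -!Nm2 rE -exprMn ler_pXn2r ?nnegrE ?mulr_ge0 ?Nm_ge0//.
apply/ler_addgt0Pr => e e0; have [A /(_ A (fsubset_refl _))[h1 _]] := hF e e0.
apply: le_trans (Nm_le_addl LF (LL_synth A c) h1) _; rewrite lerD2r.
rewrite -(@ler_pXn2r _ 2)// ?nnegrE ?mulr_ge0 ?Nm_ge0// exprMn -rE !Nm2.
by apply: le_trans (upper _ _) _; apply: ler_wpM2l => //; exact: sum_sqn_le.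
Qed.

Lemma synthesis_lower c F C : LLc c -> LL mu F -> 0 <= C ->
  (forall (J : {fset I}) (c : I -> R[i]),
    C * \sum_(i <- J) sqn (c i) <= N2 mu (fun x => \sum_(i <- J) c i * v i x)) ->
  (forall e : R, 0 < e ->
    exists A : {fset I}, forall J, (A `<=` J)%fset ->
    Nm mu (fun x => F x - \sum_(i <- J) c i * v i x) <= e /\
    Nmc (fun i => c i - trunc c J i) <= e) ->
  C * N2 (cnt i0) c <= N2 mu F.
Proof.
move=> Lc LF C0 lower hF; pose r := Num.sqrt C; have r0 : 0 <= r by exact: sqrtr_ge0.
have rE : C = r ^+ 2 by rewrite sqr_sqrtr.
rewrite -!Nm2 rE -exprMn ler_pXn2r ?nnegrE ?mulr_ge0 ?Nm_ge0//.
apply/ler_addgt0Pr => e e0; have r1 : 0 < 1 + r by rewrite ltr_wpDr.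
have d0 : 0 < e / (1 + r) by rewrite divr_gt0.
have [A /(_ A (fsubset_refl _))[h1 h2]] := hF _ d0.
have LA := LL_synth A c; have Lt := @LL_trunc R I i0 c A.
rewrite NmBC in h1; have h3 := Nm_le_addl LA LF h1.
have h4 := ler_wpM2l r0 (Nm_le_addl Lc Lt h2).
have h5 : r * Nmc (trunc c A) <= Nm mu (fun x => \sum_(i <- A) c i * v i x).
  rewrite -(@ler_pXn2r _ 2)// ?nnegrE ?mulr_ge0 ?Nm_ge0// exprMn -rE !Nm2.
  by rewrite (N2_trunc c A).2.
apply: le_trans h4 _; rewrite mulrDr.
apply: (@le_trans _ _ (Nm mu F + e / (1 + r) + r * (e / (1 + r)))).
  by apply: lerD => //; exact: le_trans h3.
by rewrite -addrA lerD2l -[X in X + _]mul1r -mulrDl mulrC divfK// gt_eqF.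
Qed.

End Synthesis.

Section L2sum.
Context {R : realType} {d : nat} {I : choiceType}.
Local Notation mu := (lebesgue R d).

Lemma has_L2sumP (v : I -> Rd R d -> R[i]) F : (forall i, LL mu (v i)) -> LL mu F ->
  has_L2sum v F <-> (forall e : R, 0 < e -> exists A : {fset I}, forall J, (A `<=` J)%fset ->
    Nm mu (fun x => F x - \sum_(i <- J) v i x) <= e).
Proof.
move=> Lv LF.
have LJ (J : {fset I}) : LL mu (fun x => F x - \sum_(i <- J) v i x).
  by apply: LL_B => //; exact: LL_sum.
have E J : sqnorm_L2 (fun x => F x - summability.partial_sum (fun i => v i x) J) =
    ((Nm mu (fun x => F x - \sum_(i <- J) v i x)) ^+ 2)%:E.
  rewrite sqnorm_L2E Nm2 -LL_fin//; congr n2; apply/funext => x.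
  by rewrite partial_sumE.
rewrite /has_L2sum; under eq_fun do rewrite E.
split=> [/fine_cvgP[_] /cvgrPdist_le h e e0|h].
  have [A _ hA] := h _ (exprn_gt0 2 e0); exists A => J AJ.
  have := hA J AJ; rewrite /= sub0r normrN ger0_norm ?sqr_ge0//.
  by rewrite ler_pXn2r ?nnegrE ?Nm_ge0 ?(ltW e0).
apply: cvg_EFin; first exact: nearW.
apply/cvgrPdist_le => e e0; have se0 : 0 < Num.sqrt e by rewrite sqrtr_gt0.
have [A hA] := h _ se0; exists A => // J AJ.
rewrite /= sub0r normrN ger0_norm ?sqr_ge0// -(sqr_sqrtr (ltW e0)).
by rewrite ler_pXn2r ?nnegrE ?Nm_ge0 ?sqrtr_ge0//; exact: hA.
Qed.

End L2sum.

Section Riesz.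
Context {R : realType} {d : nat}.
Local Notation mu := (lebesgue R d).
Variables (g : Rd R d -> R[i]) (c b : R).
Hypotheses (Lg : LL mu g) (c0 : 0 < c) (b0 : 0 < b).
Local Notation a := (c^-1).
Local Notation s := (b^-1).
Let a0 : 0 < a. Proof. by rewrite invr_gt0. Qed.
Let mC t : measurable (@cube R d t). Proof. exact: measurable_cube. Qed.
Let Coo : (mu (cube d a) < +oo)%E. Proof. by rewrite lebesgue_cube ?ltry// ltW. Qed.
Local Notation P := (pre_gramian g a b).
Local Notation e := (lat s).
Local Notation G := (gabor g s c).
Let ad0 : 0 < a ^+ d. Proof. exact: exprn_gt0. Qed.
Let LG p : LL mu (G p). Proof. exact: LL_gabor. Qed.

Definition trig (L : {fset Zd d}) (u : Zd d -> R[i]) x := \sum_(l <- L) u l * expd c l x.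

Let cmeas_trig L u : cmeas (trig L u).
Proof. by apply: cmeas_sum => l; apply: cmeasM; [exact: cmeas_cst|exact: cmeas_expd]. Qed.

Let trig_per L u x j : trig L u (tadd x (lat a j)) = trig L u x.
Proof. by apply: eq_bigr => l _; rewrite expd_per. Qed.

Lemma ind_trig L u : ind (cube d a) (trig L u) =
  fun x => \sum_(l <- L) u l * ind (cube d a) (expd c l) x.
Proof.
apply/funext => x; have [Cx|nCx] := pselect (cube d a x).
  by rewrite ind_in//; apply: eq_bigr => l _; rewrite ind_in.
by rewrite ind_out// big1// => l _; rewrite ind_out// mulr0.
Qed.

Lemma LL_trig L u : LL mu (ind (cube d a) (trig L u)).
Proof. by rewrite ind_trig; apply: LL_sum => l; apply: LL_Z; exact: LL_expd. Qed.

Let N2_trig L u : N2 mu (ind (cube d a) (trig L u)) = a ^+ d * \sum_(l <- L) sqn (u l).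
Proof.
rewrite ind_trig; apply: N2_orth; first by move=> l; exact: LL_expd.
exact: orth_expd.
Qed.

Lemma n2_ind_cube (f : Rd R d -> R[i]) t :
  n2 mu (ind (cube d t) f) = (\int[mu]_(x in cube d t) (sqn (f x))%:E)%E.
Proof.
rewrite [RHS]integral_mkcond; apply: eq_integral => x _; rewrite patchE.
case: ifPn => [/set_mem Cx|/negP nCx]; first by rewrite ind_in.
by rewrite ind_out ?sqn0// => Cx; apply: nCx; rewrite inE.
Qed.

(** The modulations of this system have period a = 1/c, so the trigonometric polynomials pull out of
    the translations by a j, and tiling by the cube of side a produces the sum over the rows j. The
    conjugate appears because P(x) carries the conjugate of g. *)
Lemma n2_tile (K L : {fset Zd d}) (w : Zd d -> Zd d -> R[i]) :
  (n2 mu (fun t => (\sum_(k <- K) \sum_(l <- L) w k l * G (k, l) t)%R) =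
   \int[mu]_(x in cube d a) fin_norm (P x) K (fun k => conjc (trig L (w k) x)))%E.
Proof.
set f := fun t => _; have Lf : LL mu f.
  by apply: LL_sum => k; apply: LL_sum => l; exact: LL_Z.
have mf : measurable_fun setT (fun x => (sqn (f x))%:E).
  by apply/measurable_EFinP/measurable_sqn; exact: LL_meas Lf.
rewrite /n2 (tiling_in a0 mf) => [|x]; last by rewrite lee_fin sqn_ge0.
apply: eq_integral => x _; apply: eq_esum => j _; congr (_%:E).
rewrite -sqnJ; congr sqn; rewrite conjc_sum; apply: eq_bigr => k _.
rewrite /pre_gramian shift_ptE -(trig_per L (w k) x j) -conjcM; congr conjc.
rewrite /trig mulr_sumr; apply: eq_bigr => l _; rewrite gaborE /= mulrCA mulrA.
by rewrite mulrC [_ * w k l]mulrC.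
Qed.

Let box (J : {fset Zd d * Zd d}) := ([fset p.1 | p in J]%fset, [fset p.2 | p in J]%fset).

Let boxP J (p : Zd d * Zd d) : p \in J -> p.1 \in (box J).1 /\ p.2 \in (box J).2.
Proof. by move=> pJ; split; apply/imfsetP; exists p. Qed.

(** A finite set of pairs is enlarged to the product of its projections, with coefficients 0
    outside, so that the double sum separates into one trigonometric polynomial for each k. The
    second identity is the orthogonality of the exponentials, of squared norm a^d. *)
Lemma n2_riesz (J : {fset Zd d * Zd d}) (q : Zd d * Zd d -> R[i]) : exists K L w,
  n2 mu (fun t => \sum_(p <- J) q p * G p t) =
    (\int[mu]_(x in cube d a) fin_norm (P x) K (fun k => conjc (trig L (w k) x)))%E /\
  (\int[mu]_(x in cube d a) (\sum_(k <- K) sqn (conjc (trig L (w k) x)))%R%:E)%E =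
    (a ^+ d * \sum_(p <- J) sqn (q p))%:E.
Proof.
pose w k l := trunc q J (k, l); exists (box J).1, (box J).2, w; split.
  rewrite -n2_tile; congr n2; apply/funext => t; rewrite (sum_rectangle _ (@boxP J)).
  apply: eq_bigr => k _; apply: eq_bigr => l _.
  by rewrite /w /trunc; case: ifP => //; rewrite mul0r.
rewrite (sum_rectangle _ (@boxP J)) mulr_sumr -sumEFin.
have mE k : measurable_fun (cube d a) (fun x => (sqn (conjc (trig (box J).2 (w k) x)))%:E).
  by apply/measurable_EFinP/measurable_funTS/measurable_sqn/cmeasJ.
under eq_integral do rewrite -sumEFin.
rewrite ge0_integral_sum//; last by move=> k x _; rewrite lee_fin sqn_ge0.
apply: eq_bigr => k _; under eq_integral do rewrite sqnJ.
rewrite -n2_ind_cube (LL_fin (LL_trig _ _)) N2_trig; congr (_ * _)%:E.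
by apply: eq_bigr => l _; rewrite /w /trunc; case: ifP => //; rewrite sqn0.
Qed.

Let mfn K L (w : Zd d -> Zd d -> R[i]) :
  measurable_fun setT (fun x => fin_norm (P x) K (fun k => conjc (trig L (w k) x))).
Proof.
by apply: (@measurable_fin_norm R d g a b Lg K (fun k x => conjc (trig L (w k) x))) => k; exact: cmeasJ.
Qed.

Let mun K L (w : Zd d -> Zd d -> R[i]) :
  measurable_fun setT (fun x => \sum_(k <- K) sqn (conjc (trig L (w k) x))).
Proof. by apply: measurable_sum => k; apply: measurable_sqn; exact: cmeasJ. Qed.

Lemma LL_sumG J (q : Zd d * Zd d -> R[i]) : LL mu (fun t => \sum_(p <- J) q p * G p t).
Proof. by apply: LL_sum => p; exact: LL_Z. Qed.

Lemma upper_riesz B : 0 <= B -> {ae mu, forall x, fin_upper B (P x)} ->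
  forall (J : {fset Zd d * Zd d}) (q : Zd d * Zd d -> R[i]),
  N2 mu (fun t => \sum_(p <- J) q p * G p t) <= (a ^+ d * B) * \sum_(p <- J) sqn (q p).
Proof.
move=> B0 hB J q; have [K [L [w [h1 h2]]]] := n2_riesz J q.
rewrite -lee_fin -(LL_fin (LL_sumG J q)) h1 mulrAC EFinM -h2 muleC.
apply: ae_integral_le => //; last by apply: filterS hB => x; apply.
- by move=> x; exact: fin_norm_ge0.
- by move=> x; apply: sumr_ge0 => k _; exact: sqn_ge0.
Qed.

Lemma lower_riesz A : 0 <= A -> {ae mu, forall x, fin_lower A (P x)} ->
  forall (J : {fset Zd d * Zd d}) (q : Zd d * Zd d -> R[i]),
  (a ^+ d * A) * \sum_(p <- J) sqn (q p) <= N2 mu (fun t => \sum_(p <- J) q p * G p t).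
Proof.
move=> A0 hA J q; have [K [L [w [h1 h2]]]] := n2_riesz J q.
rewrite -lee_fin -(LL_fin (LL_sumG J q)) h1 mulrAC EFinM -h2 muleC.
apply: ae_integral_ge => //; last by apply: filterS hA => x; apply.
- by move=> x; exact: fin_norm_ge0.
- by move=> x; apply: sumr_ge0 => k _; exact: sqn_ge0.
Qed.

Local Notation Z := (0 : Zd d, 0 : Zd d).

Lemma bounds_riesz A B : 0 < A -> 0 < B -> {ae mu, forall x, fin_upper B (P x)} ->
  {ae mu, forall x, fin_lower A (P x)} -> is_riesz_seq G.
Proof.
move=> A0 B0 hB hA; exists (a ^+ d * A), (a ^+ d * B); split; rewrite ?mulr_gt0// => q.
move=> /(@l2_LL R _ Z) Lq.
have up := upper_riesz (ltW B0) hB; have lo := lower_riesz (ltW A0) hA.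
have aB : 0 <= a ^+ d * B by rewrite mulr_ge0 ?ltW.
have aA : 0 <= a ^+ d * A by rewrite mulr_ge0 ?ltW.
have [F LF hF] := synthesis LG aB up Lq; exists F; split; first exact/L2E.
  apply/has_L2sumP => //; first by move=> p; exact: LL_Z.
  by move=> eps e0; have [J hJ] := hF eps e0; exists J => K JK; have [] := hJ K JK.
rewrite sqnorm_L2E -(@n2_l2 R _ Z) (LL_fin Lq) (LL_fin LF) -!EFinM !lee_fin.
by rewrite (synthesis_upper LG aB up Lq LF hF) (synthesis_lower LG Lq LF aA lo hF).
Qed.

(** For finitely supported coefficients the partial sums are eventually constant, so F differs from
    the finite sum by a function of norm 0. *)
Lemma riesz_finite A B : 0 <= A ->
  (forall q : Zd d * Zd d -> R[i], l2 q -> exists F,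
     [/\ L2 F, has_L2sum (fun p x => q p * G p x) F
      & (A%:E * sqnorm_l2 q <= sqnorm_L2 F <= B%:E * sqnorm_l2 q)%E]) ->
  forall (J : {fset Zd d * Zd d}) (q : Zd d * Zd d -> R[i]),
  A * \sum_(p <- J) sqn (q p) <= N2 mu (fun t => \sum_(p <- J) q p * G p t)
    <= B * \sum_(p <- J) sqn (q p).
Proof.
move=> A0 h J q; have Lt := @LL_trunc R _ Z q J.
have [F [/L2E LF /has_L2sumP hF]] := h _ (iffRL (l2_LL _) Lt).
rewrite sqnorm_L2E -(@n2_l2 R _ Z) (LL_fin Lt) (LL_fin LF) -!EFinM !lee_fin (N2_trunc q J).2.
suff -> : N2 mu F = N2 mu (fun t => \sum_(p <- J) q p * G p t) by [].
have LS := LL_sumG J q.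
have Nm0 : Nm mu (fun x => F x - \sum_(p <- J) q p * G p x) <= 0.
  apply/ler_addgt0Pr => eps e0; rewrite add0r.
  have [||K hK] := hF _ _ eps e0; [by move=> p; exact: LL_Z|exact: LF|].
  have := hK (J `|` K)%fset (fsubsetUr _ _).
  congr (Nm _ _ <= _); apply/funext => x.
  by rewrite (synth_trunc G) ?fsubsetUl.
rewrite -!Nm2; congr (_ ^+ 2); apply/eqP; rewrite eq_le.
have h1 := Nm_le_addl LF LS Nm0; rewrite addr0 in h1.
by rewrite h1/=; rewrite NmBC in Nm0; have := Nm_le_addl LS LF Nm0; rewrite addr0.
Qed.

Lemma fin_normZ M (K : {fset Zd d}) (q : Zd d -> R[i]) (z : R[i]) :
  fin_norm M K (fun k => q k * z) = ((sqn z)%:E * fin_norm M K q)%E.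
Proof.
rewrite /fin_norm -esumZl ?sqn_ge0//; last by move=> j; rewrite lee_fin sqn_ge0.
apply: eq_esum => j _; rewrite -EFinM -sqnM; congr (sqn _)%:E.
by rewrite mulrC mulr_suml; apply: eq_bigr => k _; rewrite mulrA.
Qed.

(** For the coefficients conj(q_k) u_l all the trigonometric polynomials are multiples of p =
    [trig L u], and the fiber form factors into |p|^2 and a weight in which u no longer occurs. The
    factor c^d converts the squared norm of p into the sum of the |u_l|^2. *)
Lemma riesz_weight A B : 
  (forall (J : {fset Zd d * Zd d}) (q : Zd d * Zd d -> R[i]),
  A * \sum_(p <- J) sqn (q p) <= N2 mu (fun t => \sum_(p <- J) q p * G p t)
    <= B * \sum_(p <- J) sqn (q p)) ->
  forall (K : {fset Zd d}) (q : Zd d -> R[i]) L u,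
  ((A * c ^+ d * (\sum_(k <- K) sqn (q k))%R * N2 mu (ind (cube d a) (trig L u)))%:E <=
    \int[mu]_x ((sqn (ind (cube d a) (trig L u) x))%:E * fin_norm (P x) K q) <=
    (B * c ^+ d * (\sum_(k <- K) sqn (q k))%R * N2 mu (ind (cube d a) (trig L u)))%:E)%E.
Proof.
move=> h K q L u; set S := \sum_(k <- K) _; set f := ind _ _.
pose J := (K `*` L)%fset; pose qq (p : Zd d * Zd d) := conjc (q p.1) * u p.2.
have JP p : p \in J -> p.1 \in K /\ p.2 \in L by rewrite in_fsetM => /andP.
have SE : \sum_(p <- J) sqn (qq p) = S * \sum_(l <- L) sqn (u l).
  rewrite (sum_rectangle _ JP) mulr_suml big_seq [RHS]big_seq; apply: eq_bigr => k kK.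
  rewrite mulr_sumr big_seq [RHS]big_seq; apply: eq_bigr => l lL.
  by rewrite in_fsetM/= kK lL sqnM sqnJ.
have NE : N2 mu f * c ^+ d = \sum_(l <- L) sqn (u l).
  by rewrite N2_trig mulrAC -exprMn mulVf ?gt_eqF// expr1n mul1r.
have E C : C * c ^+ d * S * N2 mu f = C * \sum_(p <- J) sqn (qq p).
  by rewrite SE -NE; ring.
rewrite !E; have := h J qq; rewrite -!lee_fin -(LL_fin (LL_sumG J qq)).
suff -> : (n2 mu (fun t => (\sum_(p <- J) qq p * G p t)%R) =
   \int[mu]_x ((sqn (f x))%:E * fin_norm (P x) K q))%E by [].
rewrite (_ : (fun t => _) = fun t => \sum_(k <- K) \sum_(l <- L) (conjc (q k) * u l) * G (k, l) t).
  rewrite (n2_tile K L (fun k l => conjc (q k) * u l)) integral_mkcond.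
  apply: eq_integral => x _; rewrite patchE.
  case: ifPn => [/set_mem Cx|/negP nCx]; last first.
    by rewrite /f ind_out ?sqn0 ?mul0e// => Cx; apply: nCx; rewrite inE.
  rewrite /f ind_in// -sqnJ -fin_normZ; congr fin_norm; apply/funext => k.
  rewrite /trig -[in RHS](conjcK (q k)) -conjcM mulr_sumr; congr conjc.
  by apply: eq_bigr => l _; rewrite mulrA.
apply/funext => t; rewrite (sum_rectangle _ JP) big_seq [RHS]big_seq; apply: eq_bigr => k kK.
by rewrite big_seq [RHS]big_seq; apply: eq_bigr => l lL; rewrite in_fsetM/= kK lL.
Qed.

End Riesz.

(* L2-approximation of 1_E by p controls the integral of |p|^2 h only for bounded h,
   so h is first replaced by min(h, C2 + 1), which is <= C2 iff h is. *)
Section Weight.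
Context d (T : measurableType d) (R : realType).
Variable mu : {measure set T -> \bar R}.
Variables (D : set T) (h : T -> \bar R) (cl : (T -> R[i]) -> Prop) (C1 C2 : R).
Hypotheses (mD : measurable D) (Doo : (mu D < +oo)%E).
Hypotheses (mh : measurable_fun setT h) (h0 : forall x, (0 <= h x)%E).
Hypotheses (C10 : 0 <= C1) (C20 : 0 <= C2).
Hypotheses (clL : forall p, cl p -> LL mu p) (clD : forall p x, cl p -> ~ D x -> p x = 0).
Hypothesis dense : forall E, measurable E -> E `<=` D -> forall e : R, 0 < e ->
  exists2 p, cl p & Nm mu (fun x => ind E (fun=> 1) x - p x) <= e.
Hypothesis lower : forall p, cl p -> ((C1 * N2 mu p)%:E <= \int[mu]_x ((sqn (p x))%:E * h x))%E.
Hypothesis upper : forall p, cl p -> (\int[mu]_x ((sqn (p x))%:E * h x) <= (C2 * N2 mu p)%:E)%E.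

Let w x : R := fine (mine (h x) (C2 + 1)%:E).

Let wE x : (w x)%:E = mine (h x) (C2 + 1)%:E.
Proof.
have C21 : 0 <= C2 + 1 by rewrite addr_ge0.
rewrite /w fineK// ge0_fin_numE; last by rewrite le_min h0 lee_fin.
by rewrite gt_min ltry orbT.
Qed.

Let w0 x : 0 <= w x.
Proof. by rewrite -lee_fin wE le_min h0 lee_fin addr_ge0. Qed.

Let wh x : ((w x)%:E <= h x)%E. Proof. by rewrite wE ge_min lexx. Qed.

Let wC x : w x <= C2 + 1. Proof. by rewrite -lee_fin wE ge_min lexx orbT. Qed.

Let mw : measurable_fun setT w.
Proof.
apply: (measurableT_comp (fine_measurable measurableT)).
by apply: measurable_mine => //; exact: measurable_cst.
Qed.

(** Multiplication by the square root of the weight: integrals of |f|^2 w become squared norms, so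
    the triangle inequality applies to them. *)
Let W (f : T -> R[i]) x := ((Num.sqrt (w x))%:C)%C * f x.

Let mW : cmeas (fun x => ((Num.sqrt (w x))%:C)%C).
Proof.
apply: cmeasR; apply: measurableT_comp mw; apply: continuous_measurable_fun.
exact: sqrt_continuous.
Qed.

Let sqnW f x : sqn (W f x) = w x * sqn (f x).
Proof. by rewrite sqnM sqnR sqr_sqrtr. Qed.

Let LW f : LL mu f -> LL mu (W f).
Proof.
move=> Lf; apply: (LL_bM (M := C2 + 1)) => // x.
by rewrite sqnR sqr_sqrtr.
Qed.

Let NmW f : LL mu f -> Nm mu (W f) <= Num.sqrt (C2 + 1) * Nm mu f.
Proof.
move=> Lf; have C21 : 0 <= C2 + 1 by rewrite addr_ge0.
rewrite -(@ler_pXn2r _ 2)// ?nnegrE ?mulr_ge0 ?sqrtr_ge0 ?Nm_ge0//.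
rewrite exprMn (sqr_sqrtr C21) !Nm2 -lee_fin EFinM -(LL_fin Lf) -(LL_fin (LW Lf)).
have c21 : sqn ((Num.sqrt (C2 + 1))%:C)%C = C2 + 1 by rewrite sqnR sqr_sqrtr.
rewrite -c21 -(n2Z _ _ (LL_meas Lf)).
apply: n2_le (LL_meas (LW Lf)) => [|x]; last by rewrite sqnW sqnM c21 ler_wpM2r ?sqn_ge0.
by apply: cmeasM; [exact: cmeas_cst|exact: LL_meas Lf].
Qed.

Let WB f p x : W f x - W p x = W (fun x => f x - p x) x.
Proof. by rewrite /W mulrBr. Qed.

Let LE E : measurable E -> E `<=` D -> LL mu (ind E (fun=> 1)).
Proof.
move=> mE ED; apply: (LL_ind_bounded (M := 1)) => //; last by move=> x; rewrite sqn1.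
  by apply: le_lt_trans Doo; apply: le_measure; rewrite ?inE.
Qed.

Let n2W E : measurable E -> n2 mu (W (ind E (fun=> 1))) = (\int[mu]_(x in E) (w x)%:E)%E.
Proof.
move=> mE; rewrite [RHS]integral_mkcond; apply: eq_integral => x _; rewrite patchE sqnW.
case: ifPn => [/set_mem Ex|/negP nEx]; first by rewrite ind_in// sqn1 mulr1.
by rewrite ind_out ?sqn0 ?mulr0// => Ex; apply: nEx; rewrite inE.
Qed.

Let n2E E : measurable E -> n2 mu (ind E (fun=> 1)) = mu E.
Proof.
move=> mE; rewrite -[X in mu X]setIT -integral_indic//; apply: eq_integral => x _.
rewrite indicE; have [Ex|nEx] := pselect (E x); first by rewrite ind_in// sqn1 mem_set.
by rewrite ind_out// sqn0 memNset.
Qed.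

Let slack (x y k : R) : 0 <= k -> (forall e, 0 < e -> x <= y + k * e) -> x <= y.
Proof.
move=> k0 xy; apply/ler_addgt0Pr => e e0; have k1 : 0 < 1 + k by rewrite ltr_wpDr.
apply: le_trans (xy (e / (1 + k)) _) _; first by rewrite divr_gt0.
by rewrite lerD2l mulrCA ler_piMr ?(ltW e0)// ler_pdivrMr// mul1r lerDr.
Qed.

Lemma weight_upper : {ae mu, forall x, D x -> (h x <= C2%:E)%E}.
Proof.
have : {ae mu, forall x, D x -> ((w x)%:E <= C2%:E)%E}.
  apply: (ae_le_of_int mD Doo) => //.
  - exact/measurable_EFinP.
  move=> E mE ED; have L1 := LE mE ED; have LW1 := LW L1.
  rewrite -n2W// -n2E// (LL_fin L1) (LL_fin LW1) -EFinM lee_fin.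
  pose r := Num.sqrt C2; have r0 : 0 <= r by exact: sqrtr_ge0.
  have rE : C2 = r ^+ 2 by rewrite sqr_sqrtr.
  rewrite -!Nm2 [in leRHS]rE -exprMn ler_pXn2r ?nnegrE ?mulr_ge0 ?Nm_ge0//.
  apply: (@slack _ _ (r + Num.sqrt (C2 + 1))) => [|e e0]; first by rewrite addr_ge0 ?sqrtr_ge0.
  have [p cp hp] := dense mE ED e0; have Lp := clL cp; have LWp := LW Lp.
  have h1 : Nm mu (W (ind E (fun=> 1))) <= Nm mu (W p) + Num.sqrt (C2 + 1) * e.
    apply: Nm_le_addl => //; rewrite (_ : (fun x => _ - _) = W (fun x => ind E (fun=> 1) x - p x)).
      apply: le_trans (NmW _) _; first exact: LL_B.
      by apply: ler_wpM2l => //; exact: sqrtr_ge0.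
    by apply/funext => x; rewrite WB.
  rewrite NmBC in hp; have h2 := ler_wpM2l r0 (Nm_le_addl Lp L1 hp).
  have h3 : Nm mu (W p) <= r * Nm mu p.
    rewrite -(@ler_pXn2r _ 2)// ?nnegrE ?mulr_ge0 ?Nm_ge0// exprMn -rE !Nm2.
    rewrite -lee_fin -(LL_fin LWp); apply: le_trans (upper cp).
    apply: ge0_le_integral => //.
    - by move=> x _; rewrite lee_fin sqn_ge0.
    - by apply/measurable_EFinP/measurable_sqn; exact: LL_meas LWp.
    - apply: emeasurable_funM => //.
      by apply/measurable_EFinP/measurable_sqn; exact: LL_meas Lp.
    move=> x _; rewrite sqnW mulrC EFinM; apply: lee_wpmul2l => //.
    by rewrite lee_fin sqn_ge0.
  apply: le_trans h1 _; rewrite mulrDl addrA lerD2r; apply: le_trans h3 _.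
  by move: h2; rewrite mulrDr.
apply: filterS => x wx Dx; have := wx Dx; rewrite wE ge_min => /orP[//|].
by rewrite lee_fin gerDl ler10.
Qed.

(** The hypothesis [lower] concerns h, while the approximation concerns the truncated weight w. By
    [weight_upper] the truncation changes nothing almost everywhere on D, and p vanishes off D; this
    is why the upper bound has to come first. *)
Lemma weight_lower : {ae mu, forall x, D x -> (C1%:E <= h x)%E}.
Proof.
have : {ae mu, forall x, D x -> (C1%:E <= (w x)%:E)%E}.
  apply: (ae_ge_of_int mD Doo) => //.
  - exact/measurable_EFinP.
  move=> E mE ED; have L1 := LE mE ED; have LW1 := LW L1.
  rewrite -n2W// -n2E// (LL_fin L1) (LL_fin LW1) -EFinM lee_fin.
  pose r := Num.sqrt C1; have r0 : 0 <= r by exact: sqrtr_ge0.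
  have rE : C1 = r ^+ 2 by rewrite sqr_sqrtr.
  rewrite -!Nm2 [in leLHS]rE -exprMn ler_pXn2r ?nnegrE ?mulr_ge0 ?Nm_ge0//.
  apply: (@slack _ _ (Num.sqrt (C2 + 1) + r)) => [|e e0]; first by rewrite addr_ge0 ?sqrtr_ge0.
  have [p cp hp] := dense mE ED e0; have Lp := clL cp; have LWp := LW Lp.
  have h2 := ler_wpM2l r0 (Nm_le_addl L1 Lp hp); rewrite NmBC in hp.
  have h1 : Nm mu (W p) <= Nm mu (W (ind E (fun=> 1))) + Num.sqrt (C2 + 1) * e.
    apply: Nm_le_addl => //; rewrite (_ : (fun x => _ - _) = W (fun x => p x - ind E (fun=> 1) x)).
      apply: le_trans (NmW _) _; first exact: LL_B.
      by apply: ler_wpM2l => //; exact: sqrtr_ge0.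
    by apply/funext => x; rewrite WB.
  have h3 : r * Nm mu p <= Nm mu (W p).
    rewrite -(@ler_pXn2r _ 2)// ?nnegrE ?mulr_ge0 ?Nm_ge0// exprMn -rE !Nm2.
    rewrite -lee_fin -(LL_fin LWp); apply: le_trans (lower cp) _.
    apply: ae_ge0_le_integral => //.
    - by move=> x _; rewrite mule_ge0// lee_fin sqn_ge0.
    - apply: emeasurable_funM => //.
      by apply/measurable_EFinP/measurable_sqn; exact: LL_meas Lp.
    - by move=> x _; rewrite lee_fin sqn_ge0.
    - by apply/measurable_EFinP/measurable_sqn; exact: LL_meas LWp.
    apply: filterS weight_upper => x hx _; have [Dx|nDx] := pselect (D x); last first.
      by rewrite clD// sqn0 mul0e lee_fin sqn_ge0.
    rewrite sqnW mulrC EFinM; apply: lee_wpmul2l; first by rewrite lee_fin sqn_ge0.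
    by rewrite wE le_min lexx/=; apply: le_trans (hx Dx) _; rewrite lee_fin lerDl.
  apply: le_trans h2 _; rewrite mulrDr mulrDl addrA lerD2r.
  exact: le_trans h3 h1.
by apply: filterS => x wx Dx; apply: le_trans (wx Dx) (wh x).
Qed.

End Weight.

Section RieszFiber.
Context {R : realType} {d : nat}.
Local Notation mu := (lebesgue R d).
Variables (g : Rd R d -> R[i]) (c b : R).
Hypotheses (Lg : LL mu g) (c0 : 0 < c) (b0 : 0 < b).
Local Notation a := (c^-1).
Local Notation s := (b^-1).
Let a0 : 0 < a. Proof. by rewrite invr_gt0. Qed.
Let mC t : measurable (@cube R d t). Proof. exact: measurable_cube. Qed.
Let Coo : (mu (cube d a) < +oo)%E. Proof. by rewrite lebesgue_cube ?ltry// ltW. Qed.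
Local Notation P := (pre_gramian g a b).
Local Notation G := (gabor g s c).

Definition trig_fun (f : Rd R d -> R[i]) := exists L u, f = ind (cube d a) (trig c L u).

(** The closed span yields a list of terms in which indices may repeat; [best] replaces it by a
    projection, which is a trigonometric polynomial over a finite set and is at least as close. *)
Lemma trig_dense E : measurable E -> E `<=` cube d a -> forall e : R, 0 < e ->
  exists2 p, trig_fun p & Nm mu (fun x => ind E (fun=> 1) x - p x) <= e.
Proof.
move=> mE EC e e0.
have EE : ind E (fun=> 1 : R[i]) = ind (cube d a) (ind E (fun=> 1)).
  apply/funext => x; have [Cx|nCx] := pselect (cube d a x); first by rewrite [RHS]ind_in.
  by rewrite [RHS]ind_out// ind_out// => /EC.
have L1 : LL mu (ind E (fun=> 1)).
  rewrite EE; apply: (LL_cube c0 (M := 1)); first by apply: cmeas_ind => //; exact: cmeas_cst.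
  by move=> x; apply: le_trans (sqn_ind _ _ _) _; rewrite sqn1.
have [_ /(_ e e0)[r hr]] := clo_cube c0 L1; rewrite -EE in hr.
have [J hJ] := best (exprn_gt0 d a0) (@LL_expd R c c0 d) (@orth_expd R c c0 d) r L1.
exists (proj mu (fun l => ind (cube d a) (expd c l)) (a ^+ d) (ind E (fun=> 1)) J).
  exists J, (fun l => (((a ^+ d)^-1)%:C)%C * ip mu (ind E (fun=> 1)) (ind (cube d a) (expd c l))).
  by rewrite ind_trig.
by rewrite -(@ler_pXn2r _ 2)// ?nnegrE ?Nm_ge0 ?(ltW e0)// Nm2 (le_trans hJ)// -Nm2
   ler_pXn2r ?nnegrE ?Nm_ge0 ?(ltW e0).
Qed.

Lemma riesz_bounds A B : 0 < A -> 0 < B ->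
  (forall q : Zd d * Zd d -> R[i], l2 q -> exists F,
     [/\ L2 F, has_L2sum (fun p x => q p * G p x) F
      & (A%:E * sqnorm_l2 q <= sqnorm_L2 F <= B%:E * sqnorm_l2 q)%E]) ->
  {ae mu, forall x, fin_upper (B * c ^+ d) (P x)} /\
  {ae mu, forall x, fin_lower (A * c ^+ d) (P x)}.
Proof.
move=> A0 B0 /(riesz_finite Lg (ltW A0)) hAB.
have Ac : 0 <= A * c ^+ d by rewrite mulr_ge0 ?exprn_ge0 ?ltW.
have Bc : 0 <= B * c ^+ d by rewrite mulr_ge0 ?exprn_ge0 ?ltW.
have h (p : {fset Zd d} * seq (rat * rat)) : {ae mu, forall x, cube d a x ->
    ((A * c ^+ d * \sum_(k <- p.1) sqn (ratc p.1 p.2 k : R[i]))%:E <=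
      fin_norm (P x) p.1 (ratc p.1 p.2) <=
     (B * c ^+ d * \sum_(k <- p.1) sqn (ratc p.1 p.2 k : R[i]))%:E)%E}.
  pose S := \sum_(k <- p.1) sqn (ratc p.1 p.2 k : R[i]).
  have S0 : 0 <= S by apply: sumr_ge0 => k _; exact: sqn_ge0.
  have hw := riesz_weight Lg c0 hAB p.1 (ratc p.1 p.2).
  have mf : measurable_fun setT (fun x => fin_norm (P x) p.1 (ratc p.1 p.2)).
    by apply: (@measurable_fin_norm R d g a b Lg p.1 (fun k _ => ratc p.1 p.2 k)) => k; exact: cmeas_cst.
  have f0 x : (0 <= fin_norm (P x) p.1 (ratc p.1 p.2))%E by exact: fin_norm_ge0.
  have tL f : trig_fun f -> LL mu f by move=> [L [u ->]]; exact: LL_trig c0 L u.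
  have tD f x : trig_fun f -> ~ cube d a x -> f x = 0 by move=> [L [u ->]]; exact: ind_out.
  have AS : 0 <= A * c ^+ d * S by exact: mulr_ge0.
  have BS : 0 <= B * c ^+ d * S by exact: mulr_ge0.
  have lo f : trig_fun f -> ((A * c ^+ d * S * N2 mu f)%:E <=
      \int[mu]_x ((sqn (f x))%:E * fin_norm (P x) p.1 (ratc p.1 p.2)))%E.
    by move=> [L [u ->]]; have /andP[] := hw L u.
  have up f : trig_fun f -> (\int[mu]_x ((sqn (f x))%:E * fin_norm (P x) p.1 (ratc p.1 p.2)) <=
      (B * c ^+ d * S * N2 mu f)%:E)%E.
    by move=> [L [u ->]]; have /andP[] := hw L u.
  have h1 := weight_upper (mC a) Coo mf f0 BS tL trig_dense up.
  have h2 := weight_lower (mC a) Coo mf f0 AS BS tL tD trig_dense lo up.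
  by have := ae_and h1 h2; apply: filterS => x [k1 k2] Cx; rewrite k1// k2.
have H := ae_and (ae_all h) (ae_columns b Lg a0).
split.
  apply: (ae_cube a0) => [x k hx|]; first by rewrite pre_shift_row; exact: fin_upper_row.
  apply: filterS H => x [hx cx] Cx.
  by apply: (fin_upper_dense cx) => // K q; have /andP[] := hx (K, q) Cx.
apply: (ae_cube a0) => [x k hx|]; first by rewrite pre_shift_row; exact: fin_lower_row.
apply: filterS H => x [hx cx] Cx.
by apply: (fin_lower_dense cx) => // K q; have /andP[] := hx (K, q) Cx.
Qed.

End RieszFiber.

(** * Left inverses and dual windows *)

Section MatrixEquiv.
Context {R : realType} {I : countType} {i0 : I}.
Implicit Types (c u : I -> R[i]) (K : {fset I}) (M : I -> I -> R[i]) (A B C : R).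
Local Notation cnt := (@cnt R I i0).
Local Notation LLc := (@LL _ (disc i0) R cnt).
Local Notation N2c := (@N2 _ (disc i0) R cnt).
Local Notation Nmc := (@Nm _ (disc i0) R cnt).
Local Notation ipc := (@ip _ (disc i0) R cnt).

Lemma fin_upper_mono B B' M : B <= B' -> fin_upper B M -> fin_upper B' M.
Proof.
move=> BB h K c; apply: le_trans (h K c) _; rewrite lee_fin ler_wpM2r//.
by apply: sumr_ge0 => k _; exact: sqn_ge0.
Qed.

Lemma csum_mx_op M c : (fun j => csum (fun k => c k * M j k)) = mx_op M c.
Proof.
by apply/funext => j; congr csum; apply/funext => k; rewrite mulrC.
Qed.

Lemma fin_frame A B M : 0 <= A -> 0 <= B -> fin_upper B M -> fin_lower A M ->
  forall c, l2 c -> (forall j, csummable (fun k => c k * M j k)) /\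
   (A%:E * sqnorm_l2 c <= \esum_(j in setT) (normc (csum (fun k => (c k * M j k)%R)) ^+ 2)%:E
     <= B%:E * sqnorm_l2 c)%E.
Proof.
move=> A0 B0 hB hA c /(@l2_LL R I i0) Lc; split=> [j|].
  exists (ipc c (fun k => conjc (M j k))).
  by apply: has_csum_eq (fin_csum B0 hB (j := j) Lc) => k; rewrite mulrC.
have [L1 h1] := fin_upper_N2 B0 hB Lc.
have -> : (\esum_(j in setT) (normc (csum (fun k => (c k * M j k)%R)) ^+ 2)%:E = n2 cnt (mx_op M c))%E.
  rewrite n2_l2 -csum_mx_op; by [].
rewrite -(@n2_l2 R I i0) (LL_fin Lc) (LL_fin L1) -!EFinM !lee_fin h1 andbT.
exact: (@fin_lower_N2 R I i0 B M B0 hB A c A0 hA Lc).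
Qed.

Lemma frame_fin A B M : 
  (forall c, l2 c -> (forall j, csummable (fun k => c k * M j k)) /\
   (A%:E * sqnorm_l2 c <= \esum_(j in setT) (normc (csum (fun k => (c k * M j k)%R)) ^+ 2)%:E
     <= B%:E * sqnorm_l2 c)%E) ->
  fin_upper B M /\ fin_lower A M.
Proof.
move=> h.
have hK K c : ((A * \sum_(k <- K) sqn (c k))%:E <= fin_norm M K c <= (B * \sum_(k <- K) sqn (c k))%:E)%E.
  have [Lt Et] := @N2_trunc R I i0 c K.
  have [_] := h _ (iffRL (l2_LL _) Lt).
  have -> : (\esum_(j in setT) (normc (csum (fun k => (trunc c K k * M j k)%R)) ^+ 2)%:E = fin_norm M K c)%E.
    rewrite (@fin_normE _ _ i0) -csum_mx_op n2_l2; by [].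
  by rewrite -(@n2_l2 R I i0) (LL_fin Lt) Et -!EFinM.
by split=> K c; have /andP[] := hK K c.
Qed.

Section Inverse.
Variables (A B : R) (M : I -> I -> R[i]).
Hypotheses (A0 : 0 < A) (B0 : 0 <= B) (hB : fin_upper B M) (hA : fin_lower A M).
Let bM := @fin_upper_bounded R I i0 B M B0 hB.
Let bT : bounded_op (Num.sqrt B ^+ 2) (mx_op (gram M)).
Proof. exact: (@gram_bounded R I i0 _ M bM).2. Qed.

Let coerc c : LLc c -> A * N2c c <= complex.Re (ipc (mx_op (gram M) c) c).
Proof.
move=> Lc; rewrite (gram_form bM Lc Lc) ipff ReR.
exact: (@fin_lower_N2 R I i0 B M B0 hB A c (ltW A0) hA Lc).
Qed.

Lemma gram_inverse : exists S, bounded_op A^-1 S /\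
  forall c, LLc c -> [/\ LLc (S c), S (mx_op (gram M) c) = c, mx_op (gram M) (S c) = c &
   forall e : R, 0 < e -> exists N, forall n, (N <= n)%N ->
     Nmc (fun x => S c x - richardson (Num.sqrt B ^+ 2) A (mx_op (gram M)) c n x) <= e].
Proof. exact: lax_inverse bT A0 coerc. Qed.

Lemma gram_inj u v : LLc u -> LLc v -> mx_op (gram M) u = mx_op (gram M) v -> u = v.
Proof. exact: coercive_inj bT A0 coerc u v. Qed.

Lemma LL_gram_rich c n : LLc c -> LLc (richardson (Num.sqrt B ^+ 2) A (mx_op (gram M)) c n).
Proof. exact: LL_richardson. Qed.

(** The constant multiplies the bound 1/A of the inverse Gram operator by the bound of the adjoint
    of M, which is that of M. *)
Lemma left_inverse : exists G, bounded_op (A^-1 * Num.sqrt B) G /\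
  forall c, l2 c -> G (mx_op M c) = c.
Proof.
have [S [bS hS]] := gram_inverse; have bA := adj_op (i0 := i0) bM.2.
exists (S \o @adj R I i0 (mx_op M)); split.
  apply: (@bounded_opI R I i0).
  - by rewrite mulr_ge0 ?sqrtr_ge0// invr_ge0 ltW.
  - move=> a c c' Lc Lc' /=; rewrite (op_lin bA a Lc Lc').
    by rewrite (op_lin bS a (op_LL bA Lc) (op_LL bA Lc')).
  - move=> c Lc /=; have L1 := op_LL bA Lc; have [h1 h2] := bounded_opP bS L1.
    split; first exact: h1.
    apply: le_trans h2 _; rewrite [leRHS](_ : _ = A^-1 ^+ 2 * (Num.sqrt B ^+ 2 * N2c c)); last by ring.
    by apply: ler_wpM2l; [exact: sqr_ge0|exact: (bounded_opP bA Lc).2].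
move=> c /(@l2_LL R I i0) Lc /=; rewrite -(gram_op bM Lc).
by have [] := hS c Lc.
Qed.

End Inverse.

(** From G M c = c follows |c|^2 <= C^2 |M c|^2; adding 1 makes the constant invertible even if C =
    0. *)
Lemma left_inverse_lower C M G : (exists C' : R, bounded_mx C' M) -> bounded_op C G ->
  (forall c, l2 c -> G (mx_op M c) = c) -> fin_lower (C ^+ 2 + 1)^-1 M.
Proof.
move=> [C' [_ bM]] bG GM K c.
have [Lt Et] := @N2_trunc R I i0 c K; have LM := op_LL bM Lt.
have C1 : 0 < C ^+ 2 + 1 by rewrite ltr_wpDl ?sqr_ge0.
rewrite (@fin_normE _ _ i0) (LL_fin LM) lee_fin ler_pdivrMl// -Et.
have := op_N2 bG LM; rewrite GM; last exact/(l2_LL (i0 := i0)).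
move=> h; apply: le_trans h _; rewrite ler_wpM2r ?N2_ge0// lerDl.
by [].
Qed.

(** For v = M c and w = N c biorthogonality gives <v, w> = beta |c|^2. Cauchy-Schwarz and the upper
    bound for N then give beta^2 |c|^4 <= |v|^2 B |c|^2. *)
Lemma dual_lower (B beta : R) (M N : I -> I -> R[i]) : 0 < B -> (forall k, LLc (M ^~ k)) -> fin_upper B N ->
  (forall k, LLc (N ^~ k)) ->
  (forall m k, ipc (M ^~ k) (N ^~ m) = ((if k == m then beta else 0)%:C)%C) ->
  fin_lower (beta ^+ 2 / B) M.
Proof.
move=> B0 LM hN LN bi K c; rewrite (fin_norm_comb LM) Nm2 lee_fin.
pose v j := \sum_(k <- K) M j k * c k; rewrite -/v; pose w j := \sum_(k <- K) N j k * c k; set S := \sum_(k <- K) sqn (c k).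
have Lv : LLc v by exact: LL_comb.
have Lw : LLc w by exact: LL_comb.
have S0 : 0 <= S by apply: sumr_ge0 => k _; exact: sqn_ge0.
have ipvw : ipc v w = ((beta * S)%:C)%C.
  rewrite ip_suml//; last by move=> k; under eq_fun do rewrite mulrC; exact: LL_Z.
  rewrite /S mulr_sumr RC_sum big_seq [RHS]big_seq; apply: eq_bigr => k kK.
  under [X in ip _ X _]eq_fun do rewrite mulrC.
  rewrite ipZl// ip_sumr//; last by move=> m; under eq_fun do rewrite mulrC; exact: LL_Z.
  rewrite (eq_bigr (fun m => if m == k then conjc (c k) * (beta%:C)%C else 0)); last first.
    move=> m _; under [X in ip _ _ X]eq_fun do rewrite mulrC.
    rewrite ipZr// bi; case: eqVneq => [->//|_].
    by rewrite mulr0.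
  by rewrite fset_pick// mulrA mulcJ -RCM mulrC.
have := CS Lv Lw; rewrite ipvw sqnR => h.
have hw : N2c w <= B * S.
  have := hN K c; rewrite (fin_norm_comb LN) Nm2 lee_fin; by [].
have [->|S1] := eqVneq S 0; first by rewrite mulr0 N2_ge0.
have Sp : 0 < S by rewrite lt_neqAle eq_sym S1.
have h2 : (beta * S) ^+ 2 <= N2c v * (B * S).
  by apply: le_trans h _; apply: ler_wpM2l; rewrite ?N2_ge0.
rewrite mulrAC ler_pdivrMr// -(ler_pM2r Sp).
by move: h2; rewrite exprMn [S ^+ 2]expr2 !mulrA.
Qed.

(** A finite combination of these columns is M S applied to a finitely supported vector, so the
    bounds of M and S multiply. *)
Lemma dual_upper A B M S : 0 < A -> 0 <= B -> fin_upper B M -> bounded_op A^-1 S ->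
  fin_upper (B * A^-1 ^+ 2) (fun j m => mx_op M (S (delta m)) j).
Proof.
move=> A0 B0 hB bS K c.
have LS m : LLc (S (delta m)) by apply: (op_LL bS); exact: LL_delta.
have bM := (@fin_upper_bounded R I i0 B M B0 hB).2.
have L1 (K' : seq I) : LLc (fun i => \sum_(m <- K') c m * S (delta m) i).
  by apply: LL_sum => m; exact: LL_Z.
have E (K' : seq I) : (fun j => \sum_(m <- K') mx_op M (S (delta m)) j * c m) =
    mx_op M (fun i => \sum_(m <- K') c m * S (delta m) i).
  elim: K' => [|m r ih].
    transitivity (mx_op M (fun=> 0)).
      rewrite (op_0 (i0 := i0) bM); apply/funext => j.
      by rewrite big_nil.
    by congr mx_op; apply/funext => i; rewrite big_nil.
  have -> : (fun i => \sum_(m <- m :: r) c m * S (delta m) i) =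
     (fun i => c m * S (delta m) i + \sum_(m <- r) c m * S (delta m) i).
    by apply/funext => i; rewrite big_cons.
  rewrite (op_lin bM (c m) (LS m) (L1 r)) -ih; apply/funext => j.
  by rewrite big_cons mulrC.
have E' (K' : seq I) : (fun i => \sum_(m <- K') c m * S (delta m) i) =
    S (fun i => \sum_(m <- K') c m * delta m i).
  elim: K' => [|m r ih].
    transitivity (S (fun=> 0)).
      rewrite (op_0 (i0 := i0) bS); apply/funext => j.
      by rewrite big_nil.
    by congr S; apply/funext => i; rewrite big_nil.
  have -> : (fun i => \sum_(m <- m :: r) c m * delta m i) =
     (fun i => c m * delta m i + \sum_(m <- r) c m * delta m i).
    by apply/funext => i; rewrite big_cons.
  have Ld : LLc (fun i => \sum_(m <- r) c m * delta m i).
    by apply: LL_sum => k; apply: LL_Z; exact: LL_delta.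
  rewrite (op_lin (i0 := i0) bS (c m) (@LL_delta R I i0 m) Ld) -ih.
  by apply/funext => j; rewrite big_cons.
have [Lt Et] := @N2_trunc R I i0 c K.
have EK : fin_norm (fun j m => mx_op M (S (delta m)) j) K c = n2 cnt (mx_op M (S (trunc c K))).
  by rewrite trunc_sum -E' -E n2_esum.
have L2' := op_LL bS Lt; have [L3 h3] := fin_upper_N2 B0 hB L2'.
rewrite EK (LL_fin L3) lee_fin -Et -mulrA; apply: le_trans h3 _.
by apply: ler_wpM2l => //; exact: (bounded_opP bS Lt).2.
Qed.

End MatrixEquiv.

(** * Behaviour of the inverse Gram matrix under shifts *)

Section ShiftInverse.
Context {R : realType} {d : nat}.
Local Notation V := (Zd d).
Local Notation cnt := (@cnt R V 0).
Local Notation LLc := (@LL _ (disc (0 : V)) R cnt).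

Lemma has_csum_shift (u : V -> R[i]) (z : R[i]) (m : V) :
  has_csum u z -> has_csum (fun k => u (k + m)) z.
Proof.
move=> /has_csumP h; apply/has_csumP => e e0; have [A hA] := h e e0.
exists [fset k - m | k in A]%fset => K AK.
have -> : \sum_(k <- K) u (k + m) = \sum_(k <- [fset k - (- m) | k in K]%fset) u k.
  by rewrite big_shift; apply: eq_bigr => k _; rewrite opprK.
apply: hA; apply/fsubsetP => k kA; apply/imfsetP; exists (k - m) => /=; last by rewrite opprK subrK.
by apply: (fsubsetP AK); apply/imfsetP; exists k.
Qed.

Lemma LL_shiftZ (u : V -> R[i]) m : LLc u -> LLc (fun k => u (k + m)).
Proof.
move=> [_]; rewrite n2_esum => h; split; first exact: cmeas_disc.
by rewrite n2_esum -(esum_addr (fun k => (sqn (u k))%:E)).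
Qed.

Variables (A B : R) (M : V -> V -> R[i]) (j m : V).
Hypotheses (A0 : 0 < A) (B0 : 0 <= B) (hB : fin_upper B M) (hA : fin_lower A M).
Let M' : V -> V -> R[i] := fun i k => M (i + j) (k + m).

Let hB' : fin_upper B M'.
Proof.
rewrite (_ : M' = fun i k => M (i + j) (k - (- m))).
  by apply: (fin_upper_col (M := fun i k => M (i + j) k)); exact: fin_upper_row.
by apply/funext => i; apply/funext => k; rewrite opprK.
Qed.

Let hA' : fin_lower A M'.
Proof.
rewrite (_ : M' = fun i k => M (i + j) (k - (- m))).
  by apply: (fin_lower_col (M := fun i k => M (i + j) k)); exact: fin_lower_row.
by apply/funext => i; apply/funext => k; rewrite opprK.
Qed.

Lemma mx_op_shift u i : LLc u -> mx_op M' (fun k => u (k + m)) i = mx_op M u (i + j).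
Proof.
move=> Lu; rewrite [RHS](csum_eq (fin_csum B0 hB (j := i + j) Lu)); apply: csum_eq.
exact: has_csum_shift (fin_csum B0 hB (j := i + j) Lu).
Qed.

Lemma gram_shift k l : gram M' k l = gram M (k + m) (l + m).
Proof.
have bM := @fin_upper_bounded R V 0 B M B0 hB; have LM := @bounded_col R V 0 _ _ bM.
have h : has_csum (fun i => conjc (M i (k + m)) * M i (l + m)) (gram M (k + m) (l + m)).
  rewrite (gramE _ _ LM).
  by apply: has_csum_eq (ip_csum (LM (l + m)) (LM (k + m))) => i; rewrite mulrC.
by apply: csum_eq; exact: has_csum_shift h.
Qed.

(** The Gram matrix of the shifted matrix is the shifted Gram matrix, so [u'] and the shift of u
    solve the same equation, and solutions are unique. For fibers it says that the solution for e_0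
    at x + a j - m/b is the shifted solution for e_m at x. *)
Lemma inverse_shift u u' : LLc u -> LLc u' -> mx_op (gram M) u = delta m ->
  mx_op (gram M') u' = delta (0 : V) -> u' = fun k => u (k + m).
Proof.
move=> Lu Lu' Eu Eu'; have Lum := LL_shiftZ m Lu.
apply: (gram_inj A0 B0 hB' hA' Lu' Lum); rewrite Eu'; apply/funext => k; apply/esym.
have bM := @fin_upper_bounded R V 0 B M B0 hB.
have h := gram_csum (k := k + m) bM Lu.
transitivity (mx_op (gram M) u (k + m)).
  rewrite [RHS](csum_eq h); apply: csum_eq.
  by apply: has_csum_eq (has_csum_shift m h) => l; rewrite gram_shift.
rewrite Eu /delta; congr (_%:R); congr nat_of_bool.
by rewrite -subr_eq0 addrK.
Qed.

End ShiftInverse.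

(** * Measurability of limits and sums *)

Section MeasurableLimits.
Context d (T : measurableType d) (R : realType).

Lemma cmeas_lim (F : T -> R[i]) (f : nat -> T -> R[i]) : (forall n, cmeas (f n)) ->
  (forall x (e : R), 0 < e -> exists N, forall n, (N <= n)%N -> sqn (F x - f n x) <= e) ->
  cmeas F.
Proof.
move=> mf h.
have cv (p : R[i] -> R) : (forall z w, (p z - p w) ^+ 2 <= sqn (z - w)) ->
    forall x, p (f n x) @[n --> \oo] --> p (F x).
  move=> hp x; apply/cvgrPdist_le => e e0.
  have [N hN] := h x _ (exprn_gt0 2 e0); exists N => // n /= Nn.
  rewrite -(@ler_pXn2r _ 2)// ?nnegrE ?(ltW e0)// real_normK ?num_real//.
  exact: le_trans (hp _ _) (hN n Nn).
split.
  apply: (measurable_fun_cvg (h := fun n x => complex.Re (f n x))).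
    by move=> n; have [] := mf n.
  move=> x _; apply: (cv (@complex.Re R)) => z w.
  by rewrite /sqn ReD ReN lerDl sqr_ge0.
apply: (measurable_fun_cvg (h := fun n x => complex.Im (f n x))).
  by move=> n; have [] := mf n.
move=> x _; apply: (cv (@complex.Im R)) => z w.
by rewrite /sqn ImD ImN lerDr sqr_ge0.
Qed.

(** An unconditional sum is in particular the limit along one increasing sequence of finite sets
    that exhausts I, the same sequence for all x. *)
Lemma cmeas_csum (I : countType) (v : I -> T -> R[i]) : (forall k, cmeas (v k)) ->
  (forall x, csummable (v ^~ x)) -> cmeas (fun x => csum (v ^~ x)).
Proof.
move=> mv sv; pose A n := seq_fset tt (pmap (@pickle_inv I) (iota 0 n)).
have AP n (k : I) : (choice.pickle k < n)%N -> k \in A n.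
  move=> kn; rewrite seq_fsetE mem_pmap -(@pickleK_inv I k); apply: map_f.
  by rewrite mem_iota.
apply: (@cmeas_lim _ (fun n x => \sum_(k <- A n) v k x)); first by move=> n; exact: cmeas_sum.
move=> x e e0; have [z hz] := sv x; rewrite (csum_eq hz).
have [K hK] := (iffLR (has_csumP _ _) hz) e e0.
exists (\max_(k <- K) (choice.pickle k).+1) => n Kn; apply: hK; apply/fsubsetP => k kK.
by apply: AP; apply: leq_trans Kn; exact: (@leq_bigmax_seq _ _ xpredT (fun k => (choice.pickle k).+1) k kK isT).
Qed.

Variable D : set T.

Definition cmeas_on (f : T -> R[i]) := cmeas (ind D f).

Lemma cmeas_onD f g : cmeas_on f -> cmeas_on g -> cmeas_on (fun x => f x + g x).
Proof.
move=> mf mg; rewrite /cmeas_on (_ : ind D _ = fun x => ind D f x + ind D g x).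
  exact: cmeasD.
by apply/funext => x; rewrite /ind mulrDr.
Qed.

Lemma cmeas_onM f g : cmeas_on f -> cmeas_on g -> cmeas_on (fun x => f x * g x).
Proof.
move=> mf mg; rewrite /cmeas_on (_ : ind D _ = fun x => ind D f x * ind D g x).
  exact: cmeasM.
apply/funext => x; have [Dx|nDx] := pselect (D x); first by rewrite !ind_in.
by rewrite (ind_out _ nDx) (ind_out f nDx) mul0r.
Qed.

Hypothesis mD : measurable D.

Lemma cmeas_onW f : cmeas f -> cmeas_on f.
Proof. exact: cmeas_ind. Qed.

Lemma cmeas_on_csum (I : countType) (v : I -> T -> R[i]) : (forall k, cmeas_on (v k)) ->
  (forall x, D x -> csummable (v ^~ x)) -> cmeas_on (fun x => csum (v ^~ x)).
Proof.
move=> mv sv.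
have c0 : has_csum (fun _ : I => 0 : R[i]) 0.
  by have := @has_csum_fin R I (fun=> 0) fset0 (fun _ _ => erefl); rewrite big_seq_fset0.
rewrite /cmeas_on (_ : ind D _ = fun x => csum (fun k => ind D (v k) x)).
  apply: cmeas_csum => // x; have [Dx|nDx] := pselect (D x).
    rewrite (_ : (fun k => _) = v ^~ x); first exact: sv.
    by apply/funext => k; rewrite ind_in.
  exists 0; apply: has_csum_eq c0 => k; by rewrite ind_out.
apply/funext => x; have [Dx|nDx] := pselect (D x).
  by rewrite ind_in//; congr csum; apply/funext => k; rewrite ind_in.
rewrite (ind_out _ nDx); apply/esym/csum_eq; apply: has_csum_eq c0 => k.
by rewrite ind_out.
Qed.

Lemma cmeas_on_lim (F : T -> R[i]) (f : nat -> T -> R[i]) : (forall n, cmeas_on (f n)) ->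
  (forall x, D x -> forall e : R, 0 < e -> exists N, forall n, (N <= n)%N -> sqn (F x - f n x) <= e) ->
  cmeas_on F.
Proof.
move=> mf h; apply: (@cmeas_lim _ (fun n => ind D (f n))) => // x e e0.
have [Dx|nDx] := pselect (D x).
  have [N hN] := h x Dx e e0; exists N => n Nn; rewrite !(ind_in _ Dx); exact: hN.
by exists 0%N => n _; rewrite !(ind_out _ nDx) subrr sqn0 ltW.
Qed.

End MeasurableLimits.

Lemma has_csumZ (R : realType) (I : choiceType) (a z : R[i]) (u : I -> R[i]) :
  has_csum u z -> has_csum (fun i => a * u i) (a * z).
Proof.
move=> /has_csumP h; apply/has_csumP => e e0; have a1 : 0 < 1 + sqn a by rewrite ltr_wpDr ?sqn_ge0.
have [A hA] := h _ (divr_gt0 e0 a1); exists A => B AB.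
rewrite -mulr_sumr -mulrBr sqnM; apply: le_trans (ler_wpM2l (sqn_ge0 a) (hA B AB)) _.
by rewrite mulrCA ler_piMr ?(ltW e0)// ler_pdivrMr// mul1r lerDr.
Qed.

Lemma fin_upper_scale (R : realType) (I : countType) (M : I -> I -> R[i]) (B : R) (z : R[i]) :
  fin_upper B M -> fin_upper (sqn z * B) (fun j k => z * M j k).
Proof.
move=> h K c; have -> : fin_norm (fun j k => z * M j k) K c = ((sqn z)%:E * fin_norm M K c)%E.
  rewrite /fin_norm -esumZl ?sqn_ge0//; last by move=> j; rewrite lee_fin sqn_ge0.
  apply: eq_esum => j _; rewrite -EFinM -sqnM; congr (sqn _)%:E.
  by rewrite mulr_sumr; apply: eq_bigr => k _; rewrite mulrA.
rewrite -mulrA EFinM; apply: lee_wpmul2l (h K c).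
by rewrite lee_fin sqn_ge0.
Qed.

(** * The dual window *)

Section DualWindow.
Context {R : realType} {d : nat}.
Local Notation mu := (lebesgue R d).
Variables (g : Rd R d -> R[i]) (a b A B : R).
Hypotheses (Lg : LL mu g) (a0 : 0 < a) (b0 : 0 < b) (A0 : 0 < A) (B0 : 0 <= B).
Local Notation s := (b^-1).
Let s0 : 0 < s. Proof. by rewrite invr_gt0. Qed.
Local Notation P := (pre_gramian g a b).
Local Notation V := (Zd d).
Local Notation cnt := (@cnt R V 0).
Local Notation LLc := (@LL _ (disc (0 : V)) R cnt).
Local Notation ipc := (@ip _ (disc (0 : V)) R cnt).
Local Notation del m := (@delta R V m).

Section Construction.
Variables (D : set (Rd R d)) (S : Rd R d -> (V -> R[i]) -> (V -> R[i])).
Hypotheses (mD : measurable D).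
Hypotheses (DU : forall x, D x -> fin_upper B (P x)) (DL : forall x, D x -> fin_lower A (P x)).
Hypothesis hS : forall x, D x -> bounded_op A^-1 (S x) /\
  forall c, LLc c -> [/\ LLc (S x c), S x (mx_op (gram (P x)) c) = c, mx_op (gram (P x)) (S x c) = c &
   forall e : R, 0 < e -> exists N, forall n, (N <= n)%N ->
     @Nm _ (disc (0 : V)) R cnt (fun k => S x c k - richardson (Num.sqrt B ^+ 2) A (mx_op (gram (P x))) c n k) <= e].

Let bM x (Dx : D x) := @fin_upper_bounded R V 0 B (P x) B0 (DU Dx).

Lemma cmeas_gram k l : cmeas_on D (fun x => gram (P x) k l).
Proof.
apply: (cmeas_on_csum (v := fun j x => conjc (P x j k) * P x j l)).
  move=> j; apply: cmeas_onW => //; apply: cmeasM; last exact: cmeas_pre.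
  by apply: cmeasJ; exact: cmeas_pre.
move=> x Dx; have LM := @bounded_col R V 0 _ _ (bM Dx).
exists (ipc ((P x) ^~ l) ((P x) ^~ k)).
by apply: has_csum_eq (ip_csum (LM l) (LM k)) => j; rewrite mulrC.
Qed.

Lemma cmeas_gram_op (w : Rd R d -> V -> R[i]) : (forall k, cmeas_on D (w ^~ k)) ->
  (forall x, D x -> LLc (w x)) -> forall k, cmeas_on D (fun x => mx_op (gram (P x)) (w x) k).
Proof.
move=> mw Lw k; apply: (cmeas_on_csum (v := fun l x => gram (P x) k l * w x l)).
  by move=> l; apply: cmeas_onM => //; exact: cmeas_gram.
by move=> x Dx; eexists; exact: (gram_csum (k := k) (bM Dx) (Lw x Dx)).
Qed.

Lemma cmeas_rich c n : LLc c -> forall k,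
  cmeas_on D (fun x => richardson (Num.sqrt B ^+ 2) A (mx_op (gram (P x))) c n k).
Proof.
move=> Lc; elim: n => [|n ih] k.
  by apply: cmeas_onW => //; exact: cmeas_cst.
apply: cmeas_onD; first exact: ih.
apply: cmeas_onM; first by apply: cmeas_onW => //; exact: cmeas_cst.
apply: cmeas_onD; first by apply: cmeas_onW => //; exact: cmeas_cst.
rewrite (_ : (fun x => _) = fun x => (-1) * mx_op (gram (P x))
   (richardson (Num.sqrt B ^+ 2) A (mx_op (gram (P x))) c n) k); last first.
  by apply/funext => x; rewrite mulN1r.
apply: cmeas_onM; first by apply: cmeas_onW => //; exact: cmeas_cst.
apply: (cmeas_gram_op (w := fun x => richardson (Num.sqrt B ^+ 2) A (mx_op (gram (P x))) c n)) => //.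
by move=> x Dx; exact: (@LL_gram_rich R V 0 A B (P x) B0 (DU Dx) c n Lc).
Qed.

Lemma cmeas_inverse c : LLc c -> forall k, cmeas_on D (fun x => S x c k).
Proof.
move=> Lc k; apply: (cmeas_on_lim (f := fun n x => richardson (Num.sqrt B ^+ 2) A (mx_op (gram (P x))) c n k)).
  by move=> n; exact: cmeas_rich.
move=> x Dx e e0; have [_ /(_ c Lc)[L1 _ _ h]] := hS Dx.
have se0 : 0 < Num.sqrt e by rewrite sqrtr_gt0.
have [N hN] := h _ se0; exists N => n Nn.
have LB := LL_B L1 (@LL_gram_rich R V 0 A B (P x) B0 (DU Dx) c n Lc).
apply: le_trans (sqn_le_N2 k LB) _; rewrite -Nm2 -(sqr_sqrtr (ltW e0)).
by rewrite ler_pXn2r ?nnegrE ?Nm_ge0 ?sqrtr_ge0//; exact: hN.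
Qed.

Definition dual_window : Rd R d -> R[i] := ind D (fun x =>
  ((b ^+ d)%:C)%C * conjc (mx_op (P x) (S x (del 0)) 0)).

Lemma cmeas_dual : cmeas dual_window.
Proof.
apply: cmeas_onM; first by apply: cmeas_onW => //; exact: cmeas_cst.
have : cmeas_on D (fun x => mx_op (P x) (S x (del 0)) 0).
  apply: (cmeas_on_csum (v := fun k x => P x 0 k * S x (del 0) k)).
    move=> k; apply: cmeas_onM; first by apply: cmeas_onW => //; exact: cmeas_pre.
    by apply: cmeas_inverse; exact: LL_delta.
  move=> x Dx; have [_ /(_ _ (@LL_delta R V 0 0))[L1 _ _ _]] := hS Dx.
  by eexists; exact: (fin_csum B0 (DU Dx) (j := 0) L1).
move=> /cmeasJ; rewrite /cmeas_on; congr cmeas; apply/funext => x.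
have [Dx|nDx] := pselect (D x); first by rewrite !(ind_in _ Dx).
by rewrite !(ind_out _ nDx) conjc0.
Qed.

(** The window at x + a j - m/b is built from the inverse Gram operator at that point;
    [inverse_shift] expresses it through the one at x. Up to b^d the pre-Gramian of the window is
    thus P(x) R(x)^-1, whichever inverses were chosen along the orbit. *)
Lemma dual_pre x : D x -> (forall j m, D (shift_pt a b x j m)) ->
  pre_gramian dual_window a b x =
  fun j m => ((b ^+ d)%:C)%C * mx_op (P x) (S x (del m)) j.
Proof.
move=> Dx Dsh; apply/funext => j; apply/funext => m; rewrite /pre_gramian /dual_window.
have Dy := Dsh j m; rewrite ind_in// conjcM conjcK conjc_real; congr (_ * _).
have Py : P (shift_pt a b x j m) = fun i k => P x (i + j) (k + m).
  rewrite shift_ptE pre_shift_col pre_shift_row.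
  by apply/funext => i; apply/funext => k; rewrite opprK.
have [_ /(_ _ (@LL_delta R V 0 0))[L1 _ E1 _]] := hS Dy.
have [_ /(_ _ (@LL_delta R V 0 m))[L2 _ E2 _]] := hS Dx.
rewrite Py in E1.
have E := inverse_shift A0 B0 (DU Dx) (DL Dx) L2 L1 E2 E1.
by rewrite Py E (mx_op_shift j m B0 (DU Dx) 0 L2) add0r.
Qed.

Hypothesis aeD : {ae mu, forall x, D x}.

Lemma ae_dual_pre : {ae mu, forall x, D x /\ pre_gramian dual_window a b x =
  fun j m => ((b ^+ d)%:C)%C * mx_op (P x) (S x (del m)) j}.
Proof.
(* For almost every x all lattice translates lie in D at once, since they are countable in
   number. *)
have h : {ae mu, forall x, forall p : V * V, D (shift_pt a b x p.1 p.2)}.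
  apply: ae_all => p; have := ae_shift (tadd (lat a p.1) (lat s (- p.2))) aeD.
  by apply: filterS => x; rewrite shift_ptE taddA.
have := ae_and aeD h; apply: filterS => x [Dx hx]; split => //.
by apply: dual_pre => // j m; exact: hx (j, m).
Qed.

Let Bd := sqn (((b ^+ d)%:C)%C : R[i]) * (B * A^-1 ^+ 2).
Let Bd0 : 0 <= Bd. Proof. by rewrite mulr_ge0 ?sqn_ge0// mulr_ge0 ?sqr_ge0. Qed.

Lemma ae_dual_upper : {ae mu, forall x, fin_upper Bd (pre_gramian dual_window a b x)}.
Proof.
apply: filterS ae_dual_pre => x [Dx ->]; apply: fin_upper_scale.
exact: (@dual_upper R V 0 A B (P x) (S x) A0 B0 (DU Dx) (hS Dx).1).
Qed.

(** The sum over j of |gamma(x + a j)|^2 is the squared norm of column 0 of the pre-Gramian of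
    gamma. It is almost everywhere at most [Bd], and the cube of side a has finite measure. *)
Lemma LL_dual : LL mu dual_window.
Proof.
split; first exact: cmeas_dual.
have mf : measurable_fun setT (fun x => (sqn (dual_window x))%:E).
  by apply/measurable_EFinP/measurable_sqn; exact: cmeas_dual.
rewrite /n2 (tiling_in a0 mf) => [|x]; last by rewrite lee_fin sqn_ge0.
have mC : measurable (@cube R d a) by exact: measurable_cube.
apply: (@le_lt_trans _ _ (Bd%:E * \int[mu]_(x in cube d a) (cst 1 x)%:E)%E); last first.
  rewrite (_ : (\int[mu]_(x in _) _)%E = (\int[mu]_(x in cube d a) (cst 1%E x))%E)//.
  by rewrite integral_cst// mul1e -[X in (_ * X)%E]/(mu (cube d a)) lebesgue_cube ?(ltW a0)// -EFinM ltry.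
apply: ae_integral_le => //.
- apply: (emeasurable_esum (f := fun j x => (sqn (dual_window (tadd x (lat a j))))%:E)).
    by move=> j; exact: measurableT_comp mf (measurable_tadd _).
  by move=> j x; rewrite lee_fin sqn_ge0.
- by move=> x; apply: esum_ge0 => j _; rewrite lee_fin sqn_ge0.
- apply: filterS ae_dual_upper => x /(_ [fset 0]%fset (fun=> 1)).
  rewrite big_seq_fset1 sqn1; apply: le_trans; apply: le_esum => j _.
  rewrite big_seq_fset1 mulr1 /pre_gramian sqnJ shift_ptE.
  by rewrite oppr0 (_ : tadd (tadd x _) _ = tadd x (lat a j))//;
     apply: eq_from_tnth => i; rewrite !tnth_tadd [tnth (lat s 0) i]tnth_lat ffunE mulr0 addr0.
Qed.

(** For u = R(x)^-1 e_0 one has <P(x) e_k, P(x) u> = <e_k, R(x) u>, which is 1 for k = 0 and 0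
    otherwise; the factor b^d is that of the window. *)
Lemma dual_biorth k : {ae mu, forall x, has_csum
  (fun j => dual_window (shift_pt a b x j 0) * conjc (g (shift_pt a b x j k)))
  ((b ^+ d * (k == 0)%:R)%:C)%C}.
Proof.
apply: filterS ae_dual_pre => x [Dx Ex].
have E j : dual_window (shift_pt a b x j 0) =
    conjc (((b ^+ d)%:C)%C * mx_op (P x) (S x (del 0)) j).
  by have /(congr1 (fun f => conjc (f j 0))) := Ex; rewrite /= /pre_gramian conjcK.
have Ld m : LLc (del m) by exact: LL_delta.
have [_ /(_ _ (Ld 0))[Lu _ Eu _]] := hS Dx.
have bx := bM Dx; have LPu := op_LL bx.2 Lu; have LPk := op_LL bx.2 (Ld k).
have h := @has_csumZ R V (((b ^+ d)%:C)%C) _ _ (ip_csum LPk LPu).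
have F : ipc (mx_op (P x) (del k)) (mx_op (P x) (S x (del 0))) = (((k == 0)%:R)%:C)%C.
  rewrite (ipJ LPu LPk) -(gram_form bx Lu (Ld k)) Eu ip_deltar; last exact: Ld.
  by rewrite /delta; case: (k == 0); apply: cplxP; rewrite //= oppr0.
rewrite RCM -F; apply: has_csum_eq h => j.
rewrite E conjcM conjc_real -mulrA; congr (_ * _).
by rewrite mx_op_delta mulrC.
Qed.

End Construction.

Lemma dual_exists : {ae mu, forall x, fin_upper B (P x)} -> {ae mu, forall x, fin_lower A (P x)} ->
  exists gamma, [/\ LL mu gamma,
    exists2 C : R, 0 <= C & {ae mu, forall x, fin_upper C (pre_gramian gamma a b x)} &
    forall k : V, {ae mu, forall x, has_csum
      (fun j => gamma (shift_pt a b x j 0) * conjc (g (shift_pt a b x j k)))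
      ((b ^+ d * (k == 0)%:R)%:C)%C}].
Proof.
move=> hU hL; have [N [mN N0 hN]] := ae_and hU hL.
(* D is the complement of a measurable null set because the set where the bounds hold is not itself
   known to be measurable. *)
pose D := ~` N; have mD : measurable D by exact: measurableC.
have good x : D x -> fin_upper B (P x) /\ fin_lower A (P x).
  by move=> Dx; apply: contrapT => h; apply: Dx; exact: hN.
have DU x (Dx : D x) := (good x Dx).1; have DL x (Dx : D x) := (good x Dx).2.
have aeD : {ae mu, forall x, D x} by exists N; split => // x /contrapT.
(* The inverses are picked point by point, with no regularity in x; the recorded convergence of the
   iterates restores measurability. *)
have /choice[S hS] : forall x, exists S, D x -> bounded_op A^-1 S /\
  forall c, LLc c -> [/\ LLc (S c), S (mx_op (gram (P x)) c) = c, mx_op (gram (P x)) (S c) = c &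
   forall e : R, 0 < e -> exists N, forall n, (N <= n)%N ->
     @Nm _ (disc (0 : V)) R cnt (fun k => S c k - richardson (Num.sqrt B ^+ 2) A (mx_op (gram (P x))) c n k) <= e].
  move=> x; have [Dx|nDx] := pselect (D x); last by exists id.
  by have [S ?] := @gram_inverse R V 0 A B (P x) A0 B0 (DU x Dx) (DL x Dx); exists S.
exists (dual_window D S); split.
- exact: LL_dual.
- eexists; last exact: ae_dual_upper.
  by rewrite mulr_ge0 ?sqn_ge0// mulr_ge0 ?sqr_ge0.
- by move=> k; exact: dual_biorth.
Qed.

End DualWindow.

Section DualLower.
Context {R : realType} {d : nat}.
Local Notation mu := (lebesgue R d).
Variables (g gamma : Rd R d -> R[i]) (a b B : R).
Hypotheses (Lg : LL mu g) (Lgamma : LL mu gamma) (a0 : 0 < a) (b0 : 0 < b) (B0 : 0 < B).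
Local Notation V := (Zd d).

(** The relations involve gamma at index 0 only. Taken at x - m/b for the countably many m, they
    give biorthogonality between all columns of the two pre-Gramians, as [dual_lower] requires. *)
Lemma biorth_lower : {ae mu, forall x, fin_upper B (pre_gramian gamma a b x)} ->
  (forall k : V, {ae mu, forall x, has_csum
      (fun j => gamma (shift_pt a b x j 0) * conjc (g (shift_pt a b x j k)))
      ((b ^+ d * (k == 0)%:R)%:C)%C}) ->
  {ae mu, forall x, fin_lower ((b ^+ d) ^+ 2 / B) (pre_gramian g a b x)}.
Proof.
move=> hU hb.
have h : {ae mu, forall x, forall p : V * V, has_csum
   (fun j => gamma (shift_pt a b (tadd x (lat b^-1 (- p.1))) j 0) *
      conjc (g (shift_pt a b (tadd x (lat b^-1 (- p.1))) j p.2)))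
   ((b ^+ d * (p.2 == 0)%:R)%:C)%C}.
  by apply: ae_all => p; exact: (ae_shift (lat b^-1 (- p.1)) (hb p.2)).
have := ae_and (ae_and h hU) (ae_and (ae_columns b Lg a0) (ae_columns b Lgamma a0)).
apply: filterS => x [[hx Ux] [cg cgam]].
apply: (@dual_lower R V 0 B (b ^+ d) _ _ B0 cg Ux cgam) => m k.
have sh j l : shift_pt a b (tadd x (lat b^-1 (- m))) j l = shift_pt a b x j (l + m).
  by rewrite !shift_ptE [tadd (tadd x _) _]taddAC taddA lat_add opprD addrC.
have := hx (m, k - m); rewrite /=.
have E j : gamma (shift_pt a b (tadd x (lat b^-1 (- m))) j 0) *
      conjc (g (shift_pt a b (tadd x (lat b^-1 (- m))) j (k - m))) =
   pre_gramian g a b x j k * conjc (pre_gramian gamma a b x j m).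
  by rewrite !sh add0r subrK /pre_gramian conjcK mulrC.
move=> /(has_csum_eq E) h1.
rewrite (has_csum_unique (ip_csum (cg k) (cgam m)) h1) subr_eq0.
by case: eqP => _; rewrite ?mulr1 ?mulr0.
Qed.

End DualLower.

(** * Equivalences *)

Section Characterization.
Context {R : realType} {d : nat}.
Local Notation mu := (lebesgue R d).
Variables (g : Rd R d -> R[i]) (a b : R).
Hypotheses (Lg : LL mu g) (a0 : 0 < a) (b0 : 0 < b).
Local Notation s := (b^-1).
Let s0 : 0 < s. Proof. by rewrite invr_gt0. Qed.
Local Notation P := (pre_gramian g a b).
Local Notation V := (Zd d).

Definition fiber_bounds := exists A B : R, [/\ 0 < A, 0 < B,
  {ae mu, forall x, fin_upper B (P x)} & {ae mu, forall x, fin_lower A (P x)}].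

Lemma esum_inner (f h : Rd R d -> R[i]) (c e : R) :
  (\esum_(p in setT) (normc (inner f (gabor h c e p)) ^+ 2)%:E =
   \esum_(p in setT) (sqn (ip mu f (gabor h c e p)))%:E)%E.
Proof. by apply: eq_esum => p _; rewrite normc_sqn. Qed.

Lemma bessel_fiber (h : Rd R d -> R[i]) : LL mu h -> is_bessel (gabor h a b) <->
  exists2 B : R, 0 < B & {ae mu, forall x, fin_upper B (pre_gramian h a b x)}.
Proof.
move=> Lh; split=> [[B [B0 hB]]|[B B0 hB]].
  exists (B * b ^+ d); first by rewrite mulr_gt0// exprn_gt0.
  apply: bessel_upper => // [|f /L2E Lf]; first exact: ltW.
  by have := hB f Lf; rewrite esum_inner sqnorm_L2E.
exists (s ^+ d * B); split; first by rewrite mulr_gt0// exprn_gt0.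
move=> f /L2E Lf; rewrite esum_inner sqnorm_L2E.
exact: (upper_bessel Lh b0 (ltW B0) hB Lf).
Qed.

Lemma frame_fiber : is_frame (gabor g a b) <-> fiber_bounds.
Proof.
split=> [[A [B [A0 B0 h]]]|[A [B [A0 B0 hB hA]]]].
  exists (A * b ^+ d), (B * b ^+ d); split; rewrite ?mulr_gt0 ?exprn_gt0//.
    apply: bessel_upper => // [|f /L2E Lf]; first exact: ltW.
    by have /andP[_] := h f Lf; rewrite esum_inner sqnorm_L2E.
  apply: frame_lower => // [|f /L2E Lf]; first exact: ltW.
  by have /andP[+ _] := h f Lf; rewrite esum_inner sqnorm_L2E.
exists (s ^+ d * A), (s ^+ d * B); split; rewrite ?mulr_gt0 ?exprn_gt0//.
move=> f /L2E Lf; rewrite esum_inner sqnorm_L2E.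
rewrite (lower_frame Lg b0 (ltW A0) (ltW B0) hB hA Lf).
by rewrite (upper_bessel Lg b0 (ltW B0) hB Lf).
Qed.

Lemma dual_fiber :
  (is_bessel (gabor g a b) /\ exists gamma : Rd R d -> R[i],
     [/\ L2 gamma, is_bessel (gabor gamma a b)
       & forall k : V, {ae mu, forall x, has_csum
            (fun j : V => gamma (shift_pt a b x j 0) * conjc (g (shift_pt a b x j k)))
            ((b ^+ d * (k == 0)%:R)%:C)%C}])
  <-> fiber_bounds.
Proof.
split=> [[/(bessel_fiber Lg)[B B0 hB] [gamma [/L2E Lgam bgam bi]]]|[A [B [A0 B0 hB hA]]]].
  have [B' B'0 hB'] := (iffLR (bessel_fiber Lgam)) bgam.
  exists ((b ^+ d) ^+ 2 / B'), B; split => //.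
    by rewrite divr_gt0 ?exprn_gt0.
  exact: (biorth_lower Lg Lgam a0 B'0 hB' bi).
split; first by apply/bessel_fiber => //; exists B.
have [gamma [Lgam [C C0 hC] bi]] := dual_exists Lg a0 A0 (ltW B0) hB hA.
exists gamma; split => //; first exact/L2E.
(* The bound C may be 0, while a Bessel bound is positive. *)
apply/bessel_fiber => //; exists (C + 1); first by rewrite ltr_wpDl.
by apply: filterS hC => x; apply: fin_upper_mono; rewrite lerDl.
Qed.

(** The results on Riesz sequences take the modulation step c as parameter and 1/c as side of the
    cube; here c = 1/a, whence the double inverses that [invrK] removes. *)
Lemma riesz_fiber : is_riesz_seq (gabor g s a^-1) <-> fiber_bounds.
Proof.
have ai0 : 0 < a^-1 by rewrite invr_gt0.
split=> [[A [B [A0 B0 h]]]|[A [B [A0 B0 hB hA]]]].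
  exists (A * a^-1 ^+ d), (B * a^-1 ^+ d).
  have [h1 h2] := riesz_bounds Lg ai0 A0 B0 h.
  by rewrite invrK in h1 h2; split; rewrite ?mulr_gt0 ?exprn_gt0.
by apply: (bounds_riesz Lg ai0 A0 B0); rewrite invrK.
Qed.

Lemma fin_frame_fiber :
  (exists A B : R, [/\ 0 < A, 0 < B
      & {ae mu, forall x, forall c : V -> R[i], l2 c ->
          (forall j : V, csummable (fun k : V => c k * conjc (g (shift_pt a b x j k)))) /\
          (A%:E * sqnorm_l2 c
             <= \esum_(j in [set: V])
                  (normc (csum (fun k : V => (c k * conjc (g (shift_pt a b x j k)))%R)) ^+ 2)%:E
             <= B%:E * sqnorm_l2 c)%E}])
  <-> fiber_bounds.
Proof.
split=> [[A [B [A0 B0 h]]]|[A [B [A0 B0 hB hA]]]]; exists A, B; split => //.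
- by apply: filterS h => x /(@frame_fin R V 0 A B (P x))[].
- by apply: filterS h => x /(@frame_fin R V 0 A B (P x))[].
have := ae_and hB hA; apply: filterS => x [hU hL].
exact: (@fin_frame R V 0 A B (P x) (ltW A0) (ltW B0) hU hL).
Qed.

Lemma ron_shenE x : ron_shen g a b x = gram (P x).
Proof.
apply/funext => k; apply/funext => l; congr csum; apply/funext => j.
by rewrite /pre_gramian conjcK.
Qed.

Lemma spectrum_fiber :
  (exists A B : R, [/\ 0 < A, 0 < B
      & {ae mu, forall x,
          (exists C : R, bounded_mx C (ron_shen g a b x)) /\
          spectrum (mx_op (ron_shen g a b x)) `<=` [set (r%:C)%C | r in `[A, B]]}])
  <-> fiber_bounds.
Proof.
split=> [[A [B [A0 B0 h]]]|[A [B [A0 B0 hB hA]]]]; exists A, B.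
  have H : {ae mu, forall x, fin_upper B (P x) /\ fin_lower A (P x)}.
    have := ae_and h (ae_columns b Lg a0); apply: filterS => x [[[C bC] sp] LM].
    rewrite ron_shenE in bC sp.
    exact: (@gram_spectrum_fin R V 0 C A B (P x) LM bC sp).
  by split => //; apply: filterS H => x [].
split => //; have := ae_and hB hA; apply: filterS => x [hU hL]; rewrite ron_shenE; split.
  exists (Num.sqrt B ^+ 2).
  exact: (@gram_bounded R V 0 _ _ (@fin_upper_bounded R V 0 B (P x) (ltW B0) hU)).
exact: (@fin_gram_spectrum R V 0 A B (P x) (ltW A0) (ltW B0) hU hL).
Qed.

Lemma left_inverse_fiber :
  ((exists C : R, {ae mu, forall x, bounded_mx C (P x)}) /\
   exists (C : R) (Gamma : Rd R d -> (V -> R[i]) -> (V -> R[i])),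
      {ae mu, forall x, bounded_op C (Gamma x) /\
        forall c : V -> R[i], l2 c -> Gamma x (mx_op (P x) c) = c})
  <-> fiber_bounds.
Proof.
split=> [[[C hC] [C' [Gamma hG]]]|[A [B [A0 B0 hB hA]]]].
  (* The lower constant is that of [left_inverse_lower]; adding 1 keeps both constants positive if C
     or C' is 0. *)
  exists (C' ^+ 2 + 1)^-1, (C ^+ 2 + 1); split.
  - by rewrite invr_gt0 ltr_wpDl ?sqr_ge0.
  - by rewrite ltr_wpDl ?sqr_ge0.
  - apply: filterS hC => x bx; apply: fin_upper_mono (@bounded_fin_upper R V 0 C (P x) bx).
    by rewrite lerDl.
  have := ae_and hC hG; apply: filterS => x [bx [bG hGx]].
  by apply: (@left_inverse_lower R V 0 C' (P x) (Gamma x)) => //; exists C.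
split.
  exists (Num.sqrt B); apply: filterS hB => x hU.
  exact: (@fin_upper_bounded R V 0 B (P x) (ltW B0) hU).
exists (A^-1 * Num.sqrt B).
(* The condition relates [Gamma x] to [P x] at each x separately, so a choice at each x provides the
   family. *)
have /choice[Gamma hG] : forall x, exists G, fin_upper B (P x) /\ fin_lower A (P x) ->
    bounded_op (A^-1 * Num.sqrt B) G /\ forall c : V -> R[i], l2 c -> G (mx_op (P x) c) = c.
  move=> x; have [[hU hL]|n] := pselect (fin_upper B (P x) /\ fin_lower A (P x)); last by exists id.
  by have [G hG] := @left_inverse R V 0 A B (P x) A0 (ltW B0) hU hL; exists G.
exists Gamma; have := ae_and hB hA; apply: filterS => x hx.
exact: hG.
Qed.

End Characterization.

Theorem theorem6p2 (R : realType) (d : nat) (hd : (0 < d)%N)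
    (g : Rd R d -> R[i]) (hg : L2 g) (alpha beta : R)
    (halpha : 0 < alpha) (hbeta : 0 < beta) :
  [<->
    (* i *)
    is_frame (gabor g alpha beta);
    (* ii *)
    is_bessel (gabor g alpha beta) /\
    exists gamma : Rd R d -> R[i],
      [/\ L2 gamma,
          is_bessel (gabor gamma alpha beta)
        & forall k : Zd d, {ae lebesgue R d, forall x,
            has_csum
              (fun j : Zd d => gamma (shift_pt alpha beta x j 0)
                 * conjc (g (shift_pt alpha beta x j k)))
              ((beta ^+ d * (k == 0)%:R)%:C)%C}];
    (* iii *)
    is_riesz_seq (gabor g beta^-1 alpha^-1);
    (* iv *)
    exists A B : R, [/\ 0 < A, 0 < B
      & {ae lebesgue R d, forall x, forall c : Zd d -> R[i], l2 c ->
          (forall j : Zd d, csummable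
             (fun k : Zd d => c k * conjc (g (shift_pt alpha beta x j k)))) /\
          (A%:E * sqnorm_l2 c
             <= \esum_(j in [set: Zd d])
                  (normc (csum (fun k : Zd d =>
                     c k * conjc (g (shift_pt alpha beta x j k)))) ^+ 2)%:E
             <= B%:E * sqnorm_l2 c)%E}];
    (* v *)
    exists A B : R, [/\ 0 < A, 0 < B
      & {ae lebesgue R d, forall x,
          (exists C : R, bounded_mx C (ron_shen g alpha beta x)) /\
          spectrum (mx_op (ron_shen g alpha beta x))
            `<=` [set (r%:C)%C | r in `[A, B]]}];
    (* vi *)
    (exists C : R, {ae lebesgue R d, forall x,
       bounded_mx C (pre_gramian g alpha beta x)}) /\
    exists (C : R) (Gamma : Rd R d -> (Zd d -> R[i]) -> (Zd d -> R[i])),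
      {ae lebesgue R d, forall x,
        bounded_op C (Gamma x) /\
        forall c : Zd d -> R[i], l2 c ->
          Gamma x (mx_op (pre_gramian g alpha beta x) c) = c}].
Proof.
move/L2E: hg => Lg.
tfae.
- by move/(frame_fiber Lg halpha hbeta)/(dual_fiber Lg halpha hbeta).
- by move/(dual_fiber Lg halpha hbeta)/(riesz_fiber _ Lg halpha).
- by move/(riesz_fiber _ Lg halpha)/fin_frame_fiber.
- by move/fin_frame_fiber/(spectrum_fiber _ Lg halpha).
- by move/(spectrum_fiber _ Lg halpha)/left_inverse_fiber.
- by move/left_inverse_fiber/(frame_fiber Lg halpha hbeta).
Qed.
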